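(* Let $u,v\in L^3((0,T);C^{0,\beta}(\mathbb{T}^3)\cap W^{1,p}(\mathbb{T}^3))$ with $\beta>\frac12$ and $p>1$, or alternatively let $u,v\in L^3((0,T);W^{1,p}(\mathbb{T}^3))$ with $p>6$. Moreover, assume that $\int_{\mathbb{T}}\nabla_H\cdot\mathbf{u}_H\,dz=0$, where $\mathbf{u}_H=(u,v)$, and that, together with the associated vertical velocity $w$ determined by $\partial_zw=-\nabla_H\cdot\mathbf{u}_H$, $w|_{z=0}=0$, the velocity field $\mathbf{u}=(u,v,w)$ satisfies, for some pressure $P\in L^1(\mathbb{T}^3\times(0,T))$ and all $\phi_1,\phi_2,\phi_3\in\mathcal{D}(\mathbb{T}^3\times(0,T))$, the weak formulation $$\int_0^T\int_{\mathbb{T}^3}\big[u\,\partial_t\phi_1+u\mathbf{u}\cdot\nabla\phi_1+\Omega v\phi_1+P\,\partial_x\phi_1\big]dx\,dt=0,$$ $$\int_0^T\int_{\mathbb{T}^3}\big[v\,\partial_t\phi_2+v\mathbf{u}\cdot\nabla\phi_2-\Omega u\phi_2+P\,\partial_y\phi_2\big]dx\,dt=0,\qquad\int_0^T\int_{\mathbb{T}^3}P\,\partial_z\phi_3\,dx\,dt=0.$$ Then $D(\mathbf{u})=0$. In particular, the weak solution conserves energy: $$\lVert u(t_1,\cdot)\rVert_{L^2}^2+\lVert v(t_1,\cdot)\rVert_{L^2}^2=\lVert u(t_2,\cdot)\rVert_{L^2}^2+\lVert v(t_2,\cdot)\rVert_{L^2}^2\quad\text{for a.e. } t_1,t_2\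in(0,T).$$
   Context: $\mathbb{T}^3$ is the flat unit torus with coordinates $(x,y,z)$ (in integrals over $\mathbb{T}^3$ the spatial variable is also written $x$), $T>0$, $\Omega\in\mathbb{R}$ is the Coriolis parameter, $\nabla_H=(\partial_x,\partial_y)$. $\mathcal{D}(\mathbb{T}^3\times(0,T))$ denotes smooth real functions compactly supported in time in $(0,T)$. The weak formulation is that of the hydrostatic Euler equations $\partial_t u+\nabla\cdot(u\mathbf{u})-\Omega v+\partial_x P=0$, $\partial_t v+\nabla\cdot(v\mathbf{u})+\Omega u+\partial_y P=0$, $\partial_z P=0$, $\nabla\cdot\mathbf{u}=0$, considered on the torus under the symmetry conditions that $u,v,P$ are even in $z$ and $w$ is odd in $z$. Defect term: let $\varphi\in C_c^\infty(\mathbb{R}^3;\mathbb{R})$ be a radial standard mollifier with $\int\varphi=1$, $\varphi_\epsilon(x)=\epsilon^{-3}\varphi(x/\epsilon)$, and $\delta f(\xi;x,t)=f(x+\xi,t)-f(x,t)$. Then $$D(\mathbf{u})(x,t)=\lim_{\epsilon\to0}\int_{\mathbb{R}^3}\nabla\varphi_\epsilon(\xi)\cdot\delta\mathbf{u}(\xi;x,t)\big(|\delta u(\xi;x,t)|^2+|\delta v(\xi;x,t)|^2\big)\,d\xi,$$ the limit being taken in the sense of distributions on $\mathbb{T}^3\times(0,T)$. *)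

(* Defs.v *)
From HB Require Import structures.
From mathcomp Require Import all_boot all_order all_algebra.
From mathcomp Require Import all_classical all_reals all_analysis.

Set Implicit Arguments.
Unset Strict Implicit.
Unset Printing Implicit Defensive.

Import Order.TTheory GRing.Theory Num.Theory.
Import numFieldNormedType.Exports.

Local Open Scope classical_set_scope.
Local Open Scope ring_scope.

(* Functions on the torus T^3 are represented by functions on R^3 that are
   1-periodic in each variable, and integrals over T^3 by integrals over the
   unit cube.  A point of R^3 is (x, y, z) = ((x, y), z); a point of
   space-time is (X, t) with X in R^3. *)
Notation vec3 R := ((R * R) * R)%type.
Notation spacetime R := (((R * R) * R) * R)%type.

Section HydrostaticEuler.
Variable R : realType.

Local Notation B := (measurableTypeR R).
Definition leb1 : {sigma_finite_measure set B -> \bar R} :=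
  @lebesgue_measure R.
Definition leb2 : {measure set (B * B)%type -> \bar R} :=
  (leb1 \x leb1)%E.
Definition leb3 : {measure set (B * B * B)%type -> \bar R} :=
  (leb2 \x leb1)%E.
Definition leb4 : {measure set (B * B * B * B)%type -> \bar R} :=
  (leb3 \x leb1)%E.

Definition cube : set (vec3 R) := (`[0, 1] `*` `[0, 1]) `*` `[0, 1].
Definition torus_time (T : R) : set (spacetime R) := cube `*` `]0, T[.

Definition ex : vec3 R := (1, 0, 0).
Definition ey : vec3 R := (0, 1, 0).
Definition ez : vec3 R := (0, 0, 1).

Definition slice (f : spacetime R -> R) (t : R) : vec3 R -> R :=
  fun X => f (X, t).

Definition torus_periodic (f : vec3 R -> R) : Prop :=
  forall X, [/\ f (X + ex) = f X, f (X + ey) = f X & f (X + ez) = f X].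

Definition enorm (X : vec3 R) : R :=
  Num.sqrt (X.1.1 ^+ 2 + X.1.2 ^+ 2 + X.2 ^+ 2).

(* In finite dimension, differentiability of all iterated directional
   derivatives is C^infinity. *)
Definition smooth (V : normedModType R) (f : V -> R) : Prop :=
  forall (vs : seq V) (X : V),
    differentiable (foldr (fun v (g : V -> R) => ('D_v g : V -> R)) f vs) X.

Definition torus_L1 (f : vec3 R -> R) : Prop :=
  torus_periodic f /\ leb3.-integrable cube (EFin \o f).

Definition weak_partial (e : vec3 R) (f g : vec3 R -> R) : Prop :=
  [/\ torus_L1 f, torus_L1 g &
    forall psi : vec3 R -> R, smooth psi -> torus_periodic psi ->
      \int[leb3]_(X in cube) (f X * 'D_e psi X) =
      - \int[leb3]_(X in cube) (g X * psi X)].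

Definition torus_Lnorm (p : \bar R) (f : vec3 R -> R) : \bar R :=
  'N[leb3]_p[EFin \o (f \_ cube)]%E.

(* The infimum is over representatives of the weak gradient, on which the
   expression does not depend; it is +oo when there is no weak gradient. *)
Definition W1_norm (p : \bar R) (f : vec3 R -> R) : \bar R :=
  ereal_inf [set r | exists gx gy gz : vec3 R -> R,
    [/\ weak_partial ex f gx, weak_partial ey f gy, weak_partial ez f gz &
      r = (torus_Lnorm p f + torus_Lnorm p gx + torus_Lnorm p gy
           + torus_Lnorm p gz)%E]].

(* For a periodic function, the supremum of the quotients over R^3 is the one
   for the distance of the flat torus. *)
Definition holder_norm (beta : R) (f : vec3 R -> R) : \bar R :=
  (ereal_sup [set (`|f X|)%:E | X in [set: vec3 R]] +
   ereal_sup [set r | exists X Y : vec3 R,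
     X <> Y /\ r = (`|f X - f Y| / (enorm (X - Y) `^ beta))%:E])%E.

Definition holder_W1_norm (beta : R) (p : \bar R) (f : vec3 R -> R) : \bar R :=
  (holder_norm beta f + W1_norm p f)%E.

(* The Banach space of functions on T^3 with norm N, where N takes the value
   +oo outside of the space. *)
Definition in_space (N : (vec3 R -> R) -> \bar R) (f : vec3 R -> R) : Prop :=
  torus_periodic f /\ (N f < +oo)%E.

Definition simple_valued (N : (vec3 R -> R) -> \bar R)
    (s : R -> vec3 R -> R) : Prop :=
  exists (k : nat) (A : 'I_k -> set R) (c : 'I_k -> vec3 R -> R),
    [/\ forall i, measurable (A i), forall i, in_space N (c i) &
      forall t X, s t X = \sum_(i < k) \1_(A i) t * c i X].

(* The Bochner space L^q((0,T); N): strong measurability, i.e. approximation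
   in norm by simple functions for almost every t, and integrability of the
   q-th power of the norm.  The representative in (X, t) is moreover chosen
   jointly measurable. *)
Definition bochner (q T : R) (N : (vec3 R -> R) -> \bar R)
    (u : spacetime R -> R) : Prop :=
  [/\ measurable_fun ([set: vec3 R] `*` `]0, T[) u,
      {ae leb1, forall t, 0 < t < T -> in_space N (slice u t)},
      exists s : nat -> R -> vec3 R -> R,
        (forall n, simple_valued N (s n)) /\
        {ae leb1, forall t, 0 < t < T ->
          (fun n => N (slice u t \- s n t)) @ \oo --> 0%E} &
      (\int[leb1]_(t in `]0%R, T[) (N (slice u t) `^ q) < +oo)%E].

Definition div_H (f g d : vec3 R -> R) : Prop :=
  exists gx gy : vec3 R -> R,
    [/\ weak_partial ex f gx, weak_partial ey g gy & d = gx \+ gy].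

Definition zero_mean_div_H (f g : vec3 R -> R) : Prop :=
  exists2 d, div_H f g d &
    {ae leb2, forall xy, \int[leb1]_(z in `[0, 1]) d (xy, z) = 0}.

(* The trace at z = 0 is taken on the representative of h that is continuous
   along almost every vertical line. *)
Definition vertical_velocity (f g h : vec3 R -> R) : Prop :=
  (exists2 d, div_H f g d & weak_partial ez h (\- d)) /\
  {ae leb2, forall xy,
    continuous (fun z : R => h (xy, z)) /\ h (xy, 0) = 0}.

Definition reflect_z (p : spacetime R) : spacetime R :=
  ((p.1.1, - p.1.2), p.2).

Definition even_z (T : R) (f : spacetime R -> R) : Prop :=
  {ae leb4, forall p, 0 < p.2 < T -> f (reflect_z p) = f p}.

Definition odd_z (T : R) (f : spacetime R -> R) : Prop :=
  {ae leb4, forall p, 0 < p.2 < T -> f (reflect_z p) = - f p}.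

Definition test_function (T : R) (phi : spacetime R -> R) : Prop :=
  [/\ smooth phi, forall t, torus_periodic (slice phi t) &
    exists a b : R, [/\ 0 < a, b < T &
      forall X t, ~ (a <= t <= b) -> phi (X, t) = 0]].

Definition d_t (phi : spacetime R -> R) (p : spacetime R) : R :=
  'D_((0, 1) : spacetime R) phi p.
Definition d_x (phi : spacetime R -> R) (p : spacetime R) : R :=
  'D_((ex, 0) : spacetime R) phi p.
Definition d_y (phi : spacetime R -> R) (p : spacetime R) : R :=
  'D_((ey, 0) : spacetime R) phi p.
Definition d_z (phi : spacetime R -> R) (p : spacetime R) : R :=
  'D_((ez, 0) : spacetime R) phi p.

Definition weak_solution (T Omega : R) (u v w P : spacetime R -> R) : Prop :=
  forall phi1 phi2 phi3 : spacetime R -> R,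
    test_function T phi1 -> test_function T phi2 -> test_function T phi3 ->
  [/\ \int[leb4]_(p in torus_time T)
        (u p * d_t phi1 p
         + u p * (u p * d_x phi1 p + v p * d_y phi1 p + w p * d_z phi1 p)
         + Omega * v p * phi1 p + P p * d_x phi1 p) = 0,
      \int[leb4]_(p in torus_time T)
        (v p * d_t phi2 p
         + v p * (u p * d_x phi2 p + v p * d_y phi2 p + w p * d_z phi2 p)
         - Omega * u p * phi2 p + P p * d_y phi2 p) = 0 &
      \int[leb4]_(p in torus_time T) (P p * d_z phi3 p) = 0].

Definition mollifier (phi : vec3 R -> R) : Prop :=
  [/\ smooth phi, compact (closure [set X | phi X != 0]),
      forall X, 0 <= phi X,
      forall X Y, enorm X = enorm Y -> phi X = phi Y &
      \int[leb3]_X phi X = 1].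

Definition rescale (phi : vec3 R -> R) (eps : R) : vec3 R -> R :=
  fun X => eps ^- 3 * phi (eps^-1 *: X).

Definition delta (f : spacetime R -> R) (xi : vec3 R) (p : spacetime R) : R :=
  f (p.1 + xi, p.2) - f p.

Definition defect_approx (phi : vec3 R -> R) (u v w : spacetime R -> R)
    (eps : R) (p : spacetime R) : R :=
  \int[leb3]_xi
    (('D_ex (rescale phi eps) xi * delta u xi p
      + 'D_ey (rescale phi eps) xi * delta v xi p
      + 'D_ez (rescale phi eps) xi * delta w xi p)
     * (`|delta u xi p| ^+ 2 + `|delta v xi p| ^+ 2)).

Definition distribution_limit (T : R) (F : R -> spacetime R -> R)
    (D : (spacetime R -> R) -> R) : Prop :=
  forall psi, test_function T psi ->
    (forall eps, 0 < eps ->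
      leb4.-integrable (torus_time T) (fun p => (F eps p * psi p)%:E)) /\
    (fun eps => \int[leb4]_(p in torus_time T) (F eps p * psi p)) @ 0^'+
      --> D psi.

Definition defect_is (T : R) (phi : vec3 R -> R) (u v w : spacetime R -> R)
    (D : (spacetime R -> R) -> R) : Prop :=
  distribution_limit T (defect_approx phi u v w) D.

Definition energy (u v : spacetime R -> R) (t : R) : \bar R :=
  (torus_Lnorm 2%:E (slice u t) ^+ 2 + torus_Lnorm 2%:E (slice v t) ^+ 2)%E.

End HydrostaticEuler.

(* Main.v *)
Require Import Defs.
From HB Require Import structures.
From mathcomp Require Import all_boot all_order all_algebra.
From mathcomp Require Import all_classical all_reals all_analysis.
From mathcomp Require Import measurable_realfun ess_sup_inf trigo ring lra.
Import Order.TTheory GRing.Theory Num.Theory.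
Import numFieldNormedType.Exports.
Local Open Scope classical_set_scope.
Local Open Scope ring_scope.
Set Implicit Arguments.
Unset Strict Implicit.
Unset Printing Implicit Defensive.

(** At almost every time the two regularity assumptions have one common consequence
    ([slice_regularity], in terms of [slice_reg]): the horizontal velocity
    u_H = (u, v) satisfies, for some 1 < gamma <= 2 and some A(t) integrable in time,

      int |u_H(X + xi) - u_H(X)|^2 (1 + |u| + |v| + |w|) dX <= A(t) |xi|^gamma.

    For Hoelder functions gamma = min(2 beta, 2), and the weight is integrable
    because |w| is at most the integral of |div_H u_H| along the vertical line.
    For Sobolev functions gamma = 2: increments of u_H are of order |xi| in L^3, the
    vertical velocity is in L^3 for the same reason as before, and the inequality of
    Young combines the two. Both cases rest on the identity between f(X + s e) - f(X)
    and the integral of the weak derivative along the segment ([weak_difference]),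
    which is proved by testing with averages along the segment and from the fact
    that products of smooth periodic functions of one variable separate integrable
    functions on the torus ([torus_unique]). The condition gamma > 1 is the threshold
    of Onsager: the horizontal increments enter squared, and the vertical velocity
    costs integrability but no regularity.

    The defect at the scale eps is then at most eps^-1 eps^gamma in L^1, the gradient
    of the mollifier costing one power of eps, so it tends to zero ([defect_zero]).

    For the energy, the natural argument is to mollify the equations and to pass
    to the limit in the balance of the mollified energy. Here the mollifier in the
    space variables is a kernel K(X - Y), a product of powers of cosines, which is a
    finite sum of products c_j e_j(X) e_j(Y) ([sum_kernel_exists]). Testing the
    equations with e_j(X) psi(t) shows that the coefficients U_j and V_j of u and v
    are absolutely continuous in time ([evolution], [weak_primitive_square]), and the
    energy at the scale of the kernel is the finite sum of c_j (U_j^2 + V_j^2). In its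
    time derivative

    - the Coriolis terms cancel;
    - the pressure terms cancel, since derivatives of K(X - Y) in X and in Y are
      opposite, the velocity is divergence-free and P does not depend on z;
    - in the advection terms, u_H(X).u_H(Y) is half of
      |u_H(X)|^2 + |u_H(Y)|^2 - |u_H(X) - u_H(Y)|^2; the first square vanishes against
      the divergence-free velocity at Y, the second because the gradient of K has
      mean zero, and what is left is a double integral of |u_H(X) - u_H(Y)|^2 against
      the velocity and the gradient of K.

    At the scale 1/M of the kernel, the regularity bounds this flux by a constant times
    A(t) M^(1 - gamma) ([flux_le]), and by the same polarisation the distance from the
    energy at that scale to the kinetic energy ([energy_le]). As M grows, the kinetic
    energy is seen to be constant outside a negligible set of times
    ([kinetic_conserved]). *)

(** * Fubini and Tonelli on rectangles *)

Section Tonelli.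
Local Open Scope ereal_scope.
Context d1 d2 (T1 : measurableType d1) (T2 : measurableType d2) (R : realType).
Variables (m1 : {sigma_finite_measure set T1 -> \bar R})
          (m2 : {sigma_finite_measure set T2 -> \bar R}).
Variables (A : set T1) (B : set T2).
Hypotheses (mA : measurable A) (mB : measurable B).
Variable f : T1 * T2 -> \bar R.
Hypothesis mf : measurable_fun [set: T1 * T2] f.

(* Extending the integrand by zero reduces a rectangle to the whole product,
   which is why measurability is assumed everywhere. *)
Let restrictE x y : (f \_ (A `*` B)) (x, y) =
  if x \in A then ((fun y => f (x, y)) \_ B) y else 0.
Proof. by rewrite !patchE in_setX; case: (x \in A). Qed.

Let mfAB : measurable_fun setT (f \_ (A `*` B)).
Proof.
apply/(measurable_restrictT _ (measurableX mA mB)).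
exact: measurable_funS mf.
Qed.

Let int1 x : \int[m2]_y (f \_ (A `*` B)) (x, y) =
  ((fun x => \int[m2]_(y in B) f (x, y)) \_ A) x.
Proof.
under eq_integral do rewrite restrictE.
rewrite patchE; case: ifPn => xA; last by rewrite integral0.
by rewrite [RHS]integral_mkcond.
Qed.

Let int2 y : \int[m1]_x (f \_ (A `*` B)) (x, y) =
  ((fun y => \int[m1]_(x in A) f (x, y)) \_ B) y.
Proof.
rewrite patchE; case: ifPn => yB.
  rewrite [RHS]integral_mkcond; apply: eq_integral => x _.
  by rewrite !patchE in_setX yB andbT.
under eq_integral do rewrite patchE in_setX (negbTE yB) andbF.
by rewrite integral0.
Qed.

Section nonneg.
Hypothesis f0 : forall p, 0 <= f p.

Let fAB0 p : 0 <= (f \_ (A `*` B)) p.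
Proof. by rewrite patchE; case: ifP. Qed.

Lemma tonelli_prod1 :
  \int[m1 \x m2]_(p in A `*` B) f p =
  \int[m1]_(x in A) \int[m2]_(y in B) f (x, y).
Proof.
rewrite integral_mkcond [RHS]integral_mkcond.
rewrite (@fubini_tonelli1 _ _ _ _ _ m1 m2 _ mfAB fAB0).
by apply: eq_integral => x _; rewrite -int1.
Qed.

Lemma tonelli_prod2 :
  \int[m1 \x m2]_(p in A `*` B) f p =
  \int[m2]_(y in B) \int[m1]_(x in A) f (x, y).
Proof.
rewrite integral_mkcond [RHS]integral_mkcond.
rewrite (@fubini_tonelli2 _ _ _ _ _ m1 m2 _ mfAB fAB0).
by apply: eq_integral => y _; rewrite -int2.
Qed.

Lemma tonelli_swap :
  \int[m1]_(x in A) \int[m2]_(y in B) f (x, y) =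
  \int[m2]_(y in B) \int[m1]_(x in A) f (x, y).
Proof. by rewrite -tonelli_prod1 tonelli_prod2. Qed.

Lemma measurable_tonelli1 :
  measurable_fun setT (fun x => \int[m2]_(y in B) f (x, y)).
Proof.
have -> : (fun x => \int[m2]_(y in B) f (x, y)) =
    fubini_F m2 (f \_ (setT `*` B)).
  apply/funext => x; rewrite /fubini_F [LHS]integral_mkcond.
  by apply: eq_integral => y _; rewrite !patchE in_setX in_setT.
apply: measurable_fun_fubini_tonelli_F.
- apply/(measurable_restrictT _ (measurableX measurableT mB)).
  exact: measurable_funS mf.
- by move=> p; rewrite patchE; case: ifP.
Qed.

Lemma measurable_tonelli2 :
  measurable_fun setT (fun y => \int[m1]_(x in A) f (x, y)).
Proof.
have -> : (fun y => \int[m1]_(x in A) f (x, y)) =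
    fubini_G m1 (f \_ (A `*` setT)).
  apply/funext => y; rewrite /fubini_G [LHS]integral_mkcond.
  by apply: eq_integral => x _; rewrite !patchE in_setX in_setT andbT.
apply: measurable_fun_fubini_tonelli_G.
- apply/(measurable_restrictT _ (measurableX mA measurableT)).
  exact: measurable_funS mf.
- by move=> p; rewrite patchE; case: ifP.
Qed.

End nonneg.

Hypothesis fi : (m1 \x m2).-integrable (A `*` B) f.

Let fi' : (m1 \x m2).-integrable setT (f \_ (A `*` B)).
Proof. exact/(integrable_mkcond _ (measurableX mA mB)). Qed.

Lemma fubini_prod1 :
  \int[m1 \x m2]_(p in A `*` B) f p =
  \int[m1]_(x in A) \int[m2]_(y in B) f (x, y).
Proof.
rewrite integral_mkcond [RHS]integral_mkcond.
rewrite -(@integral12_prod_meas1 _ _ _ _ _ m1 m2 _ fi').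
by apply: eq_integral => x _; rewrite -int1.
Qed.

Lemma fubini_prod2 :
  \int[m1 \x m2]_(p in A `*` B) f p =
  \int[m2]_(y in B) \int[m1]_(x in A) f (x, y).
Proof.
rewrite integral_mkcond [RHS]integral_mkcond.
rewrite -(@integral21_prod_meas1 _ _ _ _ _ m1 m2 _ fi').
by apply: eq_integral => y _; rewrite -int2.
Qed.

Lemma integrable_fubini1 :
  m1.-integrable A (fun x => \int[m2]_(y in B) f (x, y)).
Proof.
apply/(integrable_mkcond _ mA).
rewrite (_ : _ \_ A = fubini_F m2 (f \_ (A `*` B))).
  exact: integrable_fubini_F.
by apply/funext => x; rewrite -int1.
Qed.

Lemma integrable_fubini2 :
  m2.-integrable B (fun y => \int[m1]_(x in A) f (x, y)).
Proof.
apply/(integrable_mkcond _ mB).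
rewrite (_ : _ \_ B = fubini_G m1 (f \_ (A `*` B))); last first.
  by apply/funext => x; rewrite -int2.
apply/integrableP; split; first exact: (measurable_fubini_G fi').
have := (@integrable21ltyP _ _ _ _ _ m1 m2 _ mfAB).1 fi'; apply: le_lt_trans.
apply: ge0_le_integral => //.
- by apply: measurableT_comp => //; exact: (measurable_fubini_G fi').
- apply: (@measurable_fun_fubini_tonelli_G _ _ _ _ _ m1 (abse \o (f \_ (A `*` B)))).
    exact: measurableT_comp.
  by move=> p; exact: abse_ge0.
- move=> y _; apply: le_abse_integral => //.
  exact: (measurableT_comp mfAB (pair2_measurable y)).
Qed.

End Tonelli.


Section ProductSigmaFinite.
Context d1 d2 (T1 : measurableType d1) (T2 : measurableType d2) (R : realType)
  (m1 : {sigma_finite_measure set T1 -> \bar R})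
  (m2 : {sigma_finite_measure set T2 -> \bar R}).
Let T : measurableType _ := (T1 * T2)%type.

(** The Lebesgue measures on R^2, R^3 and R^4 are iterated products.  The
    theorems of Fubini and Tonelli ask for sigma-finite factors, so the product of
    two such measures has to carry its own sigma-finite structure before it can
    itself serve as a factor. *)
Definition prod_fun : set T -> \bar R := product_measure1 m1 m2.

HB.instance Definition _ := Measure.on prod_fun.

Let sf : sigma_finite setT prod_fun.
Proof.
have /sigma_finiteP[F [TF ndF Foo]] := sigma_finiteT m1.
have /sigma_finiteP[G [TG ndG Goo]] := sigma_finiteT m2.
exists (fun n => F n `*` G n).
  rewrite -setXTT TF TG predeqE => -[x y]; split.
    move=> [/= [n _ Fnx] [k _ Gky]]; exists (maxn n k) => //; split.
    - by move: x Fnx; exact/subsetPset/ndF/leq_maxl.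
    - by move: y Gky; exact/subsetPset/ndG/leq_maxr.
  by move=> [n _ []/= ? ?]; split; exists n.
move=> k; have [? ?] := Foo k; have [? ?] := Goo k.
split; first exact: measurableX.
by rewrite /prod_fun product_measure1E// lte_mul_pinfty// ge0_fin_numE.
Qed.

HB.instance Definition _ := Measure_isSigmaFinite.Build _ _ _ prod_fun sf.

Definition prod_sfin : {sigma_finite_measure set T -> \bar R} := prod_fun.

End ProductSigmaFinite.

Section LebesgueSpaces.
Variable R : realType.
Local Notation B := (measurableTypeR R).
Local Notation V := (B * B * B)%type.
Local Notation W := (B * B * B * B)%type.

Definition sleb2 : {sigma_finite_measure set (B * B)%type -> \bar R} :=
  prod_sfin (leb1 R) (leb1 R).
Definition sleb3 : {sigma_finite_measure set V -> \bar R} :=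
  prod_sfin sleb2 (leb1 R).

Lemma measurable_itvB (i : interval R) : measurable ([set` i] : set B).
Proof. exact: measurable_itv. Qed.

Lemma measurable_square :
  measurable (`[0, 1]%classic `*` `[0, 1]%classic : set (B * B)%type).
Proof. by apply: measurableX; exact: measurable_itv. Qed.

Lemma measurable_cube : measurable (@cube R : set V).
Proof.
by apply: (measurableX measurable_square); exact: measurable_itv. Qed.

Lemma measurable_torus_time T : measurable (torus_time T : set W).
Proof.
by apply: (measurableX measurable_cube); exact: measurable_itv. Qed.

Lemma leb3_cubeE (f : V -> \bar R) :
  measurable_fun setT f -> (forall X, 0 <= f X)%E ->
  (\int[leb3 R]_(X in @cube R) f X =
  \int[leb1 R]_(x in `[0%R, 1%R]) \int[leb1 R]_(y in `[0%R, 1%R])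
     \int[leb1 R]_(z in `[0%R, 1%R]) f (x, y, z))%E.
Proof.
move=> mf f0.
have mI := @measurable_itvB `[0, 1].
transitivity (\int[sleb2]_(p in `[0%R, 1%R]%classic `*` `[0%R, 1%R]%classic)
    \int[leb1 R]_(z in `[0%R, 1%R]) f (p, z))%E.
  exact: (@tonelli_prod1 _ _ _ _ _ sleb2 (leb1 R) _ _ measurable_square
    mI _ mf f0).
have mg := @measurable_tonelli1 _ _ _ _ _ (leb1 R) _ mI f mf f0.
apply: (@tonelli_prod1 _ _ _ _ _ (leb1 R) (leb1 R) _ _ mI mI _ mg).
by move=> p; apply: integral_ge0 => z _.
Qed.

(** * Translations *)

Lemma pushforward_shift (s : R) (A : set B) : measurable A ->
  pushforward (leb1 R) (fun x : B => (x + s : B)) A = leb1 R A.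
Proof.
move=> mA.
have ms : measurable_fun setT (fun x : B => (x + s : B)).
  exact: measurable_funD.
pose phi : {mfun B >-> B} := HB.pack (fun x : B => (x + s : B))
  (isMeasurableFun.Build _ _ _ _ _ ms).
apply/esym/(@lebesgue_measure_unique R (pushforward (leb1 R) phi)) => //.
move=> _ [[a b]] _ <-; rewrite /pushforward /=.
have E : (fun x : B => (x + s : B)) @^-1` `]a, b]%classic =
    `](a - s), (b - s)]%classic.
  by apply/seteqP; split => x /=; rewrite !in_itv/= ltrBlDr lerBrDr.
rewrite [X in _ = leb1 R X]E /leb1 /= !lebesgue_measure_itv/= !lte_fin ltrD2r.
by rewrite -!EFinB; case: ifP => // _; congr EFin; ring.
Qed.

Lemma integral_shift (s : R) (f : B -> \bar R) :
  measurable_fun setT f -> (forall x, 0 <= f x)%E ->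
  (\int[leb1 R]_x f (x + s)%R = \int[leb1 R]_x f x)%E.
Proof.
move=> mf f0.
have ms : measurable_fun setT (fun x : B => (x + s : B)).
  exact: measurable_funD.
have := @ge0_integral_pushforward _ _ B B R _ ms (leb1 R) setT f measurableT mf
  (fun x _ => f0 x).
rewrite preimage_setT => <-.
by apply: eq_measure_integral => A mA _; exact: pushforward_shift.
Qed.

Lemma periodic_int (T : Type) (f : R -> T) (m : int) x :
  (forall y, f (y + 1) = f y) -> f (x + m%:~R) = f x.
Proof.
move=> f1; have H n y : f (y + n%:R) = f y.
  by elim: n => [|n IH]; rewrite ?addr0// -natr1 addrA f1.
case: m => n; first exact: H.
by rewrite NegzE mulrNz -[in RHS](subrK (n.+1%:R) x) H.
Qed.

(** Split the shifted interval at the integer that it contains and move one of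
    the two pieces back by one period. *)
Lemma integral_periodic_shift (s : R) (f : B -> \bar R) :
  measurable_fun setT f -> (forall x, 0 <= f x)%E ->
  (forall x : R, f (x + 1) = f x) ->
  (\int[leb1 R]_(x in `[0%R, 1%R]) f (x + s)%R =
   \int[leb1 R]_(x in `[0%R, 1%R]) f x)%E.
Proof.
move=> mf f0 f1.
pose r := s - (Num.floor s)%:~R.
have r01 : 0 <= r < 1.
  by rewrite subr_ge0 ge_floor ltrBlDr addrC -intrD1 lt_succ_floor.
have -> : (fun x => f (x + s)) = (fun x => f (x + r)).
  apply/funext => x; rewrite -[in RHS](periodic_int (Num.floor s) _ f1).
  by rewrite /r -addrA subrK.
have mI (a b : itv_bound R) (g : B -> \bar R) : measurable_fun setT g ->
    measurable_fun ([set` Interval a b] : set B) g.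
  by move=> mg; exact: measurable_funS mg.
have shiftI (a b : R) t : (\int[leb1 R]_(x in `[a, b[) f (x + t)%R =
    \int[leb1 R]_(x in `[(a + t)%R, (b + t)%R[) f x)%E.
  rewrite integral_mkcond [RHS]integral_mkcond.
  rewrite -[RHS](integral_shift t)//; last first.
  - by move=> x; rewrite patchE; case: ifP.
  - apply/(measurable_restrictT _ (measurable_itvB _)).
    exact: measurable_funS mf.
  apply: eq_integral => x _; rewrite !patchE.
  have -> : (x \in (`[a, b[%classic : set R)) =
            (x + t \in (`[a + t, b + t[%classic : set R)).
    by apply/idP/idP; rewrite !inE/= !in_itv/= lerD2r ltrD2r.
  by [].
have splitI (a b c : R) : a <= b -> b <= c -> (\int[leb1 R]_(x in `[a, c[) f x =
   \int[leb1 R]_(x in `[a, b[) f x + \int[leb1 R]_(x in `[b, c[) f x)%E.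
  move=> ab bc; rewrite (@itv_bndbnd_setU _ _ (BLeft a) (BLeft b) (BLeft c))//.
  apply: (@ge0_integral_setU _ B R (leb1 R)).
  - exact: measurable_itvB.
  - exact: measurable_itvB.
  - by apply: (measurable_funS measurableT) => //.
  - by [].
  - apply/disj_setPS => y [/=]; rewrite 2!in_itv/= => /andP[_ yx] /andP[].
    by rewrite leNgt yx.
have ms t : measurable_fun setT (fun x : B => f (x + t)).
  apply: (measurableT_comp mf); exact: measurable_funD.
rewrite -!integral_itv_bndo_bndc; [|exact: mI|exact: mI].
rewrite shiftI add0r.
rewrite (splitI r 1 (1 + r)); [|lra|lra].
rewrite [RHS](splitI 0 r 1); [|lra|lra].
rewrite addeC; congr (_ + _)%E.
have := shiftI 0 r 1; rewrite add0r (addrC r) => <-.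
by under eq_integral do rewrite f1.
Qed.

Lemma measurable_mk3 d (T : measurableType d) (a b c : T -> R) :
  measurable_fun setT a -> measurable_fun setT b -> measurable_fun setT c ->
  measurable_fun setT (fun t => (a t, b t, c t) : V).
Proof.
move=> ma mb mc; apply: (measurable_fun_pair (T1 := (B * B)%type)) mc.
exact: measurable_fun_pair.
Qed.

Lemma measurable_p11 : measurable_fun setT (fun X : V => X.1.1 : R).
Proof. exact: measurableT_comp. Qed.

Lemma measurable_p12 : measurable_fun setT (fun X : V => X.1.2 : R).
Proof. exact: measurableT_comp. Qed.

Lemma measurable_p2 : measurable_fun setT (fun X : V => X.2 : R).
Proof. exact: measurable_snd. Qed.

Lemma measurable_addV d (T : measurableType d) (f g : T -> V) :
  measurable_fun setT f -> measurable_fun setT g ->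
  measurable_fun setT (fun t => (f t : vec3 R) + (g t : vec3 R) : V).
Proof.
move=> mf mg; apply: measurable_mk3; apply: measurable_funD;
  by [exact: measurableT_comp measurable_p11 _ | exact: measurableT_comp measurable_p12 _ | exact: measurableT_comp measurable_p2 _].
Qed.

Lemma measurable_oppV d (T : measurableType d) (f : T -> V) :
  measurable_fun setT f ->
  measurable_fun setT (fun t => - (f t : vec3 R) : V).
Proof.
move=> mf; apply: measurable_mk3; apply: measurable_funN;
  by [exact: measurableT_comp measurable_p11 _ | exact: measurableT_comp measurable_p12 _ | exact: measurableT_comp measurable_p2 _].
Qed.

Lemma addVE (a b c a' b' c' : R) :
  ((a, b, c) : vec3 R) + (a', b', c') = (a + a', b + b', c + c').
Proof. by []. Qed.

(** The integral over the cube is a Haar integral on the torus; one coordinate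
    is shifted at a time, under the iterated integral. *)
Lemma integral_cube_shift (xi : vec3 R) (f : V -> R) :
  measurable_fun setT f -> (forall X, 0 <= f X) -> torus_periodic f ->
  (\int[leb3 R]_(X in @cube R) (f ((X : vec3 R) + xi))%:E =
   \int[leb3 R]_(X in @cube R) (f X)%:E)%E.
Proof.
move=> mf f0 fper; case: xi => -[a b] c.
have mfx (g : V -> V) : measurable_fun setT g ->
    measurable_fun setT (fun X => (f (g X))%:E).
  by move=> mg; apply/measurable_EFinP; exact: measurableT_comp mf mg.
rewrite leb3_cubeE; last 2 first.
- apply: mfx; apply: (measurable_addV (T := V)) => //.
- by move=> X; rewrite lee_fin.
rewrite leb3_cubeE; last 2 first.
- exact: (mfx id).
- by move=> X; rewrite lee_fin.
have mI := @measurable_itvB `[0, 1].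
have mE : measurable_fun setT (EFin \o f) by exact/measurable_EFinP.
pose F1 (p : B * B) := (\int[leb1 R]_(z in `[0%R, 1%R]) (f (p, z))%:E)%E.
have mF1 : measurable_fun setT F1.
  by apply: (@measurable_tonelli1 _ _ _ _ _ (leb1 R) _ mI (EFin \o f)) => // X;
    rewrite lee_fin.
have F10 p : (0 <= F1 p)%E by apply: integral_ge0 => z _; rewrite lee_fin.
pose F2 (x : B) := (\int[leb1 R]_(y in `[0%R, 1%R]) F1 (x, y))%E.
have mF2 : measurable_fun setT F2.
  exact: (@measurable_tonelli1 _ _ _ _ _ (leb1 R) _ mI F1).
have F20 p : (0 <= F2 p)%E by apply: integral_ge0.
transitivity (\int[leb1 R]_(x in `[0%R, 1%R]) F2 (x + a)%R)%E; last first.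
  apply: (integral_periodic_shift _ (f := F2)) => // x; apply: eq_integral => y _.
  apply: eq_integral => z _; have [+ _ _] := fper (x, y, z).
  by rewrite /ex addVE !addr0 => ->.
apply: eq_integral => x _.
transitivity (\int[leb1 R]_(y in `[0%R, 1%R]) F1 ((x + a)%R, (y + b)%R))%E;
  last first.
  apply: (integral_periodic_shift _ (f := fun y => F1 (x + a, y))) => //.
    by apply: measurableT_comp mF1 _; exact: pair1_measurable.
  move=> y; apply: eq_integral => z _; have [_ + _] := fper (x + a, y, z).
  by rewrite /ey addVE !addr0 => ->.
apply: eq_integral => y _.
apply: (integral_periodic_shift _ (f := fun z => (f (x + a, y + b, z))%:E)).
- by apply: measurableT_comp mE _; exact: pair1_measurable.
- by move=> z; rewrite lee_fin.
- move=> z; have [_ _ +] := fper (x + a, y + b, z).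
  by rewrite /ez addVE !addr0 => ->.
Qed.

End LebesgueSpaces.

(** * Smooth functions of one variable *)

Section Smooth1.
Variable R : realType.
Implicit Types (f g : R -> R).

(** Smoothness in one variable, one derivative at a time: an induction on the
    number of derivatives gives the closure properties without any formula for
    the iterated derivatives. *)
Fixpoint ndiff n f : Prop := if n is n'.+1 then
  exists2 f' : R -> R,
    (forall x : R, is_derive x (1 : R) f (f' x)) & ndiff n' f'
  else True.

Definition smooth1 f := forall n, ndiff n f.

Lemma ndiffS n f : ndiff n.+1 f -> ndiff n f.
Proof.
by elim: n f => // n IH f [f' df sf]; exists f' => //; exact: IH.
Qed.

Lemma ndiffD n f g : ndiff n f -> ndiff n g -> ndiff n (fun x => f x + g x).
Proof.
elim: n f g => // n IH f g [f' df sf] [g' dg sg].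
by exists (fun x => f' x + g' x); [move=> x; exact: is_deriveD|exact: IH].
Qed.

Lemma ndiffM n f g : ndiff n f -> ndiff n g -> ndiff n (fun x => f x * g x).
Proof.
elim: n f g => // n IH f g hf hg.
have [nf ng] := (ndiffS hf, ndiffS hg).
case: hf hg => f' df sf [g' dg sg].
exists (fun x => f x * g' x + g x * f' x); first by move=> x; exact: is_deriveM.
by apply: ndiffD; exact: IH.
Qed.

Lemma ndiff_cst n (c : R) : ndiff n (fun=> c).
Proof. by elim: n c => // n IH c; exists (fun=> 0) => [x|]; [exact: is_derive_cst|exact: IH]. Qed.

Lemma ndiff_comp n f g : ndiff n f -> ndiff n g -> ndiff n (fun x => f (g x)).
Proof.
elim: n f g => // n IH f g hf hg; have ng := ndiffS hg.
case: hf hg => f' df sf [g' dg sg].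
exists (fun x => g' x * f' (g x)).
  move=> x; have dfx := df (g x); have dgx := dg x.
  apply: (is_derive_eq (@is_derive1_comp _ f g x _ _ dfx dgx)).
  by rewrite mulrC.
by apply: ndiffM => //; exact: IH.
Qed.

Lemma smooth1_cst (c : R) : smooth1 (fun=> c).
Proof. by move=> n; exact: ndiff_cst. Qed.

Lemma smooth1D f g : smooth1 f -> smooth1 g -> smooth1 (fun x => f x + g x).
Proof. by move=> sf sg n; exact: ndiffD. Qed.

Lemma smooth1M f g : smooth1 f -> smooth1 g -> smooth1 (fun x => f x * g x).
Proof. by move=> sf sg n; exact: ndiffM. Qed.

Lemma smooth1_comp f g : smooth1 f -> smooth1 g -> smooth1 (fun x => f (g x)).
Proof. by move=> sf sg n; exact: ndiff_comp. Qed.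

Lemma smooth1N f : smooth1 f -> smooth1 (fun x => - f x).
Proof.
move=> sf; rewrite (_ : (fun x => _) = fun x => -1 * f x).
  by apply: smooth1M => //; exact: smooth1_cst.
by apply/funext => x; rewrite mulN1r.
Qed.

Lemma smooth1B f g : smooth1 f -> smooth1 g -> smooth1 (fun x => f x - g x).
Proof. by move=> sf sg; apply: smooth1D => //; exact: smooth1N. Qed.

Lemma smooth1_id : smooth1 (fun x => x).
Proof. by case=> // n; exists (fun=> 1) => [x|]; [exact: is_derive_id|exact: ndiff_cst]. Qed.

Lemma smooth1X f k : smooth1 f -> smooth1 (fun x => f x ^+ k).
Proof.
move=> sf; elim: k => [|k IH]; first exact: smooth1_cst.
rewrite (_ : (fun x => _) = fun x => f x * f x ^+ k); first exact: smooth1M.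
by apply/funext => x; rewrite exprS.
Qed.

Lemma is_derive_unique1 f f' (x : R) : is_derive x (1 : R) f (f' x) -> (derive1 f) x = f' x.
Proof. by move=> df; rewrite derive1E derive_val. Qed.

Lemma smooth1_derive f : smooth1 f -> forall x : R, is_derive x (1 : R) f ((derive1 f) x).
Proof.
move=> sf x; have [f' df _] := sf 1%N.
by rewrite (is_derive_unique1 (df x)).
Qed.

Lemma smooth1_derive1 f : smooth1 f -> smooth1 (derive1 f).
Proof.
move=> sf n; have [f' df nf'] := sf n.+1.
by rewrite (_ : (derive1 f) = f')//; apply/funext => x; exact: is_derive_unique1.
Qed.

Lemma smooth1_prim f f' : (forall x : R, is_derive x (1 : R) f (f' x)) -> smooth1 f' ->
  smooth1 f.
Proof. by move=> df sf; case=> // n; exists f' => //; exact: sf. Qed.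

Lemma smooth1_continuous f : smooth1 f -> continuous f.
Proof.
move=> sf x; have /derivable1_diffP := @ex_derive _ _ _ _ _ _ _ (smooth1_derive sf x).
exact: differentiable_continuous.
Qed.

Lemma smooth1_measurable f : smooth1 f -> measurable_fun [set: measurableTypeR R] f.
Proof.
move=> sf; have := smooth1_continuous sf; exact: continuous_measurable_fun.
Qed.

Lemma ndiff_sincos n : ndiff n (@sin R) /\ ndiff n (@cos R).
Proof.
elim: n => // n [IHs IHc]; split; first by exists cos => // x; exact: is_derive_sin.
exists (fun x => -1 * sin x); last by apply: ndiffM => //; exact: ndiff_cst.
by move=> x; rewrite mulN1r; exact: is_derive_cos.
Qed.

Lemma smooth1_sin : smooth1 sin. Proof. by move=> n; case: (ndiff_sincos n). Qed.
Lemma smooth1_cos : smooth1 cos. Proof. by move=> n; case: (ndiff_sincos n). Qed.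

(** * A smooth cutoff *)

(** The family [x^-k exp(-1/x)] on [x > 0], extended by zero, is closed under
    differentiation up to linear combinations, hence consists of smooth
    functions. *)
Definition flat k (x : R) : R := if 0 < x then x ^- k * expR (- x^-1) else 0.

Lemma flat_ge0 k x : 0 <= flat k x.
Proof.
rewrite /flat; case: ifPn => // x0.
by rewrite mulr_ge0 ?expR_ge0// invr_ge0 exprn_ge0// ltW.
Qed.

Lemma flat_le k x : 0 <= x -> flat k x <= (k.+1)`!%:R * x.
Proof.
rewrite le_eqVlt => /predU1P[<-|x0]; first by rewrite /flat ltxx mulr0.
have y0 : 0 < x^-1 by rewrite invr_gt0.
rewrite /flat x0 -exprVn expRN ler_pdivrMr ?expR_gt0//.
have -> : x^-1 ^+ k = x^-1 ^+ k.+1 * x.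
  by rewrite exprS mulrAC mulVf ?gt_eqF// mul1r.
rewrite mulrAC ler_pM2r// mulrC -ler_pdivrMr ?ltr0n ?fact_gt0//.
by apply: le_trans (expR_ge1Dxn k (ltW y0)); rewrite lerDr.
Qed.

Lemma is_derive_flat k (x : R) :
  is_derive x (1 : R) (flat k) (flat k.+2 x - k%:R * flat k.+1 x).
Proof.
have [x0|x0|->] := ltgtP x 0.
- rewrite /flat !ifF ?(lt_gtF x0)// mulr0 subrr.
  apply: (near_eq_is_derive _ (is_derive_cst (0 : R) x (1 : R))).
  near=> y; rewrite /flat ifF//; apply/negbTE; rewrite -leNgt ltW//.
  by near: y; exact: lt_nbhsl.
- have D : is_derive x (1 : R) (fun y => (y ^-1) ^+ k * expR (- y^-1))
      (flat k.+2 x - k%:R * flat k.+1 x).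
    have xn0 : x != 0 by rewrite gt_eqF.
    have dV : is_derive x (1 : R) (fun y : R => y^-1) (- x ^- 2).
      apply: (is_derive_eq (@is_deriveV _ id x 1 1 xn0 (is_derive_id _ _))).
      exact: mulr1.
    have dE : is_derive x (1 : R) (fun y : R => expR (- y^-1))
        (x ^- 2 * expR (- x^-1)).
      have dN : is_derive x (1 : R) (fun y : R => - y^-1) (x ^- 2).
        by apply: (is_derive_eq (is_deriveN dV)); rewrite opprK.
      apply: (is_derive_eq (@is_derive1_comp _ expR (fun y : R => - y^-1) x _ _
        (is_derive_expR _) dN)).
      by rewrite mulrC.
    have dP : is_derive x (1 : R) (fun y : R => (y ^-1) ^+ k)
        (k%:R * x^-1 ^+ k.-1 * - x ^- 2).
      have := is_deriveX k dV; rewrite exprfctE; move/is_derive_eq; apply.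
      by rewrite /GRing.scale /= mulr_natl.
    have := is_deriveM dP dE; move/is_derive_eq; apply.
    rewrite /flat x0 /GRing.scale /= !exprVn.
    case: k {dP} => [|k]; first by rewrite !mul0r /=; field.
    rewrite /= !exprS; field.
    by rewrite expf_neq0.
  apply: (near_eq_is_derive _ D).
  near=> y; rewrite /flat ifT ?exprVn//.
  by near: y; exact: lt_nbhsr.
- have -> : flat k.+2 0 - k%:R * flat k.+1 0 = 0.
    by rewrite /flat ltxx mulr0 subrr.
  have D : (fun h => h^-1 *: ((flat k \o shift (0 : R)) (h *: (1 : R)) - flat k 0))
      @ 0^' --> (0 : R).
    apply/cvgrPdist_le => e e0; near=> h.
    rewrite sub0r normrN /= addr0 [flat k 0]/flat ltxx subr0.
    rewrite /GRing.scale /= mulr1 normrM normfV (ger0_norm (flat_ge0 _ _)).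
    have h0 : h != 0 by near: h; exact: nbhs_dnbhs_neq.
    have [hp|hn] := ltP 0 h; last first.
      by rewrite /flat ifF ?mulr0 ?ltW// ltNge hn.
    have -> : `|h|^-1 * flat k h = flat k.+1 h.
      by rewrite /flat hp gtr0_norm// exprS invfM -!mulrA; congr (_ * _); ring.
    apply: le_trans (flat_le _ (ltW hp)) _.
    rewrite mulrC -ler_pdivlMr ?ltr0n ?fact_gt0//.
    apply: le_trans (ler_norm _) _.
    near: h; apply: dnbhs0_le.
    by rewrite divr_gt0// ltr0n fact_gt0.
  apply: DeriveDef; last exact: (cvg_lim (@norm_hausdorff _ _) D).
  by apply/cvg_ex; exists 0.
Unshelve. all: by end_near.
Qed.

Lemma smooth1_flat k : smooth1 (flat k).
Proof.
move=> n; elim: n k => // n IH k.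
exists (fun x => flat k.+2 x + - k%:R * flat k.+1 x).
  by move=> x; apply: (is_derive_eq (is_derive_flat k x)); rewrite mulNr.
by apply: ndiffD => //; apply: ndiffM => //; exact: ndiff_cst.
Qed.

Definition cutoff : R -> R := flat 0.

Lemma smooth1_cutoff : smooth1 cutoff. Proof. exact: smooth1_flat. Qed.

Lemma cutoff_ge0 x : 0 <= cutoff x. Proof. exact: flat_ge0. Qed.

Lemma cutoff_le1 x : cutoff x <= 1.
Proof.
rewrite /cutoff /flat; case: ifPn => // x0.
by rewrite expr0 invr1 mul1r expR_le1 oppr_le0 invr_ge0 ltW.
Qed.

Lemma cutoff_eq0 x : x <= 0 -> cutoff x = 0.
Proof. by move=> x0; rewrite /cutoff /flat ltNge x0. Qed.

(** Rescaled cutoffs approximate the indicator of the positive half-line, even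
    along arguments that vary with [n]. *)
Lemma cutoff_cvg (u : nat -> R) : u n @[n --> \oo] --> +oo%R ->
  cutoff (u n) @[n --> \oo] --> (1 : R).
Proof.
move=> uoo.
have V : (u n)^-1 @[n --> \oo] --> (0 : R).
  apply/gtr0_cvgV0 => //.
  by move/cvgryPgt : uoo => /(_ 0).
have E : expR (- (u n)^-1) @[n --> \oo] --> (1 : R).
  rewrite -[X in _ --> X](@expR0 R) -oppr0.
  apply: continuous_cvg; first exact: continuous_expR.
  exact: cvgN.
apply: cvg_trans E; apply: near_eq_cvg.
move/cvgryPgt : uoo => /(_ 0) uoo; near=> n.
rewrite /cutoff /flat ifT ?expr0 ?invr1 ?mul1r//.
by near: n.
Unshelve. all: by end_near.
Qed.

End Smooth1.

(** * Smooth functions of several variables *)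

Section SmoothV.
Variable R : realType.
Variable V : normedModType R.
Implicit Types f g : V -> R.

(** The analogue in several variables: all directional derivatives are again in
    the class. *)
Fixpoint vdiff n f : Prop := if n is n'.+1 then
  (forall X, differentiable f X) /\ forall v, vdiff n' (fun X => 'D_v f X)
  else True.

Lemma vdiffS n f : vdiff n.+1 f -> vdiff n f.
Proof.
by elim: n f => // n IH f [df sf]; split => // v; apply: IH; exact: sf.
Qed.

Lemma smooth_vdiff f : (forall n, vdiff n f) -> smooth f.
Proof.
move=> sf vs; elim/last_ind: vs f sf => [|vs v IH] f sf X.
  by have [] := sf 1%N.
by rewrite foldr_rcons; apply: IH => n; have [_ /(_ v)] := sf n.+1.
Qed.

Lemma vdiffD n f g : vdiff n f -> vdiff n g -> vdiff n (fun X => f X + g X).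
Proof.
elim: n f g => // n IH f g [df sf] [dg sg].
split=> [X|v]; first exact: differentiableD.
rewrite (_ : (fun X => _) = (fun X => 'D_v f X + 'D_v g X)).
  by apply: IH; [exact: sf|exact: sg].
by apply/funext => X; apply: deriveD; exact: diff_derivable.
Qed.

Lemma vdiffM n f g : vdiff n f -> vdiff n g -> vdiff n (fun X => f X * g X).
Proof.
elim: n f g => // n IH f g hf hg; have [nf ng] := (vdiffS hf, vdiffS hg).
case: hf hg => df sf [dg sg].
split=> [X|v]; first exact: differentiableM.
rewrite (_ : (fun X => _) = (fun X => f X * 'D_v g X + g X * 'D_v f X)).
  by apply: vdiffD; apply: IH => //; [exact: sg|exact: sf].
by apply/funext => X; apply: deriveM; exact: diff_derivable.
Qed.

Lemma vdiff_cst n (c : R) : vdiff n (fun=> c).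
Proof.
elim: n c => // n IH c; split=> [X|v]; first exact: (differentiable_cst c X).
have -> : (fun X => 'D_v (fun=> c) X) = (fun=> 0).
  by apply/funext => X; exact: (derive_cst c).
exact: IH.
Qed.

(** Only linear projections occur: the chain rule for them reduces the
    derivatives of a product of functions of single coordinates to derivatives in
    one variable. *)
Definition linear_coord (L : V -> R) : Prop :=
  (forall X, differentiable L X) /\ forall X v, 'D_v L X = L v.

Lemma derive_comp_coord (g : R -> R) L v X : smooth1 g -> linear_coord L ->
  'D_v (fun X => g (L X)) X = L v * derive1 g (L X).
Proof.
move=> sg [dL DL].
have dg : differentiable g (L X).
  by apply/derivable1_diffP; have [] := smooth1_derive sg (L X).
rewrite (deriveE v (differentiable_comp (dL X) dg)) diff_comp// /= diff1E//.
by rewrite -deriveE// DL.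
Qed.

Lemma differentiable_comp_coord (g : R -> R) L X : smooth1 g -> linear_coord L ->
  differentiable (fun X => g (L X)) X.
Proof.
move=> sg [dL DL]; apply: differentiable_comp => //.
by apply/derivable1_diffP; have [] := smooth1_derive sg (L X).
Qed.

Lemma vdiff_comp n (g : R -> R) L : smooth1 g -> linear_coord L ->
  vdiff n (fun X => g (L X)).
Proof.
move=> + hL; elim: n g => // n IH g sg; split=> [X|v].
  exact: differentiable_comp_coord.
rewrite (_ : (fun X => _) = (fun X => L v * derive1 g (L X))).
  by apply: vdiffM; [exact: vdiff_cst|exact/IH/smooth1_derive1].
by apply/funext => X; exact: derive_comp_coord.
Qed.

End SmoothV.

Section Tensors.
Variable R : realType.
Local Notation vec3 := (vec3 R).
Local Notation spacetime := (spacetime R).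

Lemma linear_coord_of (V : normedModType R) (L : V -> R) :
  (forall a x y, L (a *: x + y) = a * L x + L y) -> continuous L ->
  linear_coord L.
Proof.
move=> hL cL.
pose l : {linear V -> R^o} := HB.pack L (GRing.isLinear.Build R V R^o _ L hL).
have dl X : differentiable (l : V -> R^o) X by exact: linear_differentiable.
split=> [X|X v]; first exact: dl.
by rewrite deriveE; [rewrite (diff_lin _ (cL : continuous l))|exact: dl].
Qed.

Let cvg_fst' (V W : normedModType R) : continuous (@fst V W).
Proof. by move=> [x y]; exact: cvg_fst. Qed.
Let cvg_snd' (V W : normedModType R) : continuous (@snd V W).
Proof. by move=> [x y]; exact: cvg_snd. Qed.

Lemma coord_x : linear_coord (fun X : vec3 => X.1.1).
Proof.
apply: linear_coord_of => // X.
by apply: (continuous_comp (f := fst) (g := fst)); exact: cvg_fst'.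
Qed.

Lemma coord_y : linear_coord (fun X : vec3 => X.1.2).
Proof.
apply: linear_coord_of => // X.
by apply: (continuous_comp (f := fst) (g := snd)); [exact: cvg_fst'|exact: cvg_snd'].
Qed.

Lemma coord_z : linear_coord (fun X : vec3 => X.2).
Proof. by apply: linear_coord_of => // X; exact: cvg_snd'. Qed.

Lemma coord_time : linear_coord (fun p : spacetime => p.2).
Proof. by apply: linear_coord_of => // X; exact: cvg_snd'. Qed.

Lemma coord_space (L : vec3 -> R) : (forall a x y, L (a *: x + y) = a * L x + L y) ->
  linear_coord L -> linear_coord (fun p : spacetime => L p.1).
Proof.
move=> hL [dL _]; apply: linear_coord_of => [a x y|X].
  exact: hL.
apply: (continuous_comp (f := fst) (g := L)); first exact: cvg_fst'.
exact/differentiable_continuous/dL.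
Qed.

(** Products of functions of one coordinate each. Weak derivatives and weak
    formulations are only ever tested with such products, times a function of time
    for the latter. *)
Definition tensor (a b c : R -> R) : vec3 -> R :=
  fun X => a X.1.1 * b X.1.2 * c X.2.

Definition times_psi (f : vec3 -> R) (psi : R -> R) : spacetime -> R :=
  fun p => f p.1 * psi p.2.

Variables (a b c : R -> R).
Hypotheses (sa : smooth1 a) (sb : smooth1 b) (sc : smooth1 c).

Lemma smooth_tensor : smooth (tensor a b c).
Proof.
apply: smooth_vdiff => n; apply: vdiffM; first apply: vdiffM.
- exact: (vdiff_comp _ sa coord_x).
- exact: (vdiff_comp _ sb coord_y).
- exact: (vdiff_comp _ sc coord_z).
Qed.

Lemma derive_tensor (v X : vec3) : 'D_v (tensor a b c) X =
  v.1.1 * tensor (derive1 a) b c X + v.1.2 * tensor a (derive1 b) c X +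
  v.2 * tensor a b (derive1 c) X.
Proof.
have dx : derivable (fun X : vec3 => a X.1.1) X v.
  exact/diff_derivable/(differentiable_comp_coord _ sa coord_x).
have dy : derivable (fun X : vec3 => b X.1.2) X v.
  exact/diff_derivable/(differentiable_comp_coord _ sb coord_y).
have dz : derivable (fun X : vec3 => c X.2) X v.
  exact/diff_derivable/(differentiable_comp_coord _ sc coord_z).
rewrite (deriveM (derivableM dx dy) dz) (deriveM dx dy).
rewrite (derive_comp_coord _ _ sa coord_x) (derive_comp_coord _ _ sb coord_y).
rewrite (derive_comp_coord _ _ sc coord_z).
rewrite /GRing.scale /= /tensor. by rewrite ?fctE /=; ring.
Qed.

Lemma derive_tensor_ex : 'D_(@ex R) (tensor a b c) = tensor (derive1 a) b c.
Proof. by apply/funext => X; rewrite derive_tensor /= !mul0r !addr0 mul1r. Qed.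

Lemma derive_tensor_ey : 'D_(@ey R) (tensor a b c) = tensor a (derive1 b) c.
Proof. by apply/funext => X; rewrite derive_tensor /= !mul0r add0r addr0 mul1r. Qed.

Lemma derive_tensor_ez : 'D_(@ez R) (tensor a b c) = tensor a b (derive1 c).
Proof. by apply/funext => X; rewrite derive_tensor /= !mul0r !add0r mul1r. Qed.

Variables (psi : R -> R).
Hypotheses (sp : smooth1 psi).

Let tE : times_psi (tensor a b c) psi =
  fun p : spacetime => a p.1.1.1 * b p.1.1.2 * c p.1.2 * psi p.2.
Proof. by []. Qed.

Let cx := coord_space (fun _ _ _ => erefl) coord_x.
Let cy := coord_space (fun _ _ _ => erefl) coord_y.
Let cz := coord_space (fun _ _ _ => erefl) coord_z.

Lemma smooth_times_psi : smooth (times_psi (tensor a b c) psi).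
Proof.
rewrite tE; apply: smooth_vdiff => n.
apply: vdiffM; first apply: vdiffM; first apply: vdiffM.
- exact: (vdiff_comp _ sa cx).
- exact: (vdiff_comp _ sb cy).
- exact: (vdiff_comp _ sc cz).
- exact: (vdiff_comp _ sp coord_time).
Qed.

Lemma derive_times_psi (v p : spacetime) : 'D_v (times_psi (tensor a b c) psi) p =
  (v.1.1.1 * tensor (derive1 a) b c p.1 + v.1.1.2 * tensor a (derive1 b) c p.1 +
  v.1.2 * tensor a b (derive1 c) p.1) * psi p.2 +
  v.2 * (tensor a b c p.1 * derive1 psi p.2).
Proof.
have dx : derivable (fun p : spacetime => a p.1.1.1) p v.
  exact/diff_derivable/(differentiable_comp_coord _ sa cx).
have dy : derivable (fun p : spacetime => b p.1.1.2) p v.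
  exact/diff_derivable/(differentiable_comp_coord _ sb cy).
have dz : derivable (fun p : spacetime => c p.1.2) p v.
  exact/diff_derivable/(differentiable_comp_coord _ sc cz).
have dt : derivable (fun p : spacetime => psi p.2) p v.
  exact/diff_derivable/(differentiable_comp_coord _ sp coord_time).
rewrite tE (deriveM (derivableM (derivableM dx dy) dz) dt).
rewrite (deriveM (derivableM dx dy) dz) (deriveM dx dy).
rewrite (derive_comp_coord _ _ sa cx) (derive_comp_coord _ _ sb cy).
rewrite (derive_comp_coord _ _ sc cz) (derive_comp_coord _ _ sp coord_time).
by rewrite /GRing.scale /= /tensor ?fctE /=; ring.
Qed.

End Tensors.

(** * Primitives *)

Section Primitive.
Variable R : realType.
Local Notation mu := (@lebesgue_measure R).

Lemma continuous_integrable (f : R -> R) (x y : R) : continuous f ->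
  mu.-integrable `[x, y] (EFin \o f).
Proof.
move=> cf; apply: continuous_compact_integrable; first exact: segment_compact.
exact: continuous_subspaceT.
Qed.

Lemma continuous_primitive (f : R -> R) : continuous f ->
  exists F : R -> R, forall x : R, is_derive x (1 : R) F (f x).
Proof.
move=> cf.
pose I (c x : R) := \int[mu]_(t in `[c, x]) f t.
have IB (c c' x y : R) : c <= c' -> c' <= x -> c' <= y ->
    I c x - I c y = I c' x - I c' y.
  move=> cc' cx cy.
  have H z : c' <= z -> I c z - I c c' = I c' z.
    move=> c'z; rewrite /I.
    rewrite (@Rintegral_itvB R f (BLeft c) (BRight z) c') ?bnd_simp//; last first.
      exact: continuous_integrable.
    rewrite Rintegral_itv_obnd_cbnd//.
    apply: integrableS (continuous_integrable c' z cf) => //.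
    by apply: subset_itvr; rewrite bnd_simp.
  by rewrite -(H x cx) -(H y cy); ring.
exists (fun x => I (- `|x| - 1) x - I (- `|x| - 1) 0) => x.
pose c := - `|x| - 2.
have D : is_derive x (1 : R) (fun y => I c y - I c 0) (f x).
  have cx : c < x.
    by rewrite /c; have := lerNnormlW (lexx `|x|); lra.
  have xx : x < x + 1 by rewrite ltrDl.
  have [d1 d2] := @continuous_FTC1_closed R f c x (x + 1) xx
    (continuous_integrable c (x + 1) cf) cx (cf x).
  have D1 : is_derive x (1 : R) (I c) (f x).
    by apply: (DeriveDef d1); rewrite -derive1E; exact: d2.
  apply: (is_derive_eq (is_deriveB D1 (is_derive_cst (I c 0) x (1 : R)))).
  by rewrite subr0.
apply: (near_eq_is_derive _ D); near=> y.
have y1 : `|y| <= `|x| + 1.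
  have xy : `|x - y| < 1 by near: y; exact: (nbhsx_ballx x 1 ltr01).
  have -> : y = x - (x - y) by ring.
  by apply: le_trans (ler_normB _ _) _; rewrite lerD2l ltW.
have := lerNnormlW (lexx `|y|); have := normr_ge0 y; have := normr_ge0 x.
by move=> ? ? ?; apply: IB; rewrite /c; lra.
Unshelve. all: by end_near.
Qed.

End Primitive.

(** * Integration tools for uniqueness *)

Section DominatedRintegral.
Context d (T : measurableType d) (R : realType).
Variable mu : {measure set T -> \bar R}.

Lemma cvg_Rintegral_dominated (D : set T) (f_ : nat -> T -> R) (f g : T -> R) :
  measurable D -> (forall n, measurable_fun D (f_ n)) ->
  (forall x, D x -> f_ n x @[n --> \oo] --> f x) ->
  mu.-integrable D (EFin \o g) ->
  (forall n x, D x -> `|f_ n x| <= g x) ->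
  mu.-integrable D (EFin \o f) /\
  \int[mu]_(x in D) f_ n x @[n --> \oo] --> \int[mu]_(x in D) f x.
Proof.
move=> mD mf ff ig fg.
have mflim : measurable_fun D f by exact: measurable_fun_cvg mf ff.
have ffE x : D x -> (f_ n x)%:E @[n --> \oo] --> (f x)%:E.
  by move=> Dx; apply/fine_cvgP; split; [exact: nearW|exact: ff].
have [i1 _ c] := @dominated_convergence _ T R mu D mD
  (fun n => EFin \o f_ n) (EFin \o f) (EFin \o g)
  (fun n => (measurable_EFinP _ _).2 (mf n)) ((measurable_EFinP _ _).2 mflim)
  (aeW _ ffE) ig (aeW _ (fun x n Dx => fg n x Dx)).
split => //.
have -> : (fun n => \int[mu]_(x in D) f_ n x) =
   fine \o (fun n => \int[mu]_(x in D) (f_ n x)%:E)%E by [].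
have -> : \int[mu]_(x in D) f x = fine (\int[mu]_(x in D) (f x)%:E)%E by [].
apply: fine_cvg; rewrite fineK//; exact: integrable_fin_num.
Qed.

End DominatedRintegral.

Section PiLambda.
Context d (T : measurableType d) (R : realType).
Variable mu : {measure set T -> \bar R}.

(** The sets over whose preimage [h] has integral zero form a lambda-system. *)
Lemma pi_lambda_integral d' (T' : measurableType d') (G : set (set T'))
    (phi : T -> T') (h : T -> R) :
  measurable_fun setT phi -> mu.-integrable setT (EFin \o h) ->
  @measurable _ T' = <<s G >> -> setI_closed G ->
  (\int[mu]_x h x = 0) ->
  (forall B, G B -> \int[mu]_(x in phi @^-1` B) h x = 0) ->
  forall B, measurable B -> \int[mu]_(x in phi @^-1` B) h x = 0.
Proof.
move=> mphi ih genG IG hT hG.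
pose H := [set B : set T' | measurable B /\ \int[mu]_(x in phi @^-1` B) h x = 0].
have mpre B : measurable B -> measurable (phi @^-1` B).
  by move=> mB; rewrite -[X in measurable X]setTI; exact: mphi.
have ihB B : measurable B -> mu.-integrable (phi @^-1` B) (EFin \o h).
  move=> mB; apply: integrableS ih => //; exact: mpre.
suff GH : @measurable _ T' `<=` H by move=> B /GH[].
rewrite genG; apply: lambda_system_subset => //; last first.
  by move=> B GB; split; [rewrite genG; exact: sub_sigma_algebra|exact: hG].
split => //.
- move=> A B BA [mA hA] [mB hB]; split; first exact: measurableD.
  have E : phi @^-1` A = (phi @^-1` B) `|` (phi @^-1` (A `\` B)).
    by rewrite -preimage_setU setDUK.
  move: hA; rewrite E Rintegral_setU.
  + by rewrite hB add0r.
  + exact: mpre.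
  + exact/mpre/measurableD.
  + by rewrite -E; exact: ihB.
  + by apply/disj_setPS => x [/= Bx []].
- move=> F ndF HF.
  have mF i : measurable (F i) by have [] := HF i.
  split; first exact: bigcupT_measurable.
  have mU : measurable (\bigcup_i F i) by exact: bigcupT_measurable.
  have [] := @cvg_Rintegral_dominated _ _ R mu setT
    (fun n => h \_ (phi @^-1` F n)) (h \_ (phi @^-1` \bigcup_i F i))
    (fun x => `|h x|) measurableT.
  + move=> n; apply/(measurable_restrictT _ (mpre _ (mF n))).
    by apply/measurable_EFinP; case/integrableP : (ihB _ (mF n)).
  + move=> x _; rewrite !patchE.
    have [Fx|Fx] := pselect ((\bigcup_i F i) (phi x)); last first.
      have -> : (fun n => (h \_ (phi @^-1` F n)) x) = cst 0.
        apply/funext => n; rewrite patchE memNset//= => Fn; apply: Fx.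
        by exists n.
      by rewrite memNset//; exact: cvg_cst.
    rewrite mem_set//; have [m _ Fm] := Fx.
    apply: cvg_near_cst; near=> n.
    rewrite patchE mem_set//=.
    have mn : (m <= n)%N by near: n; exists m.
    by have /subsetPset := ndF _ _ mn; apply.
  + exact: integrable_norm ih.
  + move=> n x _; rewrite patchE; case: ifP => // _.
    by rewrite normr0.
  move=> _; under eq_fun do rewrite -Rintegral_mkcond (HF _).2.
  rewrite -Rintegral_mkcond => c0.
  exact/esym/(cvg_unique _ (cvg_cst _) c0).
Unshelve. all: by end_near.
Qed.

End PiLambda.

(** * Testing against tensor products determines a function on the torus *)

Section TorusUnique.
Variable R : realType.
Local Notation B := (measurableTypeR R).
Local Notation V := (B * B * B)%type.
Local Notation leb3 := (leb3 R).

Definition per1 (a : R -> R) := forall x, a (x + 1) = a x.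

(** The sets whose indicator is, inside the open period, a bounded pointwise
    limit of smooth periodic functions; dominated convergence turns orthogonality
    to such functions into a vanishing integral over the set. *)
Definition approx (A : set B) := exists a : nat -> R -> R,
  [/\ forall n, smooth1 (a n), forall n, per1 (a n),
      forall n t, 0 <= a n t <= 1 &
      forall t, 0 < t < 1 -> a n t @[n --> \oo] --> (\1_A t : R)].

Lemma approxT : approx setT.
Proof.
exists (fun _ _ => 1); split => //.
- by move=> n; exact: smooth1_cst.
- by move=> n t; rewrite ler01 lexx.
- by move=> t _; rewrite indicT; exact: cvg_cst.
Qed.

(** Apply cutoffs to a large multiple of a periodic function that is positive
    exactly on the part of the ray inside the period: a product of two sines, one
    vanishing at the end point of the ray and one at the integers. *)
Lemma approx_ray x : approx `]x, +oo[%classic.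
Proof.
pose m := Num.max x 0.
have [m1|m1] := leP 1 m.
  exists (fun _ _ => 0); split => //.
  - by move=> n; exact: smooth1_cst.
  - by move=> n t; rewrite lexx ler01.
  - move=> t /andP[t0 t1]; rewrite indicE memNset; first exact: cvg_cst.
    rewrite /= in_itv/= andbT => xt.
    by move: m1; rewrite /m le_max => /orP[|]; lra.
pose s t : R := sin (pi * (t - m)) * sin (pi * (1 - t)).
have ss : smooth1 s.
  apply: smooth1M; apply: smooth1_comp; try exact: smooth1_sin.
  - apply: smooth1M; first exact: smooth1_cst.
    by apply: smooth1B; [exact: smooth1_id|exact: smooth1_cst].
  - apply: smooth1M; first exact: smooth1_cst.
    by apply: smooth1B; [exact: smooth1_cst|exact: smooth1_id].
have m0 : 0 <= m by rewrite /m le_max lexx orbT.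
have sn (t : R) : 0 < t < 1 -> 0 < sin (pi * t).
  move=> /andP[t0 t1]; apply: sin_gt0_pi.
  by rewrite mulr_gt0 ?pi_gt0//= gtr_pMr// pi_gt0.
exists (fun n t => cutoff (n%:R * s t)); split.
- move=> n; apply: smooth1_comp; first exact: smooth1_cutoff.
  by apply: smooth1M => //; exact: smooth1_cst.
- move=> n t; congr (cutoff (_ * _)); rewrite /s.
  rewrite (_ : pi * (t + 1 - m) = pi * (t - m) + pi); last by ring.
  rewrite (_ : pi * (1 - t) = pi * (1 - (t + 1)) + pi); last by ring.
  by rewrite !sinDpi; ring.
- by move=> n t; rewrite cutoff_ge0 cutoff_le1.
move=> t /andP[t0 t1].
have s1 : 0 < sin (pi * (1 - t)) by apply: sn; lra.
have [tm|mt] := leP t m.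
  have xm : x = m.
    by move: tm; rewrite /m; have [x0|x0] := leP x 0; lra.
  rewrite indicE memNset; last by rewrite /= in_itv/= andbT; lra.
  have -> : (fun n : nat => cutoff (n%:R * s t)) = cst 0.
    apply/funext => n; apply: cutoff_eq0.
    apply: mulr_ge0_le0 => //; apply: mulr_le0_ge0; last exact: ltW.
    have [->|tm'] := eqVneq t m; first by rewrite subrr mulr0 sin0.
    rewrite -oppr_ge0 -sinN -mulrN opprB ltW// sn// subr_gt0 lt_neqAle tm' tm/=.
    by lra.
  exact: cvg_cst.
rewrite indicE mem_set; last first.
  by rewrite /= in_itv/= andbT (le_lt_trans _ mt)// /m le_max lexx.
have st : 0 < s t by rewrite mulr_gt0// sn//; lra.
apply: cutoff_cvg; apply/cvgryPge => A; near=> n.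
rewrite -ler_pdivrMr//; near: n; exact: nbhs_infty_ger.
Unshelve. all: by end_near.
Qed.

(** The approximations say nothing at the integers, but the faces of the cube are
    negligible. *)
Definition ocube : set V := (`]0, 1[ `*` `]0, 1[) `*` `]0, 1[.

Lemma measurable_ocube : measurable ocube.
Proof.
by apply: measurableX; [apply: measurableX|]; exact: measurable_itv.
Qed.

Lemma leb3_box (i j k : interval R) :
  leb3 (([set` i] `*` [set` j]) `*` [set` k]) =
  (leb1 R [set` i] * leb1 R [set` j] * leb1 R [set` k])%E.
Proof.
have mI (l : interval R) : measurable ([set` l] : set B) by exact: measurable_itv.
rewrite [LHS](product_measure1E (leb2 R) (leb1 R))//; last exact: measurableX.
by rewrite [X in (X * _)%E](product_measure1E (leb1 R) (leb1 R)).
Qed.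

Lemma ocube_sub : ocube `<=` @cube R.
Proof.
move=> [[x y] z] [[/= + +] +]; rewrite !in_itv/= => /andP[? ?] /andP[? ?] /andP[? ?].
by split; [split|]; rewrite /= in_itv/=; apply/andP; split; exact: ltW.
Qed.

Lemma leb3_faces : leb3 (@cube R `\` ocube) = 0%E.
Proof.
have mc := @measurable_cube R; have mo := measurable_ocube.
have c1 : leb3 (@cube R) = 1%E.
  by rewrite leb3_box /leb1 /= !lebesgue_measure_itv/= !lte_fin ltr01 !oppr0 !adde0 !mule1.
have o1 : leb3 ocube = 1%E.
  by rewrite leb3_box /leb1 /= !lebesgue_measure_itv/= !lte_fin ltr01 !oppr0 !adde0 !mule1.
have c1y : (leb3 (@cube R) < +oo)%E by rewrite c1 ltry.
have D := @measureD _ V R leb3 _ _ mc mo c1y.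
rewrite (setIidr ocube_sub) in D; apply: etrans D _.
transitivity (1 - 1 : \bar R)%E; last by rewrite subee.
by congr (_ - _)%E; [exact: c1|exact: o1].
Qed.

Lemma integral_cube_ocube (f : V -> \bar R) : leb3.-integrable (@cube R) f ->
  (\int[leb3]_(X in @cube R) f X = \int[leb3]_(X in ocube) f X)%E.
Proof.
move=> fi; have mc := @measurable_cube R; have mo := measurable_ocube.
rewrite (negligible_integral (measurableD mc mo) mc fi leb3_faces).
by rewrite setDD setIidr//; exact: ocube_sub.
Qed.

Variable h : V -> R.
Hypothesis ih : leb3.-integrable (@cube R) (EFin \o h).
Hypothesis h_tensor : forall a b c,
  smooth1 a -> smooth1 b -> smooth1 c -> per1 a -> per1 b -> per1 c ->
  \int[leb3]_(X in @cube R) (h X * tensor a b c X) = 0.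

Let h0 := h \_ ocube.

Let ih0 : leb3.-integrable setT (EFin \o h0).
Proof.
rewrite /h0 -restrict_EFin; apply/(integrable_mkcond _ measurable_ocube).
by apply: integrableS ih; [exact: measurable_cube|exact: measurable_ocube|
  exact: ocube_sub].
Qed.

Let mh0 : measurable_fun setT h0.
Proof. by apply/measurable_EFinP; case/integrableP : ih0. Qed.

Let box (A A' C : set B) : set V := (A `*` A') `*` C.

Let P A A' C := \int[leb3]_(X in box A A' C) h0 X = 0.

Lemma smooth1_measurableV (a b c : R -> R) : smooth1 a -> smooth1 b -> smooth1 c ->
  measurable_fun setT (tensor a b c : V -> R).
Proof.
move=> sa sb sc; apply: measurable_funM; first apply: measurable_funM.
- exact: measurableT_comp (smooth1_measurable sa) (@measurable_p11 R).
- exact: measurableT_comp (smooth1_measurable sb) (@measurable_p12 R).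
- exact: measurableT_comp (smooth1_measurable sc) (@measurable_p2 R).
Qed.

Let P_approx A A' C : approx A -> approx A' -> approx C ->
  measurable A -> measurable A' -> measurable C -> P A A' C.
Proof.
move=> [a [sa pa a01 aA]] [b [sb pb b01 bA]] [c [sc pc c01 cA]] mA mA' mC.
have [] := @cvg_Rintegral_dominated _ V R leb3 setT
  (fun n X => h0 X * tensor (a n) (b n) (c n) X) (h0 \_ (box A A' C))
  (fun X => `|h0 X|) measurableT.
- move=> n; apply: measurable_funM => //; exact: smooth1_measurableV.
- move=> [[x y] z] _.
  rewrite patchE; have [oX|oX] := pselect (ocube (x, y, z)); last first.
    rewrite /h0 patchE memNset//= if_same.
    by under eq_fun do rewrite mul0r; exact: cvg_cst.
  move: (oX) => [[/= + +] +]; rewrite !in_itv/= => xo yo zo.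
  have -> : (if (x, y, z) \in box A A' C then h0 (x, y, z) else 0) =
     h0 (x, y, z) * (\1_A x * \1_A' y * \1_C z).
    rewrite /box !in_setX /= !indicE.
    by case: (x \in A); case: (y \in A'); case: (z \in C);
       rewrite /= ?mulr0 ?mul0r ?mulr1 ?mulr0.
  apply: cvgMr; apply: cvgM; last exact: cA.
  by apply: cvgM; [exact: aA|exact: bA].
- by have := integrable_norm ih0.
- move=> n X _; rewrite normrM ler_piMr// /tensor !normrM.
  have H : forall e : R, 0 <= e <= 1 -> `|e| <= 1.
    by move=> e /andP[e0 e1]; rewrite ger0_norm.
  by rewrite !mulr_ile1 ?normr_ge0 ?mulr_ge0 ?H.
move=> _ cv.
have E n : \int[leb3]_X (h0 X * tensor (a n) (b n) (c n) X) = 0.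
  rewrite -[RHS](h_tensor (sa n) (sb n) (sc n) (pa n) (pb n) (pc n)).
  rewrite [RHS]/Rintegral integral_cube_ocube.
    rewrite -/(Rintegral leb3 ocube (fun X => h X * tensor (a n) (b n) (c n) X)).
    rewrite [RHS]Rintegral_mkcond; apply: eq_Rintegral => X _.
    by rewrite /h0 !patchE; case: ifP => // _; rewrite mul0r.
  have := @integrableMl _ V R leb3 (@cube R) (@measurable_cube R) (EFin \o h) (tensor (a n) (b n) (c n)).
  apply => //.
  - apply: (@measurable_funTS _ _ V); exact: smooth1_measurableV.
  - exists 1; split; first exact: num_real.
    move=> r r1 X _; apply: le_trans (ltW r1).
    have H : forall e : R, 0 <= e <= 1 -> `|e| <= 1.
      by move=> e /andP[e0 e1]; rewrite ger0_norm.
    by rewrite /tensor !normrM !mulr_ile1 ?normr_ge0 ?mulr_ge0 ?H.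
rewrite /P Rintegral_mkcond.
apply: cvg_unique cv _ => //; rewrite (_ : (fun n => _) = cst 0).
  exact: cvg_cst.
by apply/funext.
Qed.

Let ih0S (D : set V) : measurable D -> leb3.-integrable setT (EFin \o (h0 \_ D)).
Proof.
move=> mD; rewrite -restrict_EFin; apply/(integrable_mkcond _ mD).
by apply: integrableS ih0.
Qed.

(** Extension from a generating family in one coordinate, the others being
    fixed by the set [D]. *)
Let extend d' (T' : measurableType d') (G : set (set T')) (phi : V -> T')
    (D : set V) :
  measurable_fun setT phi -> measurable D ->
  @measurable _ T' = <<s G >> -> setI_closed G ->
  \int[leb3]_(X in D) h0 X = 0 ->
  (forall A, G A -> \int[leb3]_(X in D `&` phi @^-1` A) h0 X = 0) ->
  forall A, measurable A -> \int[leb3]_(X in D `&` phi @^-1` A) h0 X = 0.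
Proof.
move=> mphi mD gG IG hT hG A mA.
have E A' : \int[leb3]_(X in D `&` phi @^-1` A') h0 X =
    \int[leb3]_(X in phi @^-1` A') (h0 \_ D) X.
  by rewrite setIC Rintegral_mkcondr.
rewrite E; apply: (pi_lambda_integral mphi (ih0S mD) gG IG) => //.
- by rewrite -Rintegral_mkcond.
- by move=> A' GA'; rewrite -E; exact: hG.
Qed.

Let rays := @RGenOInfty.G R.

Let rays_gen : @measurable _ B = <<s rays >>.
Proof. exact: RGenOInfty.measurableE. Qed.

Let rays_setI : setI_closed rays.
Proof.
move=> _ _ [x ->] [y ->]; exists (Num.max x y).
by apply/seteqP; split => t /=; rewrite !in_itv/= !andbT gt_max;
  [move=> [-> ->]|move=> /andP].
Qed.

Let rays_approx A : rays A -> approx A.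
Proof. by move=> [x ->]; exact: approx_ray. Qed.

Let rays_measurable A : rays A -> measurable (A : set B).
Proof. by move=> rA; rewrite rays_gen; exact: sub_sigma_algebra. Qed.

Let mT : measurable (setT : set B) := measurableT.

Let mbox A A' C : measurable A -> measurable A' -> measurable C ->
  measurable (box A A' C).
Proof.
by move=> mA mA' mC; apply: measurableX => //; exact: measurableX.
Qed.

Let P1 A A' C : measurable A -> approx A' -> approx C ->
  measurable A' -> measurable C -> P A A' C.
Proof.
move=> mA aA' aC mA' mC; have mD := mbox mT mA' mC.
have E A0 : box A0 A' C = box setT A' C `&` (fun X : V => X.1.1) @^-1` A0.
  apply/seteqP; split => [[[x y] z] [[/= ? ?] ?]|[[x y] z] [[[/= ? ?] ?] ?]].
    by split => //; split.
  by split => //; split.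
rewrite /P E; apply: (extend (@measurable_p11 R) mD rays_gen rays_setI) => //.
- by apply: P_approx => //; exact: approxT.
- move=> A0 rA0; rewrite -E; apply: P_approx => //.
  + exact: rays_approx.
  + exact: rays_measurable.
Qed.

Let P2 A A' C : measurable A -> measurable A' -> approx C ->
  measurable C -> P A A' C.
Proof.
move=> mA mA' aC mC; have mD := mbox mA mT mC.
have E A0 : box A A0 C = box A setT C `&` (fun X : V => X.1.2) @^-1` A0.
  apply/seteqP; split => [[[x y] z] [[/= ? ?] ?]|[[x y] z] [[[/= ? ?] ?] ?]].
    by split => //; split.
  by split => //; split.
rewrite /P E; apply: (extend (@measurable_p12 R) mD rays_gen rays_setI) => //.
- by apply: P1 => //; exact: approxT.
- move=> A0 rA0; rewrite -E; apply: P1 => //.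
  + exact: rays_approx.
  + exact: rays_measurable.
Qed.

Let P3 A A' C : measurable A -> measurable A' -> measurable C -> P A A' C.
Proof.
move=> mA mA' mC; have mD := mbox mA mA' mT.
have E A0 : box A A' A0 = box A A' setT `&` (fun X : V => X.2) @^-1` A0.
  apply/seteqP; split => [[[x y] z] [[/= ? ?] ?]|[[x y] z] [[[/= ? ?] ?] ?]].
    by split => //; split.
  by split => //; split.
rewrite /P E; apply: (extend (@measurable_p2 R) mD rays_gen rays_setI) => //.
- by apply: P2 => //; exact: approxT.
- move=> A0 rA0; rewrite -E; apply: P2 => //.
  + exact: rays_approx.
  + exact: rays_measurable.
Qed.

Let rect d1 d2 (T1 : measurableType d1) (T2 : measurableType d2) :
  setI_closed [set A `*` A' | A in @measurable _ T1 & A' in @measurable _ T2].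
Proof.
move=> _ _ [A mA [A' mA' <-]] [C mC [C' mC' <-]].
exists (A `&` C); first exact: measurableI.
exists (A' `&` C'); first exact: measurableI.
by rewrite setXI.
Qed.

Let P4 (S : set (B * B)) C : measurable S -> measurable C ->
  \int[leb3]_(X in S `*` C) h0 X = 0.
Proof.
move=> mS mC; have mD := mbox mT mT mC.
have E (S0 : set (B * B)) : S0 `*` C = box setT setT C `&` (fun X : V => X.1) @^-1` S0.
  apply/seteqP; split => [[[x y] z] [/= ? ?]|[[x y] z] [[[/= ? ?] ?] ?]] //.
rewrite E; apply: (extend (T' := (B * B)%type) measurable_fst mD
  (measurable_prod_measurableType B B) (@rect _ _ B B)) => //.
- exact: P3.
- by move=> _ [A mA [A' mA' <-]]; rewrite -E; exact: P3.
Qed.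

Let P5 (S : set V) : measurable S -> \int[leb3]_(X in S) h0 X = 0.
Proof.
move=> mS; rewrite -(setTI S).
apply: (extend (T' := V) (phi := id) _ measurableT
  (measurable_prod_measurableType (B * B)%type B) (@rect _ _ (B * B)%type B)) => //.
- by rewrite -setXTT; exact: P4.
- by move=> _ [A mA [A' mA' <-]]; rewrite setTI; exact: P4.
Qed.

(** The extension of [h] by zero integrates to zero over all boxes of rays, by
    approximation; replacing the rays by Borel sets in one coordinate after the
    other, and then the boxes by Borel sets of the space, gives zero over every
    Borel set, in particular over the sets of positivity and of negativity. *)
Lemma torus_unique : {ae leb3, forall X, @cube R X -> h X = 0}.
Proof.
have ae0 : ae_eq leb3 setT (EFin \o h0) (cst 0%E).
  apply: (integral_ae_eq measurableT ih0) => // S _ mS.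
  rewrite integral0 -[LHS]fineK; first by have := P5 mS; rewrite /Rintegral => ->.
  by apply: integrable_fin_num => //; apply: integrableS ih0.
have [N [mN N0 sN]] := ae0.
have mF : measurable (@cube R `\` ocube : set V).
  by apply: measurableD; [exact: measurable_cube|exact: measurable_ocube].
exists (N `|` (@cube R `\` ocube)); split.
- exact: measurableU.
- by rewrite measureU0//; exact: leb3_faces.
move=> X /= hX; have [oX|oX] := pselect (ocube X).
  left; apply: sN => /= H; apply: hX => _; have := H I.
  by rewrite /h0 patchE mem_set// => -[].
by right; split => //; apply: contrapT => nc; apply: hX.
Qed.

End TorusUnique.

(** * Absolutely continuous functions of time *)

Section Triangle.
Variable R : realType.
Local Notation B := (measurableTypeR R).
Local Notation mu := (leb1 R).
Variables (al ga : B -> R).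
Hypotheses (ial : mu.-integrable setT (EFin \o al))
  (iga : mu.-integrable setT (EFin \o ga)).

Let mal : measurable_fun setT al.
Proof. by apply/measurable_EFinP; case/integrableP : ial. Qed.
Let mga : measurable_fun setT ga.
Proof. by apply/measurable_EFinP; case/integrableP : iga. Qed.

Let k (p : B * B) : \bar R := (if p.2 < p.1 then al p.1 * ga p.2 else 0)%:E.

Let mk : measurable_fun setT k.
Proof.
apply/measurable_EFinP; apply: measurable_fun_ifT => //.
  by apply: measurable_fun_ltr; [exact: measurable_snd|exact: measurable_fst].
apply: measurable_funM.
  exact: measurableT_comp mal measurable_fst.
exact: measurableT_comp mga measurable_snd.
Qed.

Let ik : (mu \x mu)%E.-integrable (setT `*` setT) k.
Proof.
rewrite setXTT; apply/integrable12ltyP => //.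
have [_ oal] := integrableP _ _ _ ial; have [_ oga] := integrableP _ _ _ iga.
apply: (@le_lt_trans _ _
  (\int[mu]_x (\int[mu]_y `|(ga y)%:E| * `|(al x)%:E|))%E).
  apply: ge0_le_integral => //.
  - by move=> x _; exact: integral_ge0.
  - apply: (@measurable_fun_fubini_tonelli_F _ _ _ _ _ mu (abse \o k)).
      exact: measurableT_comp.
    by move=> p; exact: abse_ge0.
  - apply: measurable_funeM; apply: measurableT_comp => //.
    exact/measurable_EFinP.
  move=> x _.
  have mag : measurable_fun setT (fun y => `|(ga y)%:E|%E).
    by apply: measurableT_comp => //; exact/measurable_EFinP.
  rewrite -ge0_integralZr//.
  apply: ge0_le_integral => //.
  - apply: measurableT_comp => //.
    exact: (measurableT_comp mk (pair1_measurable x)).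
  - by apply: emeasurable_funM; [exact: mag|exact: measurable_cst].
  move=> y _; rewrite /k /=; case: ifP => _; last by rewrite normr0 mule_ge0.
  by rewrite normrM mulrC EFinM.
have maa : measurable_fun setT (fun y => `|(al y)%:E|%E).
  by apply: measurableT_comp => //; exact/measurable_EFinP.
have g0 : (0 <= \int[mu]_y `|(ga y)%:E|)%E by exact: integral_ge0.
by rewrite ge0_integralZl// lte_mul_pinfty// ge0_fin_numE.
Qed.

Let int1 t : (\int[mu]_s k (t, s))%E =
  (al t * \int[mu]_(s in `]-oo, t[) ga s)%:E.
Proof.
have ig : mu.-integrable `]-oo, t[ (EFin \o ga).
  by apply: integrableS iga => //; exact: measurable_itvB.
rewrite EFinM fineK; last exact: (integrable_fin_num (measurable_itvB _) ig).
rewrite -(integralZl (measurable_itvB _) ig).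
rewrite [RHS]integral_mkcond; apply: eq_integral => s _.
rewrite /k /= patchE; case: ifPn => st.
  by rewrite mem_set//= in_itv.
by rewrite memNset//= in_itv/=; apply/negP.
Qed.

Let int2 s : (\int[mu]_t k (t, s))%E =
  (ga s * \int[mu]_(t in `]s, +oo[) al t)%:E.
Proof.
have ig : mu.-integrable `]s, +oo[ (EFin \o al).
  by apply: integrableS ial => //; exact: measurable_itvB.
rewrite EFinM fineK; last exact: (integrable_fin_num (measurable_itvB _) ig).
rewrite -(integralZl (measurable_itvB _) ig).
rewrite [RHS]integral_mkcond; apply: eq_integral => t _.
rewrite /k /= patchE; case: ifPn => st.
  by rewrite mem_set//= ?in_itv/= ?andbT// mulrC.
by rewrite memNset//= in_itv/= andbT; apply/negP.
Qed.

Lemma triangle_integrable :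
  mu.-integrable setT (fun t => (al t * \int[mu]_(s in `]-oo, t[) ga s)%:E).
Proof.
have := @integrable_fubini1 _ _ _ _ _ mu mu setT setT measurableT measurableT k ik.
by apply: eq_integrable => // t _; exact: int1.
Qed.

Lemma triangle_fubini :
  \int[mu]_t (al t * \int[mu]_(s in `]-oo, t[) ga s) =
  \int[mu]_s (ga s * \int[mu]_(t in `]s, +oo[) al t).
Proof.
congr fine.
under eq_integral do rewrite -int1.
under [RHS]eq_integral do rewrite -int2.
rewrite -(@fubini_prod1 _ _ _ _ _ mu mu setT setT measurableT measurableT k ik).
exact: (@fubini_prod2 _ _ _ _ _ mu mu setT setT measurableT measurableT k ik).
Qed.

End Triangle.

Section SquarePrimitive.
Variable R : realType.
Local Notation B := (measurableTypeR R).
Local Notation mu := (leb1 R).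

(** The square of the total integral is the integral over the plane of
    [ga t * ga s]; the two triangles on the sides of the diagonal contribute
    equally, and one of them is the right-hand side. This replaces the chain rule
    for the square of an absolutely continuous function. *)
Lemma square_primitive (ga : B -> R) : mu.-integrable setT (EFin \o ga) ->
  (\int[mu]_t ga t) ^+ 2 =
  2 * \int[mu]_t (ga t * \int[mu]_(s in `]-oo, t[) ga s).
Proof.
move=> ig.
set D := \int[mu]_t ga t; set I := \int[mu]_t _.
have mI (i : interval R) : measurable ([set` i] : set B) by exact: measurable_itvB.
have H s : \int[mu]_(t in `]s, +oo[) ga t = D - \int[mu]_(t in `]-oo, s[) ga t.
  have E : setT = `]-oo, s]%classic `|` `]s, +oo[%classic :> set R.
    by rewrite -itv_bndbnd_setU// set_itvNyy.
  have : D = \int[mu]_(t in `]-oo, s]) ga t + \int[mu]_(t in `]s, +oo[) ga t.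
    have := @Rintegral_setU _ B R mu `]-oo, s]%classic `]s, +oo[%classic ga
      (mI _) (mI _); rewrite -E; apply => //.
    apply/disj_setPS => y [/=]; rewrite !in_itv/= andbT => ys sy.
    by move: sy; rewrite ltNge ys.
  move=> ->; rewrite -(Rintegral_itv_bndo_bndc (f := ga)).
    by rewrite addrAC subrr add0r.
  by apply: integrableS ig => //; exact: mI.
have : I = \int[mu]_s (D * ga s - ga s * \int[mu]_(t in `]-oo, s[) ga t).
  rewrite /I triangle_fubini//; apply: eq_Rintegral => s _.
  by rewrite H mulrBr (mulrC (ga s) D).
rewrite RintegralB//; last 2 first.
- rewrite (_ : EFin \o _ = fun s => (D%:E * (ga s)%:E)%E)//.
  exact: integrableZl.
- exact: triangle_integrable.
by rewrite RintegralZl// -/D -/I; lra.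
Qed.

End SquarePrimitive.

(** * The fundamental lemma in time *)

Lemma ae_imp d (T : measurableType d) (R : realType)
    (mu : {measure set T -> \bar R}) (P Q : T -> Prop) :
  (forall x, P x -> Q x) ->
  {ae mu, forall x, P x} -> {ae mu, forall x, Q x}.
Proof. by move=> PQ; apply: negligibleS => x /= nQ Px; exact/nQ/PQ. Qed.

Lemma ae_imp2 d (T : measurableType d) (R : realType)
    (mu : {measure set T -> \bar R}) (P Q S : T -> Prop) :
  (forall x, P x -> Q x -> S x) ->
  {ae mu, forall x, P x} -> {ae mu, forall x, Q x} -> {ae mu, forall x, S x}.
Proof.
move=> PQS hP hQ; have := negligibleU hP hQ; apply: negligibleS => x /= nS.
by apply: contrapT => /not_orP[/contrapT Px /contrapT Qx]; apply: nS; exact: PQS.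
Qed.

Lemma integrable_mul_bounded d (T : measurableType d) (R : realType)
    (mu : {measure set T -> \bar R}) (D : set T) (f k : T -> R) (M : R) :
  measurable D -> mu.-integrable D (EFin \o f) -> measurable_fun D k ->
  (forall x, D x -> `|k x| <= M) ->
  mu.-integrable D (fun x => (f x * k x)%:E).
Proof.
move=> mD fi mk kM.
apply: (@le_integrable _ _ _ mu D mD _ (fun x => (M%:E * (f x)%:E)%E)).
- apply/measurable_EFinP; apply: measurable_funM => //.
  by apply/measurable_EFinP; case/integrableP : fi.
- move=> x Dx; rewrite -EFinM !abse_EFin lee_fin !normrM mulrC.
  by rewrite ler_wpM2r// (le_trans (kM _ Dx))// ler_norm.
- exact: integrableZl.
Qed.

Section TimeTests.
Variable R : realType.
Local Notation B := (measurableTypeR R).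
Local Notation mu := (leb1 R).

Lemma ftc2 (F f : R -> R) (x y : R) : x <= y ->
  (forall x : R, is_derive x (1 : R) F (f x)) -> continuous f ->
  \int[mu]_(t in `[x, y]) f t = F y - F x.
Proof.
rewrite le_eqVlt => /predU1P[<- _ _|xy dF cf].
  by rewrite set_itv1 Rintegral_set1 subrr.
have cF : continuous F.
  move=> t; have [d _] := dF t.
  exact/differentiable_continuous/derivable1_diffP.
rewrite /Rintegral (@continuous_FTC2 R f F)//.
- exact: continuous_subspaceT.
- split.
  + by move=> t _; have [] := dF t.
  + exact/cvg_at_right_filter/cF.
  + exact/cvg_at_left_filter/cF.
- by move=> t _; rewrite derive1E; have [_ ->] := dF t.
Qed.

Variable T : R.
Hypothesis hT : 0 < T.

Definition test1 (psi : R -> R) := smooth1 psi /\ exists a b : R,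
  [/\ 0 < a, b < T & forall t, ~ (a <= t <= b) -> psi t = 0].

Lemma test1_out psi t : test1 psi -> ~ (0 < t < T) -> psi t = 0.
Proof.
move=> [_ [a [b [a0 bT H]]]] nt; apply: H => /andP[at_ tb]; apply: nt.
by rewrite (lt_le_trans a0)//= (le_lt_trans tb).
Qed.

Lemma test1_bounded psi : test1 psi -> exists M, forall t, `|psi t| <= M.
Proof.
move=> tp; have [sp _] := tp.
have c : {within `[0, T], continuous (fun t => `|psi t|)}.
  apply: continuous_subspaceT => t.
  apply: (continuous_comp (f := psi)); first exact: smooth1_continuous.
  exact: norm_continuous.
have [m _ mM] := EVT_max (ltW hT) c.
exists `|psi m| => t; have [t0|t0] := boolP (0 < t < T).
  apply: mM; rewrite in_itv/=; case/andP : t0 => t0 t1.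
  by rewrite (ltW t0) (ltW t1).
by rewrite (test1_out tp (negP t0)) normr0.
Qed.

Local Notation I := (`]0%R, T[%classic : set B).

Let mI : measurable I. Proof. exact: measurable_itvB. Qed.

Lemma integrable_test f psi : mu.-integrable I (EFin \o f) -> test1 psi ->
  mu.-integrable I (fun t => (f t * psi t)%:E).
Proof.
move=> fi tp; have [M psiM] := test1_bounded tp.
apply: (integrable_mul_bounded (M := M)) => //.
by apply: measurable_funTS; exact: smooth1_measurable tp.1.
Qed.

Lemma test1_derive psi : test1 psi -> test1 (derive1 psi).
Proof.
move=> [sp [a [b [a0 bT H]]]]; split; first exact: smooth1_derive1.
exists a, b; split => // t /negP nt.
rewrite derive1E (@near_eq_derive _ _ _ psi (cst 0)) ?derive_cst//.
move: nt; rewrite negb_and -!ltNge => /orP[ta|bt].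
  near=> s; apply: H; apply/negP; rewrite negb_and -!ltNge.
  by apply/orP; left; near: s; exact: lt_nbhsl.
near=> s; apply: H; apply/negP; rewrite negb_and -!ltNge.
by apply/orP; right; near: s; exact: lt_nbhsr.
Unshelve. all: by end_near.
Qed.

(** Smooth functions compactly supported in (0, T) that converge to the indicator
    of (m, T): the offset [1] keeps the support away from the end points. *)
Lemma test1_window m n : 0 <= m ->
  test1 (fun t => cutoff (n%:R * (t - m) - 1) * cutoff (n%:R * (T - t) - 1)).
Proof.
move=> m0; split.
  apply: smooth1M; apply: smooth1_comp; try exact: smooth1_cutoff.
  - apply: smooth1B; last exact: smooth1_cst.
    apply: smooth1M; first exact: smooth1_cst.
    by apply: smooth1B; [exact: smooth1_id|exact: smooth1_cst].
  - apply: smooth1B; last exact: smooth1_cst.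
    apply: smooth1M; first exact: smooth1_cst.
    by apply: smooth1B; [exact: smooth1_cst|exact: smooth1_id].
case: n => [|n].
  exists (T / 2), (T / 2); split.
  - by rewrite divr_gt0.
  - by rewrite ltr_pdivrMr// ltr_pMr// ltr1n.
  move=> t _.
  by rewrite cutoff_eq0 ?mul0r// sub0r oppr_le0 ler01.
have n0 : 0 < n.+1%:R :> R by rewrite ltr0n.
exists (m + n.+1%:R^-1), (T - n.+1%:R^-1); split.
- by rewrite ltr_wpDl// invr_gt0.
- by rewrite ltrBlDr ltrDl invr_gt0.
- move=> t /negP; rewrite negb_and -!ltNge => /orP[tm|tm].
    rewrite cutoff_eq0 ?mul0r// subr_le0 mulrC -ler_pdivlMr// mul1r.
    by rewrite lerBlDl ltW.
  rewrite [X in _ * X]cutoff_eq0 ?mulr0// subr_le0 mulrC -ler_pdivlMr// mul1r.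
  by rewrite lerBlDl -lerBlDr ltW.
Qed.

(** Windows approximate the indicators of rays, and rays generate the Borel sets. *)
Lemma time_unique (h : B -> R) : mu.-integrable I (EFin \o h) ->
  (forall eta, test1 eta -> \int[mu]_(t in I) (h t * eta t) = 0) ->
  {ae mu, forall t, 0 < t < T -> h t = 0}.
Proof.
move=> ih H.
pose h0 := h \_ I.
have ih0 : mu.-integrable setT (EFin \o h0).
  by rewrite -restrict_EFin; apply/(integrable_mkcond _ mI).
have cutoff_oo (e : R) : 0 < e -> cutoff (n%:R * e - 1) @[n --> \oo] --> (1 : R).
  move=> e0; apply: cutoff_cvg; apply/cvgryPge => A; near=> n.
  rewrite lerBrDr -ler_pdivrMr//; near: n; exact: nbhs_infty_ger.
have ray (x : R) : \int[mu]_(t in `]x, +oo[) h0 t = 0.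
  pose m := Num.max x 0.
  have m0 : 0 <= m by rewrite /m le_max lexx orbT.
  have mI' t : I t -> (\1_(`]x, +oo[%classic : set R) t = (m < t)%R%:R :> R).
    rewrite /= in_itv/= => /andP[t0 tT]; rewrite indicE.
    suff -> : (t \in (`]x, +oo[%classic : set R)) = (m < t)%R by [].
    by rewrite /m gt_max t0 andbT; apply/idP/idP;
       rewrite inE /= in_itv/= andbT.
  pose e n t := cutoff (n%:R * (t - m) - 1) * cutoff (n%:R * (T - t) - 1).
  have [] := @cvg_Rintegral_dominated _ B R mu I
    (fun n t => h t * e n t) (fun t => h t * (m < t)%R%:R)
    (fun t => `|h t|) mI.
  - move=> n; apply: measurable_funM.
      by apply/measurable_EFinP; case/integrableP : ih.
    apply: measurable_funTS; apply: smooth1_measurable.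
    by have [] := test1_window n m0.
  - move=> t; rewrite /= in_itv/= => /andP[t0 tT]; apply: cvgMr.
    have [mt|tm] := ltP m t.
      rewrite -[X in _ --> X]mulr1; apply: cvgM; apply: cutoff_oo; lra.
    rewrite (_ : (fun n => _) = cst 0); first exact: cvg_cst.
    apply/funext => n; rewrite /e cutoff_eq0 ?mul0r//= subr_le0.
    apply: (@le_trans _ _ 0) => //; apply: mulr_ge0_le0 => //; lra.
  - exact: integrable_norm ih.
  - move=> n t _; rewrite normrM ler_piMr// /e ger0_norm ?mulr_ge0 ?cutoff_ge0//.
    by rewrite mulr_ile1 ?cutoff_ge0 ?cutoff_le1.
  move=> _; under eq_fun do rewrite (H _ (test1_window _ m0)).
  move=> c0.
  have <- : \int[mu]_(t in I) (h t * (m < t)%R%:R) = 0.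
    by apply: cvg_unique c0 _ => //; exact: cvg_cst.
  rewrite [LHS]Rintegral_mkcond [RHS]Rintegral_mkcond.
  apply: eq_Rintegral => t _; rewrite /h0 !patchE.
  have [tI|tI] := boolP (t \in I); last by case: ifP.
  rewrite -mI'; last exact: set_mem.
  by rewrite indicE; case: ifP => _; rewrite ?mulr1 ?mulr0.
have hT0 : \int[mu]_t h0 t = 0.
  rewrite -[RHS](ray (-1)) [RHS]Rintegral_mkcond.
  apply: eq_Rintegral => t _; rewrite patchE; case: ifPn => // tI.
  rewrite /h0 patchE ifF//; apply/negbTE; apply: contra tI.
  by rewrite !inE/= !in_itv/= andbT => /andP[t0 _]; lra.
have all0 : forall A, measurable A -> \int[mu]_(t in A) h0 t = 0.
  move=> A mA.
  apply: (@pi_lambda_integral _ B R mu _ B (@RGenOInfty.G R) id) => //.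
  - exact: RGenOInfty.measurableE.
  - move=> _ _ [x ->] [y ->]; exists (Num.max x y).
    by apply/seteqP; split => t /=; rewrite !in_itv/= !andbT gt_max;
      [move=> [-> ->]|move=> /andP].
  - by move=> _ [x ->]; exact: ray.
have ae0 : ae_eq mu setT (EFin \o h0) (cst 0%E).
  apply: (integral_ae_eq measurableT ih0) => // S _ mS.
  rewrite integral0 -[LHS]fineK; first by have := all0 _ mS; rewrite /Rintegral => ->.
  by apply: integrable_fin_num => //; apply: integrableS ih0.
apply: filterS ae0 => t /(_ Logic.I) + t0; rewrite /= /h0 patchE mem_set ?in_itv//.
by move=> -[].
Unshelve. all: by end_near.
Qed.

Lemma primitive_test eta : test1 eta -> \int[mu]_(t in I) eta t = 0 ->
  exists2 psi, test1 psi & forall x : R, is_derive x (1 : R) psi (eta x).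
Proof.
move=> [se [a [b [a0 bT H]]]] e0.
have ce := smooth1_continuous se.
have [F dF] := continuous_primitive ce.
exists (fun t => F t - F 0); last first.
  move=> t; apply: (is_derive_eq (is_deriveB (dF t) (is_derive_cst (F 0) t (1 : R)))).
  by rewrite subr0.
split.
  apply: (smooth1_prim (f' := eta)) => // t.
  apply: (is_derive_eq (is_deriveB (dF t) (is_derive_cst (F 0) t (1 : R)))).
  by rewrite subr0.
exists a, b; split => // t /negP; rewrite negb_and -!ltNge => /orP[ta|bt].
  have zero (x y : R) : x <= y -> y < a -> F y - F x = 0.
    move=> xy ya; rewrite -(ftc2 xy dF ce) /Rintegral integral0_eq// => s.
    rewrite /= in_itv/= => /andP[_ sy]; congr EFin; apply: H => /andP[as_ _].
    by move: (le_lt_trans sy ya); rewrite ltNge as_.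
  have [t0|t0] := leP t 0; last by rewrite zero// ltW.
  by apply/eqP; rewrite -oppr_eq0 opprB zero.
have [t0|t0] := leP t 0.
  have zero : F 0 - F t = 0.
    rewrite -(ftc2 t0 dF ce) /Rintegral integral0_eq// => s.
    rewrite /= in_itv/= => /andP[_ s0]; congr EFin; apply: H => /andP[as_ _].
    by move: (lt_le_trans a0 as_); rewrite ltNge s0.
  by apply/eqP; rewrite -oppr_eq0 opprB zero.
rewrite -(ftc2 (ltW t0) dF ce) -[RHS]e0 [LHS]Rintegral_mkcond [RHS]Rintegral_mkcond.
apply: eq_Rintegral => s _; rewrite !patchE.
have [/andP[as_ sb]|ns] := boolP (a <= s <= b).
  have s0 := lt_le_trans a0 as_.
  rewrite !mem_set//=; rewrite in_itv/= ?s0 ?(le_lt_trans sb)//.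
  by rewrite (ltW s0) (ltW (le_lt_trans sb bt)).
by rewrite (H s (negP ns)) !if_same.
Qed.

(** A weak derivative in time comes from an absolutely continuous
    representative.  Test functions of zero mean are derivatives of test
    functions, so the difference of [f] and the primitive of [g] is orthogonal
    to all of them, hence constant. *)
Lemma weak_primitive (f g : B -> R) :
  mu.-integrable I (EFin \o f) -> mu.-integrable I (EFin \o g) ->
  (forall psi, test1 psi ->
    \int[mu]_(t in I) (f t * derive1 psi t + g t * psi t) = 0) ->
  exists c, {ae mu, forall t, 0 < t < T ->
    f t = c + \int[mu]_(s in `]-oo, t[) (g \_ I) s}.
Proof.
move=> ifn ign W.
pose ga := g \_ I.
have iga : mu.-integrable setT (EFin \o ga).
  by rewrite -restrict_EFin; apply/(integrable_mkcond _ mI).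
pose G t := \int[mu]_(s in `]-oo, t[) ga s.
have restr k : mu.-integrable I (EFin \o k) ->
    mu.-integrable setT (EFin \o (k \_ I)).
  by move=> ik; rewrite -restrict_EFin; apply/(integrable_mkcond _ mI).
have i1 : mu.-integrable I (EFin \o cst 1).
  apply/integrableP; split; first exact/measurable_EFinP.
  under eq_integral do rewrite /= normr1.
  by rewrite integral_cst// mul1e /leb1 /= lebesgue_measure_itv/= lte_fin hT ltry.
have iG : mu.-integrable I (EFin \o G).
  have := triangle_integrable (restr _ i1) iga.
  move/(integrableS measurableT mI (@subsetT _ _)); apply: eq_integrable => //.
  by move=> t tI; rewrite /= patchE tI mul1r.
have ih : mu.-integrable I (EFin \o (fun t => f t - G t)).
  by rewrite (_ : EFin \o _ = (EFin \o f) \- (EFin \o G))%E//; exact: integrableB.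
have zero psi : test1 psi -> \int[mu]_(t in I) ((f t - G t) * derive1 psi t) = 0.
  move=> tp; have tdp := test1_derive tp.
  have cdp := smooth1_continuous tdp.1.
  have dp := smooth1_derive tp.1.
  have I1 := integrable_test ifn tdp.
  have I2 := integrable_test iG tdp.
  have I3 := integrable_test ign tp.
  have E1 : \int[mu]_(t in I) (f t * derive1 psi t) =
      - \int[mu]_(t in I) (g t * psi t).
    by apply/eqP; rewrite -addr_eq0 -RintegralD//; apply/eqP; exact: W.
  have out t : t \notin I -> derive1 psi t = 0.
    move=> tI; apply: (test1_out tdp) => t0.
    by move/negP: tI; apply; rewrite inE /= in_itv.
  have idp : mu.-integrable setT (EFin \o derive1 psi).
    have := integrable_test i1 tdp => /restr; apply: eq_integrable => // t _.
    rewrite /= patchE; case: ifPn => tI; first by rewrite mul1r.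
    by rewrite (out _ tI).
  have E2 : \int[mu]_(t in I) (G t * derive1 psi t) =
      - \int[mu]_(t in I) (g t * psi t).
    transitivity (\int[mu]_t (derive1 psi t * G t)).
      rewrite [LHS]Rintegral_mkcond; apply: eq_Rintegral => t _.
      rewrite patchE; case: ifPn => tI; first by rewrite mulrC.
      by rewrite (out _ tI) mul0r.
    rewrite (triangle_fubini idp iga).
    transitivity (\int[mu]_(t in I) (- 1 * (g t * psi t))); last first.
      by rewrite RintegralZl// mulN1r.
    rewrite [RHS]Rintegral_mkcond; apply: eq_Rintegral => s _.
    rewrite /ga !patchE; case: ifPn => sI; last by rewrite mul0r.
    have /andP[s0 sT] : 0 < s < T by move: sI; rewrite inE /= in_itv.
    have -> : \int[mu]_(t in `]s, +oo[) derive1 psi t = - psi s.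
      transitivity (\int[mu]_(t in `[s, T]) derive1 psi t).
        rewrite -Rintegral_itv_obnd_cbnd; last first.
          apply: integrableS (continuous_integrable s T cdp) => //.
          by apply: subset_itvr; rewrite bnd_simp.
        rewrite [LHS]Rintegral_mkcond [RHS]Rintegral_mkcond.
        apply: eq_Rintegral => t _; rewrite !patchE.
        have [tI|tI] := boolP (t \in I); last by rewrite (out _ tI) !if_same.
        have /andP[t0 tT] : 0 < t < T by move: tI; rewrite inE /= in_itv.
        congr (if _ then _ else _); apply/idP/idP; rewrite !inE /= !in_itv/= andbT.
          by move=> ->; rewrite ltW.
        by case/andP.
      rewrite (ftc2 (ltW sT) dp cdp) (test1_out (t := T) tp) ?sub0r//.
      by rewrite ltxx andbF.
    by ring.
  transitivity (\int[mu]_(t in I) (f t * derive1 psi t - G t * derive1 psi t)).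
    by apply: eq_Rintegral => t _; rewrite mulrBl.
  by rewrite RintegralB// E1 E2 subrr.
have [theta tt nz] : exists2 theta, test1 theta & \int[mu]_(t in I) theta t != 0.
  apply: contrapT => nex.
  have : {ae mu, forall t, 0 < t < T -> (cst 1 : B -> R) t = 0}.
    apply: time_unique => // eta te.
    under eq_Rintegral do rewrite mul1r.
    by apply: contrapT => /eqP ne; apply: nex; exists eta.
  move=> [N [mN N0 sN]].
  have : (mu I <= mu N)%E.
    apply: le_measure; [exact: mem_set|exact: mem_set|].
    move=> t It; apply: sN => /= H.
    have /eqP := H (ltac:(by move: It; rewrite /= in_itv)).
    by rewrite oner_eq0.
  by rewrite N0 /leb1 /= lebesgue_measure_itv/= lte_fin hT oppr0 adde0 lee_fin leNgt hT.
exists (\int[mu]_(t in I) ((f t - G t) * theta t) / \int[mu]_(t in I) theta t).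
set c := _ / _.
have : {ae mu, forall t, 0 < t < T -> f t - G t - c = 0}.
  apply: time_unique.
    rewrite (_ : EFin \o _ = (EFin \o (fun t => (f t - G t)%R)) \- (EFin \o cst c))%E//.
    apply: integrableB => //.
    rewrite (_ : EFin \o cst c = fun t => (c%:E * (EFin \o cst 1%R) t)%E).
      exact: integrableZl.
    by apply/funext => t /=; rewrite mule1.
  move=> eta te.
  have ie k : test1 k -> mu.-integrable I (EFin \o k).
    move=> tk; have := integrable_test i1 tk; apply: eq_integrable => // t _.
    by rewrite /= mul1r.
  pose r := \int[mu]_(t in I) eta t / \int[mu]_(t in I) theta t.
  have tz : test1 (fun t => eta t - r * theta t).
    have [[se [a [b [a0 bT H]]]] [st [a' [b' [a'0 b'T H']]]]] := (te, tt).
    split.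
      by apply: smooth1B => //; apply: smooth1M => //; exact: smooth1_cst.
    exists (Num.min a a'), (Num.max b b'); split.
    - by rewrite lt_min a0 a'0.
    - by rewrite gt_max bT b'T.
    - move=> t nt; rewrite H ?H' ?mulr0 ?subr0// => /andP[h1 h2]; apply: nt;
        by rewrite ge_min h1 le_max h2 ?orbT.
  have iz : \int[mu]_(t in I) (eta t - r * theta t) = 0.
    rewrite RintegralB//; last 2 first.
    - exact: ie.
    - rewrite (_ : EFin \o _ = fun t => (r%:E * (EFin \o theta) t)%E)//.
      by apply: integrableZl => //; exact: ie.
    by rewrite RintegralZl//; [rewrite /r divfK// subrr|exact: ie].
  have [psi tp dpsi] := primitive_test tz iz.
  have dpE : derive1 psi = (fun t => eta t - r * theta t).
    by apply/funext => t; exact: (is_derive_unique1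
      (f' := fun t => eta t - r * theta t) (dpsi t)).
  have := zero _ tp; rewrite dpE.
  have A1 := integrable_test ih te; have A2 := integrable_test ih tt.
  have -> : \int[mu]_(t in I) ((f t - G t) * (eta t - r * theta t)) =
    \int[mu]_(t in I) ((f t - G t) * eta t) - r * \int[mu]_(t in I) ((f t - G t) * theta t).
    rewrite -RintegralZl// -RintegralB//.
      by apply: eq_Rintegral => t _; ring.
    rewrite (_ : EFin \o _ = fun t => (r%:E * ((f t - G t) * theta t)%:E)%E)//.
    exact: integrableZl.
  move=> Z.
  have -> : \int[mu]_(t in I) ((f t - G t - c) * eta t) =
    \int[mu]_(t in I) ((f t - G t) * eta t) - c * \int[mu]_(t in I) eta t.
    rewrite -RintegralZl//; last exact: ie.
    rewrite -RintegralB//; last first.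
      rewrite (_ : EFin \o _ = fun t => (c%:E * (EFin \o eta) t)%E)//.
      by apply: integrableZl => //; exact: ie.
    by apply: eq_Rintegral => t _; ring.
  by rewrite -[RHS]Z /c /r; congr (_ - _); ring.
apply: ae_imp => t H t0; have := H t0; rewrite /G => /eqP.
by rewrite subr_eq add0r subr_eq addrC => /eqP; rewrite addrC.
Qed.

(** The balance of the square of a coefficient follows from the balance of the
    coefficient; the triangle argument provides it without differentiating the
    representative. *)
Lemma weak_primitive_square (f g : B -> R) :
  mu.-integrable I (EFin \o f) -> mu.-integrable I (EFin \o g) ->
  (forall psi, test1 psi ->
    \int[mu]_(t in I) (f t * derive1 psi t + g t * psi t) = 0) ->
  exists F : B -> R,
  [/\ {ae mu, forall t, 0 < t < T -> f t = F t},
      mu.-integrable I (fun t => (F t * g t)%:E) &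
      forall s t, 0 < s -> s <= t -> t < T ->
        F t ^+ 2 - F s ^+ 2 = \int[mu]_(r in `]s, t[) (2 * (F r * g r))].
Proof.
move=> ifn ign W; have [c fc] := weak_primitive ifn ign W.
pose ga := g \_ I.
have iga : mu.-integrable setT (EFin \o ga).
  by rewrite -restrict_EFin; apply/(integrable_mkcond _ mI).
pose G t := \int[mu]_(s in `]-oo, t[) ga s.
have iFg : mu.-integrable I (fun t => ((c + G t) * g t)%:E).
  rewrite (_ : (fun t => _) = (fun t => (c%:E * (EFin \o g) t)%E) \+
      (fun t => (g t * G t)%:E))%E; last first.
    by apply/funext => t /=; rewrite mulrDl EFinD EFinM (mulrC (g t)).
  apply: integrableD => //; first exact: integrableZl.
  have := triangle_integrable iga iga.
  move/(integrableS measurableT mI (@subsetT _ _)); apply: eq_integrable => //.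
  by move=> t tI; rewrite /= /ga patchE tI.
exists (fun t => c + G t); split => // s t s0 st tT.
have mJ (i : interval R) : measurable ([set` i] : set B) by exact: measurable_itvB.
have iJ (i : interval R) : mu.-integrable [set` i] (EFin \o ga).
  by apply: integrableS iga => //; exact: mJ.
pose J := (`]s, t[%classic : set B).
pose de := ga \_ J.
have ide : mu.-integrable setT (EFin \o de).
  by rewrite -restrict_EFin; apply/(integrable_mkcond _ (mJ `]s, t[)).
pose D := \int[mu]_r de r.
have GsE r : s <= r -> r <= t -> G r = G s + \int[mu]_(x in `]-oo, r[) de x.
  move=> sr rt; have : G r - G s = \int[mu]_(x in `[s, r[) ga x.
    have E : `]-oo, r[%classic = `]-oo, s[%classic `|` `[s, r[%classic :> set R.
      by rewrite -itv_bndbnd_setU.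
    rewrite /G E Rintegral_setU.
    - by rewrite addrAC subrr add0r.
    - exact: mJ.
    - exact: mJ.
    - by rewrite -E.
    - apply/disj_setPS => y [/=]; rewrite !in_itv/= => ys /andP[sy _].
      by move: ys; rewrite ltNge sy.
  move/eqP; rewrite subr_eq => /eqP ->; rewrite addrC; congr (_ + _).
  rewrite -Rintegral_itv_obnd_cbnd; last exact: iJ.
  rewrite [LHS]Rintegral_mkcond [RHS]Rintegral_mkcond.
  apply: eq_Rintegral => x _; rewrite /de !patchE.
  have -> : (x \in (`]s, r[%classic : set R)) =
      (x \in (`]-oo, r[%classic : set R)) && (x \in J).
    apply/idP/andP; rewrite /J !inE/= !in_itv/=.
      by move=> /andP[sx xr]; split => //; rewrite sx (lt_le_trans xr).
    by move=> [-> /andP[-> _]].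
  by case: (x \in `]-oo, r[%classic).
have DE : G t - G s = D.
  rewrite (GsE t st (lexx _)) addrAC subrr add0r /D [LHS]Rintegral_mkcond.
  apply: eq_Rintegral => x _; rewrite patchE; case: ifPn => // xt.
  rewrite /de patchE ifF//; apply/negbTE; apply: contra xt.
  by rewrite /J !inE/= !in_itv/= => /andP[].
have JI : J `<=` I.
  move=> x; rewrite /J /= !in_itv/= => /andP[sx xt].
  by rewrite (lt_trans s0)//= (lt_trans xt).
have iJg : mu.-integrable J (EFin \o g).
  by apply: integrableS ign => //; exact: mJ.
pose Ga r := \int[mu]_(x in `]-oo, r[) de x.
have iJG : mu.-integrable J (fun r => (g r * Ga r)%:E).
  have := triangle_integrable ide ide.
  move/(integrableS measurableT (mJ `]s, t[) (@subsetT _ _)).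
  apply: eq_integrable; first exact: mJ.
  by move=> r rJ; rewrite /= /de patchE rJ /ga patchE mem_set//; exact/JI/set_mem.
have Dg : D = \int[mu]_(r in J) g r.
  rewrite /D [RHS]Rintegral_mkcond; apply: eq_Rintegral => r _.
  rewrite /de !patchE; case: ifPn => // rJ; rewrite /ga patchE mem_set//.
  exact/JI/set_mem.
have D2 : D ^+ 2 = 2 * \int[mu]_(r in J) (g r * Ga r).
  rewrite /D (square_primitive ide); congr (_ * _).
  rewrite [RHS]Rintegral_mkcond; apply: eq_Rintegral => r _.
  rewrite patchE; case: ifPn => rJ.
    by rewrite /de patchE rJ /ga patchE mem_set//; exact/JI/set_mem.
  by rewrite /de patchE (negbTE rJ) mul0r.
transitivity (2 * (c + G s) * D + D ^+ 2).
  by rewrite -DE; ring.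
rewrite D2 {1}Dg -!RintegralZl//; last 2 first.
- exact: mJ.
- exact: mJ.
rewrite -RintegralD//; last 3 first.
- exact: mJ.
- rewrite (_ : EFin \o _ = fun r => ((2 * (c + G s))%:E * (EFin \o g) r)%E)//.
  by apply: integrableZl => //; exact: mJ.
- rewrite (_ : EFin \o _ = fun r => (2%:E * (g r * Ga r)%:E)%E)//.
  by apply: integrableZl => //; exact: mJ.
apply: eq_Rintegral => r; rewrite inE /J /= in_itv/= => /andP[sr rt].
by rewrite (GsE r (ltW sr) (ltW rt)) -/(Ga r); ring.
Qed.

End TimeTests.

(** * Fubini for real-valued integrals *)

Section RealFubini.
Context d1 d2 (T1 : measurableType d1) (T2 : measurableType d2) (R : realType).
Variables (m1 : {sigma_finite_measure set T1 -> \bar R})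
          (m2 : {sigma_finite_measure set T2 -> \bar R}).
Variables (A : set T1) (B : set T2).
Hypotheses (mA : measurable A) (mB : measurable B).

(** Inner integrals are finite only almost everywhere, while the real-valued
    integral reads an infinite one as zero; the two agree once the outer
    integrability is known. *)
Lemma Rintegral_fine d (T : measurableType d) (mu : {measure set T -> \bar R})
    (D : set T) (f : T -> \bar R) : measurable D -> mu.-integrable D f ->
  mu.-integrable D (fun x => (fine (f x))%:E) /\
  \int[mu]_(x in D) (fine (f x)) = fine (\int[mu]_(x in D) f x)%E.
Proof.
move=> mD fi; have /integrableP[mf _] := fi.
have mfine : measurable_fun D (fun x => (fine (f x))%:E).
  by apply/measurable_EFinP; apply: measurableT_comp mf; exact: fine_measurable.
split.
  apply: (le_integrable mD mfine _ fi) => x _.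
  by case: (f x) => //= ; rewrite normr0 // leey.
rewrite /Rintegral; congr fine; apply: ae_eq_integral => //.
have [N [mN N0 sN]] := integrable_ae mD fi.
by exists N; split => // x /= nx; apply: sN => /= H; apply: nx => Dx; rewrite fineK// H.
Qed.

Variable F : T1 * T2 -> R.
Hypothesis mF : measurable_fun setT F.
Hypothesis Fi : (m1 \x m2)%E.-integrable (A `*` B) (EFin \o F).

Let mF' : measurable_fun setT (EFin \o F). Proof. exact/measurable_EFinP. Qed.

Lemma integrable_Rfubini1 :
  m1.-integrable A (fun x => (\int[m2]_(y in B) F (x, y))%:E).
Proof.
have i1 := @integrable_fubini1 _ _ _ _ _ m1 m2 A B mA mB _ Fi.
by have [] := Rintegral_fine mA i1.
Qed.

Lemma Rfubini1 : \int[(m1 \x m2)%E]_(p in A `*` B) F p =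
  \int[m1]_(x in A) \int[m2]_(y in B) F (x, y).
Proof.
have i1 := @integrable_fubini1 _ _ _ _ _ m1 m2 A B mA mB _ Fi.
rewrite [RHS](Rintegral_fine mA i1).2.
by rewrite /Rintegral (@fubini_prod1 _ _ _ _ _ m1 m2 A B mA mB _ Fi).
Qed.

Lemma integrable_Rfubini2 :
  m2.-integrable B (fun y => (\int[m1]_(x in A) F (x, y))%:E).
Proof.
have i1 := @integrable_fubini2 _ _ _ _ _ m1 m2 A B mA mB _ mF' Fi.
by have [] := Rintegral_fine mB i1.
Qed.

Lemma Rfubini2 : \int[(m1 \x m2)%E]_(p in A `*` B) F p =
  \int[m2]_(y in B) \int[m1]_(x in A) F (x, y).
Proof.
have i1 := @integrable_fubini2 _ _ _ _ _ m1 m2 A B mA mB _ mF' Fi.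
rewrite [RHS](Rintegral_fine mB i1).2.
by rewrite /Rintegral (@fubini_prod2 _ _ _ _ _ m1 m2 A B mA mB _ Fi).
Qed.

Lemma ae_integrable_fubini1 : {ae m1, forall x, A x ->
  m2.-integrable B (fun y => (F (x, y))%:E)}.
Proof.
have mn : measurable_fun setT (fun p => (`|F p|)%:E).
  by apply/measurable_EFinP; exact: measurableT_comp.
have n0 p : (0 <= (`|F p|)%:E)%E by rewrite lee_fin.
have i : m1.-integrable A (fun x => \int[m2]_(y in B) (`|F (x, y)|)%:E)%E.
  apply/integrableP; split.
    apply: measurable_funTS.
    exact: (@measurable_tonelli1 _ _ _ _ _ m2 B mB (fun p => (`|F p|)%:E)).
  have /integrableP[_] := Fi.
  rewrite (_ : integral _ _ _ =
    \int[m1]_(x in A) \int[m2]_(y in B) (`|F (x, y)|)%:E)%E.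
    rewrite (_ : integral m1 _ _ = integral m1 A (fun x => \int[m2]_(y in B) (`|F (x, y)|)%:E)%E)//.
    by apply: eq_integral => x _; rewrite gee0_abs// integral_ge0.
  exact: (@tonelli_prod1 _ _ _ _ _ m1 m2 A B mA mB (fun p => (`|F p|)%:E)).
apply: ae_imp (integrable_ae mA i) => x H Ax; apply/integrableP; split.
  by apply: measurable_funTS; exact: (measurableT_comp mF' (pair1_measurable x)).
by have := H Ax; rewrite ge0_fin_numE ?integral_ge0.
Qed.

Lemma ae_integrable_fubini2 : {ae m2, forall y, B y ->
  m1.-integrable A (fun x => (F (x, y))%:E)}.
Proof.
have mn : measurable_fun setT (fun p => (`|F p|)%:E).
  by apply/measurable_EFinP; exact: measurableT_comp.
have n0 p : (0 <= (`|F p|)%:E)%E by rewrite lee_fin.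
have i : m2.-integrable B (fun y => \int[m1]_(x in A) (`|F (x, y)|)%:E)%E.
  apply/integrableP; split.
    apply: measurable_funTS.
    exact: (@measurable_tonelli2 _ _ _ _ _ m1 A mA (fun p => (`|F p|)%:E)).
  have /integrableP[_] := Fi.
  rewrite (_ : integral _ _ _ =
    \int[m2]_(y in B) \int[m1]_(x in A) (`|F (x, y)|)%:E)%E.
    rewrite (_ : integral m2 _ _ = integral m2 B (fun y => \int[m1]_(x in A) (`|F (x, y)|)%:E)%E)//.
    by apply: eq_integral => x _; rewrite gee0_abs// integral_ge0.
  exact: (@tonelli_prod2 _ _ _ _ _ m1 m2 A B mA mB (fun p => (`|F p|)%:E)).
apply: ae_imp (integrable_ae mB i) => x H Ax; apply/integrableP; split.
  by apply: measurable_funTS; exact: (measurableT_comp mF' (pair2_measurable x)).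
by have := H Ax; rewrite ge0_fin_numE ?integral_ge0.
Qed.

Lemma integrable_prod2 : (\int[m2]_(y in B) \int[m1]_(x in A) (`|F (x, y)|)%:E < +oo)%E ->
  (m1 \x m2)%E.-integrable (A `*` B) (EFin \o F).
Proof.
move=> h; apply/integrableP; split; first exact: measurable_funTS.
apply: le_lt_trans h.
rewrite -(@tonelli_prod2 _ _ _ _ _ m1 m2 A B mA mB (fun p => (`|F p|)%:E))//.
by apply/measurable_EFinP; exact: measurableT_comp.
Qed.

End RealFubini.

(** * Continuous functions of several variables *)

Section Caratheodory.
Context d (T : measurableType d) (R : realType).
Local Notation B := (measurableTypeR R).

(** A function that is measurable in one variable and continuous in the other
    is the limit of the functions obtained by rounding the second variable. *)
Lemma caratheodory_measurable (f : T * B -> R) :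
  (forall y, measurable_fun setT (fun x => f (x, y))) ->
  (forall x, continuous (fun y : R => f (x, y))) ->
  measurable_fun setT f.
Proof.
move=> mf cf.
pose rnd (n : nat) (y : R) : R := (Num.floor (n.+1%:R * y))%:~R / n.+1%:R.
apply: (@measurable_fun_cvg _ _ _ setT (fun n p => f (p.1, rnd n p.2))) => //.
- move=> n _ Y mY; rewrite setTI.
  have -> : (fun p => f (p.1, rnd n p.2)) @^-1` Y = \bigcup_(m in [set: int])
     ((fun x => f (x, m%:~R / n.+1%:R)) @^-1` Y `*`
      [set` `[m%:~R / n.+1%:R, (m + 1)%:~R / n.+1%:R[]).
    have n0 : 0 < n.+1%:R :> R by [].
    apply/seteqP; split => [[x y] /= h|[x y] [m _ [/= h]]].
      exists (Num.floor (n.+1%:R * y)) => //; split => //=.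
      rewrite in_itv/= ler_pdivrMr// mulrC ge_floor/=.
      by rewrite ltr_pdivlMr// mulrC lt_succ_floor.
    rewrite in_itv/= ler_pdivrMr// ltr_pdivlMr// mulrC => h2.
    by rewrite /rnd (floor_def h2).
  apply: countable_bigcupT_measurable => // m.
  apply: measurableX; last exact: measurable_itv.
  by rewrite -[X in measurable X]setTI; exact: mf.
- move=> [x y] _; suff cr : rnd n y @[n --> \oo] --> y.
    exact: cvg_comp cr (cf x y).
  apply/cvgrPdist_le => e e0; near=> n.
  have n0 : 0 < n.+1%:R :> R by [].
  have -> : y - rnd n y = (n.+1%:R * y - (Num.floor (n.+1%:R * y))%:~R) / n.+1%:R.
    by rewrite /rnd mulrBl mulrAC divff ?mul1r// gt_eqF.
  rewrite normrM normfV (gtr0_norm n0) ler_pdivrMr//.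
  rewrite ger0_norm ?subr_ge0 ?ge_floor//.
  apply: (@le_trans _ _ 1).
    by rewrite lerBlDr ltW// addrC -intrD1 lt_succ_floor.
  rewrite mulrC -ler_pdivrMr// mul1r (@le_trans _ _ n%:R)//; last by rewrite ler_nat.
  by near: n; exact: nbhs_infty_ger.
Unshelve. all: by end_near.
Qed.

End Caratheodory.

Section ContinuousV.
Variable R : realType.
Local Notation B := (measurableTypeR R).
Local Notation V := (B * B * B)%type.
Local Notation W := (B * B * B * B)%type.

Lemma continuous_pair (U1 U2 : topologicalType) (x : U1) : continuous (fun y : U2 => (x, y)).
Proof. by move=> y; apply: cvg_pair; [exact: cvg_cst|exact: cvg_id]. Qed.

Lemma continuous_pairl (U1 U2 : topologicalType) (y : U2) : continuous (fun x : U1 => (x, y)).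
Proof. by move=> x; apply: cvg_pair; [exact: cvg_id|exact: cvg_cst]. Qed.

Lemma continuous_comp_pair (U1 U2 : topologicalType) (f : U1 * U2 -> R) :
  continuous f -> (forall x, continuous (fun y => f (x, y))) /\
                  (forall y, continuous (fun x => f (x, y))).
Proof.
move=> cf; split => [x y|y x].
  apply: (continuous_comp (f := fun y => (x, y))); first exact: continuous_pair.
  exact: cf.
apply: (continuous_comp (f := fun x => (x, y))); first exact: continuous_pairl.
exact: cf.
Qed.

Lemma continuous_measurable2 (f : R * R -> R) : continuous f ->
  measurable_fun setT (f : B * B -> R).
Proof.
move=> /continuous_comp_pair[c1 c2]; apply: caratheodory_measurable => [y|x].
  exact: continuous_measurable_fun (c2 y).
exact: c1.
Qed.

Lemma continuous_measurable3 (f : vec3 R -> R) : continuous f ->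
  measurable_fun setT (f : V -> R).
Proof.
move=> /continuous_comp_pair[c1 c2].
apply: (@caratheodory_measurable _ (B * B)%type) => [y|x].
  exact: continuous_measurable2 (c2 y).
exact: c1.
Qed.

Lemma continuous_measurable4 (f : spacetime R -> R) : continuous f ->
  measurable_fun setT (f : W -> R).
Proof.
move=> /continuous_comp_pair[c1 c2].
apply: (@caratheodory_measurable _ V) => [y|x].
  exact: continuous_measurable3 (c2 y).
exact: c1.
Qed.

Lemma bounded_on_compact (U : topologicalType) (f : U -> R) (K : set U) :
  continuous f -> compact K -> exists M, forall x, K x -> `|f x| <= M.
Proof.
move=> cf cK.
have := @continuous_compact _ _ f K (continuous_subspaceT cf) cK.
move=> /(@compact_bounded R R^o)[M [_ HM]]; exists (M + 1) => x Kx.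
by apply: (HM (M + 1)); [rewrite ltrDl|exists x].
Qed.

Lemma compact_cube : compact (@cube R).
Proof.
have c : compact (`[0%R, 1%R]%classic : set R) by exact: segment_compact.
by apply: compact_setX => //; exact: compact_setX.
Qed.

Lemma smooth_continuous (V' : normedModType R) (f : V' -> R) : smooth f -> continuous f.
Proof. by move=> sf x; exact/differentiable_continuous/(sf [::]). Qed.

Lemma smooth_derive_continuous (V' : normedModType R) (f : V' -> R) v : smooth f ->
  continuous ('D_v f).
Proof. by move=> sf x; exact/differentiable_continuous/(sf [:: v]). Qed.

End ContinuousV.

(** * Sobolev and Hoelder norms *)

Section Norms.
Variable R : realType.
Local Notation B := (measurableTypeR R).
Local Notation V := (B * B * B)%type.
Local Notation leb3 := (leb3 R).
Local Notation Q := (@cube R).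
Local Notation vec3 := (vec3 R).
Implicit Types f g h : vec3 -> R.

(** What the argument needs of the norms of the function spaces, including the
    value [+oo] outside the space. *)
Record seminorm (N : (vec3 -> R) -> \bar R) : Prop := Seminorm {
  seminorm_ge0 : forall f, (0 <= N f)%E;
  seminormD : forall f g, (N (f \+ g)%R <= N f + N g)%E;
  seminormN : forall f, N (\- f)%R = N f }.

Lemma seminorm_add N1 N2 : seminorm N1 -> seminorm N2 ->
  seminorm (fun f => N1 f + N2 f)%E.
Proof.
move=> [a1 a2 a3] [b1 b2 b3]; split => [f|f g|f].
- by rewrite adde_ge0.
- by apply: (le_trans (leeD (a2 _ _) (b2 _ _))); rewrite addeACA.
- by rewrite a3 b3.
Qed.

(** Reverse triangle inequality, by squeezing. *)
Lemma seminormB_cvg N f (s : nat -> vec3 -> R) : seminorm N -> (N f < +oo)%E ->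
  N (f \- s n)%R @[n --> \oo] --> 0%E -> N (s n) @[n --> \oo] --> N f.
Proof.
move=> [N0 ND NN] fy c0.
have ffin : N f \is a fin_num by rewrite ge0_fin_numE.
pose e n := N (f \- s n)%R.
have up n : (N (s n) <= N f + e n)%E.
  have {1}-> : s n = f \+ (\- (f \- s n)) by apply/funext => X /=; ring.
  by apply: le_trans (ND _ _) _; rewrite NN.
have low n : (N f - e n <= N (s n))%E.
  have [->|ey] := eqVneq (e n) +oo%E; first by rewrite addeNy ?leNye// gt_eqF// (lt_le_trans _ (N0 f)).
  rewrite leeBlDr; last by rewrite ge0_fin_numE ?lt_neqAle ?ey ?leey//; exact: N0.
  have {1}-> : f = s n \+ (f \- s n) by apply/funext => X /=; ring.
  exact: ND.
apply: (squeeze_cvge (f := fun n => (N f - e n)%E) (h := fun n => (N f + e n)%E)).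
- by apply: nearW => n; rewrite low up.
- rewrite -[X in _ --> X]sube0; apply: cvgeB; [exact: fin_num_adde_defr|exact: cvg_cst|exact: c0].
- rewrite -[X in _ --> X]adde0; apply: cvgeD; [exact: fin_num_adde_defr|exact: cvg_cst|exact: c0].
Qed.

Lemma integrable_smooth_mul (f psi : vec3 -> R) : torus_L1 f -> continuous psi ->
  leb3.-integrable Q (fun X => (f X * psi X)%:E).
Proof.
move=> [_ fi] cp; have [M pM] := bounded_on_compact cp (@compact_cube R).
apply: (integrable_mul_bounded (M := M)) => //.
- exact: measurable_cube.
- by apply: measurable_funTS; exact: continuous_measurable3.
Qed.

Lemma torus_L1D f g : torus_L1 f -> torus_L1 g -> torus_L1 (f \+ g).
Proof.
move=> [pf fi] [pg gi]; split.
  by move=> X /=; have [-> -> ->] := pf X; have [-> -> ->] := pg X.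
rewrite (_ : EFin \o _ = (EFin \o f) \+ (EFin \o g))%E//.
by apply: integrableD => //; exact: measurable_cube.
Qed.

Lemma torus_L1N f : torus_L1 f -> torus_L1 (\- f).
Proof.
move=> [pf fi]; split; first by move=> X /=; have [-> -> ->] := pf X.
rewrite (_ : EFin \o _ = (-%E \o (EFin \o f)))//.
by apply: integrableN => //; exact: measurable_cube.
Qed.

Lemma weak_partialD e f g f' g' : weak_partial e f f' -> weak_partial e g g' ->
  weak_partial e (f \+ g) (f' \+ g').
Proof.
move=> [Lf Lf' Wf] [Lg Lg' Wg]; split; [exact: torus_L1D|exact: torus_L1D|].
move=> psi sp pp; have cp := smooth_continuous sp.
have cd := smooth_derive_continuous (v := e) sp.
have mQ := @measurable_cube R.
transitivity (\int[leb3]_(X in Q) (f X * 'D_e psi X + g X * 'D_e psi X)).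
  by apply: eq_Rintegral => X _; rewrite mulrDl.
rewrite RintegralD//; [|exact: integrable_smooth_mul|exact: integrable_smooth_mul].
rewrite Wf// Wg// -opprD; congr (- _).
rewrite -RintegralD//; [|exact: integrable_smooth_mul|exact: integrable_smooth_mul].
by apply: eq_Rintegral => X _; rewrite mulrDl.
Qed.

Lemma weak_partialN e f f' : weak_partial e f f' ->
  weak_partial e (\- f) (\- f').
Proof.
move=> [Lf Lf' Wf]; split; [exact: torus_L1N|exact: torus_L1N|].
move=> psi sp pp; have cp := smooth_continuous sp.
have cd := smooth_derive_continuous (v := e) sp.
have mQ := @measurable_cube R.
transitivity (\int[leb3]_(X in Q) (-1 * (f X * 'D_e psi X))).
  by apply: eq_Rintegral => X _ /=; ring.
rewrite RintegralZl//; last exact: integrable_smooth_mul.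
rewrite Wf// mulN1r; congr (- _).
rewrite -mulN1r -RintegralZl//; last exact: integrable_smooth_mul.
by apply: eq_Rintegral => X _ /=; ring.
Qed.

Let measL1 f : torus_L1 f -> measurable_fun setT (f \_ Q : V -> R).
Proof.
move=> [_ fi]; apply/(measurable_restrictT _ (@measurable_cube R)).
by apply/measurable_EFinP; case/integrableP : fi.
Qed.

Lemma torus_LnormD p f g : (1%:E <= p)%E -> torus_L1 f -> torus_L1 g ->
  (torus_Lnorm p (f \+ g)%R <= torus_Lnorm p f + torus_Lnorm p g)%E.
Proof.
move=> p1 Lf Lg.
apply: le_trans (eminkowski leb3 (measL1 Lf) (measL1 Lg) p1).
rewrite /torus_Lnorm (@eq_Lnorm _ V R leb3 p _ (EFin \o ((f \_ Q) \+ (g \_ Q)))%R)//.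
by move=> X /=; rewrite !patchE; case: ifP => //; rewrite addr0.
Qed.

Lemma torus_LnormN p f : torus_Lnorm p (\- f)%R = torus_Lnorm p f.
Proof.
rewrite /torus_Lnorm -[RHS]oppe_Lnorm; apply: eq_Lnorm => X /=.
by rewrite !patchE; case: ifP => //; rewrite oppr0.
Qed.

(** Weak gradients of two functions add up to a weak gradient of the sum, so the
    infimum over representatives inherits the triangle inequality of the Lebesgue
    norms. *)
Lemma W1_seminorm p : (1%:E <= p)%E -> seminorm (@W1_norm R p).
Proof.
move=> p1.
have rep0 f r : (exists gx gy gz : vec3 -> R,
    [/\ weak_partial (ex R) f gx, weak_partial (ey R) f gy, weak_partial (ez R) f gz &
      r = (torus_Lnorm p f + torus_Lnorm p gx + torus_Lnorm p gy
           + torus_Lnorm p gz)%E]) -> (0 <= r)%E.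
  by move=> [gx [gy [gz [_ _ _ ->]]]]; rewrite !adde_ge0// Lnorm_ge0.
have W0 f : (0 <= W1_norm p f)%E.
  by apply: le_ereal_inf_tmp => r; exact: rep0.
split => // [f g|f].
  have [->|fy] := eqVneq (W1_norm p f) +oo%E.
    by rewrite addye ?leey// gt_eqF// (lt_le_trans _ (W0 g)).
  have [->|gy] := eqVneq (W1_norm p g) +oo%E.
    by rewrite addey ?leey// gt_eqF// (lt_le_trans _ (W0 f)).
  have ffin : W1_norm p f \is a fin_num by rewrite ge0_fin_numE// lt_neqAle fy leey.
  have gfin : W1_norm p g \is a fin_num by rewrite ge0_fin_numE// lt_neqAle gy leey.
  apply/lee_addgt0Pr => e e0.
  have e20 : 0 < e / 2 by rewrite divr_gt0.
  have [r [fx [fy' [fz [Wx Wy Wz ->]]]] rf] := lb_ereal_inf_adherent e20 ffin.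
  have [s [gx [gy' [gz [Vx Vy Vz ->]]]] sg] := lb_ereal_inf_adherent e20 gfin.
  have -> : (W1_norm p f + W1_norm p g + e%:E =
    (W1_norm p f + (e / 2)%:E) + (W1_norm p g + (e / 2)%:E))%E.
    by rewrite addeACA -EFinD -splitr.
  apply: (le_trans _ (leeD (ltW rf) (ltW sg))).
  apply: ge_ereal_inf; exists (torus_Lnorm p (f \+ g)%R + torus_Lnorm p (fx \+ gx)%R
    + torus_Lnorm p (fy' \+ gy')%R + torus_Lnorm p (fz \+ gz)%R)%E.
    exists (fx \+ gx), (fy' \+ gy'), (fz \+ gz).
    by split; [exact: weak_partialD|exact: weak_partialD|exact: weak_partialD|].
  have [[[Lf Lfx _] [_ Lfy _]] [_ Lfz _]] := (Wx, Wy, Wz).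
  have [[[Lg Lgx _] [_ Lgy _]] [_ Lgz _]] := (Vx, Vy, Vz).
  rewrite [leRHS]addeACA [X in (_ <= X + _)%E]addeACA.
  rewrite [X in (_ <= X + _ + _)%E]addeACA.
  by apply: leeD; [apply: leeD; [apply: leeD|]|]; exact: torus_LnormD.
have H h : (W1_norm p (\- h)%R <= W1_norm p h)%E.
  apply: le_ereal_inf_tmp => r [gx [gy [gz [Wx Wy Wz ->]]]].
  apply: ereal_inf_lbound; exists (\- gx), (\- gy), (\- gz).
  split; [exact: weak_partialN|exact: weak_partialN|exact: weak_partialN|].
  by rewrite !torus_LnormN.
apply/eqP; rewrite eq_le H/=.
by rewrite -[X in (W1_norm p X <= _)%E](_ : \- (\- f) = f) ?H//; apply/funext => X /=; rewrite opprK.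
Qed.

Lemma holder_seminorm beta : seminorm (@holder_norm R beta).
Proof.
have enn (X : vec3) : 0 <= enorm X `^ beta by exact: powR_ge0.
have S0 f : (0 <= ereal_sup [set (`|f X|)%:E | X in [set: vec3]])%E.
  by apply: le_trans (ereal_sup_ubound _); last by exists 0.
have neq : ((1, 0, 0) : vec3) <> 0 by move=> [] /eqP; rewrite oner_eq0.
have H0 f : (0 <= ereal_sup [set r | exists X Y : vec3,
     X <> Y /\ r = (`|f X - f Y| / (enorm (X - Y) `^ beta))%:E])%E.
  apply: le_trans (ereal_sup_ubound _); last by exists (1, 0, 0), 0; split.
  by rewrite lee_fin divr_ge0.
split => [f|f g|f].
- by rewrite adde_ge0.
- rewrite /holder_norm addeACA; apply: leeD; apply: ge_ereal_sup.
    move=> _ [X _ <-]; apply: (@le_trans _ _ (`|f X|%:E + `|g X|%:E)%E).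
      by rewrite -EFinD lee_fin ler_normD.
    by apply: leeD; apply: ereal_sup_ubound; exists X.
  move=> _ [X [Y [XY ->]]].
  apply: (@le_trans _ _ ((`|f X - f Y| / (enorm (X - Y) `^ beta))%:E +
    (`|g X - g Y| / (enorm (X - Y) `^ beta))%:E)%E).
    rewrite -EFinD lee_fin -mulrDl ler_wpM2r ?invr_ge0//.
    by rewrite (_ : _ - _ = (f X - f Y) + (g X - g Y)) ?ler_normD//=; ring.
  by apply: leeD; apply: ereal_sup_ubound; exists X, Y.
- rewrite /holder_norm; congr (_ + _)%E; congr ereal_sup.
    by apply/seteqP; split => _ [X _ <-]; exists X; rewrite //= normrN.
  apply/seteqP; split => _ [X [Y [XY ->]]]; exists X, Y; split => //=;
    by rewrite -opprD normrN.
Qed.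

Lemma simple_valued_measurable N (s : R -> vec3 -> R) : simple_valued N s ->
  measurable_fun setT (fun t : B => N (s t)).
Proof.
move=> [k [A [c [mA _ sE]]]].
pose F (b : {ffun 'I_k -> bool}) := N (fun X => \sum_(i < k) (b i)%:R * c i X).
pose S (b : {ffun 'I_k -> bool}) := [set t : R | forall i, (t \in A i) = b i].
have mS b : measurable (S b : set B).
  have -> : S b = \bigcap_(i in [set: 'I_k]) (if b i then A i else ~` A i).
    apply/seteqP; split => t /= H i.
      move=> _; have := H i; case: (b i) => Hi; first exact: set_mem.
      by move=> /mem_set; rewrite Hi.
    have := H i Logic.I; case: (b i) => [/mem_set -> //|].
    by move=> /= nt; exact: memNset.
  apply: fin_bigcap_measurable => // i _; case: (b i); first exact: mA.
  by apply: measurableC; exact: mA.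
have NE t : N (s t) = F [ffun i => t \in A i].
  rewrite /F; congr N; apply/funext => X; rewrite sE; apply: eq_bigr => i _.
  by rewrite ffunE indicE.
move=> _ Y mY; rewrite setTI.
have -> : (fun t => N (s t)) @^-1` Y = \bigcup_(b in [set b | Y (F b)]) S b.
  apply/seteqP; split => [t /= Yt|t [b /= Yb Sb]].
    by exists [ffun i => t \in A i]; rewrite /= -?NE// => i; rewrite ffunE.
  rewrite /= NE; suff -> : [ffun i => t \in A i] = b by [].
  by apply/ffunP => i; rewrite ffunE Sb.
by apply: fin_bigcup_measurable => //; exact: finite_finset.
Qed.

(** The norm of a strongly measurable function agrees almost everywhere with a
    measurable function, namely the limit of the norms of its simple
    approximations; this is what turns the finiteness of the integral of the
    norm into an integrable bound. *)
Lemma bochner_bound (N : (vec3 -> R) -> \bar R) (T : R) u :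
  seminorm N -> bochner 3 T N u ->
  exists M : B -> R, [/\ measurable_fun setT M, forall t, 0 <= M t,
    (leb1 R).-integrable `]0, T[ (fun t => (M t ^+ 3)%:E) &
    {ae leb1 R, forall t, 0 < t < T ->
      torus_periodic (slice u t) /\ (N (slice u t) <= (M t)%:E)%E}].
Proof.
move=> sN [_ spc [s [ssv scv]] iN].
have mI : measurable (`]0%R, T[%classic : set B) by exact: measurable_itvB.
have key : {ae leb1 R, forall t, 0 < t < T -> in_space N (slice u t) /\
    N (s n t) @[n --> \oo] --> N (slice u t)}.
  apply: ae_imp2 spc scv => t H1 H2 t0; split; first exact: H1.
  by apply: seminormB_cvg (H2 t0) => //; have [] := H1 t0.
have [Z [mZ Z0 sZ]] := key.
pose D := `]0%R, T[%classic `\` Z.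
have mD : measurable (D : set B) by exact: measurableD.
pose m t := limn_esup (fun n => N (s n t)).
have mm : measurable_fun setT m.
  by apply: measurable_fun_limn_esup => n; exact: simple_valued_measurable.
have good t : D t -> [/\ torus_periodic (slice u t), (N (slice u t) < +oo)%E &
    N (slice u t) = m t].
  move=> [tT nZ]; have [] : in_space N (slice u t) /\
      N (s n t) @[n --> \oo] --> N (slice u t).
    apply: contrapT => H; apply: nZ; apply: sZ => /= H'; apply: H; apply: H'.
    by move: tT; rewrite /= in_itv.
  move=> [pu uy] c; split => //; apply/esym.
  rewrite /m is_cvg_limn_esupE; first exact/cvg_lim.
  by apply/cvg_ex; exists (N (slice u t)).
pose M := (fine \o m) \_ D.
have ME t : D t -> (M t)%:E = N (slice u t).
  move=> Dt; have [_ uy mE] := good t Dt; rewrite /M patchE mem_set//= -mE.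
  by rewrite fineK// ge0_fin_numE//; exact: seminorm_ge0.
have M0 t : 0 <= M t.
  rewrite /M patchE; case: ifPn => // /set_mem Dt.
  by have [_ _ /= <-] := good t Dt; rewrite fine_ge0//; exact: seminorm_ge0.
have mM : measurable_fun setT M.
  apply/(measurable_restrictT _ mD); apply: measurable_funTS.
  by apply: measurableT_comp mm; exact: fine_measurable.
exists M; split => //; last first.
  exists Z; split => // t /= H; apply: contrapT => nZ; apply: H => t0.
  have Dt : D t by split => //=; rewrite in_itv.
  by have [pu _ _] := good t Dt; split => //; rewrite ME.
apply/integrableP; split.
  by apply/measurable_EFinP/measurable_funTS; exact: measurable_funX.
apply: le_lt_trans iN.
rewrite ge0_integralE; last by move=> t _; exact: abse_ge0.
rewrite ge0_integralE; last by move=> t _; exact: poweR_ge0.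
apply: le_ereal_sup => _ [h /= hM <-]; exists h => //= t.
apply: (le_trans (hM t)); rewrite !patchE; case: ifPn => // /set_mem tI.
have [Dt|nD] := pselect (D t).
  by rewrite -(ME t Dt) poweR_EFin powR_mulrn//= ger0_norm// exprn_ge0.
by rewrite /M patchE memNset// expr0n/= normr0; exact: poweR_ge0.
Qed.

End Norms.

(** * Weak derivatives and difference quotients *)

Section Periodic.
Variable R : realType.
Local Notation B := (measurableTypeR R).
Local Notation V := (B * B * B)%type.
Local Notation leb3 := (leb3 R).
Local Notation Q := (@cube R).
Local Notation vec3 := (vec3 R).
Implicit Types f g h : vec3 -> R.

Lemma periodic_int3 f (m n k : int) (x y z : R) : torus_periodic f ->
  f (x + m%:~R, y + n%:~R, z + k%:~R) = f (x, y, z).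
Proof.
move=> pf.
rewrite (@periodic_int R _ (fun x => f (x, y + n%:~R, z + k%:~R)) m x); last first.
  by move=> t; have [+ _ _] := pf (t, y + n%:~R, z + k%:~R); rewrite /ex addVE !addr0.
rewrite (@periodic_int R _ (fun y => f (x, y, z + k%:~R)) n y); last first.
  by move=> t; have [_ + _] := pf (x, t, z + k%:~R); rewrite /ey addVE !addr0.
apply: (@periodic_int R _ (fun z => f (x, y, z)) k z) => t.
by have [_ _ +] := pf (x, y, t); rewrite /ez addVE !addr0.
Qed.

Lemma measurable_floorR : measurable_fun setT (fun x : B => (Num.floor x)%:~R : R).
Proof.
apply: nondecreasing_measurable => // x y xy.
by rewrite ler_int le_floor.
Qed.

Lemma frac_itv (x : R) : `[0, 1]%classic (x - (Num.floor x)%:~R).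
Proof.
rewrite /= in_itv/=; apply/andP; split; first by rewrite subr_ge0 ge_floor.
by rewrite ltW// ltrBlDr addrC -intrD1 lt_succ_floor.
Qed.

Lemma periodic_frac f X : torus_periodic f -> exists2 Y, Q Y & f X = f Y.
Proof.
case: X => -[x y] z pf.
exists (x - (Num.floor x)%:~R, y - (Num.floor y)%:~R, z - (Num.floor z)%:~R).
  by split; [split|]; exact: frac_itv.
rewrite -[LHS](periodic_int3 (- Num.floor x) (- Num.floor y) (- Num.floor z) _ _ _ pf).
by rewrite !mulrNz.
Qed.

(** A periodic function is its restriction to the cube composed with the
    fractional parts, which are Borel. *)
Lemma measurable_periodic f : torus_periodic f -> measurable_fun Q (f : V -> R) ->
  measurable_fun setT (f : V -> R).
Proof.
move=> pf mf; pose r (x : R) : R := x - (Num.floor x)%:~R.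
have mr : measurable_fun setT (r : B -> R).
  by apply: measurable_funB => //; exact: measurable_floorR.
pose G (X : V) : V := (r X.1.1, r X.1.2, r X.2).
have -> : (f : V -> R) = f \o G.
  apply/funext => -[[x y] z] /=; rewrite -[LHS](periodic_int3 (- Num.floor x) (- Num.floor y)
    (- Num.floor z) x y z pf).
  by rewrite !mulrNz.
apply: (measurable_comp (F := Q)) => //; first exact: measurable_cube.
- by move=> _ [X _ <-]; split; [split|]; exact: frac_itv.
- apply: measurable_mk3.
  + exact: measurableT_comp mr (@measurable_p11 R).
  + exact: measurableT_comp mr (@measurable_p12 R).
  + exact: measurableT_comp mr (@measurable_p2 R).
Qed.

Lemma torus_L1_measurable f : torus_L1 f -> measurable_fun setT (f : V -> R).
Proof.
move=> [pf fi]; apply: measurable_periodic => //.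
by apply/measurable_EFinP; case/integrableP : fi.
Qed.

Lemma measurable_shiftV f (xi : vec3) : measurable_fun setT (f : V -> R) ->
  measurable_fun setT (fun X : V => f ((X : vec3) + xi)).
Proof. by move=> mf; apply: measurableT_comp mf _; exact: (@measurable_addV _ _ V). Qed.

Lemma torus_periodic_shift f (xi : vec3) : torus_periodic f ->
  torus_periodic (fun X => f (X + xi)).
Proof. by move=> pf X; rewrite ![_ + _ + xi]addrAC; exact: pf. Qed.

Lemma torus_L1_shift f (xi : vec3) : torus_L1 f -> torus_L1 (fun X => f (X + xi)).
Proof.
move=> Lf; have mf := torus_L1_measurable Lf; case: Lf => pf fi.
split; first exact: torus_periodic_shift.
apply/integrableP; split.
  by apply/measurable_funTS/measurable_EFinP; exact: measurable_shiftV.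
case/integrableP : fi => _; apply: le_lt_trans.
rewrite (_ : integral _ _ _ = \int[leb3]_(X in Q) (`|f X|)%:E)%E//.
apply: (@integral_cube_shift R xi (fun X => `|f X|)) => //.
  exact: measurableT_comp.
by move=> X /=; have [-> -> ->] := pf X.
Qed.

Lemma Rintegral_shift f (xi : vec3) : torus_L1 f ->
  \int[leb3]_(X in Q) f (X + xi) = \int[leb3]_(X in Q) f X.
Proof.
move=> Lf; have mf := torus_L1_measurable Lf; case: Lf => pf fi.
rewrite /Rintegral integralE [in RHS]integralE; congr (fine (_ - _)).
  have -> : (EFin \o f)^\+%E = EFin \o (fun X : V => Num.max (f X) 0).
    by apply/funext => X /=; rewrite funeposE EFin_max.
  rewrite -[RHS](@integral_cube_shift R xi (fun X => Num.max (f X) 0)).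
  - by apply: eq_integral => X _; rewrite funeposE EFin_max.
  - exact: measurable_maxr.
  - by move=> X; rewrite le_max lexx orbT.
  - by move=> X /=; have [-> -> ->] := pf X.
have -> : (EFin \o f)^\-%E = EFin \o (fun X : V => Num.max (- f X) 0).
  by apply/funext => X /=; rewrite funenegE EFin_max.
rewrite -[RHS](@integral_cube_shift R xi (fun X => Num.max (- f X) 0)).
- by apply: eq_integral => X _; rewrite funenegE EFin_max.
- by apply: measurable_maxr => //; exact: measurable_funN.
- by move=> X; rewrite le_max lexx orbT.
- by move=> X /=; have [-> -> ->] := pf X.
Qed.

End Periodic.

Section WeakDifference.
Variable R : realType.
Local Notation B := (measurableTypeR R).
Local Notation V := (B * B * B)%type.
Local Notation leb1 := (leb1 R).
Local Notation leb3 := (leb3 R).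
Local Notation Q := (@cube R).
Local Notation vec3 := (vec3 R).
Implicit Types f g h : vec3 -> R.

Lemma measurable_move (e : vec3) : measurable_fun setT
  (fun p : V * B => (p.1 : vec3) + (p.2 : R) *: e : V).
Proof.
apply: measurable_addV => //.
have mr (c : R) : measurable_fun setT (fun p : V * B => (p.2 : R) * c : R).
  exact: measurable_funM.
case: e => -[a b] c; exact: (measurable_mk3 (mr a) (mr b) (mr c)).
Qed.

Lemma torus_L1_mul f (psi : vec3 -> R) : torus_L1 f -> torus_periodic psi ->
  continuous psi -> torus_L1 (fun X => f X * psi X).
Proof.
move=> Lf pp cp; split; last exact: integrable_smooth_mul.
by move=> X; have [-> -> ->] := Lf.1 X; have [-> -> ->] := pp X.
Qed.

Lemma torus_periodic_tensor (a b c : R -> R) : per1 a -> per1 b -> per1 c ->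
  torus_periodic (tensor a b c).
Proof.
move=> pa pb pc [[x y] z].
by rewrite /tensor /= !addr0 pa pb pc.
Qed.

Variables (e : vec3) (f g : vec3 -> R) (s : R).
Hypotheses (s0 : 0 <= s) (fg : weak_partial e f g).
(** The test function [Psi] is the average of a product along the segment from
    [X - s e] to [X]; its derivative along the segment is a difference of
    translates. *)
Hypothesis average : forall a b c, smooth1 a -> smooth1 b -> smooth1 c ->
  per1 a -> per1 b -> per1 c -> exists Psi, [/\ smooth Psi, torus_periodic Psi &
    forall X, 'D_e Psi X = tensor a b c X - tensor a b c (X - s *: e) /\
      Psi X = \int[leb1]_(r in `[0, s]) tensor a b c (X - r *: e)].

Let I : set B := `[0, s]%classic.
Let mI : measurable I. Proof. exact: measurable_itvB. Qed.
Let Lf : torus_L1 f. Proof. by case: fg. Qed.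
Let Lg : torus_L1 g. Proof. by case: fg. Qed.
Let mf := torus_L1_measurable Lf.
Let mg := torus_L1_measurable Lg.

Let K (p : V * B) : R := g ((p.1 : vec3) + (p.2 : R) *: e).

Let mK : measurable_fun setT K.
Proof. exact: measurableT_comp mg (measurable_move e). Qed.

Let const_lty : (\int[leb1]_(r in I) \int[leb3]_(X in Q) (`|g X|)%:E < +oo)%E.
Proof.
rewrite integral_cst// lte_mul_pinfty//; [exact: integral_ge0| |].
  by rewrite ge0_fin_numE ?integral_ge0//; case/integrableP : Lg.2.
by rewrite /Defs.leb1 /= /I lebesgue_measure_itv/= lte_fin; case: ifP => _; rewrite ?ltry.
Qed.

Let Ki : (sleb3 R \x leb1)%E.-integrable (Q `*` I) (EFin \o K).
Proof.
apply: (@integrable_prod2 _ _ _ _ _ (sleb3 R) leb1 _ _ (@measurable_cube R) mI K mK).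
rewrite (_ : integral _ _ _ = \int[leb1]_(r in I) \int[leb3]_(X in Q) (`|g X|)%:E)%E.
  exact: const_lty.
apply: eq_integral => r _.
apply: (@integral_cube_shift R (r *: e) (fun X => `|g X|)) => //.
  exact: measurableT_comp.
by move=> X /=; have [-> -> ->] := Lg.1 X.
Qed.

Let G (X : vec3) := \int[leb1]_(r in I) g (X + r *: e).
Let h (X : vec3) := f (X + s *: e) - f X - G X.

Let Gi : leb3.-integrable Q (EFin \o G).
Proof. exact: (@integrable_Rfubini1 _ _ _ _ _ (sleb3 R) leb1 _ _ (@measurable_cube R) mI K Ki). Qed.

Let Bi : leb3.-integrable Q (EFin \o (fun X => f (X + s *: e) - f X)).
Proof.
rewrite (_ : EFin \o _ = (EFin \o (fun X => f (X + s *: e)%R)) \- (EFin \o f))%E//.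
apply: integrableB; [exact: measurable_cube| |exact: Lf.2].
exact: (torus_L1_shift (s *: e) Lf).2.
Qed.

Let hi : leb3.-integrable Q (EFin \o h).
Proof.
rewrite (_ : EFin \o _ = (EFin \o (fun X => f (X + s *: e)%R - f X)%R) \- (EFin \o G))%E//.
by apply: integrableB => //; exact: measurable_cube.
Qed.

Let G_tensor (psi : vec3 -> R) (Psi : vec3 -> R) : continuous psi -> torus_periodic psi ->
  (forall X, Psi X = \int[leb1]_(r in `[0, s]) psi (X - r *: e)) ->
  \int[leb3]_(X in Q) (G X * psi X) = \int[leb3]_(X in Q) (g X * Psi X).
Proof.
move=> cp pp PE; have [M pM] := bounded_on_compact cp (@compact_cube R).
have mp := continuous_measurable3 cp.
pose K1 (p : V * B) : R := K p * psi p.1.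
have mK1 : measurable_fun setT K1.
  by apply: measurable_funM => //; exact: measurableT_comp mp measurable_fst.
have K1i : (sleb3 R \x leb1)%E.-integrable (Q `*` I) (EFin \o K1).
  apply: (integrable_mul_bounded (M := M)) => //.
  - by apply: measurableX => //; exact: measurable_cube.
  - by apply: measurable_funTS; exact: measurableT_comp mp measurable_fst.
  - by move=> [X r] [/= QX _]; exact: pM.
have pT X : `|psi X| <= M by have [Y QY ->] := periodic_frac X pp; exact: pM.
pose K2 (p : V * B) : R := g p.1 * psi ((p.1 : vec3) - (p.2 : R) *: e).
have mp2 : measurable_fun setT (fun p : V * B => psi ((p.1 : vec3) - (p.2 : R) *: e)).
  have := measurableT_comp mp (measurable_move (- e)).
  by rewrite [X in measurable_fun _ X -> _](_ : _ = fun p : V * B => psi ((p.1 : vec3) - (p.2 : R) *: e))//;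
     apply/funext => p /=; rewrite scalerN.
have mK2 : measurable_fun setT K2.
  by apply: measurable_funM => //; exact: measurableT_comp mg measurable_fst.
have shiftE r : \int[leb3]_(X in Q) K1 (X, r) = \int[leb3]_(X in Q) K2 (X, r).
  rewrite -(@Rintegral_shift _ (fun X => K2 (X, r)) (r *: e)).
    by apply: eq_Rintegral => X _; rewrite /K1 /K2 /= addrK.
  have c2 : continuous (fun X : vec3 => psi (X - r *: e)).
    move=> X; apply: (continuous_comp (f := fun X : vec3 => X - r *: e)); last exact: cp.
    by apply: cvgB; [exact: cvg_id|exact: cvg_cst].
  apply: (torus_L1_mul Lg _ c2); exact: torus_periodic_shift.
have K2i : (sleb3 R \x leb1)%E.-integrable (Q `*` I) (EFin \o K2).
  apply: (integrable_mul_bounded (M := M)) => //.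
  - by apply: measurableX => //; exact: measurable_cube.
  - apply: (@integrable_prod2 _ _ _ _ _ (sleb3 R) leb1 _ _ (@measurable_cube R) mI (fun p => g p.1)).
      exact: measurableT_comp mg measurable_fst.
    exact: const_lty.
  - exact: measurable_funTS.
have mQ : measurable (Q : set V) := @measurable_cube R.
transitivity (\int[leb3]_(X in Q) \int[leb1]_(r in I) K1 (X, r)).
  rewrite /Rintegral; congr fine; apply: ae_eq_integral => //.
  - apply/measurable_EFinP/measurable_funM; last exact: measurable_funTS.
    by apply/measurable_EFinP; case/integrableP : Gi.
  - by have /integrableP[] := (@integrable_Rfubini1 _ _ _ _ _ (sleb3 R) leb1 _ _ mQ mI K1 K1i).
  - apply: ae_imp (@ae_integrable_fubini1 _ _ _ _ _ (sleb3 R) leb1 _ _ mQ mI K mK Ki).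
    move=> X H QX; congr EFin; rewrite /K1 /= [RHS]RintegralZr//; exact: H.
rewrite -(@Rfubini1 _ _ _ _ _ (sleb3 R) leb1 _ _ mQ mI K1 K1i).
rewrite (@Rfubini2 _ _ _ _ _ (sleb3 R) leb1 _ _ mQ mI K1 mK1 K1i).
under [LHS]eq_Rintegral do rewrite shiftE.
rewrite -(@Rfubini2 _ _ _ _ _ (sleb3 R) leb1 _ _ mQ mI K2 mK2 K2i).
rewrite (@Rfubini1 _ _ _ _ _ (sleb3 R) leb1 _ _ mQ mI K2 K2i).
apply: eq_Rintegral => X _; rewrite /K2 /= PE RintegralZl//.
apply: continuous_integrable => r.
apply: (continuous_comp (f := fun r : R => X - r *: e)); last exact: cp.
apply: cvgB; first exact: cvg_cst.
by apply: cvgZ; [exact: cvg_id|exact: cvg_cst].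
Qed.

(** The difference [f (X + s e) - f X] equals the integral of [g] along the
    segment. Both sides have the same integrals against products of smooth
    periodic functions, by testing the weak derivative with the averages of these
    functions along the segment, and such integrals determine a function. Thus no
    mollification of [f] is needed. *)
Lemma weak_difference : {ae leb3, forall X, Q X ->
  ((`|f (X + s *: e) - f X|)%:E <= \int[leb1]_(r in `[0%R, s]) (`|g (X + r *: e)|)%:E)%E}.
Proof.
have mQ : measurable (Q : set V) := @measurable_cube R.
have h0 : {ae leb3, forall X, Q X -> h X = 0}.
  apply: (torus_unique hi) => a b c sa sb sc pa pb pc.
  have [Psi [sP pP PE]] := average sa sb sc pa pb pc.
  have ct := smooth_continuous (smooth_tensor sa sb sc).
  have pt := torus_periodic_tensor pa pb pc.
  set psi := tensor a b c in PE ct pt *.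
  have fs := torus_L1_mul (torus_L1_shift (s *: e) Lf) pt ct.
  have c2 : continuous (fun X : vec3 => psi (X - s *: e)).
    move=> X; apply: (continuous_comp (f := fun X : vec3 => X - s *: e)); last exact: ct.
    by apply: cvgB; [exact: cvg_id|exact: cvg_cst].
  have fs2 := torus_L1_mul Lf (torus_periodic_shift (- (s *: e)) pt) c2.
  have f1 := torus_L1_mul Lf pt ct.
  have Gp : leb3.-integrable Q (fun X => (G X * psi X)%:E).
    have [M pM] := bounded_on_compact ct (@compact_cube R).
    apply: (integrable_mul_bounded (M := M)) => //.
    by apply: measurable_funTS; exact: continuous_measurable3.
  transitivity (\int[leb3]_(X in Q) (f (X + s *: e) * psi X - f X * psi X - G X * psi X)).
    by apply: eq_Rintegral => X _; rewrite /h; ring.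
  rewrite RintegralB//; last by apply: (@integrableB _ _ _ _ _ mQ _ _ fs.2 f1.2).
  rewrite RintegralB//; [|exact: fs.2|exact: f1.2].
  rewrite (G_tensor ct pt (fun X => (PE X).2)).
  have -> : \int[leb3]_(X in Q) (f (X + s *: e) * psi X) =
      \int[leb3]_(X in Q) (f X * psi (X - s *: e)).
    rewrite -(Rintegral_shift (s *: e) fs2).
    by apply: eq_Rintegral => X _; rewrite addrK.
  case: fg => _ _ /(_ _ sP pP) W.
  have {W} : - (\int[leb3]_(X in Q) (g X * Psi X)) =
      (\int[leb3]_(X in Q) (f X * psi X)) - (\int[leb3]_(X in Q) (f X * psi (X - s *: e))).
    rewrite -W -RintegralB//; [|exact: f1.2|exact: fs2.2].
    by apply: eq_Rintegral => X _; rewrite (PE X).1; ring.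
  by move=> W; lra.
apply: ae_imp h0 => X h0 QX; have /eqP := h0 QX; rewrite /h subr_eq0 => /eqP ->.
apply: (@le_trans _ _ (`|\int[leb1]_(r in I) (g (X + r *: e)%R)%:E|)%E); last first.
  apply: le_abse_integral => //; apply: measurable_funTS; apply/measurable_EFinP.
  exact: (measurableT_comp mK (pair1_measurable (X : V))).
rewrite /G /Rintegral; case: (integral _ _ _) => [r| |] /=; [exact: lexx|exact: leey|exact: leey].
Qed.

End WeakDifference.

Section Averages.
Variable R : realType.
Local Notation B := (measurableTypeR R).
Local Notation V := (B * B * B)%type.
Local Notation leb1 := (leb1 R).
Local Notation leb3 := (leb3 R).
Local Notation Q := (@cube R).
Local Notation vec3 := (vec3 R).
Implicit Types f g h : vec3 -> R.

Lemma is_derive_shift1 (A : R -> R) (a d x : R) : is_derive (x + d) (1 : R) A a ->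
  is_derive x (1 : R) (fun x => A (x + d)) a.
Proof.
move=> D; have Dd : is_derive x (1 : R) (fun x => x + d) 1.
  apply: (is_derive_eq (is_deriveD (is_derive_id x (1 : R)) (is_derive_cst d x (1 : R)))).
  by rewrite addr0.
by apply: (is_derive_eq (@is_derive1_comp _ A (fun x => x + d) x _ _ D Dd)); rewrite mulr1.
Qed.

(** The average is [A x - A (x - s)] for a primitive [A]; it is smooth and periodic
    even when [A] itself is not periodic. *)
Lemma smooth1_average (a : R -> R) (s : R) : 0 <= s -> smooth1 a -> per1 a ->
  exists al, [/\ smooth1 al, per1 al &
    forall x, derive1 al x = a x - a (x - s) /\ al x = \int[leb1]_(r in `[0, s]) a (x - r)].
Proof.
move=> s0 sa pa; have ca := smooth1_continuous sa.
have [A DA] := continuous_primitive ca.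
pose al x := A x - A (x - s).
have Dal (x : R) : is_derive x (1 : R) al (a x - a (x - s)).
  by apply: is_deriveB; exact: is_derive_shift1.
have cs (x : R) : continuous (fun r : R => a (x - r)).
  move=> r; apply: (continuous_comp (f := fun r : R => x - r)); last exact: ca.
  by apply: cvgB; [exact: cvg_cst|exact: cvg_id].
have alE x : al x = \int[leb1]_(r in `[0, s]) a (x - r).
  have D (r : R) : is_derive r (1 : R) (fun r => - A (x - r)) (a (x - r)).
    have Dr : is_derive r (1 : R) (fun r => x - r) (-1).
      apply: (is_derive_eq (is_deriveB (is_derive_cst x r (1 : R)) (is_derive_id r (1 : R)))).
      by rewrite add0r.
    apply: (is_derive_eq (is_deriveN (@is_derive1_comp _ A (fun r => x - r) r _ _ (DA (x - r)) Dr))).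
    by rewrite mulrN1 opprK.
  rewrite [RHS](ftc2 s0 D (cs x)) subr0 /al; ring.
exists al; split.
- have s1 : smooth1 (fun x => x - s) by exact: (smooth1B (@smooth1_id R) (smooth1_cst s)).
  exact: (smooth1_prim Dal (smooth1B sa (smooth1_comp sa s1))).
- by move=> x; rewrite !alE; apply: eq_Rintegral => r _; rewrite addrAC pa.
- by move=> x; split => //; exact: (@is_derive_unique1 _ al (fun x => a x - a (x - s)) x (Dal x)).
Qed.

Lemma pull_Rintegral (s k l : R) (a : R -> R) (F : R -> R) : continuous a ->
  (forall r, F r = k * a r * l) ->
  \int[leb1]_(r in `[0, s]) F r = k * (\int[leb1]_(r in `[0, s]) a r) * l.
Proof.
move=> ca FE; under eq_Rintegral do rewrite FE mulrAC.
have i : leb1.-integrable `[0, s] (EFin \o a) by exact: continuous_integrable.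
by rewrite RintegralZl// mulrAC.
Qed.

Lemma continuous_rsub (a : R -> R) (x : R) : continuous a -> continuous (fun r : R => a (x - r)).
Proof.
move=> ca r; apply: (continuous_comp (f := fun r : R => x - r)); last exact: ca.
by apply: cvgB; [exact: cvg_cst|exact: cvg_id].
Qed.

Lemma scale_exE (X : vec3) (s : R) : X + s *: ex R = (X.1.1 + s, X.1.2, X.2).
Proof.
case: X => -[x y] z; rewrite (_ : _ + _ = (x + s * 1, y + s * 0, z + s * 0))//=.
by rewrite mulr1 !mulr0 !addr0.
Qed.

Lemma scale_eyE (X : vec3) (s : R) : X + s *: ey R = (X.1.1, X.1.2 + s, X.2).
Proof.
case: X => -[x y] z; rewrite (_ : _ + _ = (x + s * 0, y + s * 1, z + s * 0))//=.
by rewrite mulr1 !mulr0 !addr0.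
Qed.

Lemma scale_ezE (X : vec3) (s : R) : X + s *: ez R = (X.1.1, X.1.2, X.2 + s).
Proof.
case: X => -[x y] z; rewrite (_ : _ + _ = (x + s * 0, y + s * 0, z + s * 1))//=.
by rewrite mulr1 !mulr0 !addr0.
Qed.

Lemma tensor_subE (a b c : R -> R) (X : vec3) (s : R) :
  [/\ tensor a b c (X - s *: ex R) = a (X.1.1 - s) * b X.1.2 * c X.2,
    tensor a b c (X - s *: ey R) = a X.1.1 * b (X.1.2 - s) * c X.2 &
    tensor a b c (X - s *: ez R) = a X.1.1 * b X.1.2 * c (X.2 - s)].
Proof. by rewrite -!scaleNr scale_exE scale_eyE scale_ezE. Qed.

Variables (f g : vec3 -> R) (s : R).
Hypothesis s0 : 0 <= s.

Let claim e := {ae leb3, forall X, Q X ->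
  ((`|f (X + s *: e) - f X|)%:E <= \int[leb1]_(r in `[0%R, s]) (`|g (X + r *: e)|)%:E)%E}.

Lemma weak_difference_x : weak_partial (ex R) f g -> claim (ex R).
Proof.
move=> W; apply: weak_difference => // a b c sa sb sc pa pb pc.
have [al [sal pal alE]] := smooth1_average s0 sa pa.
exists (tensor al b c); split; [exact: smooth_tensor|exact: torus_periodic_tensor|].
move=> X; rewrite (congr1 (fun F => F X) (derive_tensor_ex sal sb sc)) /tensor /= (alE _).1.
split.
  have [E _ _] := tensor_subE a b c X s; rewrite [X in _ = _ - X]E; ring.
rewrite (alE _).2 [RHS](@pull_Rintegral s 1 (b X.1.2 * c X.2) (fun r => a (X.1.1 - r))
  (fun r => tensor a b c (X - r *: ex R))) /=.
- by ring.
- exact/continuous_rsub/smooth1_continuous.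
by move=> r; have [E _ _] := tensor_subE a b c X r; rewrite [LHS]E; ring.
Qed.

Lemma weak_difference_y : weak_partial (ey R) f g -> claim (ey R).
Proof.
move=> W; apply: weak_difference => // a b c sa sb sc pa pb pc.
have [al [sal pal alE]] := smooth1_average s0 sb pb.
exists (tensor a al c); split; [exact: smooth_tensor|exact: torus_periodic_tensor|].
move=> X; rewrite (congr1 (fun F => F X) (derive_tensor_ey sa sal sc)) /tensor /= (alE _).1.
split.
  have [_ E _] := tensor_subE a b c X s; rewrite [X in _ = _ - X]E; ring.
rewrite (alE _).2 [RHS](@pull_Rintegral s (a X.1.1) (c X.2) (fun r => b (X.1.2 - r))
  (fun r => tensor a b c (X - r *: ey R))) /=.
- by ring.
- exact/continuous_rsub/smooth1_continuous.
by move=> r; have [_ E _] := tensor_subE a b c X r; rewrite [LHS]E; ring.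
Qed.

Lemma weak_difference_z : weak_partial (ez R) f g -> claim (ez R).
Proof.
move=> W; apply: weak_difference => // a b c sa sb sc pa pb pc.
have [al [sal pal alE]] := smooth1_average s0 sc pc.
exists (tensor a b al); split; [exact: smooth_tensor|exact: torus_periodic_tensor|].
move=> X; rewrite (congr1 (fun F => F X) (derive_tensor_ez sa sb sal)) /tensor /= (alE _).1.
split.
  have [_ _ E] := tensor_subE a b c X s; rewrite [X in _ = _ - X]E; ring.
rewrite (alE _).2 [RHS](@pull_Rintegral s (a X.1.1 * b X.1.2) 1 (fun r => c (X.2 - r))
  (fun r => tensor a b c (X - r *: ez R))) /=.
- by ring.
- exact/continuous_rsub/smooth1_continuous.
by move=> r; have [_ _ E] := tensor_subE a b c X r; rewrite [LHS]E; ring.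
Qed.

End Averages.

Section Cubes.
Variable R : realType.
Local Notation B := (measurableTypeR R).
Local Notation V := (B * B * B)%type.
Local Notation leb1 := (leb1 R).
Local Notation leb3 := (leb3 R).
Local Notation Q := (@cube R).
Local Notation vec3 := (vec3 R).
Implicit Types f g h : vec3 -> R.

Lemma leb1_itv0 (s : R) : 0 <= s -> leb1 `[0, s]%classic = s%:E.
Proof.
move=> s0; rewrite /Defs.leb1 /= lebesgue_measure_itv/= lte_fin.
by case: ltgtP s0 => // [_|<-] _; rewrite ?oppr0 ?adde0.
Qed.

(** Jensen's inequality for the cube, integrated from the tangent line at the
    mean. *)
Lemma jensen_cube (h : B -> R) (s a : R) : 0 <= s -> 0 <= a ->
  measurable_fun setT h -> (forall r, 0 <= h r) ->
  (a%:E <= \int[leb1]_(r in `[0%R, s]) (h r)%:E)%E ->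
  ((a ^+ 3)%:E <= (s ^+ 2)%:E * \int[leb1]_(r in `[0%R, s]) (h r ^+ 3)%:E)%E.
Proof.
rewrite le_eqVlt => /predU1P[<-|s0] a0 mh h0.
  rewrite set_itv1 integral_set1 lee_fin => a0'.
  by rewrite (_ : a = 0) ?expr0n ?mul0e//; apply/eqP; rewrite eq_le a0 a0'.
move=> le_a; pose m := a / s; have m0 : 0 <= m by rewrite divr_ge0// ltW.
have mI : measurable (`[0, s]%classic : set B) by exact: measurable_itvB.
have mhE : measurable_fun (`[0, s]%classic : set B) (EFin \o h).
  by apply/measurable_funTS/measurable_EFinP.
have mh3 : measurable_fun (`[0, s]%classic : set B) (fun r => (h r ^+ 3)%:E).
  by apply/measurable_funTS/measurable_EFinP/measurable_funX.
have H : ((3 * m ^+ 2)%:E * \int[leb1]_(r in `[0%R, s]) (h r)%:E <=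
    \int[leb1]_(r in `[0%R, s]) (h r ^+ 3)%:E + (2 * m ^+ 3 * s)%:E)%E.
  rewrite -ge0_integralZl//; last 2 first.
  - by move=> r _; rewrite lee_fin.
  - by rewrite lee_fin mulr_ge0// sqr_ge0.
  have -> : (2 * m ^+ 3 * s)%:E = (\int[leb1]_(r in `[0%R, s]) (2 * m ^+ 3)%:E)%E.
    by rewrite integral_cst// EFinM; congr (_ * _)%E; exact/esym/leb1_itv0/ltW.
  rewrite -ge0_integralD//; last 2 first.
  - by move=> r _; rewrite lee_fin exprn_ge0.
  - by move=> r _; rewrite lee_fin mulr_ge0// exprn_ge0.
  apply: ge0_le_integral => //.
  - by move=> r _; rewrite -EFinM lee_fin mulr_ge0// mulr_ge0// sqr_ge0.
  - by apply: measurable_funeM.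
  - by apply: emeasurable_funD.
  move=> r _; rewrite -EFinM -EFinD lee_fin -subr_ge0.
  rewrite (_ : _ - _ = (h r - m) ^+ 2 * (h r + 2 * m)); last by ring.
  by rewrite mulr_ge0 ?sqr_ge0// addr_ge0// mulr_ge0.
have m2 : (0 <= (3 * m ^+ 2)%:E)%E by rewrite lee_fin mulr_ge0 ?sqr_ge0.
have {}H := le_trans (lee_wpmul2l m2 le_a) H.
have sa : a = m * s by rewrite /m divfK// gt_eqF.
have : ((m ^+ 3 * s)%:E <= \int[leb1]_(r in `[0%R, s]) (h r ^+ 3)%:E)%E.
  rewrite -(@leeD2rE _ (2 * m ^+ 3 * s)%:E)//; apply: le_trans H.
  by rewrite -EFinM -EFinD lee_fin sa le_eqVlt; apply/orP; left; apply/eqP; ring.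
have s2 : (0 <= (s ^+ 2)%:E)%E by rewrite lee_fin sqr_ge0.
move=> /(lee_wpmul2l s2); apply: le_trans.
by rewrite -EFinM lee_fin sa le_eqVlt; apply/orP; left; apply/eqP; ring.
Qed.

(** The cubes are the right power: the defect and the flux are trilinear in the
    velocity. *)
Definition int3 (g : vec3 -> R) : \bar R := \int[leb3]_(X in Q) (`|g X| ^+ 3)%:E.

Let diff_claim f g e (s : R) := {ae leb3, forall X, Q X ->
  ((`|f (X + s *: e) - f X|)%:E <= \int[leb1]_(r in `[0%R, s]) (`|g (X + r *: e)|)%:E)%E}.

(** Minkowski for the segment, in the form of the inequality of Jensen followed
    by translation invariance of the torus. *)
Lemma int3_difference f g e (s : R) : 0 <= s -> torus_L1 f -> torus_L1 g ->
  diff_claim f g e s ->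
  (int3 (fun X => (f (X + s *: e) - f X)%R) <= (s ^+ 3)%:E * int3 g)%E.
Proof.
move=> s0 Lf Lg cl.
have mf := torus_L1_measurable Lf; have mg := torus_L1_measurable Lg.
have mQ : measurable (Q : set V) := @measurable_cube R.
have mI : measurable (`[0, s]%classic : set B) by exact: measurable_itvB.
pose K (p : V * B) : \bar R := (`|g ((p.1 : vec3) + (p.2 : R) *: e)| ^+ 3)%:E.
have mK : measurable_fun setT K.
  apply/measurable_EFinP/measurable_funX; apply: measurableT_comp => //.
  exact: measurableT_comp mg (measurable_move e).
have K0 p : (0 <= K p)%E by rewrite lee_fin exprn_ge0.
have mF1 := @measurable_tonelli1 _ _ _ _ _ leb1 _ mI K mK K0.
have -> : ((s ^+ 3)%:E * int3 g =
    \int[leb3]_(X in Q) ((s ^+ 2)%:E * \int[leb1]_(r in `[0%R, s]) K (X, r)))%E.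
  rewrite ge0_integralZl//; last 3 first.
  - exact: measurable_funTS.
  - by move=> X _; exact: integral_ge0.
  - by rewrite lee_fin sqr_ge0.
  rewrite (@tonelli_swap _ _ _ _ _ (sleb3 R) leb1 _ _ mQ mI K mK K0).
  transitivity ((s ^+ 2)%:E * \int[leb1]_(r in `[0%R, s]) int3 g)%E.
    rewrite integral_cst//.
    rewrite [X in (_ * (_ * X))%E](leb1_itv0 s0) [(int3 g * _)%E]muleC muleA -EFinM.
    by congr (_%:E * _)%E; ring.
  apply: (congr1 (mule _)); apply: eq_integral => r _.
  rewrite -[LHS](@integral_cube_shift R (r *: e) (fun X => `|g X| ^+ 3))//.
  - apply: measurable_funX; exact: measurableT_comp.
  - by move=> X /=; have [-> -> ->] := Lg.1 X.
have me : measurable_fun setT (fun X : V => (`|f ((X : vec3) + s *: e) - f X| ^+ 3)%:E).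
  apply/measurable_EFinP/measurable_funX; apply: measurableT_comp => //.
  by apply: measurable_funB => //; exact: measurable_shiftV.
apply: ae_ge0_le_integral => //.
- exact: measurable_funTS.
- by move=> X _; rewrite mule_ge0 ?lee_fin ?sqr_ge0//; exact: integral_ge0.
- by apply: measurable_funeM; exact: measurable_funTS.
- apply: ae_imp cl => X H QX; apply: (jensen_cube s0 (h := fun r => `|g (X + r *: e)|)) => //.
  + apply: measurableT_comp => //.
    exact: (measurableT_comp (measurableT_comp mg (measurable_move e)) (pair1_measurable (X : V))).
  + exact: H.
Qed.

Lemma int3_sub_shift f xi : torus_L1 f ->
  int3 (fun X => f (X - xi) - f X) = int3 (fun X => f (X + xi) - f X).
Proof.
move=> Lf; have mf := torus_L1_measurable Lf.
rewrite /int3 -(@integral_cube_shift R xi (fun X => `|f (X - xi) - f X| ^+ 3)).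
- by apply: eq_integral => X _; rewrite addrK distrC.
- apply: measurable_funX; apply: measurableT_comp => //.
  by apply: measurable_funB => //; exact: measurable_shiftV.
- by move=> X; rewrite exprn_ge0.
- move=> X /=; have [-> -> ->] := Lf.1 X.
  by have [-> -> ->] := (torus_L1_shift (- xi) Lf).1 X.
Qed.

Lemma int3_differenceN f g e (s : R) : torus_L1 f -> torus_L1 g ->
  (forall s, 0 <= s -> diff_claim f g e s) ->
  (int3 (fun X => (f (X + s *: e) - f X)%R) <= (`|s| ^+ 3)%:E * int3 g)%E.
Proof.
move=> Lf Lg cl; have [s0|s0] := leP 0 s.
  by rewrite ger0_norm//; apply: int3_difference => //; exact: cl.
rewrite ltr0_norm// -(int3_sub_shift _ Lf) -scaleNr.
apply: int3_difference => //; first by rewrite oppr_ge0 ltW.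
by apply: cl; rewrite oppr_ge0 ltW.
Qed.

(** The sum norm splits an increment into increments along the axes. *)
Definition n1 (xi : vec3) : R := `|xi.1.1| + `|xi.1.2| + `|xi.2|.

Lemma n1_ge0 xi : 0 <= n1 xi. Proof. by rewrite /n1 !addr_ge0. Qed.

Lemma int3_shift f xi : torus_L1 f -> int3 (fun X => f (X + xi)) = int3 f.
Proof.
move=> Lf; have mf := torus_L1_measurable Lf.
apply: (@integral_cube_shift R xi (fun X => `|f X| ^+ 3)).
- by apply: measurable_funX; apply: measurableT_comp.
- by move=> X; rewrite exprn_ge0.
- by move=> X /=; have [-> -> ->] := Lf.1 X.
Qed.

Lemma int3_add (f g h k : vec3 -> R) : measurable_fun setT (g : V -> R) ->
  measurable_fun setT (h : V -> R) -> measurable_fun setT (k : V -> R) ->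
  (forall X, `|f X| <= `|g X| + `|h X| + `|k X|) ->
  measurable_fun setT (f : V -> R) ->
  (int3 f <= 9%:E * (int3 g + int3 h + int3 k))%E.
Proof.
move=> mg mh mk H mf; have mQ : measurable (Q : set V) := @measurable_cube R.
have m3 (l : vec3 -> R) : measurable_fun setT (l : V -> R) ->
    measurable_fun Q (fun X : V => (`|l X| ^+ 3)%:E).
  by move=> ml; apply/measurable_funTS/measurable_EFinP/measurable_funX/measurableT_comp.
have p3 (l : vec3 -> R) X : (0 <= (`|l X| ^+ 3)%:E)%E by rewrite lee_fin exprn_ge0.
rewrite /int3 -!ge0_integralD//; last 5 first.
- by move=> X _; rewrite adde_ge0.
- by apply: emeasurable_funD; exact: m3.
- exact: m3.
- exact: m3.
- exact: m3.
rewrite -ge0_integralZl//; last 2 first.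
- by apply: emeasurable_funD; [apply: emeasurable_funD|]; exact: m3.
- by move=> X _; rewrite !adde_ge0.
apply: ge0_le_integral => //; first exact: m3.
- by apply: measurable_funeM; apply: emeasurable_funD; [apply: emeasurable_funD|]; exact: m3.
move=> X _; rewrite -!EFinD -EFinM lee_fin.
have a0 := normr_ge0 (g X); have b0 := normr_ge0 (h X); have c0 := normr_ge0 (k X).
move: a0 b0 c0 (H X).
move: (`|f X|) (`|g X|) (`|h X|) (`|k X|) (normr_ge0 (f X)) => r a b c r0 a0 b0 c0 hr.
apply: (@le_trans _ _ ((a + b + c) ^+ 3)); first by rewrite lerXn2r// nnegrE !addr_ge0.
have ineq (x y : R) : 0 <= x -> 0 <= y -> x ^+ 2 * y + x * y ^+ 2 <= x ^+ 3 + y ^+ 3.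
  move=> x0 y0; rewrite -subr_ge0 (_ : _ - _ = (x - y) ^+ 2 * (x + y)); last by ring.
  by apply: mulr_ge0; [exact: sqr_ge0|exact: addr_ge0].
have amgm : 6 * (a * b * c) <= 2 * (a ^+ 3 + b ^+ 3 + c ^+ 3).
  rewrite -subr_ge0 (_ : _ - _ = (a + b + c) * ((a - b) ^+ 2 + (b - c) ^+ 2 + (c - a) ^+ 2)); last by ring.
  by apply: mulr_ge0; rewrite !addr_ge0// sqr_ge0.
have := ineq a b a0 b0; have := ineq b c b0 c0; have := ineq a c a0 c0.
rewrite (_ : (a + b + c) ^+ 3 = a ^+ 3 + b ^+ 3 + c ^+ 3 + 3 * (a ^+ 2 * b + a * b ^+ 2)
  + 3 * (b ^+ 2 * c + b * c ^+ 2) + 3 * (a ^+ 2 * c + a * c ^+ 2) + 6 * (a * b * c)); last by ring.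
lra.
Qed.

(** The translation is made along one axis after the other; the constant is
    [(a + b + c)^3 <= 9 (a^3 + b^3 + c^3)]. *)
Lemma int3_delta f gx gy gz xi :
  weak_partial (ex R) f gx -> weak_partial (ey R) f gy -> weak_partial (ez R) f gz ->
  (int3 (fun X => (f (X + xi) - f X)%R) <=
   (9 * n1 xi ^+ 3)%:E * (int3 gx + int3 gy + int3 gz))%E.
Proof.
move=> Wx Wy Wz; have [[[Lf Lx _] [_ Ly _]] [_ Lz _]] := (Wx, Wy, Wz).
have mf := torus_L1_measurable Lf.
case: xi => -[a b] c.
have E X : X + (a, b, c) = X + a *: ex R + b *: ey R + c *: ez R.
  by rewrite scale_ezE scale_eyE scale_exE; case: X => -[].
have Dx := int3_differenceN a Lf Lx (fun s s0 => weak_difference_x s0 Wx).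
have Dy := int3_differenceN b Lf Ly (fun s s0 => weak_difference_y s0 Wy).
have Dz := int3_differenceN c Lf Lz (fun s s0 => weak_difference_z s0 Wz).
have Lh d := torus_L1_shift d Lf.
pose fy X := f (X + a *: ex R + b *: ey R) - f (X + a *: ex R).
pose fz X := f (X + a *: ex R + b *: ey R + c *: ez R) - f (X + a *: ex R + b *: ey R).
have Ey : int3 fy = int3 (fun X => f (X + b *: ey R) - f X).
  rewrite -(@int3_shift (fun X => f (X + b *: ey R) - f X) (a *: ex R))//.
  exact: (torus_L1D (Lh _) (torus_L1N Lf)).
have Ez : int3 fz = int3 (fun X => f (X + c *: ez R) - f X).
  rewrite -(@int3_shift (fun X => f (X + c *: ez R) - f X) (a *: ex R + b *: ey R)).
    by rewrite /fz; congr int3; apply/funext => X; rewrite addrA.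
  exact: (torus_L1D (Lh _) (torus_L1N Lf)).
have ms d : measurable_fun setT (fun X : V => f ((X : vec3) + d)) by exact: measurable_shiftV.
apply: (@le_trans _ _ (9%:E * (int3 (fun X => (f (X + a *: ex R) - f X)%R) + int3 fy + int3 fz))%E).
  apply: int3_add.
  - exact: measurable_funB.
  - apply: measurable_funB => //; rewrite (_ : (fun X => _) = fun X => f (X + (a *: ex R + b *: ey R)))//.
    by apply/funext => X; rewrite addrA.
  - apply: measurable_funB => //.
      rewrite (_ : (fun X => _) = fun X => f (X + (a *: ex R + b *: ey R + c *: ez R)))//.
      by apply/funext => X; rewrite !addrA.
    rewrite (_ : (fun X => _) = fun X => f (X + (a *: ex R + b *: ey R)))//.
    by apply/funext => X; rewrite addrA.
  - move=> X; rewrite E /fy /fz; apply: le_trans (lerD (ler_normD _ _) (lexx _)).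
    apply: le_trans (ler_normD _ _); rewrite le_eqVlt; apply/orP; left; apply/eqP.
    by congr `|_|; ring.
  - exact: measurable_funB.
have i0 (l : vec3 -> R) : (0 <= int3 l)%E by apply: integral_ge0 => X _; rewrite lee_fin exprn_ge0.
rewrite EFinM -muleA lee_pmul2l//.
rewrite (ge0_muleDr _ (adde_ge0 (i0 gx) (i0 gy)) (i0 gz)) (ge0_muleDr _ (i0 gx) (i0 gy)).
have P t (l : vec3 -> R) : t <= n1 (a, b, c) -> 0 <= t ->
    ((t ^+ 3)%:E * int3 l <= (n1 (a, b, c) ^+ 3)%:E * int3 l)%E.
  by move=> tn t0; rewrite lee_wpmul2r// lee_fin lerXn2r// nnegrE// n1_ge0.
have [[na nb] nc] := (normr_ge0 a, normr_ge0 b, normr_ge0 c).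
apply: leeD; first apply: leeD.
- by apply: (le_trans Dx); apply: P => //; rewrite /n1/=; lra.
- by rewrite Ey; apply: (le_trans Dy); apply: P => //; rewrite /n1/=; lra.
- by rewrite Ez; apply: (le_trans Dz); apply: P => //; rewrite /n1/=; lra.
Qed.

End Cubes.

(** * The vertical velocity *)

Section Vertical.
Variable R : realType.
Local Notation B := (measurableTypeR R).
Local Notation V := (B * B * B)%type.
Local Notation leb1 := (leb1 R).
Local Notation leb2 := (leb2 R).
Local Notation leb3 := (leb3 R).
Local Notation Q := (@cube R).
Local Notation vec3 := (vec3 R).
Local Notation sq := (`[0, 1]%classic `*` `[0, 1]%classic : set (B * B)%type).
Implicit Types f g h : vec3 -> R.

Lemma ae_section (P : V -> Prop) : {ae leb3, forall X, P X} ->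
  {ae leb2, forall xy, {ae leb1, forall z, P (xy, z)}}.
Proof.
move=> [N [mN N0 sN]].
have mx : measurable_fun setT (leb1 \o xsection N : B * B -> \bar R).
  exact: measurable_fun_xsection.
have : (\int[leb2]_x `|(leb1 \o xsection N) x| = 0)%E.
  by under eq_integral do rewrite gee0_abs//.
move=> /(ae_eq_integral_abs leb2 measurableT mx).
apply: ae_imp => xy H; exists (xsection N xy); split.
- exact: measurable_xsection.
- exact: H.
- by move=> z /= nz; rewrite /xsection /= inE; exact: sN.
Qed.

Lemma continuous_ae_le (phi : R -> R) (c : R) : continuous phi ->
  {ae leb1, forall z, 0 <= z <= 1 -> phi z <= c} -> phi 0 <= c.
Proof.
move=> cphi [N [mN N0 sN]]; rewrite leNgt; apply/negP => c0.
have := cphi 0; move=> /(@cvgr_gt _ _ _ _ _ _)/(_ _ c0) [e /= e0 He].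
pose k := Num.min (e / 2) 1.
have k0 : 0 < k by rewrite /k lt_min ltr01 divr_gt0.
have : (leb1 `[0%R, k]%classic <= leb1 N)%E.
  apply: le_measure; rewrite ?inE; [exact: measurable_itvB|exact: mN|].
  move=> z /=; rewrite in_itv/= => /andP[z0 zk]; apply: sN => /= H.
  have [zk1 zk2] : z <= e / 2 /\ z <= 1 by move: zk; rewrite /k le_min => /andP.
  have : phi z <= c by apply: H; rewrite z0.
  apply/negP; rewrite -ltNge; apply: He; rewrite /= sub0r normrN ger0_norm//.
  by apply: le_lt_trans zk1 _; rewrite ltr_pdivrMr// ltr_pMr// ltr1n.
rewrite N0 [X in (X <= _)%E](leb1_itv0 (ltW k0)) => H.
by move: H; rewrite lee_fin leNgt k0.
Qed.

Variables h d : vec3 -> R.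
Hypothesis hd : weak_partial (ez R) h (\- d).
Hypothesis trace : {ae leb2, forall xy,
  continuous (fun z : R => h (xy, z)) /\ h (xy, 0) = 0}.

Let Lh : torus_L1 h. Proof. by case: hd. Qed.
Let Ld : torus_L1 d.
Proof.
case: hd => _ /torus_L1N + _.
by rewrite [X in torus_L1 X](_ : _ = d)//; apply/funext => X /=; rewrite opprK.
Qed.
Let mh := torus_L1_measurable Lh.
Let md := torus_L1_measurable Ld.

(** Vertical differences of [h] are controlled by [d] on almost every line. The
    trace at height zero is recovered from almost every starting height, since
    [h] is continuous on almost every vertical line. *)
Lemma vertical_bound (s : R) : 0 <= s <= 1 -> {ae leb2, forall xy, sq xy ->
  ((`|h (xy, s)|)%:E <= \int[leb1]_(r in `[0%R, 1%R]) (`|d (xy, r)|)%:E)%E}.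
Proof.
move=> /andP[s0 s1].
apply: ae_imp2 (ae_section (weak_difference_z s0 hd)) trace => xy Hz [ch h0] sqxy.
set D := (\int[leb1]_(r in `[0%R, 1%R]) (`|d (xy, r)|)%:E)%E.
have mdr : measurable_fun setT (fun r : B => (`|d (xy, r)|)%:E).
  apply/measurable_EFinP; apply: measurableT_comp => //.
  exact: (measurableT_comp md (pair1_measurable xy)).
have Dle z : ((\int[leb1]_(r in `[0%R, s]) (`|(\- d) ((xy, z) + r *: ez R)%R|)%:E)%E <= D)%E.
  rewrite (_ : integral _ _ _ = \int[leb1]_(r in `[0%R, s]) (`|d (xy, (r + z)%R)|)%:E)%E; last first.
    by apply: eq_integral => r _; rewrite scale_ezE /= normrN addrC; case: (xy).
  have ms : measurable_fun setT (fun r : B => (`|d (xy, (r + z)%R)|)%:E).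
    by apply: measurableT_comp mdr _; exact: measurable_funD.
  apply: (@le_trans _ _ (\int[leb1]_(r in `[0%R, 1%R]) (`|d (xy, (r + z)%R)|)%:E)%E).
    apply: ge0_subset_integral => //.
    - exact: measurable_funTS.
    - by apply: subset_itvl; rewrite bnd_simp.
  rewrite (@integral_periodic_shift R z (fun r => (`|d (xy, r)|)%:E))// => r.
  by case: xy {sqxy D mdr ms Hz ch h0} => x y; have [_ _] := Ld.1 (x, y, r);
    rewrite /ez addVE !addr0 => ->.
have [Dy|Dfin] := eqVneq D +oo%E; first by rewrite Dy leey.
have DE : D = (fine D)%:E.
  by rewrite fineK// ge0_fin_numE ?lt_neqAle ?Dfin ?leey//; exact: integral_ge0.
rewrite DE lee_fin.
have : (fun z => `|h (xy, z + s) - h (xy, z)|) 0 <= fine D.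
  apply: (@continuous_ae_le (fun z => `|h (xy, z + s) - h (xy, z)|)).
    move=> z; apply: cvg_norm; apply: cvgB; last exact: ch.
    apply: (continuous_comp (f := fun z : R => z + s) (g := fun z => h (xy, z))); last exact: ch.
    by apply: cvgD; [exact: cvg_id|exact: cvg_cst].
  apply: ae_imp Hz => z Hz z01.
  have QX : Q (xy, z) by split => //=; rewrite in_itv.
  have := le_trans (Hz QX) (Dle z).
  by rewrite DE lee_fin scale_ezE /=; case: (xy).
by rewrite add0r h0 subr0.
Qed.

Definition intp (q : nat) (g : vec3 -> R) : \bar R := \int[leb3]_(X in Q) (`|g X| ^+ q)%:E.

(** Integrate the preceding bound over the horizontal variables at every fixed
    height; the hypothesis is the inequality of Jensen for the power [q]. *)
Lemma vertical_intp (q : nat) :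
  (forall (k : B -> R) (a : R), 0 <= a -> measurable_fun setT k -> (forall r, 0 <= k r) ->
    (a%:E <= \int[leb1]_(r in `[0%R, 1%R]) (k r)%:E)%E ->
    ((a ^+ q)%:E <= \int[leb1]_(r in `[0%R, 1%R]) (k r ^+ q)%:E)%E) ->
  (intp q h <= intp q d)%E.
Proof.
move=> jensen.
have mI : measurable (`[0, 1]%classic : set B) by exact: measurable_itvB.
have mS : measurable sq by exact: measurable_square.
have mq (g : vec3 -> R) : measurable_fun setT (g : V -> R) ->
    measurable_fun setT (fun X : V => (`|g X| ^+ q)%:E).
  by move=> mg; apply/measurable_EFinP/measurable_funX/measurableT_comp.
have q0 (g : vec3 -> R) X : (0 <= (`|g X| ^+ q)%:E)%E by rewrite lee_fin exprn_ge0.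
have mD := @measurable_tonelli1 _ _ _ _ _ leb1 _ mI _ (mq _ md) (q0 d).
rewrite {1}/intp (@tonelli_prod2 _ _ _ _ _ (sleb2 R) leb1 _ _ mS mI _ (mq _ mh) (q0 h)).
have -> : intp q d = (\int[leb1]_(s in `[0%R, 1%R]) intp q d)%E.
  by rewrite integral_cst// [X in (_ * X)%E](leb1_itv0 ler01) mule1.
apply: ge0_le_integral => //.
- by move=> s _; apply: integral_ge0.
- apply: measurable_funTS.
  exact: (@measurable_tonelli2 _ _ _ _ _ (sleb2 R) _ mS _ (mq _ mh) (q0 h)).
- move=> s; rewrite /= in_itv/= => s01.
  rewrite /intp (@tonelli_prod1 _ _ _ _ _ (sleb2 R) leb1 _ _ mS mI _ (mq _ md) (q0 d)).
  apply: ae_ge0_le_integral => //.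
  + apply: measurable_funTS.
    exact: (measurableT_comp (mq _ mh) (pair2_measurable s)).
  + by move=> xy _; exact: integral_ge0.
  + exact: measurable_funTS.
  + apply: ae_imp (vertical_bound s01) => xy H sqxy.
    apply: (jensen (fun r => `|d (xy, r)|)) => //; last exact: H.
    apply: measurableT_comp => //.
    exact: (measurableT_comp md (pair1_measurable xy)).
Qed.

Lemma vertical_int1 : (intp 1 h <= intp 1 d)%E.
Proof. exact: vertical_intp. Qed.

Lemma vertical_int3 : (intp 3 h <= intp 3 d)%E.
Proof.
apply: vertical_intp => k a a0 mk k0 /(jensen_cube ler01 a0 mk k0).
by rewrite expr1n mul1e.
Qed.

End Vertical.

(** * The regularity of the velocity at a fixed time *)

Section Slices.
Variable R : realType.
Local Notation B := (measurableTypeR R).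
Local Notation V := (B * B * B)%type.
Local Notation leb1 := (leb1 R).
Local Notation leb2 := (leb2 R).
Local Notation leb3 := (leb3 R).
Local Notation Q := (@cube R).
Local Notation vec3 := (vec3 R).
Implicit Types f g h u v w : vec3 -> R.

Let mQ : measurable (Q : set V) := @measurable_cube R.

Lemma leb3_cube : leb3 Q = 1%E.
Proof.
rewrite [LHS]leb3_box; rewrite /Defs.leb1 /= !lebesgue_measure_itv/= !lte_fin ltr01.
by rewrite !oppr0 !adde0 !mule1.
Qed.

Lemma integral_cube_cst (c : R) : (\int[leb3]_(X in Q) c%:E = c%:E)%E.
Proof. by rewrite integral_cst// [X in (_ * X)%E]leb3_cube mule1. Qed.

Lemma measurable_normX q g : measurable_fun setT (g : V -> R) ->
  measurable_fun Q (fun X : V => (`|g X| ^+ q)%:E).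
Proof. by move=> mg; apply/measurable_funTS/measurable_EFinP/measurable_funX/measurableT_comp. Qed.

(** Since the cube has measure one, [|g/c|^q <= 1 + |g/c|^p] controls the
    integral of the [q]-th power by the norm of exponent [p > q]. *)
Lemma Lnorm_intp (q : nat) (p : \bar R) (c : R) g : (0 < q)%N ->
  (q%:R%:E < p)%E -> 0 < c -> torus_L1 g -> (torus_Lnorm p g <= c%:E)%E ->
  (intp q g <= (2 * c ^+ q)%:E)%E.
Proof.
move=> q0 qp c0 Lg; have mg := torus_L1_measurable Lg.
have mgQ : measurable_fun setT (g \_ Q : V -> R).
  by apply/(measurable_restrictT _ mQ); exact: measurable_funTS.
rewrite /torus_Lnorm; case: p qp => [r|_|//]; last first.
  rewrite unlock; case: ifPn => [_|]; last first.
    move=> /negP[]; apply: (@lt_le_trans _ _ (leb3 Q)); first by rewrite leb3_cube.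
    by apply: le_measure; rewrite ?inE.
  move=> /ess_supP H.
  apply: (@le_trans _ _ (\int[leb3]_(X in Q) (c ^+ q)%:E)%E).
    apply: ae_ge0_le_integral => //.
    - exact: measurable_normX.
    - by move=> X _; rewrite lee_fin exprn_ge0// ltW.
    - apply: ae_imp H => X; rewrite /= => H QX; move: H; rewrite patchE mem_set// lee_fin => H.
      by rewrite lee_fin lerXn2r// nnegrE// ltW.
  rewrite integral_cube_cst lee_fin; have := exprn_ge0 q (ltW c0); lra.
rewrite lte_fin => qr H; have r0 : 0 < r by apply: lt_trans qr; rewrite ltr0n.
have : ('N[leb3]_r%:E[EFin \o g \_ Q] `^ r <= c%:E `^ r)%E.
  by apply: gt0_ler_poweR => //; rewrite ?in_itv/= ?Lnorm_ge0 ?lee_fin ?leey// ltW.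
rewrite poweR_Lnorm ?gt_eqF// poweR_EFin => {}H.
have mr : measurable_fun setT (fun X : V => (`|g X| `^ r)%:E).
  by apply/measurable_EFinP; apply: (measurableT_comp (measurable_powR r)); exact: measurableT_comp.
have {}H : (\int[leb3]_(X in Q) (`|g X| `^ r)%:E <= (c `^ r)%:E)%E.
  apply: le_trans H; rewrite [X in (X <= _)%E]integral_mkcond le_eqVlt; apply/orP; left; apply/eqP.
  apply: eq_integral => X _; rewrite [LHS]patchE /= patchE; case: ifP => //= _.
  by rewrite normr0 powR0// gt_eqF.
have cr0 : 0 < c `^ r by exact: powR_gt0.
apply: (@le_trans _ _ (\int[leb3]_(X in Q)
   ((c ^+ q)%:E + (c ^+ q / c `^ r)%:E * (`|g X| `^ r)%:E))%E).
  apply: ge0_le_integral => //.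
  - exact: measurable_normX.
  - apply: emeasurable_funD => //; apply: measurable_funeM; exact: measurable_funTS.
  - move=> X _; rewrite -EFinM -EFinD lee_fin.
    have [gc|cg] := leP `|g X| c.
      apply: (@le_trans _ _ (c ^+ q)); first by rewrite lerXn2r// nnegrE// ltW.
      by rewrite lerDl !mulr_ge0 ?exprn_ge0 ?invr_ge0 ?powR_ge0// ltW.
    have g0 : 0 < `|g X| by exact: lt_trans cg.
    apply: (@le_trans _ _ (c ^+ q / c `^ r * `|g X| `^ r)); last first.
      by rewrite lerDr exprn_ge0// ltW.
    have [t t1 ->] : exists2 t, 1 <= t & `|g X| = t * c.
      by exists (`|g X| / c); [rewrite ler_pdivlMr// mul1r ltW|rewrite divfK// gt_eqF].
    have t0 : 0 <= t by apply: le_trans t1.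
    rewrite (powRM _ t0 (ltW c0)) exprMn mulrC -mulrA ler_pM2l ?exprn_gt0//.
    rewrite mulrCA mulVf ?mulr1 ?gt_eqF// -powR_mulrn//.
    by apply: ler_powR => //; exact: ltW.
rewrite ge0_integralD//; last 3 first.
- by move=> X _; rewrite lee_fin exprn_ge0// ltW.
- by move=> X _; rewrite mule_ge0// lee_fin ?powR_ge0// divr_ge0 ?exprn_ge0 ?powR_ge0// ltW.
- by apply: measurable_funeM; exact: measurable_funTS.
rewrite integral_cube_cst ge0_integralZl//; last 2 first.
- exact: measurable_funTS.
- by rewrite lee_fin divr_ge0 ?exprn_ge0 ?powR_ge0// ltW.
rewrite mulr_natl mulr2n EFinD; apply: leeD => //.
have k0 : (0 <= (c ^+ q / c `^ r)%:E)%E by rewrite lee_fin divr_ge0 ?exprn_ge0 ?powR_ge0// ltW.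
apply: le_trans (lee_wpmul2l k0 H) _.
by rewrite -EFinM lee_fin divfK// gt_eqF.
Qed.

(** The norms and the divergence each come with their own weak derivatives; the
    bounds on the former are wanted for the latter. *)
Lemma weak_partial_unique e f g g' :
  weak_partial e f g -> weak_partial e f g' ->
  {ae leb3, forall X, Q X -> g X = g' X}.
Proof.
move=> [_ Lg W] [_ Lg' W'].
have Lh := torus_L1D Lg (torus_L1N Lg').
have : {ae leb3, forall X, Q X -> (g \+ (\- g')) X = 0}.
  apply: (torus_unique Lh.2) => a b c sa sb sc pa pb pc.
  have st := smooth_tensor sa sb sc; have pt := torus_periodic_tensor pa pb pc.
  have ct := smooth_continuous st.
  transitivity (\int[leb3]_(X in Q) (g X * tensor a b c X - g' X * tensor a b c X)).
    by apply: eq_Rintegral => X _ /=; ring.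
  rewrite RintegralB//; [|exact: integrable_smooth_mul|exact: integrable_smooth_mul].
  by apply/eqP; rewrite subr_eq0; apply/eqP/oppr_inj; rewrite -W// -W'.
by apply: ae_imp => X H QX; have /eqP := H QX; rewrite /= subr_eq0 => /eqP.
Qed.

End Slices.

Section SliceReg.
Variable R : realType.
Local Notation B := (measurableTypeR R).
Local Notation V := (B * B * B)%type.
Local Notation leb1 := (leb1 R).
Local Notation leb2 := (leb2 R).
Local Notation leb3 := (leb3 R).
Local Notation Q := (@cube R).
Local Notation vec3 := (vec3 R).
Implicit Types f g h u v w : vec3 -> R.

Let mQ : measurable (Q : set V) := @measurable_cube R.

Definition weight u v w (X : vec3) : R := 1 + `|u X| + `|v X| + `|w X|.

Definition sqdiff u v (xi X : vec3) : R :=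
  (u (X + xi) - u X) ^+ 2 + (v (X + xi) - v X) ^+ 2.

(** All that is used of the velocity at a given time: the increments of the
    horizontal velocity are of order [gamma/2 > 1/2] in the mean, even against
    the weight of the vertical velocity, which is merely integrable. *)
Record slice_reg (gamma A : R) u v w : Prop := SliceReg {
  slice_mu : measurable_fun setT (u : V -> R);
  slice_mv : measurable_fun setT (v : V -> R);
  slice_mw : measurable_fun setT (w : V -> R);
  slice_pu : torus_periodic u;
  slice_pv : torus_periodic v;
  slice_pw : torus_periodic w;
  slice_int : (\int[leb3]_(X in Q)
    ((1 + u X ^+ 2 + v X ^+ 2) * weight u v w X)%:E <= A%:E)%E;
  slice_diff : forall xi, (\int[leb3]_(X in Q)
    (sqdiff u v xi X * weight u v w X)%:E <= (A * n1 xi `^ gamma)%:E)%E;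
  slice_div : forall a b c, smooth1 a -> smooth1 b -> smooth1 c ->
    per1 a -> per1 b -> per1 c ->
    \int[leb3]_(X in Q) (u X * tensor (derive1 a) b c X +
      v X * tensor a (derive1 b) c X + w X * tensor a b (derive1 c) X) = 0 }.

Lemma W1_grad (p : \bar R) (q : nat) (c : R) f : (0 < q)%N -> (q%:R%:E < p)%E -> 0 < c ->
  (W1_norm p f < c%:E)%E -> exists gx gy gz,
    [/\ weak_partial (ex R) f gx, weak_partial (ey R) f gy & weak_partial (ez R) f gz] /\
    [/\ (intp q f <= (2 * c ^+ q)%:E)%E, (intp q gx <= (2 * c ^+ q)%:E)%E,
      (intp q gy <= (2 * c ^+ q)%:E)%E & (intp q gz <= (2 * c ^+ q)%:E)%E].
Proof.
move=> q0 qp c0 /ereal_inf_lt[_ [gx [gy [gz [Wx Wy Wz ->]]]] H].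
have [[[Lf Lx _] [_ Ly _]] [_ Lz _]] := (Wx, Wy, Wz).
exists gx, gy, gz; split => //.
have N0 g : (0 <= torus_Lnorm p g)%E by exact: Lnorm_ge0.
have := ltW H.
move: (N0 f) (N0 gx) (N0 gy) (N0 gz) => n0 n1 n2 n3 {}H.
split; apply: (Lnorm_intp (p := p)) => //; apply: (le_trans _ H).
- by rewrite -!addeA leeDl// !adde_ge0.
- by apply: (le_trans _ (leeDl _ n3)); apply: (le_trans _ (leeDl _ n2)); exact: leeDr.
- by apply: (le_trans _ (leeDl _ n3)); exact: (leeDr _ (adde_ge0 n0 n1)).
- exact: (leeDr _ (adde_ge0 (adde_ge0 n0 n1) n2)).
Qed.

Lemma intp1_add (f g h : vec3 -> R) : measurable_fun setT (g : V -> R) ->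
  measurable_fun setT (h : V -> R) -> (forall X, `|f X| <= `|g X| + `|h X|) ->
  measurable_fun setT (f : V -> R) -> (intp 1 f <= intp 1 g + intp 1 h)%E.
Proof.
move=> mg mh H mf; rewrite /intp -ge0_integralD//; [|exact: measurable_normX|exact: measurable_normX].
apply: ge0_le_integral => //; first exact: measurable_normX.
  by apply: emeasurable_funD; exact: measurable_normX.
by move=> X _; rewrite -EFinD lee_fin !expr1.
Qed.

Lemma intp_ae q g g' : torus_L1 g -> torus_L1 g' ->
  {ae leb3, forall X, Q X -> g X = g' X} -> intp q g = intp q g'.
Proof.
move=> Lg Lg' H; apply: ae_eq_integral => //.
- by apply: measurable_normX; exact: torus_L1_measurable.
- by apply: measurable_normX; exact: torus_L1_measurable.
- by apply: ae_imp H => X H QX; rewrite H.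
Qed.

(** The vertical velocity is bounded by its vertical derivative, which is minus
    the horizontal divergence. *)
Lemma vertical_intp_grad u v w gx gy : vertical_velocity u v w ->
  weak_partial (ex R) u gx -> weak_partial (ey R) v gy ->
  (intp 1 w <= intp 1 gx + intp 1 gy)%E /\
  (intp 3 w <= 9%:E * (intp 3 gx + intp 3 gy))%E.
Proof.
move=> [[d [gx' [gy' [Wx' Wy' dE]]] Ww] tr] Wx Wy.
have [_ Lx _] := Wx; have [_ Ly _] := Wy; have [_ Lx' _] := Wx'; have [_ Ly' _] := Wy'.
have mx := torus_L1_measurable Lx'; have my := torus_L1_measurable Ly'.
have Ex q := intp_ae q Lx' Lx (weak_partial_unique Wx' Wx).
have Ey q := intp_ae q Ly' Ly (weak_partial_unique Wy' Wy).
have md : measurable_fun setT (d : V -> R) by rewrite dE; exact: measurable_funD.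
split.
  apply: le_trans (vertical_int1 Ww tr) _; rewrite -Ex -Ey; apply: intp1_add => //.
  by move=> X; rewrite dE ler_normD.
apply: le_trans (vertical_int3 Ww tr) _; rewrite -Ex -Ey.
have := @int3_add R d gx' gy' (fun=> 0) mx my (measurable_cst _) _ md.
rewrite [int3 (fun=> 0)](_ : _ = 0%E) ?adde0; first by apply => X; rewrite dE normr0 addr0 ler_normD.
by rewrite /int3; under eq_integral do rewrite normr0 expr0n/=; rewrite integral0.
Qed.

Lemma weak_partial_tensor f g a b c : smooth1 a -> smooth1 b -> smooth1 c ->
  per1 a -> per1 b -> per1 c ->
  [/\ weak_partial (ex R) f g -> \int[leb3]_(X in Q) (f X * tensor (derive1 a) b c X) =
      - \int[leb3]_(X in Q) (g X * tensor a b c X),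
    weak_partial (ey R) f g -> \int[leb3]_(X in Q) (f X * tensor a (derive1 b) c X) =
      - \int[leb3]_(X in Q) (g X * tensor a b c X) &
    weak_partial (ez R) f g -> \int[leb3]_(X in Q) (f X * tensor a b (derive1 c) X) =
      - \int[leb3]_(X in Q) (g X * tensor a b c X)].
Proof.
move=> sa sb sc pa pb pc.
have st := smooth_tensor sa sb sc; have pt := torus_periodic_tensor pa pb pc.
split=> -[_ _ E]; rewrite -(E _ st pt); apply: eq_Rintegral => X _; congr (_ * _).
- exact/esym/(congr1 (fun F => F X) (derive_tensor_ex sa sb sc)).
- exact/esym/(congr1 (fun F => F X) (derive_tensor_ey sa sb sc)).
- exact/esym/(congr1 (fun F => F X) (derive_tensor_ez sa sb sc)).
Qed.

Section Assemble.
Variables (u v w ux uy uz vx vy vz : vec3 -> R).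
Hypotheses (Wux : weak_partial (ex R) u ux) (Wuy : weak_partial (ey R) u uy)
  (Wuz : weak_partial (ez R) u uz) (Wvx : weak_partial (ex R) v vx)
  (Wvy : weak_partial (ey R) v vy) (Wvz : weak_partial (ez R) v vz).
Hypothesis hw : vertical_velocity u v w.

Let Lu : torus_L1 u. Proof. by case: Wux. Qed.
Let Lv : torus_L1 v. Proof. by case: Wvx. Qed.
Let Lw : torus_L1 w. Proof. by case: hw => -[d _ []]. Qed.
Let mu := torus_L1_measurable Lu.
Let mv := torus_L1_measurable Lv.
Let mw := torus_L1_measurable Lw.

(** The vertical derivative of [w] is minus the divergence of [(u, v)], so the
    velocity is divergence-free against all test functions. *)
Lemma assemble_div a b c : smooth1 a -> smooth1 b -> smooth1 c ->
  per1 a -> per1 b -> per1 c ->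
  \int[leb3]_(X in Q) (u X * tensor (derive1 a) b c X +
    v X * tensor a (derive1 b) c X + w X * tensor a b (derive1 c) X) = 0.
Proof.
move=> sa sb sc pa pb pc; case: hw => -[d [gx [gy [Wx Wy dE]]] Ww] _.
have st := smooth_tensor sa sb sc; have pt := torus_periodic_tensor pa pb pc.
have ct := smooth_continuous st.
have [ca cb cc] : [/\ smooth1 (derive1 a), smooth1 (derive1 b) & smooth1 (derive1 c)].
  by split; exact: smooth1_derive1.
have i1 : leb3.-integrable Q (fun X => (u X * tensor (derive1 a) b c X)%:E).
  by apply: integrable_smooth_mul => //; exact/smooth_continuous/smooth_tensor.
have i2 : leb3.-integrable Q (fun X => (v X * tensor a (derive1 b) c X)%:E).
  by apply: integrable_smooth_mul => //; exact/smooth_continuous/smooth_tensor.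
have i3 : leb3.-integrable Q (fun X => (w X * tensor a b (derive1 c) X)%:E).
  by apply: integrable_smooth_mul => //; exact/smooth_continuous/smooth_tensor.
rewrite RintegralD//; last exact: (integrableD mQ i1 i2).
rewrite RintegralD//.
have [_ Lx Ex] := Wx; have [_ Ly Ey] := Wy; have [_ Ld Ez] := Ww.
have [E _ _] := weak_partial_tensor u gx sa sb sc pa pb pc; rewrite (E Wx) {E}.
have [_ E _] := weak_partial_tensor v gy sa sb sc pa pb pc; rewrite (E Wy) {E}.
have [_ _ E] := weak_partial_tensor w (\- d) sa sb sc pa pb pc; rewrite (E Ww) {E}.
have -> : \int[leb3]_(X in Q) ((\- d) X * tensor a b c X) =
   - (\int[leb3]_(X in Q) (gx X * tensor a b c X)) - (\int[leb3]_(X in Q) (gy X * tensor a b c X)).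
  rewrite -opprD -RintegralD//; [|exact: integrable_smooth_mul|exact: integrable_smooth_mul].
  rewrite -[RHS]mulN1r -RintegralZl//.
    by apply: eq_Rintegral => X _; rewrite dE /=; ring.
  exact: (integrableD mQ (integrable_smooth_mul Lx ct) (integrable_smooth_mul Ly ct)).
by rewrite opprD !opprK; ring.
Qed.

End Assemble.
End SliceReg.

Section SliceRegCases.
Variable R : realType.
Local Notation B := (measurableTypeR R).
Local Notation V := (B * B * B)%type.
Local Notation leb1 := (leb1 R).
Local Notation leb3 := (leb3 R).
Local Notation Q := (@cube R).
Local Notation vec3 := (vec3 R).
Implicit Types f g h u v w : vec3 -> R.

Let mQ : measurable (Q : set V) := @measurable_cube R.

Lemma enorm_le_n1 (X : vec3) : enorm X <= n1 X.
Proof.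
rewrite -[leRHS]ger0_norm ?n1_ge0// -sqrtr_sqr ler_wsqrtr//.
have := normr_ge0 X.1.1; have := normr_ge0 X.1.2; have := normr_ge0 X.2.
rewrite -(real_normK (num_real X.1.1)) -(real_normK (num_real X.1.2)) -(real_normK (num_real X.2)).
rewrite /n1; move: (`|X.1.1|) (`|X.1.2|) (`|X.2|) => a b c c0 b0 a0.
have := mulr_ge0 a0 b0; have := mulr_ge0 a0 c0; have := mulr_ge0 b0 c0; nra.
Qed.

Lemma enorm_eq0 (X : vec3) : enorm X = 0 -> X = 0.
Proof.
case: X => -[x y] z /eqP; rewrite /enorm sqrtr_eq0 /= => h.
have x0 : x ^+ 2 <= 0 by apply: le_trans h; rewrite -addrA lerDl addr_ge0 ?sqr_ge0.
have y0 : y ^+ 2 <= 0 by apply: le_trans h; rewrite addrAC lerDr addr_ge0 ?sqr_ge0.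
have z0 : z ^+ 2 <= 0 by apply: le_trans h; rewrite lerDr addr_ge0 ?sqr_ge0.
have sq0 t : t ^+ 2 <= 0 -> t = 0 :> R.
  by move=> t0; apply/eqP; rewrite -sqrf_eq0 eq_le t0 sqr_ge0.
by rewrite (sq0 _ x0) (sq0 _ y0) (sq0 _ z0).
Qed.

(** Exponents above [2] would not help, so for [beta > 1] it is enough to weaken the
    bound to a linear one for small increments and to use [2c] for large ones. *)
Lemma holder_bound (beta c : R) f : 1 / 2 < beta -> (holder_norm beta f <= c%:E)%E ->
  (forall X, `|f X| <= c) /\
  forall X xi, (f (X + xi) - f X) ^+ 2 <= 4 * c ^+ 2 * n1 xi `^ Num.min (2 * beta) 2.
Proof.
move=> b2 H.
have S0 : (0 <= ereal_sup [set (`|f X|)%:E | X in [set: vec3]])%E.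
  by apply: le_trans (ereal_sup_ubound _); last by exists 0.
have neq : ((1, 0, 0) : vec3) <> 0 by move=> [] /eqP; rewrite oner_eq0.
have enn (X : vec3) : 0 <= enorm X `^ beta by exact: powR_ge0.
have H0 : (0 <= ereal_sup [set r | exists X Y : vec3,
     X <> Y /\ r = (`|f X - f Y| / (enorm (X - Y) `^ beta))%:E])%E.
  apply: le_trans (ereal_sup_ubound _); last by exists (1, 0, 0), 0; split.
  by rewrite lee_fin divr_ge0.
have sup X : `|f X| <= c.
  rewrite -lee_fin; apply: (le_trans _ H); apply: (le_trans _ (leeDl _ H0)).
  by apply: ereal_sup_ubound; exists X.
have c0 : 0 <= c by exact: le_trans (sup 0).
split => // X xi.
have [->|xi0] := eqVneq xi 0.
  by rewrite addr0 subrr expr0n/= !mulr_ge0// ?sqr_ge0 ?powR_ge0.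
have e0 : 0 < enorm xi.
  by rewrite lt_neqAle sqrtr_ge0 andbT eq_sym; apply: contra_neq xi0; exact: enorm_eq0.
have n0 : 0 < n1 xi := lt_le_trans e0 (enorm_le_n1 xi).
have hol : `|f (X + xi) - f X| <= c * n1 xi `^ beta.
  apply: (@le_trans _ _ (c * enorm xi `^ beta)); last first.
    rewrite ler_wpM2l// ge0_ler_powR ?nnegrE ?enorm_le_n1 ?n1_ge0 ?sqrtr_ge0//; lra.
  rewrite -ler_pdivrMr ?powR_gt0// -lee_fin; apply: (le_trans _ H).
  apply: (le_trans _ (leeDr _ S0)); apply: ereal_sup_ubound; exists (X + xi), X.
  split; last by rewrite addrAC subrr add0r.
  by move=> /eqP; rewrite -[X in _ == X]addr0 (inj_eq (addrI _)) (negbTE xi0).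
have sup2 : `|f (X + xi) - f X| <= 2 * c.
  by rewrite mulr_natl mulr2n (le_trans (ler_normB _ _))// lerD.
rewrite -(real_normK (num_real (f (X + xi) - f X))).
move: (`|f (X + xi) - f X|) (normr_ge0 (f (X + xi) - f X)) hol sup2 => r r0 h1 h2.
have p2 (t : R) : n1 xi `^ (2 * t) = (n1 xi `^ t) ^+ 2.
  by rewrite mulrC powRrM powR_mulrn// powR_ge0.
have bnd (k : R) : 0 <= k -> r <= c * k -> r ^+ 2 <= 4 * c ^+ 2 * k ^+ 2.
  move=> k0 rk; apply: (@le_trans _ _ ((c * k) ^+ 2)); first by rewrite lerXn2r// nnegrE mulr_ge0.
  by rewrite exprMn -mulrA ler_peMl ?mulr_ge0 ?sqr_ge0// ler1n.
have [b1|b1] := leP beta 1.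
  rewrite min_l; last lra.
  by rewrite p2; apply: bnd => //; exact: powR_ge0.
rewrite min_r; last lra.
rewrite (powR_mulrn 2) ?n1_ge0//.
have [n1'|n1'] := leP (n1 xi) 1.
  apply: bnd; first exact: n1_ge0; apply: (le_trans h1); rewrite ler_wpM2l//.
  rewrite -[leRHS]powRr1 ?n1_ge0//; apply: ger_powR; rewrite ?n0//.
  exact: ltW.
apply: (@le_trans _ _ ((2 * c) ^+ 2)); first by rewrite lerXn2r// nnegrE mulr_ge0.
rewrite exprMn (_ : 2 ^+ 2 = 4); last by rewrite -natrX.
by rewrite ler_peMr ?mulr_ge0 ?sqr_ge0// exprn_ege1// ltW.
Qed.

(** Young with the scale [l] of the increment as parameter: for increments of
    order [l] in [L^3] and a weight of order one, both terms are of order [l^2]. *)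
Lemma young_cube (a b l : R) : 0 <= a -> 0 <= b -> 0 < l ->
  a ^+ 2 * b <= l^-1 * a ^+ 3 + l ^+ 2 * b ^+ 3.
Proof.
move=> a0 b0 l0; have [ab|ab] := leP a (l * b).
  apply: (@le_trans _ _ (l ^+ 2 * b ^+ 3)).
    have lb0 : 0 <= l * b by rewrite mulr_ge0// ltW.
    by rewrite [b ^+ 3]exprSr mulrA ler_wpM2r// -exprMn lerXn2r.
  by rewrite lerDr mulr_ge0 ?invr_ge0 ?exprn_ge0// ltW.
apply: (@le_trans _ _ (l^-1 * a ^+ 3)); last first.
  by rewrite lerDl mulr_ge0 ?exprn_ge0// ltW.
by rewrite [a ^+ 3]exprSr mulrCA ler_wpM2l ?sqr_ge0// ler_pdivlMl// ltW.
Qed.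

Variables (u v w ux uy uz vx vy vz : vec3 -> R).
Hypotheses (Wux : weak_partial (ex R) u ux) (Wuy : weak_partial (ey R) u uy)
  (Wuz : weak_partial (ez R) u uz) (Wvx : weak_partial (ex R) v vx)
  (Wvy : weak_partial (ey R) v vy) (Wvz : weak_partial (ez R) v vz).
Hypothesis hw : vertical_velocity u v w.
Variable c : R.
Hypothesis c1 : 1 <= c.
Variable K : R.
(** An absolute constant that dominates all numerical factors below. *)
Hypothesis K2000 : 2000 <= K.

Let c0 : 0 <= c. Proof. exact: le_trans c1. Qed.
Let Lu : torus_L1 u. Proof. by case: Wux. Qed.
Let Lv : torus_L1 v. Proof. by case: Wvx. Qed.
Let Lw : torus_L1 w. Proof. by case: hw => -[d _ []]. Qed.
Let mu := torus_L1_measurable Lu.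
Let mv := torus_L1_measurable Lv.
Let mw := torus_L1_measurable Lw.

Let mW : measurable_fun setT (weight u v w : V -> R).
Proof.
by rewrite /weight; apply: measurable_funD; [apply: measurable_funD; [apply: measurable_funD|]|] => //;
  exact: measurableT_comp.
Qed.

Let W1 X : 1 <= weight u v w X.
Proof. by rewrite /weight -!addrA lerDl !addr_ge0. Qed.

Let W0 X : 0 <= weight u v w X. Proof. exact: le_trans (W1 X). Qed.

Let mS xi : measurable_fun setT (sqdiff u v xi : V -> R).
Proof.
by rewrite /sqdiff; apply: measurable_funD; apply: measurable_funX; apply: measurable_funB => //;
  exact: measurable_shiftV.
Qed.

Let S0 xi X : 0 <= sqdiff u v xi X. Proof. by rewrite /sqdiff addr_ge0 ?sqr_ge0. Qed.

Let mE : measurable_fun setT (fun X : V => 1 + u X ^+ 2 + v X ^+ 2).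
Proof. by apply: measurable_funD; [apply: measurable_funD|] => //; exact: measurable_funX. Qed.

Let finish gamma A :
  (\int[leb3]_(X in Q) ((1 + u X ^+ 2 + v X ^+ 2) * weight u v w X)%:E <= A%:E)%E ->
  (forall xi, \int[leb3]_(X in Q)
    (sqdiff u v xi X * weight u v w X)%:E <= (A * n1 xi `^ gamma)%:E)%E ->
  slice_reg gamma A u v w.
Proof.
move=> h1 h2; split => //; [by case: Lu|by case: Lv|by case: Lw|].
by move=> a b d sa sb sd pa pb pd; exact: (assemble_div Wux Wvx hw).
Qed.

(** Bounded gradients in [L^3] give increments of order [|xi|] in [L^3] and a
    vertical velocity in [L^3], so that Young gives the exponent [gamma = 2]. *)
Lemma slice_reg_sobolev :
  [/\ (intp 3 u <= (2 * c ^+ 3)%:E)%E, (intp 3 ux <= (2 * c ^+ 3)%:E)%E,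
      (intp 3 uy <= (2 * c ^+ 3)%:E)%E & (intp 3 uz <= (2 * c ^+ 3)%:E)%E] ->
  [/\ (intp 3 v <= (2 * c ^+ 3)%:E)%E, (intp 3 vx <= (2 * c ^+ 3)%:E)%E,
      (intp 3 vy <= (2 * c ^+ 3)%:E)%E & (intp 3 vz <= (2 * c ^+ 3)%:E)%E] ->
  slice_reg 2 (K * c ^+ 3) u v w.
Proof.
move=> [iu iux iuy iuz] [iv ivx ivy ivz].
have c3 : 1 <= c ^+ 3 by exact: exprn_ege1.
have iw : (intp 3 w <= (36 * c ^+ 3)%:E)%E.
  have [_ H] := vertical_intp_grad hw Wux Wvy; apply: (le_trans H).
  apply: (@le_trans _ _ (9%:E * ((2 * c ^+ 3)%:E + (2 * c ^+ 3)%:E))%E).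
    by apply: lee_wpmul2l => //; exact: leeD.
  by rewrite -EFinD -EFinM lee_fin; lra.
have int3_0 : int3 (fun=> 0 : R) = 0%E.
  by rewrite /int3; under eq_integral do rewrite normr0 expr0n/=; rewrite integral0.
have int3_1 : int3 (fun=> 1 : R) = 1%E.
  by rewrite /int3; under eq_integral do rewrite normr1 expr1n; rewrite integral_cube_cst.
have i1u : (int3 (fun X => (1 + `|u X|)%R) <= (27 * c ^+ 3)%:E)%E.
  apply: (le_trans (@int3_add R _ (fun=> 1) u (fun=> 0) _ _ _ _ _)) => //.
  - by move=> X; rewrite normr0 addr0 normr1 (le_trans (ler_normD _ _))// normr1 normr_id.
  - by apply: measurable_funD; [exact: measurable_cst|exact: measurableT_comp].
  rewrite int3_0 adde0 int3_1; apply: (@le_trans _ _ (9%:E * (1%:E + (2 * c ^+ 3)%:E))%E).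
    by apply: lee_wpmul2l => //; exact: leeD.
  by rewrite -EFinD -EFinM lee_fin; lra.
have iW : (int3 (weight u v w) <= (585 * c ^+ 3)%:E)%E.
  apply: (le_trans (@int3_add R _ (fun X => 1 + `|u X|) v w _ _ _ _ _)) => //.
  - by apply: measurable_funD; [exact: measurable_cst|exact: measurableT_comp].
  - move=> X; rewrite (ger0_norm (W0 X)).
    by rewrite [X in _ <= X + _ + _]ger0_norm ?addr_ge0// /weight.
  apply: (@le_trans _ _ (9%:E * ((27 * c ^+ 3)%:E + (2 * c ^+ 3)%:E + (36 * c ^+ 3)%:E))%E).
    by apply: lee_wpmul2l => //; apply: leeD => //; exact: leeD.
  by rewrite -!EFinD -EFinM lee_fin; lra.
apply: finish.
  apply: (@le_trans _ _ (int3 (weight u v w))); last first.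
    apply: (le_trans iW); rewrite lee_fin ler_wpM2r ?exprn_ge0//.
  by apply: le_trans K2000; rewrite ler_nat.
  apply: ge0_le_integral => //.
  - by move=> X _; rewrite lee_fin mulr_ge0// !addr_ge0// sqr_ge0.
  - by apply/measurable_funTS/measurable_EFinP/measurable_funM.
  - exact: measurable_normX.
  - move=> X _; rewrite lee_fin ger0_norm// [_ ^+ 3]exprSr ler_wpM2r//.
    rewrite -(real_normK (num_real (u X))) -(real_normK (num_real (v X))) /weight.
    have := normr_ge0 (u X); have := normr_ge0 (v X); have := normr_ge0 (w X).
    move: (`|u X|) (`|v X|) (`|w X|) => a b d d0 b0 a0.
    have := mulr_ge0 a0 b0; have := mulr_ge0 a0 d0; have := mulr_ge0 b0 d0.

    have := sqr_ge0 d; rewrite !expr2; nra.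
move=> xi; have [n0|n0] := eqVneq (n1 xi) 0.
  have xi0 : xi = 0.
    by apply: enorm_eq0; apply/eqP; rewrite eq_le sqrtr_ge0 andbT -n0 enorm_le_n1.
  rewrite (_ : integral _ _ _ = 0%E).
    by rewrite lee_fin mulr_ge0 ?powR_ge0// mulr_ge0 ?exprn_ge0//; apply: le_trans K2000; rewrite ler0n.
  rewrite -(integral0 leb3 Q); apply: eq_integral => X _.
  by rewrite /sqdiff xi0 addr0 !subrr expr0n/= addr0 mul0r.
have np : 0 < n1 xi by rewrite lt_neqAle eq_sym n0 n1_ge0.
pose du X := u (X + xi) - u X; pose dv X := v (X + xi) - v X.
have mdu : measurable_fun setT (du : V -> R) by apply: measurable_funB => //; exact: measurable_shiftV.
have mdv : measurable_fun setT (dv : V -> R) by apply: measurable_funB => //; exact: measurable_shiftV.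
have grad f fx fy fz : weak_partial (ex R) f fx -> weak_partial (ey R) f fy ->
    weak_partial (ez R) f fz -> (intp 3 fx <= (2 * c ^+ 3)%:E)%E ->
    (intp 3 fy <= (2 * c ^+ 3)%:E)%E -> (intp 3 fz <= (2 * c ^+ 3)%:E)%E ->
    (int3 (fun X => (f (X + xi) - f X)%R) <= (n1 xi ^+ 3 * (54 * c ^+ 3))%:E)%E.
  move=> Wx Wy Wz ix iy iz; apply: (le_trans (int3_delta xi Wx Wy Wz)).
  have n30 : (0 <= (9 * n1 xi ^+ 3)%:E)%E by rewrite lee_fin mulr_ge0// exprn_ge0// n1_ge0.
  apply: (le_trans (lee_wpmul2l n30 (leeD (leeD ix iy) iz))).
  rewrite -!EFinD -EFinM lee_fin le_eqVlt; apply/orP; left; apply/eqP; ring.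
have idu := grad u ux uy uz Wux Wuy Wuz iux iuy iuz.
have idv := grad v vx vy vz Wvx Wvy Wvz ivx ivy ivz.
have i0 (l : vec3 -> R) : (0 <= int3 l)%E by apply: integral_ge0 => X _; rewrite lee_fin exprn_ge0.
have in0 : (0 <= ((n1 xi)^-1)%:E)%E by rewrite lee_fin invr_ge0 ltW.
have i20 : (0 <= (2 * n1 xi ^+ 2)%:E)%E by rewrite lee_fin mulr_ge0 ?sqr_ge0.
have m3 (g : vec3 -> R) : measurable_fun setT (g : V -> R) ->
    measurable_fun Q (fun X : V => (`|g X| ^+ 3)%:E) by exact: measurable_normX.
apply: (@le_trans _ _ (((n1 xi)^-1)%:E * (int3 du + int3 dv) + (2 * n1 xi ^+ 2)%:E * int3 (weight u v w))%E).
  have p3 (l : vec3 -> R) X : (0 <= (`|l X| ^+ 3)%:E)%E by rewrite lee_fin exprn_ge0.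
  rewrite /int3 -ge0_integralD//; [|exact: m3|exact: m3].
  rewrite -ge0_integralZl//; last 2 first.
  - by apply: emeasurable_funD; exact: m3.
  - by move=> X _; rewrite adde_ge0.
  rewrite -ge0_integralZl//; last exact: m3.
  rewrite -ge0_integralD//; last 4 first.
  - by move=> X _; rewrite mule_ge0// adde_ge0.
  - by apply: measurable_funeM; apply: emeasurable_funD; exact: m3.
  - by move=> X _; rewrite mule_ge0.
  - by apply: measurable_funeM; exact: m3.
  apply: ge0_le_integral => //.
  - by move=> X _; rewrite lee_fin mulr_ge0.
  - by apply/measurable_funTS/measurable_EFinP/measurable_funM.
  - by apply: emeasurable_funD; apply: measurable_funeM; [apply: emeasurable_funD|]; exact: m3.
  - move=> X _; rewrite (ger0_norm (W0 X)).
    suff : sqdiff u v xi X * weight u v w X <=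
        (n1 xi)^-1 * (`|du X| ^+ 3 + `|dv X| ^+ 3) + 2 * n1 xi ^+ 2 * weight u v w X ^+ 3.
      by rewrite -lee_fin.
    have yu := young_cube (normr_ge0 (du X)) (W0 X) np.
    have yv := young_cube (normr_ge0 (dv X)) (W0 X) np.
    rewrite (_ : sqdiff u v xi X = `|du X| ^+ 2 + `|dv X| ^+ 2); last first.
      by rewrite !real_normK ?num_real.
    rewrite mulrDl; apply: le_trans (lerD yu yv) _.
    by rewrite le_eqVlt; apply/orP; left; apply/eqP; ring.
apply: (@le_trans _ _ (((n1 xi)^-1)%:E * ((n1 xi ^+ 3 * (54 * c ^+ 3))%:E + (n1 xi ^+ 3 * (54 * c ^+ 3))%:E)
   + (2 * n1 xi ^+ 2)%:E * (585 * c ^+ 3)%:E)%E).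
  by apply: leeD; apply: lee_wpmul2l => //; exact: leeD.
suff : (n1 xi)^-1 * (n1 xi ^+ 3 * (54 * c ^+ 3) + n1 xi ^+ 3 * (54 * c ^+ 3)) +
    2 * n1 xi ^+ 2 * (585 * c ^+ 3) <= K * c ^+ 3 * n1 xi `^ 2 by rewrite -lee_fin.
rewrite (powR_mulrn 2) ?n1_ge0//.
rewrite (_ : (n1 xi)^-1 * _ = n1 xi ^+ 2 * (108 * c ^+ 3)); last by field; rewrite gt_eqF.
have := sqr_ge0 (n1 xi); move: (n1 xi ^+ 2) => k k0.
rewrite (_ : _ + _ = 1278 * (k * c ^+ 3)); last by ring.
rewrite (_ : K * _ * _ = K * (k * c ^+ 3)); last by ring.
rewrite ler_wpM2r ?mulr_ge0 ?exprn_ge0//; apply: le_trans K2000; by rewrite ler_nat.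
Qed.

(** The increments are bounded pointwise, so an integrable weight is enough; the
    vertical velocity is integrable because the horizontal gradient is. *)
Lemma slice_reg_holder gamma :
  (forall X, `|u X| <= c) -> (forall X, `|v X| <= c) ->
  (forall X xi, (u (X + xi) - u X) ^+ 2 <= 4 * c ^+ 2 * n1 xi `^ gamma) ->
  (forall X xi, (v (X + xi) - v X) ^+ 2 <= 4 * c ^+ 2 * n1 xi `^ gamma) ->
  (intp 1 ux <= (2 * c ^+ 1)%:E)%E -> (intp 1 vy <= (2 * c ^+ 1)%:E)%E ->
  slice_reg gamma (K * c ^+ 3) u v w.
Proof.
rewrite expr1 => su sv hu hv iux ivy.
have iw : (intp 1 w <= (4 * c)%:E)%E.
  have [H _] := vertical_intp_grad hw Wux Wvy; apply: (le_trans H).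
  by apply: (le_trans (leeD iux ivy)); rewrite -EFinD lee_fin; lra.
have mWE : measurable_fun Q (fun X : V => (weight u v w X)%:E).
  by apply: measurable_funTS; apply/measurable_EFinP.
have iW : (\int[leb3]_(X in Q) (weight u v w X)%:E <= (7 * c)%:E)%E.
  apply: (@le_trans _ _ (\int[leb3]_(X in Q) ((1 + 2 * c)%:E + (`|w X| ^+ 1)%:E))%E).
    apply: ge0_le_integral => //.
    - by move=> X _; rewrite lee_fin.
    - by apply: emeasurable_funD => //; exact: measurable_normX.
    - move=> X _; rewrite -EFinD lee_fin expr1 /weight; have := su X; have := sv X; lra.
  rewrite ge0_integralD//; last 2 first.
  - by move=> X _; rewrite lee_fin addr_ge0// mulr_ge0.
  - exact: measurable_normX.
  by rewrite integral_cube_cst; apply: (le_trans (leeD (lexx _) iw)); rewrite -EFinD lee_fin; have := c1; lra.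
have pull (k : R) (F : vec3 -> R) : 0 <= k -> (forall X, 0 <= F X <= k) ->
   measurable_fun setT (F : V -> R) ->
   (\int[leb3]_(X in Q) (F X * weight u v w X)%:E <= (k * (7 * c))%:E)%E.
  move=> k0 Fk mF; apply: (@le_trans _ _ (k%:E * \int[leb3]_(X in Q) (weight u v w X)%:E)%E).
    rewrite -ge0_integralZl//; last by move=> X _; rewrite lee_fin.
    apply: ge0_le_integral => //.
    - by move=> X _; rewrite lee_fin mulr_ge0//; have /andP[] := Fk X.
    - by apply/measurable_funTS/measurable_EFinP/measurable_funM.
    - by apply: measurable_funeM; exact: mWE.
    - by move=> X _; rewrite -EFinM lee_fin ler_wpM2r//; have /andP[] := Fk X.
  by rewrite EFinM; apply: lee_wpmul2l.
have sq0 (k : vec3 -> R) X : 0 <= k X ^+ 2 by exact: sqr_ge0.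
apply: finish.
  apply: (le_trans (pull (3 * c ^+ 2) _ _ _ _)) => //.
  - by rewrite mulr_ge0 ?sqr_ge0.
  - move=> X; rewrite !addr_ge0//=.
    have b f' : `|f' X| <= c -> f' X ^+ 2 <= c ^+ 2.
      by move=> H; rewrite -(real_normK (num_real (f' X))) lerXn2r// nnegrE.
    have := b u (su X); have := b v (sv X); have : 1 <= c ^+ 2 by exact: exprn_ege1.
    by lra.
  - by rewrite lee_fin (_ : _ * (7 * c) = 21 * c ^+ 3); [rewrite ler_wpM2r ?exprn_ge0//; apply: le_trans K2000; rewrite ler_nat|ring].
move=> xi; apply: (le_trans (pull (8 * c ^+ 2 * n1 xi `^ gamma) _ _ _ _)) => //.
- by rewrite mulr_ge0 ?powR_ge0// mulr_ge0 ?sqr_ge0.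
- move=> X; rewrite S0/= /sqdiff; have := hu X xi; have := hv X xi.
  by rewrite (_ : 8 * c ^+ 2 * n1 xi `^ gamma = 4 * c ^+ 2 * n1 xi `^ gamma + 4 * c ^+ 2 * n1 xi `^ gamma);
     [move=> h1 h2; exact: lerD|ring].
- rewrite lee_fin (_ : _ * (7 * c) = 56 * (c ^+ 3 * n1 xi `^ gamma)); last by ring.
  by rewrite -[leRHS]mulrA ler_wpM2r ?mulr_ge0 ?exprn_ge0 ?powR_ge0//; apply: le_trans K2000; rewrite ler_nat.
Qed.

End SliceRegCases.

Section SliceRegAE.
Variable R : realType.
Local Notation B := (measurableTypeR R).
Local Notation leb1 := (leb1 R).
Local Notation vec3 := (vec3 R).

Lemma integrable_majorant (T K : R) (M N : B -> R) :
  measurable_fun setT M -> measurable_fun setT N ->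
  (forall t, 0 <= M t) -> (forall t, 0 <= N t) -> 0 <= K ->
  leb1.-integrable `]0, T[ (fun t => (M t ^+ 3)%:E) ->
  leb1.-integrable `]0, T[ (fun t => (N t ^+ 3)%:E) ->
  leb1.-integrable `]0, T[ (fun t => (K * (2 + M t + N t) ^+ 3)%:E).
Proof.
move=> mM mN M0 N0 K0 iM iN.
have mI : measurable (`]0, T[%classic : set B) by exact: measurable_itvB.
have fI : (leb1 `]0%R, T[%classic < +oo)%E.
  by rewrite /Defs.leb1 /= lebesgue_measure_itv/= lte_fin; case: ifP => _; rewrite ?ltry.
have i8 : leb1.-integrable `]0, T[ (fun=> 8%:E).
  apply/integrableP; split; first exact: measurable_cst.
  by rewrite integral_cst//= lte_mul_pinfty.
have iS := integrableZl mI (9 * K) (integrableD mI (integrableD mI i8 iM) iN).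
apply: (le_integrable mI _ _ iS).
  apply/measurable_funTS/measurable_EFinP; apply: measurable_funM => //.
  by apply: measurable_funX; apply: measurable_funD => //; exact: measurable_funD.
move=> t _; have m0 := M0 t; have n0 := N0 t.
suff : `|K * (2 + M t + N t) ^+ 3| <= `|9 * K * (8 + M t ^+ 3 + N t ^+ 3)| by rewrite -lee_fin.
have p : 0 <= 2 + M t + N t by rewrite !addr_ge0.
have e1 : 0 <= K * (2 + M t + N t) ^+ 3 by rewrite mulr_ge0 ?exprn_ge0.
have e2 : 0 <= 9 * K * (8 + M t ^+ 3 + N t ^+ 3).
  by apply: mulr_ge0; [exact: mulr_ge0|rewrite !addr_ge0// exprn_ge0].
rewrite (ger0_norm e1) (ger0_norm e2).
rewrite [9 * K]mulrC -mulrA ler_wpM2l//.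
move: (M t) (N t) m0 n0 => a b a0 b0.
have ineq (x y : R) : 0 <= x -> 0 <= y -> x ^+ 2 * y + x * y ^+ 2 <= x ^+ 3 + y ^+ 3.
  move=> x0 y0; rewrite -subr_ge0 (_ : _ - _ = (x - y) ^+ 2 * (x + y)); last by ring.
  by apply: mulr_ge0; [exact: sqr_ge0|exact: addr_ge0].
have amgm : 6 * (2 * a * b) <= 2 * (8 + a ^+ 3 + b ^+ 3).
  rewrite -subr_ge0 (_ : _ - _ = (2 + a + b) * ((2 - a) ^+ 2 + (a - b) ^+ 2 + (b - 2) ^+ 2)); last by ring.
  by apply: mulr_ge0; rewrite !addr_ge0// sqr_ge0.
have := ineq a b a0 b0; have := ineq 2 b (ler0n _ _) b0; have := ineq 2 a (ler0n _ _) a0.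
rewrite (_ : (2 + a + b) ^+ 3 = 8 + a ^+ 3 + b ^+ 3 + 3 * (a ^+ 2 * b + a * b ^+ 2)
  + 3 * (2 ^+ 2 * b + 2 * b ^+ 2) + 3 * (2 ^+ 2 * a + 2 * a ^+ 2) + 6 * (2 * a * b)); last by ring.
rewrite (_ : 2 ^+ 3 = 8); last by ring.
lra.
Qed.

(** The two regularity classes enter the rest of the argument only through this
    common consequence. In the Hoelder case [gamma = min (2 beta, 2)], which is
    above [1] because [beta > 1/2]. The majorant [A] is a multiple of the cube of
    the norms, integrable because the velocity is in [L^3] in time. *)
Lemma slice_regularity (T : R) (u v w : spacetime R -> R) :
  ((exists (beta : R) (p : \bar R),
      [/\ 1 / 2 < beta, (1%:E < p)%E,
          bochner 3 T (holder_W1_norm beta p) u &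
          bochner 3 T (holder_W1_norm beta p) v])
    \/
    (exists p : \bar R,
      [/\ (6%:E < p)%E, bochner 3 T (W1_norm p) u & bochner 3 T (W1_norm p) v])) ->
  {ae leb1, forall t, 0 < t < T ->
    vertical_velocity (slice u t) (slice v t) (slice w t)} ->
  exists (gamma : R) (A : B -> R), [/\ 1 < gamma <= 2, forall t, 0 <= A t,
    measurable_fun setT A, leb1.-integrable `]0, T[ (EFin \o A) &
    {ae leb1, forall t, 0 < t < T ->
      slice_reg gamma (A t) (slice u t) (slice v t) (slice w t)}].
Proof.
move=> hreg hw.
have [K K0 K2000] : exists2 K : R, 0 <= K & 2000 <= K.
  by exists 2000; [rewrite ler0n|exact: lexx].
have build gamma (Mu Mv : B -> R) :
    1 < gamma <= 2 ->
    measurable_fun setT Mu -> (forall t, 0 <= Mu t) ->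
    leb1.-integrable `]0, T[ (fun t => (Mu t ^+ 3)%:E) ->
    measurable_fun setT Mv -> (forall t, 0 <= Mv t) ->
    leb1.-integrable `]0, T[ (fun t => (Mv t ^+ 3)%:E) ->
    {ae leb1, forall t, 0 < t < T ->
       vertical_velocity (slice u t) (slice v t) (slice w t) ->
       slice_reg gamma (K * (2 + Mu t + Mv t) ^+ 3) (slice u t) (slice v t) (slice w t)} ->
  exists (gamma : R) (A : B -> R), [/\ 1 < gamma <= 2, forall t, 0 <= A t,
    measurable_fun setT A, leb1.-integrable `]0, T[ (EFin \o A) &
    {ae leb1, forall t, 0 < t < T ->
      slice_reg gamma (A t) (slice u t) (slice v t) (slice w t)}].
  move=> hg mMu Mu0 iMu mMv Mv0 iMv H.
  exists gamma, (fun t => K * (2 + Mu t + Mv t) ^+ 3); split => //.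
  - by move=> t; rewrite mulr_ge0// exprn_ge0// !addr_ge0.
  - apply: measurable_funM => //.
    by apply: measurable_funX; apply: measurable_funD => //; exact: measurable_funD.
  - exact: integrable_majorant.
  - by apply: ae_imp2 H hw => t H h t0; exact: H t0 (h t0).
have bound (M N : B -> R) t : 0 <= M t -> 0 <= N t ->
    [/\ 1 <= 2 + M t + N t, 0 < 2 + M t + N t, M t < 2 + M t + N t & N t < 2 + M t + N t].
  by move=> m0 n0; split; lra.
case: hreg => [[beta [p [b2 p1 bu bv]]]|[p [p6 bu bv]]].
  have p1' : (1%:E <= p)%E := ltW p1.
  have sN : seminorm (@holder_W1_norm R beta p).
    exact: (seminorm_add (holder_seminorm beta) (W1_seminorm p1')).
  have [Mu [mMu Mu0 iMu hu]] := bochner_bound sN bu.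
  have [Mv [mMv Mv0 iMv hv]] := bochner_bound sN bv.
  apply: (build (Num.min (2 * beta) 2) Mu Mv) => //.
    by rewrite lt_min ge_min lexx orbT andbT; apply/andP; split; lra.
  apply: ae_imp2 hu hv => t Hu Hv t0 hv'.
  have [_ nu] := Hu t0; have [_ nv] := Hv t0.
  have [c1 c0 cu cv] := bound Mu Mv t (Mu0 t) (Mv0 t).
  set c := 2 + Mu t + Mv t in c1 c0 cu cv *.
  have split_norm f (M : R) : M < c -> (holder_W1_norm beta p f <= M%:E)%E ->
      (holder_norm beta f <= c%:E)%E /\ (W1_norm p f < c%:E)%E.
    move=> Mc H; split.
      apply: (le_trans _ (le_trans H _)); last by rewrite lee_fin ltW.
      by rewrite leeDl//; exact: (seminorm_ge0 (W1_seminorm p1')).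
    apply: (le_lt_trans _ (le_lt_trans H _)); last by rewrite lte_fin.
    by rewrite leeDr//; exact: (seminorm_ge0 (holder_seminorm beta)).
  have [hu1 hu2] := split_norm _ _ cu nu; have [hv1 hv2] := split_norm _ _ cv nv.
  have [ux [uy [uz [[Wux Wuy Wuz] [_ iux _ _]]]]] := @W1_grad R p 1 _ _ isT p1 c0 hu2.
  have [vx [vy [vz [[Wvx Wvy Wvz] [_ _ ivy _]]]]] := @W1_grad R p 1 _ _ isT p1 c0 hv2.
  have [su du] := holder_bound b2 hu1; have [sv dv] := holder_bound b2 hv1.
  by apply: (slice_reg_holder Wux Wvx Wvy hv' c1 K2000 su sv du dv iux ivy).
have p3 : (3%:E < p)%E by apply: lt_trans p6; rewrite lte_fin ltr_nat.
have p1 : (1%:E <= p)%E by apply: le_trans (ltW p3); rewrite lee_fin ler1n.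
have sN := W1_seminorm p1.
have [Mu [mMu Mu0 iMu hu]] := bochner_bound sN bu.
have [Mv [mMv Mv0 iMv hv]] := bochner_bound sN bv.
apply: (build 2 Mu Mv) => //.
  by rewrite ltr1n lexx.
apply: ae_imp2 hu hv => t Hu Hv t0 hv'.
have [_ nu] := Hu t0; have [_ nv] := Hv t0.
have [c1 c0 cu cv] := bound Mu Mv t (Mu0 t) (Mv0 t).
set c := 2 + Mu t + Mv t in c1 c0 cu cv *.
have hu2 : (W1_norm p (slice u t) < c%:E)%E by apply: (le_lt_trans nu); rewrite lte_fin.
have hv2 : (W1_norm p (slice v t) < c%:E)%E by apply: (le_lt_trans nv); rewrite lte_fin.
have [ux [uy [uz [[Wux Wuy Wuz] iu]]]] := @W1_grad R p 3 _ _ isT p3 c0 hu2.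
have [vx [vy [vz [[Wvx Wvy Wvz] iv]]]] := @W1_grad R p 3 _ _ isT p3 c0 hv2.
exact: (slice_reg_sobolev Wux Wuy Wuz Wvx Wvy Wvz hv' c1 K2000 iu iv).
Qed.

End SliceRegAE.

(** * The defect *)

Section Mollifiers.
Variable R : realType.
Local Notation B := (measurableTypeR R).
Local Notation V := (B * B * B)%type.
Local Notation leb3 := (leb3 R).
Local Notation vec3 := (vec3 R).

Definition box (r : R) : set vec3 :=
  (`[- r, r]%classic `*` `[- r, r]%classic) `*` `[- r, r]%classic.

Lemma measurable_box r : measurable (box r : set V).
Proof.
apply: (measurableX (T1 := (B * B)%type)); first apply: measurableX; exact: measurable_itvB.
Qed.

Lemma leb3_boxE r : 0 <= r -> leb3 (box r) = (8 * r ^+ 3)%:E.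
Proof.
move=> r0; rewrite [LHS]leb3_box; have H : leb1 R `[- r, r]%classic = (2 * r)%:E.
  rewrite /leb1 /= lebesgue_measure_itv/= lte_fin; case: ltP => rr.
    by congr EFin; ring.
  by congr EFin; lra.
rewrite [X in (X * _ * _)%E]H [X in (_ * X * _)%E]H [X in (_ * X)%E]H.
by congr EFin; ring.
Qed.

Lemma n1_box r xi : box r xi -> n1 xi <= 3 * r.
Proof.
case: xi => -[x y] z [[/= + +] +]; rewrite !in_itv/= -!ler_norml /n1 /=; lra.
Qed.

(** Compactness of the support bounds the derivatives and puts the support in a
    cube. *)
Lemma mollifier_derive (phi : vec3 -> R) : mollifier phi -> exists L r : R,
  [/\ 0 <= L, 0 <= r & forall (e X : vec3), e = ex R \/ e = ey R \/ e = ez R ->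
    `|'D_e phi X| <= L /\ (~ box r X -> 'D_e phi X = 0)].
Proof.
move=> [sphi cK _ _ _]; set K := closure _ in cK.
have bnd e : exists M, forall X, K X -> `|'D_e phi X| <= M.
  by apply: bounded_on_compact cK; exact: smooth_derive_continuous.
have [Mx hx] := bnd (ex R); have [My hy] := bnd (ey R); have [Mz hz] := bnd (ez R).
have out e X : ~ K X -> 'D_e phi X = 0.
  move=> nK.
  have H : \forall Y \near X, phi Y = (fun=> 0) Y.
    have : open (~` K) by rewrite openC; exact: closed_closure.
    rewrite openE => /(_ X nK); rewrite /interior; apply: filterS => Y nKY.
    by apply: contrapT => pY; apply: nKY; apply: subset_closure; exact/eqP.
  by rewrite (near_eq_derive _ H) derive_cst.
have [M hM] : exists M, forall X, K X -> `|X.1.1| <= M /\ `|X.1.2| <= M /\ `|X.2| <= M.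
  have b (f : vec3 -> R) : continuous f -> exists M, forall X, K X -> `|f X| <= M.
    by move=> cf; exact: bounded_on_compact cf cK.
  have [M1 H1] := b (fun X => X.1.1) (fun X => differentiable_continuous ((coord_x R).1 X)).
  have [M2 H2] := b (fun X => X.1.2) (fun X => differentiable_continuous ((coord_y R).1 X)).
  have [M3 H3] := b (fun X => X.2) (fun X => differentiable_continuous ((coord_z R).1 X)).
  exists (Num.max M1 (Num.max M2 M3)) => X KX.
  by rewrite !le_max H1// H2// H3// !orbT.
exists (Num.max 0 (Num.max Mx (Num.max My Mz))), (Num.max 0 M).
split; [by rewrite le_max lexx|by rewrite le_max lexx|].
move=> e X he; split.
  have [KX|/out ->] := pselect (K X); last by rewrite normr0 le_max lexx.
  case: he => [->|[->|->]].
  - by apply: (le_trans (hx _ KX)); rewrite !le_max lexx !orbT.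
  - by apply: (le_trans (hy _ KX)); rewrite !le_max lexx !orbT.
  - by apply: (le_trans (hz _ KX)); rewrite !le_max lexx !orbT.
move=> nb; apply: out => KX; apply: nb; have [h1 [h2 h3]] := hM X KX.
case: X KX h1 h2 h3 => -[x y] z KX h1 h2 h3.
by split; [split|]; rewrite /= in_itv/= -ler_norml le_max ?h1 ?h2 ?h3 orbT.
Qed.

Lemma derive_rescale (phi : vec3 -> R) (eps : R) (e X : vec3) : smooth phi ->
  'D_e (rescale phi eps) X = eps ^- 3 * eps^-1 * 'D_e phi (eps^-1 *: X).
Proof.
move=> sphi; have dphi Y : differentiable phi Y by exact: (sphi [::]).
have D : is_derive X e (fun X => phi (eps^-1 *: X)) (eps^-1 * 'D_e phi (eps^-1 *: X)).
  pose L : vec3 -> vec3 := eps^-1 *: (id : vec3 -> vec3).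
  have dL : is_diff X L L by exact: is_diffZ.
  have dc : differentiable (phi \o L) X by exact: differentiable_comp.
  apply: DeriveDef; first exact: (diff_derivable (f := phi \o L)).
  rewrite [LHS](deriveE e dc) diff_comp//= diff_val.
  rewrite -[L e]/(eps^-1 *: e) linearZ/=; congr (_ * _); exact/esym/deriveE.
have Dc : is_derive X e (rescale phi eps) (eps ^- 3 *: (eps^-1 * 'D_e phi (eps^-1 *: X))).
  exact: is_deriveZ.
by rewrite derive_val /GRing.scale /= mulrA.
Qed.

End Mollifiers.

Section Defect.
Variable R : realType.
Local Notation B := (measurableTypeR R).
Local Notation V := (B * B * B)%type.
Local Notation W := (B * B * B * B)%type.
Local Notation leb1 := (leb1 R).
Local Notation leb3 := (leb3 R).
Local Notation leb4 := (leb4 R).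
Local Notation Q := (@cube R).
Local Notation vec3 := (vec3 R).
Local Notation spacetime := (spacetime R).

Definition sleb4 : {sigma_finite_measure set W -> \bar R} := prod_sfin (sleb3 R) leb1.

Let mQ : measurable (Q : set V) := @measurable_cube R.

Lemma weight_sum (K a a' b b' c c' : R) : 0 <= K ->
  K * (a + a') + K * (b + b') + K * (c + c') <= K * (1 + a + b + c + (1 + a' + b' + c')).
Proof. by move=> K0; rewrite -!mulrDr ler_wpM2l//; lra. Qed.

Lemma n1N (xi : vec3) : n1 (- xi) = n1 xi.
Proof. by rewrite /n1 /= !normrN. Qed.

(** The weight at the translated point is handled by translating back, since
    the increments are symmetric. *)
Lemma slice_diff2 (gamma A : R) (u v w : vec3 -> R) xi : slice_reg gamma A u v w ->
  (\int[leb3]_(X in Q) (sqdiff u v xi X * (weight u v w (X + xi)%R + weight u v w X))%:E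
    <= (2 * (A * n1 xi `^ gamma))%:E)%E.
Proof.
move=> [mu mv mw pu pv pw _ sd _].
have mW : measurable_fun setT (weight u v w : V -> R).
  by rewrite /weight; apply: measurable_funD; [apply: measurable_funD; [apply: measurable_funD|]|] => //;
    exact: measurableT_comp.
have mS z : measurable_fun setT (sqdiff u v z : V -> R).
  by rewrite /sqdiff; apply: measurable_funD; apply: measurable_funX; apply: measurable_funB => //;
    exact: measurable_shiftV.
have W0 X : 0 <= weight u v w X by rewrite /weight !addr_ge0.
have S0 z X : 0 <= sqdiff u v z X by rewrite /sqdiff addr_ge0 ?sqr_ge0.
under eq_integral do rewrite mulrDr EFinD.
rewrite ge0_integralD//; last 4 first.
- by move=> X _; rewrite lee_fin mulr_ge0.
- apply: measurable_funTS; apply/measurable_EFinP.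
  exact: (measurable_funM (mS xi) (measurable_shiftV xi mW)).
- by move=> X _; rewrite lee_fin mulr_ge0.
- by apply: measurable_funTS; apply/measurable_EFinP; apply: measurable_funM.
rewrite mulr_natl mulr2n EFinD; apply: leeD; last exact: sd.
rewrite -n1N; apply: le_trans (sd (- xi)).
rewrite -[leRHS](@integral_cube_shift R xi (fun X => sqdiff u v (- xi) X * weight u v w X)).
- rewrite le_eqVlt; apply/orP; left; apply/eqP; apply: eq_integral => X _.
  by rewrite /sqdiff addrK (_ : _ ^+ 2 + _ = (u X - u (X + xi)) ^+ 2 + (v X - v (X + xi)) ^+ 2)//; ring.
- exact: measurable_funM.
- by move=> X; rewrite mulr_ge0.
- move=> X; rewrite /sqdiff /weight.
  have [-> -> ->] := pu X; have [-> -> ->] := pv X; have [-> -> ->] := pw X.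
  have [-> -> ->] := torus_periodic_shift (- xi) pu X.
  by have [-> -> ->] := torus_periodic_shift (- xi) pv X.
Qed.

Variables (T gamma : R) (A : B -> R) (u v w : spacetime -> R).
Hypotheses (mu : measurable_fun setT (u : W -> R)) (mv : measurable_fun setT (v : W -> R))
  (mw : measurable_fun setT (w : W -> R)).
Hypotheses (g1 : 1 < gamma) (A0 : forall t, 0 <= A t).
Hypothesis iA : leb1.-integrable `]0, T[ (EFin \o A).
Hypothesis reg : {ae leb1, forall t, 0 < t < T ->
      slice_reg gamma (A t) (slice u t) (slice v t) (slice w t)}.
Variables (phi : vec3 -> R) (L r : R).
Hypotheses (sphi : smooth phi) (L0 : 0 <= L) (r0 : 0 <= r).
Hypothesis phiL : forall (e X : vec3), e = ex R \/ e = ey R \/ e = ez R ->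
    `|'D_e phi X| <= L /\ (~ box r X -> 'D_e phi X = 0).

Let IA := \int[leb1]_(t in `]0, T[) A t.
Definition defect_const : R := 16 * r ^+ 3 * L * (3 * r) `^ gamma * IA.

Section fixed.
Variable eps : R.
Hypothesis e0 : 0 < eps.

Let rho (e : vec3) : vec3 -> R := 'D_e (rescale phi eps).
Let k := eps ^- 3 * eps^-1 * L.

Let e1 : 0 <= eps^-1. Proof. by rewrite invr_ge0 ltW. Qed.
Let e3 : 0 <= eps ^- 3. Proof. by rewrite invr_ge0 exprn_ge0 ?ltW. Qed.
Let k0 : 0 <= k. Proof. by rewrite /k !mulr_ge0. Qed.

Let rho_le (e X : vec3) : e = ex R \/ e = ey R \/ e = ez R ->
  `|rho e X| <= k * \1_(box (eps * r)) X.
Proof.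
move=> he; rewrite /rho derive_rescale// !normrM.
rewrite (ger0_norm e3) (ger0_norm e1).
have [h1 h2] := phiL (eps^-1 *: X) he; rewrite indicE.
case: (boolP (X \in _)) => [_|/negP nX]; rewrite /= ?mulr1 ?mulr0.
  by rewrite /k ler_wpM2l// mulr_ge0.
rewrite h2 ?normr0 ?mulr0// => bx; apply: nX; rewrite inE.
case: X bx {h1 h2} => -[x y] z [[/= + +] +]; rewrite !in_itv/= => hx hy hz.
have sc t : - r <= eps^-1 * t <= r -> `[- (eps * r), eps * r]%classic t.
  by rewrite /= in_itv/= -!ler_norml normrM (ger0_norm e1) ler_pdivrMl.
by split; [split|]; exact: sc.
Qed.

Let mrho e : measurable_fun setT (rho e : V -> R).
Proof.
apply: continuous_measurable3; rewrite /rho.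
have -> : 'D_e (rescale phi eps) = fun X => eps ^- 3 * eps^-1 * 'D_e phi (eps^-1 *: X).
  by apply/funext => X; rewrite derive_rescale.
have cd : continuous ('D_e phi) by exact: smooth_derive_continuous.
have cs : continuous (fun X : vec3 => eps^-1 *: X).
  by move=> X; apply: cvgZ; [exact: cvg_cst|exact: cvg_id].
have cc : continuous (fun X : vec3 => 'D_e phi (eps^-1 *: X)).
  by move=> X; apply: (continuous_comp (f := fun X : vec3 => eps^-1 *: X) (g := 'D_e phi)); [exact: cs|exact: cd].
by move=> X; apply: cvgM; [exact: cvg_cst|exact: cc].
Qed.

(* The integrand of the defect at the scale [eps], as a function of the point and
   of the increment. *)
Let G (q : W * V) : R :=
  (rho (ex R) q.2 * delta u q.2 q.1 + rho (ey R) q.2 * delta v q.2 q.1 +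
   rho (ez R) q.2 * delta w q.2 q.1) * (`|delta u q.2 q.1| ^+ 2 + `|delta v q.2 q.1| ^+ 2).

Let mdelta (f : spacetime -> R) : measurable_fun setT (f : W -> R) ->
  measurable_fun setT (fun q : W * V => delta f q.2 q.1).
Proof.
move=> mf; rewrite /delta; apply: measurable_funB; last exact: measurableT_comp mf measurable_fst.
apply: (measurableT_comp (f := f : W -> R)) => //.
apply: (measurable_fun_pair (T1 := V)); last exact: measurableT_comp measurable_snd measurable_fst.
apply: measurable_addV => //; exact: measurableT_comp measurable_fst measurable_fst.
Qed.

Let mG : measurable_fun setT G.
Proof.
have mr e : measurable_fun setT (fun q : W * V => rho e q.2).
  exact: measurableT_comp (mrho e) measurable_snd.
apply: measurable_funM.
  by apply: measurable_funD; [apply: measurable_funD|]; apply: measurable_funM => //; exact: mdelta.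
by apply: measurable_funD; apply: measurable_funX; apply: measurableT_comp => //; exact: mdelta.
Qed.

Let G_le (X : vec3) (t : R) (xi : vec3) : `|G ((X, t), xi)| <=
  k * \1_(box (eps * r)) xi * (sqdiff (slice u t) (slice v t) xi X *
  (weight (slice u t) (slice v t) (slice w t) (X + xi) + weight (slice u t) (slice v t) (slice w t) X)).
Proof.
have [hx hy hz] : [/\ `|rho (ex R) xi| <= k * \1_(box (eps * r)) xi,
    `|rho (ey R) xi| <= k * \1_(box (eps * r)) xi & `|rho (ez R) xi| <= k * \1_(box (eps * r)) xi].
  by split; apply: rho_le; tauto.
rewrite /G /= normrM [X in _ * X <= _](_ : _ = sqdiff (slice u t) (slice v t) xi X); last first.
  by rewrite /delta /= /sqdiff /slice !real_normK ?num_real// ger0_norm// addr_ge0 ?sqr_ge0.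
set S := sqdiff _ _ _ _; have S0 : 0 <= S by rewrite /S /sqdiff addr_ge0 ?sqr_ge0.
rewrite mulrC [leRHS]mulrCA ler_wpM2l//.
set K := k * _ in hx hy hz *; have K0 : 0 <= K by exact: le_trans hx.
have d (f : spacetime -> R) (e : vec3) : `|rho e xi| <= K ->
    `|rho e xi * delta f xi (X, t)| <= K * (`|slice f t (X + xi)| + `|slice f t X|).
  by move=> h; rewrite normrM ler_pM//; apply: ler_normB.
apply: le_trans (ler_normD _ _) _; apply: le_trans (lerD (ler_normD _ _) (lexx _)) _.
apply: le_trans (lerD (lerD (d u _ hx) (d v _ hy)) (d w _ hz)) _.
exact: weight_sum.
Qed.

Let mI : measurable (`]0, T[%classic : set B). Proof. exact: measurable_itvB. Qed.
Let mTT : measurable (torus_time T : set W). Proof. exact: measurable_torus_time. Qed.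

Let IAE : (\int[leb1]_(t in `]0%R, T[) (A t)%:E = IA%:E)%E.
Proof. by rewrite /IA /Rintegral fineK//; exact: integrable_fin_num. Qed.

Let mAbs xi : measurable_fun setT (fun p : W => (`|G (p, xi)|)%:E).
Proof.
apply/measurable_EFinP; apply: measurableT_comp => //.
exact: (measurableT_comp mG (pair2_measurable xi)).
Qed.

(* The increments of [u] and [v] appear squared and cost [(eps r)^gamma]; the third
   factor is the weight at both end points. *)
Let G_int xi : (\int[leb4]_(p in torus_time T) (`|G (p, xi)|)%:E <=
  ((cst (2 * k * (3 * (eps * r)) `^ gamma * IA)%:E) \_ (box (eps * r))) xi)%E.
Proof.
have abs0 (p : W) : (0 <= (`|G (p, xi)|)%:E)%E by rewrite lee_fin.
rewrite (@tonelli_prod2 _ _ _ _ _ (sleb3 R) leb1 _ _ mQ mI _ (mAbs xi) abs0) patchE.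
case: ifPn => [/set_mem bx|nb]; last first.
  rewrite (_ : integral _ _ _ = 0%E); first exact: lexx.
  apply: integral0_eq => t _; apply: integral0_eq => X _; congr EFin; apply/eqP.
  rewrite eq_le normr_ge0 andbT; apply: (le_trans (G_le X t xi)).
  by rewrite indicE (negbTE nb) mulr0 mul0r.
apply: (@le_trans _ _ (\int[leb1]_(t in `]0%R, T[)
  ((2 * k * (3 * (eps * r)) `^ gamma)%:E * (A t)%:E))%E); last first.
  have C0 : 0 <= 2 * k * (3 * (eps * r)) `^ gamma by rewrite mulr_ge0 ?powR_ge0// mulr_ge0.
  rewrite ge0_integralZl//; last 2 first.
  - by case/integrableP : iA.
  - by move=> t _; rewrite lee_fin.
  by rewrite IAE EFinM.
apply: ae_ge0_le_integral => //.
- by move=> t _; exact: integral_ge0.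
- apply: measurable_funTS.
  exact: (@measurable_tonelli2 _ _ _ _ _ (sleb3 R) _ mQ _ (mAbs xi) abs0).
- by move=> t _; rewrite -EFinM lee_fin mulr_ge0// mulr_ge0 ?powR_ge0// mulr_ge0.
- by apply: measurable_funeM; case/integrableP : iA.
- apply: ae_imp reg => t H; rewrite /= in_itv/= => t0; have {}H := H t0.
  have [mu' mv' mw' _ _ _ _ _ _] := H.
  have mW : measurable_fun setT (weight (slice u t) (slice v t) (slice w t) : V -> R).
    by rewrite /weight; apply: measurable_funD; [apply: measurable_funD; [apply: measurable_funD|]|] => //;
      exact: measurableT_comp.
  have mS z : measurable_fun setT (sqdiff (slice u t) (slice v t) z : V -> R).
    by rewrite /sqdiff; apply: measurable_funD; apply: measurable_funX; apply: measurable_funB => //;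
      exact: measurable_shiftV.
  have W0 X : 0 <= weight (slice u t) (slice v t) (slice w t) X by rewrite /weight !addr_ge0.
  have S0 z X : 0 <= sqdiff (slice u t) (slice v t) z X by rewrite /sqdiff addr_ge0 ?sqr_ge0.
  have mSW : measurable_fun Q (fun X : V => (sqdiff (slice u t) (slice v t) xi X *
     (weight (slice u t) (slice v t) (slice w t) ((X : vec3) + xi) +
      weight (slice u t) (slice v t) (slice w t) X))%:E).
    apply: measurable_funTS; apply/measurable_EFinP; apply: (measurable_funM (mS xi)).
    exact: (measurable_funD (measurable_shiftV xi mW) mW).
  apply: (@le_trans _ _ (k%:E * \int[leb3]_(X in Q) (sqdiff (slice u t) (slice v t) xi X *
     (weight (slice u t) (slice v t) (slice w t) (X + xi)%R +
      weight (slice u t) (slice v t) (slice w t) X))%:E)%E).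
    rewrite -ge0_integralZl//; last by move=> X _; rewrite lee_fin mulr_ge0// addr_ge0.
    apply: ge0_le_integral => //.
    - apply: measurable_funTS; exact: (measurableT_comp (mAbs xi) (pair2_measurable t)).
    - exact: measurable_funeM.
    - move=> X _; have := G_le X t xi; rewrite indicE mem_set// mulr1.
      by rewrite -lee_fin.
  have k0E : (0 <= k%:E)%E by rewrite lee_fin.
  apply: (le_trans (lee_wpmul2l k0E (slice_diff2 xi H))).
  rewrite -EFinM -EFinM lee_fin.
  apply: (@le_trans _ _ (k * (2 * (A t * (3 * (eps * r)) `^ gamma)))).
    rewrite ler_wpM2l// ler_wpM2l// ler_wpM2l//.
    rewrite ge0_ler_powR ?nnegrE ?n1_ge0 ?n1_box//; last by rewrite mulr_ge0// mulr_ge0// ltW.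
    by apply: le_trans (ltW g1).
  by rewrite le_eqVlt; apply/orP; left; apply/eqP; ring.
Qed.

Let mbox := @measurable_box R (eps * r).

(* The gradient of the mollifier has size [eps^-4] on a set of measure of order
   [eps^3], which leaves [eps^(gamma - 1)]. *)
Let G_total : (\int[leb3]_xi \int[leb4]_(p in torus_time T) (`|G (p, xi)|)%:E <=
  (defect_const * eps `^ (gamma - 1))%:E)%E.
Proof.
have abs0 (q : W * V) : (0 <= (`|G q|)%:E)%E by rewrite lee_fin.
have mAb : measurable_fun setT (fun q : W * V => (`|G q|)%:E).
  by apply/measurable_EFinP; exact: measurableT_comp.
apply: (@le_trans _ _ (\int[leb3]_xi
   ((cst (2 * k * (3 * (eps * r)) `^ gamma * IA)%:E) \_ (box (eps * r))) xi)%E).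
  apply: ge0_le_integral => //.
  - by move=> xi _; exact: integral_ge0.
  - exact: (@measurable_tonelli2 _ _ _ _ _ sleb4 _ mTT _ mAb abs0).
  - by apply/(measurable_restrictT _ mbox); exact: measurable_cst.
rewrite -integral_mkcond integral_cst//.
rewrite [X in (_ * X)%E](leb3_boxE (mulr_ge0 (ltW e0) r0)).
rewrite -EFinM lee_fin le_eqVlt; apply/orP; left; apply/eqP.
rewrite /defect_const /k (_ : 3 * (eps * r) = eps * (3 * r)); last by ring.
rewrite (powRM _ (ltW e0)) ?mulr_ge0//.
rewrite powRB ?gt_eqF ?implybT// powRr1 ?ltW//.
by field; rewrite gt_eqF.
Qed.

Let G_integrable : (sleb4 \x sleb3 R)%E.-integrable (torus_time T `*` setT) (EFin \o G).
Proof.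
apply: (@integrable_prod2 _ _ _ _ _ sleb4 (sleb3 R) _ _ mTT measurableT G mG).
exact: le_lt_trans G_total (ltry _).
Qed.

Lemma defect_integrable :
  leb4.-integrable (torus_time T) (EFin \o defect_approx phi u v w eps).
Proof.
exact: (@integrable_Rfubini1 _ _ _ _ _ sleb4 (sleb3 R) _ _ mTT measurableT G G_integrable).
Qed.

Lemma defect_le : (\int[leb4]_(p in torus_time T) (`|defect_approx phi u v w eps p|)%:E <=
  (defect_const * eps `^ (gamma - 1))%:E)%E.
Proof.
have abs0 (q : W * V) : (0 <= (`|G q|)%:E)%E by rewrite lee_fin.
have mAb : measurable_fun setT (fun q : W * V => (`|G q|)%:E).
  by apply/measurable_EFinP; exact: measurableT_comp.
apply: le_trans G_total.
rewrite -(@tonelli_swap _ _ _ _ _ sleb4 (sleb3 R) _ _ mTT measurableT _ mAb abs0).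
apply: ge0_le_integral => //.
- apply/measurable_EFinP; apply: measurableT_comp => //.
  by apply/measurable_EFinP; case/integrableP : defect_integrable.
- apply: measurable_funTS.
  exact: (@measurable_tonelli1 _ _ _ _ _ (sleb3 R) _ measurableT _ mAb abs0).
- move=> p _; apply: (@le_trans _ _ (`|\int[leb3]_xi (G (p, xi))%:E|)%E); last first.
    apply: le_abse_integral => //; apply/measurable_EFinP.
    exact: (measurableT_comp mG (pair1_measurable p)).
  rewrite /defect_approx /Rintegral.
  by case: (integral _ _ _) => [z| |] /=; [exact: lexx|exact: leey|exact: leey].
Qed.

End fixed.
End Defect.

Section DefectZero.
Variable R : realType.
Local Notation B := (measurableTypeR R).
Local Notation V := (B * B * B)%type.
Local Notation W := (B * B * B * B)%type.
Local Notation leb1 := (leb1 R).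
Local Notation leb4 := (leb4 R).
Local Notation vec3 := (vec3 R).
Local Notation spacetime := (spacetime R).
Variables (T : R).

(** Measurability is only given for times in (0, T); functions are extended by
    zero to the other times. *)
Definition timeset : set W := setT `*` `]0, T[%classic.

Lemma measurable_timeset : measurable timeset.
Proof. by apply: (measurableX (T1 := V)) => //; exact: measurable_itvB. Qed.

Lemma measurable_patch_time (f : spacetime -> R) :
  measurable_fun ([set: vec3] `*` `]0, T[) (f : W -> R) ->
  measurable_fun setT (f \_ timeset : W -> R).
Proof. by move=> mf; apply/(measurable_restrictT _ measurable_timeset). Qed.

Lemma patch_timeE (f : spacetime -> R) X t : 0 < t < T -> (f \_ timeset) (X, t) = f (X, t).
Proof. by move=> t0; rewrite patchE mem_set//; split => //=; rewrite in_itv. Qed.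

Lemma slice_patch (f : spacetime -> R) t : 0 < t < T -> slice (f \_ timeset) t = slice f t.
Proof. by move=> t0; apply/funext => X; exact: patch_timeE. Qed.

Lemma test_function_bounded (psi : spacetime -> R) : test_function T psi ->
  measurable_fun setT (psi : W -> R) /\
  exists2 M, 0 <= M & forall p, torus_time T p -> `|psi p| <= M.
Proof.
move=> [spsi _ [a [b [a0 bT out]]]]; have cp := smooth_continuous spsi.
split; first exact: continuous_measurable4.
have cK : compact (@cube R `*` (`[a, b]%classic : set R)).
  by apply: compact_setX; [exact: compact_cube|exact: segment_compact].
have [M hM] := bounded_on_compact cp cK.
exists (Num.max 0 M); first by rewrite le_max lexx.
move=> [X t] [/= QX _]; rewrite le_max; apply/orP.
have [ab|nab] := pselect (a <= t <= b); last by left; rewrite out// normr0.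
by right; apply: hM; split => //=; rewrite in_itv.
Qed.

Lemma powR_cvg0 (a C : R) : 0 < a -> 0 <= C ->
  C * eps `^ a @[eps --> 0^'+] --> (0 : R).
Proof.
move=> a0 C0; apply/cvgrPdist_le => e e0.
have d0 : 0 < (e / (C + 1)) `^ a^-1 by rewrite powR_gt0// divr_gt0// ltr_wpDl.
near=> x; have x0 : 0 < x by near: x; exact: nbhs_right_gt.
have xd : x <= (e / (C + 1)) `^ a^-1 by near: x; exact: nbhs_right_le.
rewrite sub0r normrN ger0_norm ?mulr_ge0 ?powR_ge0//.
have : x `^ a <= e / (C + 1).
  have -> : e / (C + 1) = ((e / (C + 1)) `^ a^-1) `^ a.
    by rewrite -powRrM mulVf ?gt_eqF// powRr1// divr_ge0 ?ltW// ltr_wpDl.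
  by rewrite ge0_ler_powR ?nnegrE ?ltW.
rewrite ler_pdivlMr ?ltr_wpDl// => h.
by apply: le_trans h; rewrite mulrC ler_wpM2l ?powR_ge0// lerDl.
Unshelve. all: by end_near.
Qed.

(** The defect at the scale [eps] tends to zero in [L^1], since [gamma > 1]; no
    cancellation is involved. *)
Lemma defect_zero (gamma : R) (A : B -> R) (u v w : spacetime -> R) :
  measurable_fun ([set: vec3] `*` `]0, T[) (u : W -> R) ->
  measurable_fun ([set: vec3] `*` `]0, T[) (v : W -> R) ->
  measurable_fun ([set: vec3] `*` `]0, T[) (w : W -> R) ->
  1 < gamma -> (forall t, 0 <= A t) -> leb1.-integrable `]0, T[ (EFin \o A) ->
  {ae leb1, forall t, 0 < t < T ->
      slice_reg gamma (A t) (slice u t) (slice v t) (slice w t)} ->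
  forall phi, mollifier phi -> defect_is T phi u v w (fun _ => 0).
Proof.
move=> mu mv mw g1 A0 iA reg phi mphi.
have [L [r [L0 r0 phiL]]] := mollifier_derive mphi; have [sphi _ _ _ _] := mphi.
have reg' : {ae leb1, forall t, 0 < t < T -> slice_reg gamma (A t)
    (slice (u \_ timeset) t) (slice (v \_ timeset) t) (slice (w \_ timeset) t)}.
  by apply: ae_imp reg => t H t0; rewrite !slice_patch//; exact: H.
have [mu' mv' mw'] := And3 (measurable_patch_time mu) (measurable_patch_time mv) (measurable_patch_time mw).
have DE eps p : torus_time T p -> defect_approx phi (u \_ timeset) (v \_ timeset) (w \_ timeset) eps p =
    defect_approx phi u v w eps p.
  case: p => X t [/= QX]; rewrite in_itv/= => t0.
  by apply: eq_Rintegral => xi _; rewrite /delta /= !patch_timeE.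
have mTT := @measurable_torus_time R T.
have Di eps : 0 < eps -> leb4.-integrable (torus_time T) (EFin \o defect_approx phi u v w eps).
  move=> e0; have := defect_integrable mu' mv' mw' g1 A0 iA reg' sphi L0 r0 phiL e0.
  by apply: eq_integrable => // p /set_mem hp /=; rewrite DE.
have Dle eps : 0 < eps -> (\int[leb4]_(p in torus_time T) (`|defect_approx phi u v w eps p|)%:E <=
    (defect_const T gamma A L r * eps `^ (gamma - 1))%:E)%E.
  move=> e0; have := defect_le mu' mv' mw' g1 A0 iA reg' sphi L0 r0 phiL e0.
  by under eq_integral => p /set_mem hp do rewrite DE//.
move=> psi tpsi; have [mpsi [M M0 hM]] := test_function_bounded tpsi.
have Dpi eps : 0 < eps -> leb4.-integrable (torus_time T)
    (fun p => (defect_approx phi u v w eps p * psi p)%:E).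
  by move=> e0; apply: (integrable_mul_bounded (M := M)) => //; [exact: Di|exact: measurable_funTS].
split => //; apply/cvgrPdist_le => e e0.
have C0 : 0 <= M * defect_const T gamma A L r.
  rewrite mulr_ge0// /defect_const !mulr_ge0 ?powR_ge0 ?exprn_ge0//.
  by apply: Rintegral_ge0.
have g10 : 0 < gamma - 1 by rewrite subr_gt0.
have := powR_cvg0 g10 C0; move=> /cvgrPdist_le/(_ e e0) H.
near=> eps; have eps0 : 0 < eps by near: eps; exact: nbhs_right_gt.
have : `|0 - M * defect_const T gamma A L r * eps `^ (gamma - 1)| <= e by near: eps; exact: H.
rewrite !sub0r !normrN [X in X <= _ -> _]ger0_norm ?mulr_ge0 ?powR_ge0//; last exact: Rintegral_ge0.
apply: le_trans; rewrite -lee_fin.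
apply: (@le_trans _ _ (\int[leb4]_(p in torus_time T) (`|defect_approx phi u v w eps p * psi p|)%:E)%E).
  apply: (@le_trans _ _ (`|\int[leb4]_(p in torus_time T) (defect_approx phi u v w eps p * psi p)%:E|)%E).
    by rewrite /Rintegral; case: (integral _ _ _) => [z| |] /=; [exact: lexx|exact: leey|exact: leey].
  by apply: le_abse_integral => //; case/integrableP : (Dpi _ eps0).
have mD : measurable_fun (torus_time T) (fun p : W => (`|defect_approx phi u v w eps p|)%:E).
  apply/measurable_EFinP; apply: measurableT_comp => //; apply/measurable_EFinP.
  by case/integrableP : (Di _ eps0).
apply: (@le_trans _ _ (M%:E * \int[leb4]_(p in torus_time T) (`|defect_approx phi u v w eps p|)%:E)%E).
  rewrite -ge0_integralZl//.
  apply: ge0_le_integral => //.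
  - apply/measurable_EFinP; apply: measurableT_comp => //; apply/measurable_EFinP.
    by case/integrableP : (Dpi _ eps0).
  - exact: measurable_funeM.
  - by move=> p hp; rewrite -EFinM lee_fin normrM mulrC ler_wpM2r// hM.
have M0E : (0 <= M%:E)%E by rewrite lee_fin.
apply: (le_trans (lee_wpmul2l M0E (Dle _ eps0))).
by rewrite -EFinM lee_fin mulrA.
Unshelve. all: by end_near.
Qed.

End DefectZero.

(** * A trigonometric approximation of the identity *)

Section Kernel1.
Variable R : realType.
Local Notation B := (measurableTypeR R).
Local Notation leb1 := (leb1 R).

Let C (s : R) : R := cos (pi * s).
Let S (s : R) : R := sin (pi * s).

Let sl : smooth1 (fun s : R => pi * s).
Proof. by apply: (smooth1M (smooth1_cst pi) (@smooth1_id R)). Qed.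
Let sC : smooth1 C. Proof. exact: (smooth1_comp (@smooth1_cos R) sl). Qed.
Let sS : smooth1 S. Proof. exact: (smooth1_comp (@smooth1_sin R) sl). Qed.

Let dl (x : R) : is_derive x (1 : R) (fun s : R => pi * s) pi.
Proof.
have D := is_deriveM (is_derive_cst (pi : R) x (1 : R)) (is_derive_id x (1 : R)).
by apply: (is_derive_eq D); rewrite /GRing.scale /= mulr1 mulr0 addr0.
Qed.

Let dC (x : R) : is_derive x (1 : R) C (- (pi * S x)).
Proof.
apply: (is_derive_eq (@is_derive1_comp _ cos (fun s => pi * s) x _ _ (is_derive_cos _) (dl x))).
by rewrite mulNr mulrC.
Qed.

Let dS (x : R) : is_derive x (1 : R) S (pi * C x).
Proof.
apply: (is_derive_eq (@is_derive1_comp _ sin (fun s => pi * s) x _ _ (is_derive_sin _) (dl x))).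
by rewrite mulrC.
Qed.

Let CS x : S x ^+ 2 = 1 - C x ^+ 2. Proof. by rewrite /S /C sin2cos2. Qed.
Let C1 x : C (x + 1) = - C x. Proof. by rewrite /C mulrDr mulr1 cosDpi. Qed.
Let S1 x : S (x + 1) = - S x. Proof. by rewrite /S mulrDr mulr1 sinDpi. Qed.

Let derX (f : R -> R) (f' : R) (x : R) m : is_derive x (1 : R) f f' ->
  is_derive x (1 : R) (fun s => f s ^+ m.+1) (m.+1%:R * f x ^+ m * f').
Proof.
move=> D; elim: m => [|m IH]; first by rewrite expr0 mulr1 mul1r.
have E := is_deriveM D IH.
rewrite (_ : (fun s => _) = f * (fun s => f s ^+ m.+1)); last by apply/funext => s; rewrite exprS.
apply: (is_derive_eq E); rewrite /GRing.scale /= -!natr1 !exprS; ring.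
Qed.

Definition cos_moment (N : nat) : R := \int[leb1]_(s in `[0, 1]) cos (pi * s) ^+ (2 * N).

Let Ci (f : R -> R) : smooth1 f -> leb1.-integrable `[0, 1] (EFin \o f).
Proof. by move=> sf; exact/continuous_integrable/smooth1_continuous. Qed.

(** The recursion of Wallis, by integrating the derivative of
    [sin (pi s) cos (pi s)^(2N+1)] over a period. *)
Lemma cos_momentS N : (2 * N%:R + 2) * cos_moment N.+1 = (2 * N%:R + 1) * cos_moment N.
Proof.
pose F s := C s ^+ (2 * N).+1 * S s.
pose f s := pi * ((2 * N%:R + 2) * C s ^+ (2 * N.+1) - (2 * N%:R + 1) * C s ^+ (2 * N)).
have D (x : R) : is_derive x (1 : R) F (f x).
  have E := is_deriveM (derX (2 * N) (dC x)) (dS x).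
  apply: (is_derive_eq E); rewrite /GRing.scale /= /f.
  have -> : (2 * N).+1%:R = 2 * N%:R + 1 :> R by rewrite -natr1 natrM.
  rewrite (_ : (2 * N.+1)%N = (2 * N).+2); last by rewrite mulnS.
  rewrite !exprS.
  have E2 := CS x; rewrite expr2 in E2; ring: E2.
have cf : continuous f.
  apply: smooth1_continuous.
  apply: (smooth1M (smooth1_cst pi)).
  by apply: smooth1B; apply: smooth1M; [exact: smooth1_cst|exact: smooth1X|exact: smooth1_cst|exact: smooth1X].
have := ftc2 ler01 D cf.
have -> : F 1 - F 0 = 0.
  by rewrite /F /S mulr0 mulr1 sinpi sin0 !mulr0 subrr.
have i1 := Ci (smooth1X (2 * N.+1) sC); have i0 := Ci (smooth1X (2 * N) sC).
have j1 := Ci (smooth1M (smooth1_cst (2 * N%:R + 2)) (smooth1X (2 * N.+1) sC)).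
have j0 := Ci (smooth1M (smooth1_cst (2 * N%:R + 1)) (smooth1X (2 * N) sC)).
have j := Ci (smooth1B (smooth1M (smooth1_cst (2 * N%:R + 2)) (smooth1X (2 * N.+1) sC))
  (smooth1M (smooth1_cst (2 * N%:R + 1)) (smooth1X (2 * N) sC))).
have mI : measurable (`[0, 1]%classic : set B) by exact: measurable_itvB.
rewrite /f RintegralZl// RintegralB// RintegralZl// RintegralZl//.
move/eqP; rewrite mulf_eq0 gt_eqF ?pi_gt0//= subr_eq0 => /eqP; exact.
Qed.

Lemma cos_moment_gt0 N : 0 < cos_moment N.
Proof.
elim: N => [|N IH].
  rewrite /cos_moment muln0; under eq_Rintegral do rewrite expr0.
  by rewrite Rintegral_cst ?mul1r; [rewrite (_ : fine _ = 1)//|];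
    [rewrite /Defs.leb1 /= lebesgue_measure_itv/= lte_fin ltr01/= oppr0 addr0|exact: measurable_itvB].
have p (k : R) : 0 < k -> 0 < 2 * N%:R + k by move=> k0; rewrite ltr_wpDl// mulr_ge0.
have := cos_momentS N; have := mulr_gt0 (p 1 ltr01) IH => h e.
by rewrite -e pmulr_rgt0// in h; exact: p.
Qed.

(** A mollifier [k (x - y)] at the scale [1/M] on the circle that is a finite
    combination of products [e i x * e i y]. With it, mollified quantities are
    finite sums over the coefficients of the solution against smooth modes, and
    these are genuine functions of time. The majorant [d] of the derivative is kept
    smooth in order to be integrated by the same rules as [k], and the second
    moments are taken with [sin (pi s)^2], a periodic substitute for [s^2]. *)
Record sum_kernel (M : R) n (ka : 'I_n -> R) (e : 'I_n -> R -> R) (k d : R -> R) : Prop :=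
  SumKernel {
  kernel_se : forall i, smooth1 (e i);
  kernel_pe : forall i, per1 (e i);
  kernel_sk : smooth1 k;
  kernel_pk : per1 k;
  kernel_ge0 : forall s, 0 <= k s;
  kernel_sd : smooth1 d;
  kernel_pd : per1 d;
  kernel_derive : forall s, `|derive1 k s| <= d s;
  kernel_sum : forall x y, \sum_(i < n) ka i * (e i x * e i y) = k (x - y);
  kernel_int : \int[leb1]_(s in `[0, 1]) k s = 1;
  kernel_int2 : \int[leb1]_(s in `[0, 1]) (k s * sin (pi * s) ^+ 2) <= M ^- 2;
  kernel_intd : \int[leb1]_(s in `[0, 1]) d s <= 2 * pi * M;
  kernel_intd2 : \int[leb1]_(s in `[0, 1]) (d s * sin (pi * s) ^+ 2) <= 2 * pi / M }.

Let int3 (al be ga : R) (f g h : R -> R) : smooth1 f -> smooth1 g -> smooth1 h ->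
  \int[leb1]_(s in `[0, 1]) (al * f s + be * g s + ga * h s) =
  al * (\int[leb1]_(s in `[0, 1]) f s) + be * (\int[leb1]_(s in `[0, 1]) g s) +
  ga * (\int[leb1]_(s in `[0, 1]) h s).
Proof.
move=> sf sg sh; have mI : measurable (`[0, 1]%classic : set B) by exact: measurable_itvB.
have cf := smooth1M (smooth1_cst al) sf; have cg := smooth1M (smooth1_cst be) sg.
have ch := smooth1M (smooth1_cst ga) sh.
have i1 := Ci cf; have i2 := Ci cg; have i3 := Ci ch; have i12 := Ci (smooth1D cf cg).
have j1 := Ci sf; have j2 := Ci sg; have j3 := Ci sh.
by rewrite RintegralD// RintegralD// !RintegralZl.
Qed.

(** The kernel is a normalised power [cos^2N (pi s)]: by the binomial theorem it
    is a finite combination of products of functions of [x] and of [y] at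
    [s = x - y], and its moments follow from the recursion of the Wallis
    integrals. With [N = M^2] it concentrates at the scale [1/M]. *)
Lemma sum_kernel_exists (m : nat) : exists n ka e k d,
  @sum_kernel m.+1%:R n ka e k d.
Proof.
have [M ME M1] : exists2 M : R, m.+1%:R = M & 1 <= M.
  by exists m.+1%:R; rewrite // ler1n.
rewrite ME.
have M0 : 0 < M by apply: lt_le_trans M1.
pose N := (m.+1 ^ 2)%N; pose N' := N.-1.
have NE : N = N'.+1 by rewrite /N' prednK// expn_gt0.
have NM : N%:R = M ^+ 2 by rewrite /N natrX ME.
have N'M : N'%:R = M ^+ 2 - 1 by rewrite -NM NE -natr1 addrK.
pose a := cos_moment N'; pose b := cos_moment N; pose c := cos_moment N.+1.
have b0 : 0 < b by exact: cos_moment_gt0.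
have ea : (2 * M ^+ 2 - 1) * a = 2 * M ^+ 2 * b.
  have := cos_momentS N'; rewrite -NE -/a -/b N'M => h.
  by rewrite -[LHS](_ : (2 * (M ^+ 2 - 1) + 1) * a = _); [rewrite -h; ring|ring].
have ec : (2 * M ^+ 2 + 2) * c = (2 * M ^+ 2 + 1) * b.
  by have := cos_momentS N; rewrite -/c -/b NM.
have M2 : 1 <= M ^+ 2 by exact: exprn_ege1.
have p1 : 0 < 2 * M ^+ 2 - 1 by lra.
have p2 : 0 < 2 * M ^+ 2 + 2 by lra.
have aE : a = 2 * M ^+ 2 * b / (2 * M ^+ 2 - 1) by rewrite -ea mulrAC mulfV ?mul1r// gt_eqF.
have cE : c = (2 * M ^+ 2 + 1) * b / (2 * M ^+ 2 + 2) by rewrite -ec mulrAC mulfV ?mul1r// gt_eqF.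
pose k s := b^-1 * C s ^+ (2 * N).
(* By the inequality of the means, [2 |C S| <= C^2 / M + M S^2], and the right-hand
   side is, like [k], a combination of even powers of the cosine. *)
pose d s := pi * M ^+ 2 / b * (M^-1 * C s ^+ (2 * N) + M * (C s ^+ (2 * N') * S s ^+ 2)).
pose e (i : 'I_(2 * N).+1) s := C s ^+ (2 * N - i) * S s ^+ i.
pose ka (i : 'I_(2 * N).+1) := b^-1 * 'C(2 * N, i)%:R.
have C2 j s : C (s + 1) ^+ (2 * j) = C s ^+ (2 * j) by rewrite C1 !exprM sqrrN.
have CN s : C s ^+ (2 * N) = C s ^+ (2 * N') * C s ^+ 2.
  by rewrite -exprD; congr (_ ^+ _); rewrite NE mulnS addnC.
have CN1 s : C s ^+ (2 * N.+1) = C s ^+ (2 * N') * C s ^+ 2 * C s ^+ 2.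
  by rewrite -CN -exprD; congr (_ ^+ _); rewrite mulnS addnC.
have pi0 : 0 < (pi : R) := pi_gt0 R.
have sk : smooth1 k by apply: smooth1M; [exact: smooth1_cst|exact: smooth1X].
have s1 := smooth1X (2 * N') sC; have s2 := smooth1X (2 * N) sC; have s3 := smooth1X (2 * N.+1) sC.
have kE s : k s = 0 * C s ^+ (2 * N') + b^-1 * C s ^+ (2 * N) + 0 * C s ^+ (2 * N.+1).
  by rewrite /k; ring.
have k2E s : k s * S s ^+ 2 = 0 * C s ^+ (2 * N') + b^-1 * C s ^+ (2 * N) + - b^-1 * C s ^+ (2 * N.+1).
  by rewrite /k CS CN1 CN; ring.
pose A := pi * M ^+ 2 / b.
have dE s : d s = (A * M) * C s ^+ (2 * N') + (A * M^-1 - A * M) * C s ^+ (2 * N) + 0 * C s ^+ (2 * N.+1).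
  by rewrite /d -/A CS CN; ring.
have d2E s : d s * S s ^+ 2 = (A * M) * C s ^+ (2 * N') + (A * M^-1 - 2 * (A * M)) * C s ^+ (2 * N) +
    (A * M - A * M^-1) * C s ^+ (2 * N.+1).
  by rewrite /d -/A CS CN1 CN; ring.
have bn : b != 0 by rewrite gt_eqF.
have Mn : M != 0 by rewrite gt_eqF.
have p1n : 2 * M ^+ 2 - 1 != 0 by rewrite gt_eqF.
have p2n : 2 * M ^+ 2 + 2 != 0 by rewrite gt_eqF.
exists (2 * N).+1, ka, e, k, d; split.
- by move=> i; apply: smooth1M; exact: smooth1X.
- move=> i x; rewrite /e C1 S1 (exprNn (C x)) (exprNn (S x)) mulrACA -exprD subnK; last by rewrite -ltnS.
  by rewrite exprM sqrrN !expr1n mul1r.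
- exact: sk.
- by move=> s; rewrite /k C2.
- move=> s; rewrite /k exprM; apply: mulr_ge0; first by rewrite invr_ge0 ltW.
  by rewrite exprn_ge0// sqr_ge0.
- apply: (smooth1M (smooth1_cst _)); apply: smooth1D; apply: (smooth1M (smooth1_cst _)) => //.
  by apply: smooth1M => //; exact: smooth1X.
- by move=> s; rewrite /d !C2 S1 sqrrN.
- move=> s.
  have E2N : (2 * N)%N = (2 * N').+2 by rewrite NE mulnS.
  have E : derive1 k s = b^-1 * (2 * M ^+ 2) * (C s ^+ (2 * N') * C s) * - (pi * S s).
    have D : is_derive s (1 : R) k (b^-1 * ((2 * N')%N.+2%:R * C s ^+ (2 * N').+1 * - (pi * S s))).
      have D1 := is_deriveM (is_derive_cst b^-1 s (1 : R)) (derX (2 * N').+1 (dC s)).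
      rewrite /k E2N; apply: (is_derive_eq D1); rewrite /GRing.scale /=; ring.
    rewrite derive1E derive_val -E2N natrM NM (exprSr (C s) (2 * N')); ring.
  rewrite E; set q := C s ^+ (2 * N').
  have q0 : 0 <= q by rewrite /q exprM exprn_ge0// sqr_ge0.
  rewrite [X in `|X|](_ : _ = A * q * (- (2 * C s * S s))); last by rewrite /A; field; exact: bn.
  have A0 : 0 <= A by apply: divr_ge0; [apply: mulr_ge0; [exact: ltW|exact: sqr_ge0]|exact: ltW].
  have Aq0 : 0 <= A * q by rewrite mulr_ge0.
  rewrite normrM (ger0_norm Aq0) normrN /d -/A CN -/q.
  rewrite [leRHS](_ : _ = A * q * (M^-1 * C s ^+ 2 + M * S s ^+ 2)); last by ring.
  rewrite ler_wpM2l// ler_norml; apply/andP; split; rewrite -subr_ge0.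
    rewrite (_ : _ - _ = M^-1 * (C s + M * S s) ^+ 2); last by field; exact: Mn.
    by apply: mulr_ge0; [rewrite invr_ge0 ltW|exact: sqr_ge0].
  rewrite (_ : _ - _ = M^-1 * (C s - M * S s) ^+ 2); last by field; exact: Mn.
  by apply: mulr_ge0; [rewrite invr_ge0 ltW|exact: sqr_ge0].
- move=> x y; rewrite /k /C mulrBr cosB exprDn mulr_sumr; apply: eq_bigr => i _.
  by rewrite /ka /e /C /S -mulr_natl !exprMn; ring.
- under eq_Rintegral do rewrite kE; rewrite int3// -/(cos_moment _) -/(cos_moment N) -/b.
  by rewrite !mul0r add0r addr0 mulVf.
- under eq_Rintegral do rewrite -/(S _) k2E; rewrite int3// -/(cos_moment _) -/(cos_moment N) -/(cos_moment N.+1) -/b -/c.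
  rewrite cE (_ : _ + _ = (2 * M ^+ 2 + 2)^-1); last by field; rewrite bn p2n.
  by rewrite lef_pV2 ?posrE ?exprn_gt0//; lra.
- under eq_Rintegral do rewrite dE; rewrite int3// -/(cos_moment _) -/(cos_moment N) -/(cos_moment N.+1) -/a -/b -/c.
  rewrite aE (_ : _ + _ = pi * M * (1 + M ^+ 2 / (2 * M ^+ 2 - 1))); last by rewrite /A; field; rewrite bn Mn p1n.
  rewrite (_ : 2 * pi * M = pi * M * (1 + 1)); last by ring.
  have pM : 0 <= pi * M by rewrite mulr_ge0// ltW.
  by rewrite ler_wpM2l// lerD2l ler_pdivrMr// mul1r; lra.
- under eq_Rintegral do rewrite -/(S _) d2E; rewrite int3// -/(cos_moment _) -/(cos_moment N) -/(cos_moment N.+1) -/a -/b -/c.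
  rewrite aE cE (_ : _ + _ = pi / M * (M ^+ 2 / (2 * M ^+ 2 + 2) +
     3 * (M ^+ 2 / (2 * M ^+ 2 - 1)) * (M ^+ 2 / (2 * M ^+ 2 + 2)))); last first.
    by rewrite /A; field; rewrite bn Mn p1n p2n.
  rewrite (_ : 2 * pi / M = pi / M * (1 / 2 + 3 * 1 * (1 / 2))); last by field; exact: Mn.
  have h1 : M ^+ 2 / (2 * M ^+ 2 + 2) <= 1 / 2 by rewrite ler_pdivrMr//; lra.
  have h2 : M ^+ 2 / (2 * M ^+ 2 - 1) <= 1 by rewrite ler_pdivrMr//; lra.
  have n1 : 0 <= M ^+ 2 / (2 * M ^+ 2 + 2) by apply: divr_ge0; [exact: sqr_ge0|exact: ltW].
  have n2 : 0 <= M ^+ 2 / (2 * M ^+ 2 - 1) by apply: divr_ge0; [exact: sqr_ge0|exact: ltW].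
  have pM : 0 <= pi / M by apply: divr_ge0; exact: ltW.
  rewrite ler_wpM2l// lerD// ler_pM//; first by rewrite mulr_ge0.
  by rewrite ler_wpM2l.
Qed.

Lemma sum_kernel_derive M n (ka : 'I_n -> R) e k d : @sum_kernel M n ka e k d -> forall x y,
  \sum_(i < n) ka i * (derive1 (e i) x * e i y) = derive1 k (x - y) /\
  \sum_(i < n) ka i * (e i x * derive1 (e i) y) = - derive1 k (x - y).
Proof.
move=> K x y; have se := kernel_se K; have sk := kernel_sk K; have sE := kernel_sum K.
have D1 (z : R) : is_derive z (1 : R) (fun x => k (x - y)) (derive1 k (z - y)).
  by apply: is_derive_shift1; exact: smooth1_derive.
have D2 (z : R) : is_derive z (1 : R) (fun y => k (x - y)) (- derive1 k (x - z)).
  have Dr : is_derive z (1 : R) (fun r => x - r) (-1).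
    apply: (is_derive_eq (is_deriveB (is_derive_cst x z (1 : R)) (is_derive_id z (1 : R)))).
    by rewrite add0r.
  apply: (is_derive_eq (@is_derive1_comp _ k (fun r => x - r) z _ _ (smooth1_derive sk _) Dr)).
  by rewrite mulrN1.
split.
  have H1 : is_derive x (1 : R) (fun x => k (x - y))
      (\sum_(i < n) ka i * (derive1 (e i) x * e i y)).
    rewrite (_ : (fun x => k (x - y)) = \sum_(i < n) (fun x => ka i * (e i x * e i y))).
      apply: is_derive_sum => i.
      have H := is_deriveM (is_derive_cst (ka i) x (1 : R))
        (is_deriveM (smooth1_derive (se i) x) (is_derive_cst (e i y) x (1 : R))).
      by apply: (is_derive_eq H); rewrite /GRing.scale /=; ring.
    by apply/funext => z; rewrite fct_sumE sE.
  rewrite -(@is_derive_unique1 R (fun x => k (x - y)) (fun z => derive1 k (z - y)) x (D1 x)).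
  by rewrite (@is_derive_unique1 R _ (fun=> _) x H1).
have H1 : is_derive y (1 : R) (fun y => k (x - y))
    (\sum_(i < n) ka i * (e i x * derive1 (e i) y)).
  rewrite (_ : (fun y => k (x - y)) = \sum_(i < n) (fun y => ka i * (e i x * e i y))).
    apply: is_derive_sum => i.
    have H := is_deriveM (is_derive_cst (ka i) y (1 : R))
      (is_deriveM (is_derive_cst (e i x) y (1 : R)) (smooth1_derive (se i) y)).
    by apply: (is_derive_eq H); rewrite /GRing.scale /=; ring.
  by apply/funext => z; rewrite fct_sumE sE.
rewrite -(@is_derive_unique1 R (fun y => k (x - y)) (fun z => - derive1 k (x - z)) y (D2 y)).
by rewrite (@is_derive_unique1 R _ (fun=> _) y H1).
Qed.

End Kernel1.

(** * Bilinear forms *)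

Section ProductIntegral.
Context d1 d2 (T1 : measurableType d1) (T2 : measurableType d2) (R : realType).
Variables (m1 : {sigma_finite_measure set T1 -> \bar R})
          (m2 : {sigma_finite_measure set T2 -> \bar R}).

Lemma integral_product (A : set T1) (B : set T2) (f : T1 -> R) (g : T2 -> R) :
  measurable A -> measurable B -> measurable_fun setT f -> measurable_fun setT g ->
  m1.-integrable A (EFin \o f) -> m2.-integrable B (EFin \o g) ->
  (m1 \x m2)%E.-integrable (A `*` B) (fun p => (f p.1 * g p.2)%:E) /\
  \int[(m1 \x m2)%E]_(p in A `*` B) (f p.1 * g p.2) =
  (\int[m1]_(x in A) f x) * (\int[m2]_(y in B) g y).
Proof.
move=> mA mB mf mg fi gi; pose F (p : T1 * T2) := f p.1 * g p.2.
have mF : measurable_fun setT F.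
  by apply: measurable_funM; [exact: measurableT_comp mf measurable_fst|
    exact: measurableT_comp mg measurable_snd].
have Fi : (m1 \x m2)%E.-integrable (A `*` B) (EFin \o F).
  apply: (@integrable_prod2 _ _ _ _ _ m1 m2 _ _ mA mB F mF).
  have [/integrableP[_ fy] /integrableP[_ gy]] := (fi, gi).
  have f0 : (0 <= \int[m1]_(x in A) (`|f x|)%:E)%E.
    by apply: integral_ge0 => x _; rewrite lee_fin.
  have ffin : (\int[m1]_(x in A) (`|f x|)%:E)%E \is a fin_num by rewrite ge0_fin_numE.
  have mfn : measurable_fun A (fun x => (`|f x|)%:E).
    by apply/measurable_funTS/measurable_EFinP/measurableT_comp.
  have mgn : measurable_fun B (fun x => (`|g x|)%:E).
    by apply/measurable_funTS/measurable_EFinP/measurableT_comp.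
  rewrite (_ : integral _ _ _ = \int[m2]_(y in B) ((fine (\int[m1]_(x in A) (`|f x|)%:E))%:E * (`|g y|)%:E))%E.
    rewrite ge0_integralZl//; last by rewrite lee_fin fine_ge0.
    by rewrite fineK// lte_mul_pinfty.
  apply: eq_integral => y _; rewrite fineK// muleC -ge0_integralZl//.
  by apply: eq_integral => x _; rewrite /F /= normrM EFinM muleC.
split => //; rewrite [LHS](@Rfubini1 _ _ _ _ _ m1 m2 _ _ mA mB F Fi).
rewrite -(@RintegralZr _ _ _ m1 A f _ mA fi); apply: eq_Rintegral => x _.
exact: (@RintegralZl _ _ _ m2 B g (f x) mB gi).
Qed.

End ProductIntegral.

Section Bilinear.
Variable R : realType.
Local Notation B := (measurableTypeR R).
Local Notation V := (B * B * B)%type.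
Local Notation leb3 := (leb3 R).
Local Notation Q := (@cube R).
Local Notation vec3 := (vec3 R).
Local Notation mQQ := (sleb3 R \x sleb3 R)%E.
Local Notation QQ := (Q `*` Q : set (V * V)%type).
Implicit Types f g h u v w : vec3 -> R.

Let mQ : measurable (Q : set V) := @measurable_cube R.
Let mQQs : measurable QQ. Proof. exact: measurableX. Qed.

(** Measurability on the whole space is what translations and the theorem of
    Fubini need. *)
Definition cube_L1 f := measurable_fun setT (f : V -> R) /\
  leb3.-integrable Q (EFin \o f).

Lemma cube_L1_mul f h : cube_L1 f -> continuous h -> cube_L1 (fun X => f X * h X).
Proof.
move=> [mf fi] ch; have mh := continuous_measurable3 ch; split; first exact: measurable_funM.
have [M pM] := bounded_on_compact ch (@compact_cube R).
by apply: (integrable_mul_bounded (M := M)) => //; exact: measurable_funTS.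
Qed.

Lemma cube_L1_tensor f g : cube_L1 f -> cube_L1 g ->
  mQQ.-integrable QQ (fun p => (f p.1 * g p.2)%:E) /\
  \int[mQQ]_(p in QQ) (f p.1 * g p.2) =
  (\int[leb3]_(X in Q) f X) * (\int[leb3]_(X in Q) g X).
Proof.
by move=> [mf fi] [mg gi]; exact: (@integral_product _ _ _ _ R (sleb3 R) (sleb3 R)).
Qed.

Lemma Rintegral_tensor (a b c : R -> R) : smooth1 a -> smooth1 b -> smooth1 c ->
  \int[leb3]_(X in Q) tensor a b c X = (\int[leb1 R]_(s in `[0, 1]) a s) *
   (\int[leb1 R]_(s in `[0, 1]) b s) * (\int[leb1 R]_(s in `[0, 1]) c s).
Proof.
move=> sa sb sc; have mI : measurable (`[0, 1]%classic : set B) by exact: measurable_itvB.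
have i1 (f : R -> R) : smooth1 f -> (leb1 R).-integrable `[0, 1] (EFin \o f).
  by move=> sf; exact/continuous_integrable/smooth1_continuous.
have mm (f : R -> R) : smooth1 f -> measurable_fun [set: B] f by exact: smooth1_measurable.
have [iab Eab] := @integral_product _ _ B B R (leb1 R) (leb1 R) _ _ a b mI mI (mm _ sa) (mm _ sb) (i1 _ sa) (i1 _ sb).
have mab : measurable_fun [set: (B * B)%type] (fun p : B * B => a p.1 * b p.2).
  by apply: measurable_funM; [exact: measurableT_comp (mm _ sa) measurable_fst|
    exact: measurableT_comp (mm _ sb) measurable_snd].
have [_ E] := @integral_product _ _ (B * B)%type B R (sleb2 R) (leb1 R) _ _ (fun p => a p.1 * b p.2) c
  (@measurable_square R) mI mab (mm _ sc) iab (i1 _ sc).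
by rewrite -Eab -[RHS]E.
Qed.

Lemma Rintegral_sum d (T : measurableType d) (mu : {measure set T -> \bar R}) (D : set T)
    (I : Type) (s : seq I) (F : I -> T -> R) : measurable D ->
  (forall i, mu.-integrable D (EFin \o F i)) ->
  mu.-integrable D (EFin \o (fun x => \sum_(i <- s) F i x)) /\
  \int[mu]_(x in D) (\sum_(i <- s) F i x) = \sum_(i <- s) \int[mu]_(x in D) F i x.
Proof.
move=> mD iF; elim: s => [|i s [IH1 IH2]].
  split; first by apply: (eq_integrable mD (fun=> 0%E)) => [x _ /=|]; [rewrite big_nil|exact: integrable0].
  by rewrite big_nil; under eq_Rintegral do rewrite big_nil; rewrite Rintegral_cst// mul0r.
have H : mu.-integrable D (EFin \o (fun x => F i x + \sum_(j <- s) F j x)).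
  exact: (integrableD mD (iF i) IH1).
split; first by apply: (eq_integrable mD _ _ _ H) => x _ /=; rewrite big_cons.
under eq_Rintegral do rewrite big_cons.
by rewrite RintegralD// IH2 big_cons.
Qed.

Variables (J : finType).
Implicit Types (c : J -> R).

(** The double integral of [f X * g Y] against a kernel given as a sum of products
    of modes, written as a sum over the modes. *)
Definition bil c f g (H H' : J -> vec3 -> R) : R := \sum_p c p *
  ((\int[leb3]_(X in Q) (f X * H p X)) * (\int[leb3]_(X in Q) (g X * H' p X))).

Lemma bilE c f g (H H' : J -> vec3 -> R) (S : vec3 -> vec3 -> R) : cube_L1 f -> cube_L1 g ->
  (forall p, continuous (H p)) -> (forall p, continuous (H' p)) ->
  (forall X Y, \sum_p c p * (H p X * H' p Y) = S X Y) ->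
  mQQ.-integrable QQ (fun p => (f p.1 * g p.2 * S p.1 p.2)%:E) /\
  bil c f g H H' = \int[mQQ]_(p in QQ) (f p.1 * g p.2 * S p.1 p.2).
Proof.
move=> Lf Lg cH cH' SE.
pose F j (p : V * V) := c j * ((f p.1 * H j p.1) * (g p.2 * H' j p.2)).
have T j := cube_L1_tensor (cube_L1_mul Lf (cH j)) (cube_L1_mul Lg (cH' j)).
have iF j : mQQ.-integrable QQ (EFin \o F j).
  have [i _] := T j; have := integrableZl mQQs (c j) i.
  by apply: eq_integrable => // p _.
have FE p : \sum_j F j p = f p.1 * g p.2 * S p.1 p.2.
  by rewrite -SE mulr_sumr; apply: eq_bigr => j _; rewrite /F; ring.
have [iS ES] := Rintegral_sum (index_enum J) mQQs iF.
split; first by apply: (eq_integrable mQQs _ _ _ iS) => p _ /=; rewrite FE.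
transitivity (\sum_j \int[mQQ]_(p in QQ) F j p).
  by apply: eq_bigr => j _; have [i <-] := T j; rewrite /F RintegralZl.
by rewrite -ES; apply: eq_Rintegral => p _; rewrite FE.
Qed.

(** For a kernel [K (X - Y)], a derivative in [Y] is minus the derivative in [X]:
    this is the integration by parts of the argument. *)
Lemma bil_transfer c f g (H H' : J -> vec3 -> R) : cube_L1 f -> cube_L1 g ->
  (forall p, continuous (H p)) -> (forall p, continuous (H' p)) ->
  (forall X Y, \sum_p c p * (H p X * H' p Y) = - \sum_p c p * (H' p X * H p Y)) ->
  bil c f g H H' = - bil c f g H' H.
Proof.
move=> Lf Lg cH cH' E.
have [_ ->] := bilE Lf Lg cH cH' E.
have E2 X Y : \sum_p (- c p) * (H' p X * H p Y) = - \sum_p c p * (H' p X * H p Y).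
  by rewrite -sumrN; apply: eq_bigr => p _; rewrite mulNr.
have [_ <-] := bilE Lf Lg cH' cH E2.
by rewrite /bil -sumrN; apply: eq_bigr => p _; rewrite mulNr.
Qed.

End Bilinear.

Section Kernel3.
Variable R : realType.
Local Notation vec3 := (vec3 R).
Variables (M : R) (n : nat) (ka : 'I_n -> R) (e : 'I_n -> R -> R) (k d : R -> R).
Hypothesis K : sum_kernel M ka e k d.

Definition modes := ('I_n * 'I_n * 'I_n)%type.
Definition mode_coef (p : modes) : R := ka p.1.1 * ka p.1.2 * ka p.2.
Definition mode (p : modes) : vec3 -> R := tensor (e p.1.1) (e p.1.2) (e p.2).
Definition mode_x (p : modes) : vec3 -> R := tensor (derive1 (e p.1.1)) (e p.1.2) (e p.2).
Definition mode_y (p : modes) : vec3 -> R := tensor (e p.1.1) (derive1 (e p.1.2)) (e p.2).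
Definition mode_z (p : modes) : vec3 -> R := tensor (e p.1.1) (e p.1.2) (derive1 (e p.2)).

Lemma sum_modes (f g h : 'I_n -> R) :
  \sum_(p : modes) f p.1.1 * g p.1.2 * h p.2 =
  (\sum_i f i) * (\sum_i g i) * (\sum_i h i).
Proof. by rewrite big_distrlr pair_bigA big_distrlr pair_bigA. Qed.

Let sum_tensor (a b c a' b' c' : 'I_n -> R -> R) (X Y : vec3) :
  \sum_(p : modes) mode_coef p *
    (tensor (a p.1.1) (b p.1.2) (c p.2) X * tensor (a' p.1.1) (b' p.1.2) (c' p.2) Y) =
  (\sum_i ka i * (a i X.1.1 * a' i Y.1.1)) * (\sum_i ka i * (b i X.1.2 * b' i Y.1.2)) *
  (\sum_i ka i * (c i X.2 * c' i Y.2)).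
Proof.
by rewrite -sum_modes; apply: eq_bigr => p _; rewrite /mode_coef /tensor; ring.
Qed.

Lemma sum_mode X Y : \sum_p mode_coef p * (mode p X * mode p Y) = tensor k k k (X - Y).
Proof. by rewrite sum_tensor !(kernel_sum K). Qed.

Lemma sum_mode_x X Y :
  \sum_p mode_coef p * (mode p X * mode_x p Y) = - tensor (derive1 k) k k (X - Y) /\
  \sum_p mode_coef p * (mode_x p X * mode p Y) = tensor (derive1 k) k k (X - Y).
Proof.
have [d1 d2] := sum_kernel_derive K X.1.1 Y.1.1.
split.
  by rewrite [LHS](sum_tensor e e e (fun i => derive1 (e i)) e e X Y) !(kernel_sum K) d2 /tensor /= !mulNr.
by rewrite [LHS](sum_tensor (fun i => derive1 (e i)) e e e e e X Y) !(kernel_sum K) d1.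
Qed.

Lemma sum_mode_y X Y :
  \sum_p mode_coef p * (mode p X * mode_y p Y) = - tensor k (derive1 k) k (X - Y) /\
  \sum_p mode_coef p * (mode_y p X * mode p Y) = tensor k (derive1 k) k (X - Y).
Proof.
have [d1 d2] := sum_kernel_derive K X.1.2 Y.1.2.
split.
  by rewrite [LHS](sum_tensor e e e e (fun i => derive1 (e i)) e X Y) !(kernel_sum K) d2 /tensor /= mulrN mulNr.
by rewrite [LHS](sum_tensor e (fun i => derive1 (e i)) e e e e X Y) !(kernel_sum K) d1.
Qed.

Lemma sum_mode_z X Y :
  \sum_p mode_coef p * (mode p X * mode_z p Y) = - tensor k k (derive1 k) (X - Y) /\
  \sum_p mode_coef p * (mode_z p X * mode p Y) = tensor k k (derive1 k) (X - Y).
Proof.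
have [d1 d2] := sum_kernel_derive K X.2 Y.2.
split.
  by rewrite [LHS](sum_tensor e e e e e (fun i => derive1 (e i)) X Y) !(kernel_sum K) d2 /tensor /= mulrN.
by rewrite [LHS](sum_tensor e e (fun i => derive1 (e i)) e e e X Y) !(kernel_sum K) d1.
Qed.

Let se := kernel_se K.
Let sde i : smooth1 (derive1 (e i)). Proof. exact/smooth1_derive1/se. Qed.

Lemma continuous_tensor (a b c : R -> R) : smooth1 a -> smooth1 b -> smooth1 c ->
  continuous (tensor a b c : vec3 -> R).
Proof. by move=> sa sb sc; exact/smooth_continuous/smooth_tensor. Qed.

Lemma continuous_mode p : continuous (mode p). Proof. exact: continuous_tensor. Qed.
Lemma continuous_mode_x p : continuous (mode_x p). Proof. exact: continuous_tensor. Qed.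
Lemma continuous_mode_y p : continuous (mode_y p). Proof. exact: continuous_tensor. Qed.
Lemma continuous_mode_z p : continuous (mode_z p). Proof. exact: continuous_tensor. Qed.

End Kernel3.

(** * Moments of the kernel *)

Section Moments.
Variable R : realType.
Local Notation B := (measurableTypeR R).
Local Notation V := (B * B * B)%type.
Local Notation leb1 := (leb1 R).
Local Notation leb3 := (leb3 R).
Local Notation Q := (@cube R).
Local Notation vec3 := (vec3 R).
Local Notation mQQ := (sleb3 R \x sleb3 R)%E.
Local Notation QQ := (Q `*` Q : set (V * V)%type).
Implicit Types f g u v w : vec3 -> R.

Let mQ : measurable (Q : set V) := @measurable_cube R.

Lemma sin_ge_half (x : R) : 0 <= x -> x <= pi / 4 -> x * cos (pi / 4) <= sin x.
Proof.
move=> x0 x4.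
have D (t : R) : is_derive t (1 : R) sin (cos t) by exact: is_derive_sin.
have := ftc2 x0 D (@continuous_cos R); rewrite sin0 subr0 => <-.
have mI : measurable (`[0, x]%classic : set B) by exact: measurable_itvB.
have -> : x * cos (pi / 4) = \int[leb1]_(t in `[0, x]) cos (pi / 4).
  by rewrite Rintegral_cst// [X in fine X](leb1_itv0 x0) mulrC.
apply: le_Rintegral => //.
- exact: (continuous_integrable 0 x (@cst_continuous _ _ _)).
- exact: (continuous_integrable 0 x (@continuous_cos R)).
- move=> t; rewrite /= in_itv/= => /andP[t0 tx].
  have p0 := pi_gt0 R.
  by rewrite leNgt ltr_cos ?in_itv/= -?leNgt; lra.
Qed.

(** Doubling the angle, [sin (pi s) = 2 sin (pi s / 2) cos (pi s / 2) >= pi s / 2]. *)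
Lemma sqr_le_sin (s : R) : - (1 / 2) <= s <= 1 / 2 -> s ^+ 2 <= sin (pi * s) ^+ 2.
Proof.
have H (t : R) : 0 <= t -> t <= 1 / 2 -> t ^+ 2 <= sin (pi * t) ^+ 2.
  move=> t0 t2; have p2 := pi_ge2 R.
  have c2 : cos (pi / 4 : R) ^+ 2 = 1 / 2.
    have := @cosD R (pi / 4) (pi / 4); rewrite (_ : pi / 4 + pi / 4 = pi / 2); last by field.
    rewrite cos_pihalf -!expr2 sin2cos2; lra.
  have x0 : 0 <= pi * t / 2 by rewrite divr_ge0// mulr_ge0//; lra.
  have pt : pi * t <= pi * (1 / 2) by rewrite ler_wpM2l//; lra.
  have x4 : pi * t / 2 <= pi / 4 by lra.
  have h1 := sin_ge_half x0 x4.
  have p0 := pi_gt0 R.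
  have h2 : cos (pi / 4) <= cos (pi * t / 2) by rewrite leNgt ltr_cos ?in_itv/= -?leNgt; lra.
  have c0 : 0 <= cos (pi / 4 : R) by apply: cos_ge0_pihalf; rewrite /=; lra.
  have h3 : (pi * t / 2) * cos (pi / 4) * cos (pi / 4) <= sin (pi * t / 2) * cos (pi * t / 2).
    by rewrite ler_pM// mulr_ge0.
  have h4 : sin (pi * t) = 2 * (sin (pi * t / 2) * cos (pi * t / 2)).
    rewrite [in LHS](_ : pi * t = pi * t / 2 + pi * t / 2); last by field.
    by rewrite sinD; ring.
  have h5 : 2 * t <= pi * t by rewrite ler_wpM2r.
  rewrite -mulrA -expr2 c2 in h3.
  have h6 : t <= sin (pi * t) by rewrite h4; lra.
  by rewrite lerXn2r// nnegrE// (le_trans t0).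
move=> /andP[s1 s2]; have [s0|s0] := leP 0 s; first exact: H.
have := H (- s); rewrite mulrN sinN !sqrrN; apply; lra.
Qed.

(** Trades the power [gamma] for the square, at the price of choosing a scale:
    the first term is enough for [x <= dl], the second for [x >= dl]. *)
Lemma powR_split (gamma dl x : R) : 1 < gamma <= 2 -> 0 < dl -> 0 <= x ->
  x `^ gamma <= dl `^ gamma + dl `^ (gamma - 2) * x ^+ 2.
Proof.
move=> /andP[g1 g2] d0 x0; have g0 : 0 <= gamma by lra.
have [xd|dx] := leP x dl.
  apply: (@le_trans _ _ (dl `^ gamma)); first by rewrite ge0_ler_powR ?nnegrE// ltW.
  by rewrite lerDl mulr_ge0 ?powR_ge0 ?sqr_ge0.
have xp : 0 < x by exact: lt_trans dx.
apply: (@le_trans _ _ (dl `^ (gamma - 2) * x ^+ 2)); last by rewrite lerDr powR_ge0.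
have -> : x `^ gamma = x `^ (gamma - 2) * x ^+ 2.
  rewrite -(powR_mulrn 2 x0) -powRD; first by rewrite subrK.
  by rewrite (gt_eqF xp) implybT.
rewrite ler_wpM2r ?sqr_ge0//.
have g2' : 0 <= 2 - gamma by lra.
rewrite (_ : gamma - 2 = - (2 - gamma)); last by ring.
rewrite !powRN lef_pV2; first by rewrite ge0_ler_powR ?nnegrE// ltW.
- by rewrite posrE powR_gt0.
- by rewrite posrE powR_gt0.
Qed.

Definition m0 (a : R -> R) : R := \int[leb1]_(s in `[0, 1]) a s.
Definition m2 (a : R -> R) : R := \int[leb1]_(s in `[0, 1]) (a s * sin (pi * s) ^+ 2).

Let m0E (a : R -> R) : smooth1 a -> (\int[leb1]_(s in `[0%R, 1%R]) (a s)%:E = (m0 a)%:E)%E.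
Proof.
move=> sa; rewrite /m0 /Rintegral fineK//; apply: integrable_fin_num; first exact: measurable_itvB.
exact/continuous_integrable/smooth1_continuous.
Qed.

Lemma integral_tensor (a b c : R -> R) : smooth1 a -> smooth1 b -> smooth1 c ->
  (forall s, 0 <= a s) -> (forall s, 0 <= b s) -> (forall s, 0 <= c s) ->
  (\int[leb3]_(X in Q) (tensor a b c X)%:E = (m0 a * m0 b * m0 c)%:E)%E.
Proof.
move=> sa sb sc a0 b0 c0.
have mt := smooth1_measurableV sa sb sc.
have mI : measurable (`[0, 1]%classic : set B) by exact: measurable_itvB.
have mE (f : R -> R) : smooth1 f -> measurable_fun (`[0, 1]%classic : set B) (EFin \o f).
  by move=> sf; apply/measurable_funTS/measurable_EFinP; exact: smooth1_measurable.
have p0 (f : R -> R) : smooth1 f -> (forall s, 0 <= f s) -> 0 <= m0 f.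
  by move=> sf f0; apply: Rintegral_ge0.
rewrite leb3_cubeE; last 2 first.
- exact/measurable_EFinP.
- by move=> X; rewrite lee_fin /tensor !mulr_ge0.
transitivity (\int[leb1]_(x in `[0%R, 1%R]) ((a x)%:E * (m0 b * m0 c)%:E))%E.
  apply: eq_integral => x _.
  transitivity (\int[leb1]_(y in `[0%R, 1%R]) ((a x)%:E * ((b y)%:E * (m0 c)%:E)))%E.
    apply: eq_integral => y _.
    transitivity (\int[leb1]_(z in `[0%R, 1%R]) ((a x * b y)%:E * (c z)%:E))%E.
      by apply: eq_integral => z _; rewrite /tensor EFinM.
    rewrite ge0_integralZl//; last 3 first.
    - exact: mE.
    - by move=> z _; rewrite lee_fin.
    - by rewrite lee_fin mulr_ge0.
    by rewrite m0E// EFinM muleA.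
  rewrite ge0_integralZl//; last 3 first.
  - by apply: emeasurable_funM; [exact: mE|exact: measurable_cst].
  - by move=> y _; rewrite -EFinM lee_fin mulr_ge0 ?p0.
  - by rewrite lee_fin.
  congr (_ * _)%E; under eq_integral do rewrite muleC.
  rewrite ge0_integralZl//; last 3 first.
  - exact: mE.
  - by move=> z _; rewrite lee_fin.
  - by rewrite lee_fin p0.
  by rewrite m0E// -EFinM mulrC.
under eq_integral do rewrite muleC.
rewrite ge0_integralZl//; last 3 first.
- exact: mE.
- by move=> z _; rewrite lee_fin.
- by rewrite lee_fin mulr_ge0 ?p0.
by rewrite m0E// -EFinM; congr EFin; ring.
Qed.

(** Integrating the increment over the cube around the origin, the sine bound
    for [s^2] applies to each of its coordinates. *)
Definition center : vec3 := (1 / 2, 1 / 2, 1 / 2).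

Section weights.
Variables (a b c : R -> R) (gamma dl : R).
Hypotheses (sa : smooth1 a) (sb : smooth1 b) (sc : smooth1 c)
  (pa : per1 a) (pb : per1 b) (pc : per1 c)
  (a0 : forall s, 0 <= a s) (b0 : forall s, 0 <= b s) (c0 : forall s, 0 <= c s).
Hypotheses (hg : 1 < gamma <= 2) (d0 : 0 < dl).

Definition moment_bound : R := dl `^ gamma * (m0 a * m0 b * m0 c) +
  3 * dl `^ (gamma - 2) * (m2 a * m0 b * m0 c + m0 a * m2 b * m0 c + m0 a * m0 b * m2 c).

Let s2 (s : R) : R := sin (pi * s) ^+ 2.
Let ss2 : smooth1 s2.
Proof.
apply: smooth1X; apply: (smooth1_comp (@smooth1_sin R)).
by apply: (smooth1M (smooth1_cst pi) (@smooth1_id R)).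
Qed.
Let ps2 : per1 s2. Proof. by move=> s; rewrite /s2 mulrDr mulr1 sinDpi sqrrN. Qed.

(** After [powR_split], the square of the sum norm is at most three times the sum
    of the squares, and every square is bounded by a squared sine, so that the
    integral factors over the coordinates. *)
Lemma moment_le : (\int[leb3]_(xi in Q)
  (tensor a b c (xi - center)%R * n1 (xi - center)%R `^ gamma)%:E <= moment_bound%:E)%E.
Proof.
pose be := 3 * dl `^ (gamma - 2).
pose F (X : vec3) := dl `^ gamma * tensor a b c X + be * (tensor (fun s => a s * s2 s) b c X +
  tensor a (fun s => b s * s2 s) c X + tensor a b (fun s => c s * s2 s) X).
have sas := smooth1M sa ss2; have sbs := smooth1M sb ss2; have scs := smooth1M sc ss2.
have as0 s : 0 <= a s * s2 s by rewrite mulr_ge0// sqr_ge0.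
have bs0 s : 0 <= b s * s2 s by rewrite mulr_ge0// sqr_ge0.
have cs0 s : 0 <= c s * s2 s by rewrite mulr_ge0// sqr_ge0.
have be0 : 0 <= be by rewrite mulr_ge0 ?powR_ge0.
have t0 (x y z : R -> R) X : (forall s, 0 <= x s) -> (forall s, 0 <= y s) -> (forall s, 0 <= z s) ->
  0 <= tensor x y z X by move=> hx hy hz; rewrite /tensor !mulr_ge0.
have F0 X : 0 <= F X.
  apply: addr_ge0; apply: mulr_ge0; rewrite ?powR_ge0 ?t0//.
  by apply: addr_ge0; [apply: addr_ge0|]; apply: t0.
have mt := smooth1_measurableV sa sb sc.
have mt1 := smooth1_measurableV sas sb sc.
have mt2 := smooth1_measurableV sa sbs sc.
have mt3 := smooth1_measurableV sa sb scs.
have mF : measurable_fun setT (F : V -> R).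
  apply: measurable_funD; apply: measurable_funM => //.
  by apply: measurable_funD => //; exact: measurable_funD.
have pF : torus_periodic F.
  have pp (x : R -> R) : per1 x -> per1 (fun s => x s * s2 s) by move=> px s; rewrite px ps2.
  move=> X; rewrite /F.
  have [-> -> ->] := torus_periodic_tensor pa pb pc X.
  have [-> -> ->] := torus_periodic_tensor (pp a pa) pb pc X.
  have [-> -> ->] := torus_periodic_tensor pa (pp b pb) pc X.
  by have [-> -> ->] := torus_periodic_tensor pa pb (pp c pc) X.
have FE : (\int[leb3]_(X in Q) (F X)%:E = moment_bound%:E)%E.
  have ne (x : vec3 -> R) : measurable_fun setT (x : V -> R) -> measurable_fun Q (fun X : V => (x X)%:E).
    by move=> mx; apply/measurable_funTS/measurable_EFinP.
  have i0 := integral_tensor sa sb sc a0 b0 c0.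
  have i1 := integral_tensor sas sb sc as0 b0 c0.
  have i2 := integral_tensor sa sbs sc a0 bs0 c0.
  have i3 := integral_tensor sa sb scs a0 b0 cs0.
  transitivity (\int[leb3]_(X in Q) ((dl `^ gamma)%:E * (tensor a b c X)%:E +
    be%:E * ((tensor (fun s => a s * s2 s)%R b c X)%:E + (tensor a (fun s => b s * s2 s)%R c X)%:E +
      (tensor a b (fun s => c s * s2 s)%R X)%:E)))%E.
    by apply: eq_integral => X _; rewrite /F.
  rewrite ge0_integralD//; last 4 first.
  - by move=> X _; rewrite -EFinM lee_fin mulr_ge0 ?powR_ge0 ?t0.
  - by apply: measurable_funeM; exact: ne.
  - move=> X _; apply: mule_ge0; first by rewrite lee_fin.
    by apply: adde_ge0; [apply: adde_ge0|]; rewrite lee_fin t0.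
  - by apply: measurable_funeM; apply: emeasurable_funD; [apply: emeasurable_funD|]; exact: ne.
  rewrite ge0_integralZl//; last 3 first.
  - exact: ne.
  - by move=> X _; rewrite lee_fin t0.
  - by rewrite lee_fin powR_ge0.
  rewrite ge0_integralZl//; last 2 first.
  - by apply: emeasurable_funD; [apply: emeasurable_funD|]; exact: ne.
  - by move=> X _; apply: adde_ge0; [apply: adde_ge0|]; rewrite lee_fin t0.
  rewrite ge0_integralD//; last 4 first.
  - by move=> X _; apply: adde_ge0; rewrite lee_fin t0.
  - by apply: emeasurable_funD; exact: ne.
  - by move=> X _; rewrite lee_fin t0.
  - exact: ne.
  rewrite ge0_integralD//; last 4 first.
  - by move=> X _; rewrite lee_fin t0.
  - exact: ne.
  - by move=> X _; rewrite lee_fin t0.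
  - exact: ne.
  by rewrite i0 i1 i2 i3.
rewrite -FE -(@integral_cube_shift R (- center) F mF F0 pF).
apply: ge0_le_integral => //.
- by move=> X _; rewrite lee_fin mulr_ge0 ?t0 ?powR_ge0.
- apply: measurable_funTS; apply/measurable_EFinP; apply: measurable_funM.
    exact: measurable_shiftV.
  apply: (measurableT_comp (measurable_powR gamma)).
  have mS : measurable_fun setT (fun X : V => (X : vec3) - center : V) by exact: (@measurable_addV _ _ V).
  rewrite /n1; apply: measurable_funD; first apply: measurable_funD; apply: measurableT_comp => //.
  + exact: measurableT_comp (@measurable_p11 R) mS.
  + exact: measurableT_comp (@measurable_p12 R) mS.
  + exact: measurableT_comp (@measurable_p2 R) mS.
- by apply/measurable_funTS/measurable_EFinP; exact: measurable_shiftV.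
move=> X QX; rewrite lee_fin.
have : n1 (X - center) `^ gamma <= dl `^ gamma + be *
   (s2 (X - center).1.1 + s2 (X - center).1.2 + s2 (X - center).2).
  apply: le_trans (powR_split hg d0 (n1_ge0 _)) _.
  rewrite lerD2l /be [3 * _]mulrC -mulrA ler_wpM2l ?powR_ge0//.
  case: X QX => -[x y] z [[/= + +] +]; rewrite !in_itv/= => hx hy hz.
  have lx : - (1 / 2) <= x - 1 / 2 <= 1 / 2 by lra.
  have ly : - (1 / 2) <= y - 1 / 2 <= 1 / 2 by lra.
  have lz : - (1 / 2) <= z - 1 / 2 <= 1 / 2 by lra.
  have qx := sqr_le_sin lx; have qy := sqr_le_sin ly; have qz := sqr_le_sin lz.
  rewrite /n1 /s2 /=; apply: (@le_trans _ _ (3 * ((x - 1 / 2) ^+ 2 + (y - 1 / 2) ^+ 2 + (z - 1 / 2) ^+ 2))).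
    rewrite -(real_normK (num_real (x - _))) -(real_normK (num_real (y - _))) -(real_normK (num_real (z - _))).
    move: (`|x - _|) (`|y - _|) (`|z - _|) => p q r.
    rewrite -subr_ge0 (_ : _ - _ = (p - q) ^+ 2 + (q - r) ^+ 2 + (r - p) ^+ 2); last by ring.
    by rewrite !addr_ge0 ?sqr_ge0.
  by rewrite ler_wpM2l// !lerD.
move=> h; apply: (le_trans (ler_wpM2l (t0 a b c (X - center) a0 b0 c0) h)).
by rewrite le_eqVlt; apply/orP; left; apply/eqP; rewrite /F /tensor; ring.
Qed.

Variables (A : R) (u v w : vec3 -> R).
Hypothesis reg : slice_reg gamma A u v w.

(** For a fixed increment [X - Y] the integral in [Y] is the quantity bounded by
    [slice_diff]; it remains to integrate [|xi|^gamma] against the kernel. *)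
Lemma double_shift : (\int[mQQ]_(p in QQ) (((u p.1 - u p.2)%R ^+ 2 + (v p.1 - v p.2)%R ^+ 2)%R *
   weight u v w p.2 * tensor a b c (p.1 - p.2)%R)%:E <= (A * moment_bound)%:E)%E.
Proof.
have [mu mv mw pu pv pw si sd _] := reg.
pose F (p : V * V) : \bar R := (((u p.1 - u p.2) ^+ 2 + (v p.1 - v p.2) ^+ 2) *
   weight u v w p.2 * tensor a b c ((p.1 : vec3) - (p.2 : vec3)))%:E.
have W0 X : 0 <= weight u v w X by rewrite /weight !addr_ge0.
have t0 X : 0 <= tensor a b c X by rewrite /tensor !mulr_ge0.
have mW : measurable_fun setT (weight u v w : V -> R).
  by rewrite /weight; apply: measurable_funD; [apply: measurable_funD; [apply: measurable_funD|]|] => //;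
    exact: measurableT_comp.
have mt := smooth1_measurableV sa sb sc.
have m1 (f : vec3 -> R) : measurable_fun setT (f : V -> R) -> measurable_fun setT (fun p : V * V => f p.1).
  by move=> mf; exact: measurableT_comp mf measurable_fst.
have m2 (f : vec3 -> R) : measurable_fun setT (f : V -> R) -> measurable_fun setT (fun p : V * V => f p.2).
  by move=> mf; exact: measurableT_comp mf measurable_snd.
have mF : measurable_fun setT F.
  apply/measurable_EFinP; apply: measurable_funM; first apply: measurable_funM.
  - by apply: measurable_funD; apply: measurable_funX; apply: measurable_funB; (exact: m1 || exact: m2).
  - exact: m2.
  - apply: (measurableT_comp mt); apply: (measurable_addV measurable_fst).
    exact: (measurable_oppV measurable_snd).
have F0 p : (0 <= F p)%E by rewrite lee_fin !mulr_ge0// addr_ge0 ?sqr_ge0.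
rewrite [leLHS](@tonelli_prod2 _ _ _ _ _ (sleb3 R) (sleb3 R) _ _ mQ mQ F mF F0).
pose H (p : V * V) : \bar R := F (((p.1 : vec3) + ((p.2 : vec3) - center)) : V, p.2).
have mH : measurable_fun setT H.
  apply: measurableT_comp mF _.
  apply: (measurable_fun_pair (T1 := V)); last exact: measurable_snd.
  apply: (measurable_addV measurable_fst).
  by apply: (measurable_addV measurable_snd); exact: measurable_cst.
have H0 p : (0 <= H p)%E by exact: F0.
have -> : (\int[sleb3 R]_(Y in Q) \int[sleb3 R]_(X in Q) F (X, Y) =
    \int[sleb3 R]_(Y in Q) \int[sleb3 R]_(X in Q) H (X, Y))%E.
  apply: eq_integral => Y _.
  rewrite -[LHS](@integral_cube_shift R ((Y : vec3) - center) (fun X => fine (F (X, Y))))//.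
  - apply: measurableT_comp; first exact: fine_measurable.
    exact: (measurableT_comp mF (pair2_measurable Y)).
  - by move=> X; rewrite fine_ge0.
  - move=> X; rewrite /F /=.
    have [-> -> ->] := pu X; have [-> -> ->] := pv X.
    by have [-> -> ->] := torus_periodic_shift (- (Y : vec3)) (torus_periodic_tensor pa pb pc) X.
rewrite -(@tonelli_swap _ _ _ _ _ (sleb3 R) (sleb3 R) _ _ mQ mQ H mH H0).
have A0 : 0 <= A.
  rewrite -lee_fin; apply: le_trans si; apply: integral_ge0 => X _.
  by rewrite lee_fin mulr_ge0// !addr_ge0 ?sqr_ge0.
apply: (@le_trans _ _ (A%:E * \int[leb3]_(xi in Q)
  (tensor a b c (xi - center)%R * n1 (xi - center)%R `^ gamma)%:E)%E); last first.
  rewrite EFinM; apply: lee_wpmul2l; [by rewrite lee_fin|exact: moment_le].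
have mS : measurable_fun setT (fun X : V => (X : vec3) - center : V) by exact: (@measurable_addV _ _ V).
have mm : measurable_fun Q (fun xi : V => (tensor a b c ((xi : vec3) - center) * n1 ((xi : vec3) - center) `^ gamma)%:E).
  apply: measurable_funTS; apply/measurable_EFinP; apply: measurable_funM; first exact: measurable_shiftV.
  apply: (measurableT_comp (measurable_powR gamma)).
  rewrite /n1; apply: measurable_funD; first apply: measurable_funD; apply: measurableT_comp => //.
  + exact: measurableT_comp (@measurable_p11 R) mS.
  + exact: measurableT_comp (@measurable_p12 R) mS.
  + exact: measurableT_comp (@measurable_p2 R) mS.
rewrite -ge0_integralZl//; last by move=> X _; rewrite lee_fin mulr_ge0 ?powR_ge0.
apply: ge0_le_integral => //.
- by move=> X _; apply: integral_ge0.
- apply: measurable_funTS.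
  exact: (@measurable_tonelli1 _ _ _ _ _ (sleb3 R) _ mQ H mH H0).
- exact: measurable_funeM.
move=> xi _.
have -> : (\int[sleb3 R]_(Y in Q) H (xi, Y) = \int[leb3]_(Y in Q)
    ((tensor a b c (xi - center)%R)%:E * (sqdiff u v (xi - center)%R Y * weight u v w Y)%:E))%E.
  apply: eq_integral => Y _; rewrite /H /F /= -EFinM; congr EFin.
  rewrite (_ : (xi : vec3) + (Y - center) - Y = xi - center); last by rewrite addrA addrAC addrK.
  rewrite (_ : (xi : vec3) + (Y - center) = Y + (xi - center)); last by rewrite addrCA.
  by rewrite /sqdiff mulrC.
rewrite ge0_integralZl//; last 3 first.
- apply: measurable_funTS; apply/measurable_EFinP; apply: measurable_funM => //.
  by rewrite /sqdiff; apply: measurable_funD; apply: measurable_funX; apply: measurable_funB => //;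
    exact: measurable_shiftV.
- by move=> Y _; rewrite lee_fin mulr_ge0// /sqdiff addr_ge0 ?sqr_ge0.
- by rewrite lee_fin.
rewrite [leRHS](_ : _ = (tensor a b c (xi - center)%R)%:E *
    (A * n1 (xi - center)%R `^ gamma)%:E)%E; last by rewrite -!EFinM; congr EFin; ring.
by apply: lee_wpmul2l; [rewrite lee_fin|exact: sd].
Qed.

End weights.
End Moments.

(** * The flux through the scale of the kernel *)

Section Flux.
Variable R : realType.
Local Notation B := (measurableTypeR R).
Local Notation V := (B * B * B)%type.
Local Notation leb3 := (leb3 R).
Local Notation Q := (@cube R).
Local Notation vec3 := (vec3 R).
Local Notation mQQ := (sleb3 R \x sleb3 R)%E.
Local Notation QQ := (Q `*` Q : set (V * V)%type).

Let mQ : measurable (Q : set V) := @measurable_cube R.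
Let mQQs : measurable QQ. Proof. exact: measurableX. Qed.

Variables (gamma A : R) (u v w : vec3 -> R).
Hypothesis hg : 1 < gamma <= 2.
Hypothesis reg : slice_reg gamma A u v w.

Let mu := slice_mu reg.
Let mv := slice_mv reg.
Let mw := slice_mw reg.

Let q (X : vec3) : R := u X ^+ 2 + v X ^+ 2.
Let W := weight u v w.
Let W1 X : 1 <= W X. Proof. by rewrite /W /weight -!addrA lerDl !addr_ge0. Qed.
Let W0 X : 0 <= W X. Proof. exact: le_trans (W1 X). Qed.
Let mW : measurable_fun setT (W : V -> R).
Proof.
by rewrite /W /weight; apply: measurable_funD; [apply: measurable_funD; [apply: measurable_funD|]|] => //;
  exact: measurableT_comp.
Qed.
Let q0 X : 0 <= q X. Proof. by rewrite addr_ge0 ?sqr_ge0. Qed.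
Let mq : measurable_fun setT (q : V -> R).
Proof. by apply: measurable_funD; exact: measurable_funX. Qed.

Lemma slice_A_ge0 : 0 <= A.
Proof.
rewrite -lee_fin; apply: le_trans (slice_int reg); apply: integral_ge0 => X _.
by rewrite lee_fin mulr_ge0// !addr_ge0 ?sqr_ge0.
Qed.

Lemma cube_L1_weight (f : vec3 -> R) : measurable_fun setT (f : V -> R) ->
  (forall X, `|f X| <= (1 + q X) * W X) -> cube_L1 f.
Proof.
move=> mf h; split => //; apply/integrableP; split.
  by apply: measurable_funTS; exact/measurable_EFinP.
apply: (@le_lt_trans _ _ A%:E); last exact: ltry.
apply: le_trans (slice_int reg); apply: ge0_le_integral => //.
- by apply: measurable_funTS; apply/measurable_EFinP; exact: measurableT_comp.
- apply: measurable_funTS; apply/measurable_EFinP; apply: measurable_funM => //.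
  by apply: measurable_funD; [apply: measurable_funD|]=> //; exact: measurable_funX.
- by move=> X _; rewrite lee_fin (le_trans (h X))// /q addrA.
Qed.

(** The factor transported by the flux: a component of the velocity, or the
    constant one for the energy itself. *)
Definition controlled (h : vec3 -> R) := measurable_fun setT (h : V -> R) /\ forall X, `|h X| <= W X.

Lemma controlled_u : controlled u.
Proof. by split => // X; rewrite /W /weight; have := normr_ge0 (u X); have := normr_ge0 (v X); have := normr_ge0 (w X); lra. Qed.
Lemma controlled_v : controlled v.
Proof. by split => // X; rewrite /W /weight; have := normr_ge0 (u X); have := normr_ge0 (v X); have := normr_ge0 (w X); lra. Qed.
Lemma controlled_w : controlled w.
Proof. by split => // X; rewrite /W /weight; have := normr_ge0 (u X); have := normr_ge0 (v X); have := normr_ge0 (w X); lra. Qed.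
Lemma controlled_1 : controlled (fun=> 1).
Proof. by split => // X; rewrite normr1. Qed.

Let abs_le (f : vec3 -> R) X : (f = u \/ f = v) -> `|f X| <= 1 + q X.
Proof.
have H (x : R) : `|x| <= 1 + x ^+ 2.
  rewrite -(real_normK (num_real x)); have := sqr_ge0 (`|x| - 1); have := normr_ge0 x.
  by move: (`|x|) => y; nra.
have hu := H (u X); have hv := H (v X); have u2 := sqr_ge0 (u X); have v2 := sqr_ge0 (v X).
by rewrite /q; case=> ->; lra.
Qed.

Let L1h h : controlled h -> cube_L1 h.
Proof.
move=> [mh h1]; apply: cube_L1_weight => // X; apply: (le_trans (h1 X)).
by rewrite ler_peMl// lerDl.
Qed.

Let L1fh f h : (f = u \/ f = v) -> controlled h -> cube_L1 (fun X => f X * h X).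
Proof.
move=> hf [mh h1]; apply: cube_L1_weight.
  by apply: measurable_funM => //; case: hf => ->.
by move=> X; rewrite normrM ler_pM// abs_le.
Qed.

Let L1q : cube_L1 q.
Proof.
apply: cube_L1_weight => // X; rewrite ger0_norm//.
apply: (@le_trans _ _ (1 + q X)); first by rewrite lerDr.
by rewrite ler_peMr// addr_ge0.
Qed.

Let L1qh h : controlled h -> cube_L1 (fun X => q X * h X).
Proof.
move=> [mh h1]; apply: cube_L1_weight; first exact: measurable_funM.
by move=> X; rewrite normrM ler_pM// ger0_norm// lerDr.
Qed.

Let L1Z (k : R) f : cube_L1 f -> cube_L1 (fun X => k * f X).
Proof.
move=> [mf fi]; split; first exact: measurable_funM.
exact: (integrableZl mQ k fi).
Qed.

Variables (M : R) (n : nat) (ka : 'I_n -> R) (e : 'I_n -> R -> R) (k d : R -> R).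
Hypothesis M1 : 1 <= M.
Hypothesis K : sum_kernel M ka e k d.

Let E := mode e.
Let c := mode_coef ka.
Let cE : forall p, continuous (E p). Proof. exact: (continuous_mode K). Qed.

(** Polarisation turns products of values at two points into squares of
    increments, up to terms in which one of the points only enters through
    the kernel. *)
Definition polarised (h : vec3 -> R) (H : modes n -> vec3 -> R) : R :=
  bil c u (fun X => u X * h X) E H + bil c v (fun X => v X * h X) E H +
  bil c (fun X => - (1 / 2) * q X) h E H + bil c (fun=> 1) (fun X => - (1 / 2) * (q X * h X)) E H.

(** By [u X * u Y = (u X ^ 2 + u Y ^ 2 - (u X - u Y) ^ 2) / 2], the sum is minus half of
    the double integral of the squared increments times [h] against the kernel. *)
Lemma polarised_le h H (S : vec3 -> vec3 -> R) (a1 a2 a3 : R -> R) (dl : R) :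
  controlled h -> (forall p, continuous (H p)) ->
  (forall X Y, \sum_p c p * (E p X * H p Y) = S X Y) ->
  smooth1 a1 -> smooth1 a2 -> smooth1 a3 -> per1 a1 -> per1 a2 -> per1 a3 ->
  (forall s, 0 <= a1 s) -> (forall s, 0 <= a2 s) -> (forall s, 0 <= a3 s) -> 0 < dl ->
  (forall X Y, `|S X Y| <= tensor a1 a2 a3 (X - Y)) ->
  `|polarised h H| <= 1 / 2 * (A * moment_bound a1 a2 a3 gamma dl).
Proof.
move=> ch cH SE s1 s2 s3 p1 p2 p3 z1 z2 z3 dl0 Sle; have [mh h1] := ch.
have [i1 e1] := bilE (L1h controlled_u) (L1fh (or_introl erefl) ch) cE cH SE.
have [i2 e2] := bilE (L1h controlled_v) (L1fh (or_intror erefl) ch) cE cH SE.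
have [i3 e3] := bilE (L1Z (- (1 / 2)) L1q) (L1h ch) cE cH SE.
have [i4 e4] := bilE (L1h controlled_1) (L1Z (- (1 / 2)) (L1qh ch)) cE cH SE.
pose F (p : V * V) := - (1 / 2) * (((u p.1 - u p.2) ^+ 2 + (v p.1 - v p.2) ^+ 2) * h p.2 * S p.1 p.2).
pose F1 (p : V * V) := u p.1 * (u p.2 * h p.2) * S p.1 p.2.
pose F2 (p : V * V) := v p.1 * (v p.2 * h p.2) * S p.1 p.2.
pose F3 (p : V * V) := - (1 / 2) * q p.1 * h p.2 * S p.1 p.2.
pose F4 (p : V * V) := 1 * (- (1 / 2) * (q p.2 * h p.2)) * S p.1 p.2.
have j12 := integrableD mQQs i1 i2; have j123 := integrableD mQQs j12 i3.
have j := integrableD mQQs j123 i4.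
have FE p : F1 p + F2 p + F3 p + F4 p = F p by rewrite /F /F1 /F2 /F3 /F4 /q; field.
have iF : mQQ.-integrable QQ (EFin \o F).
  by apply: (eq_integrable mQQs _ _ _ j) => p _ /=; rewrite -FE.
have -> : polarised h H = \int[mQQ]_(p in QQ) F p.
  rewrite /polarised e1 e2 e3 e4.
  rewrite -[X in X + _ + _](@RintegralD _ _ _ mQQ QQ F1 F2 mQQs i1 i2).
  rewrite -[X in X + _](@RintegralD _ _ _ mQQ QQ (fun p => F1 p + F2 p) F3 mQQs j12 i3).
  rewrite -[LHS](@RintegralD _ _ _ mQQ QQ (fun p => F1 p + F2 p + F3 p) F4 mQQs j123 i4).
  by apply: eq_Rintegral => p _; exact: FE.
rewrite -lee_fin; apply: (@le_trans _ _ (\int[mQQ]_(p in QQ) (`|F p|)%:E)%E).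
  apply: (@le_trans _ _ (`|\int[mQQ]_(p in QQ) (F p)%:E|)%E).
    by rewrite /Rintegral; case: (integral _ _ _) => [z| |] /=; [exact: lexx|exact: leey|exact: leey].
  by apply: le_abse_integral => //; case/integrableP : iF.
have D := double_shift s1 s2 s3 p1 p2 p3 z1 z2 z3 hg dl0 reg.
pose G (p : V * V) := ((u p.1 - u p.2) ^+ 2 + (v p.1 - v p.2) ^+ 2) * W p.2 *
  tensor a1 a2 a3 ((p.1 : vec3) - (p.2 : vec3)).
have G0 p : 0 <= G p.
  by rewrite /G /tensor !mulr_ge0// addr_ge0 ?sqr_ge0.
have mG : measurable_fun setT G.
  have mm1 (f : vec3 -> R) : measurable_fun setT (f : V -> R) -> measurable_fun setT (fun p : V * V => f p.1).
    by move=> mf; exact: measurableT_comp mf measurable_fst.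
  have mm2 (f : vec3 -> R) : measurable_fun setT (f : V -> R) -> measurable_fun setT (fun p : V * V => f p.2).
    by move=> mf; exact: measurableT_comp mf measurable_snd.
  apply: measurable_funM; first apply: measurable_funM.
  - by apply: measurable_funD; apply: measurable_funX; apply: measurable_funB; (exact: mm1 || exact: mm2).
  - exact: mm2.
  - apply: (measurableT_comp (smooth1_measurableV s1 s2 s3)); apply: (measurable_addV measurable_fst).
    exact: (measurable_oppV measurable_snd).
have h2 : 0 <= 1 / 2 :> R by exact: divr_ge0.
have half0 : (0 <= (1 / 2 : R)%:E)%E by rewrite lee_fin.
have mGE : measurable_fun QQ (fun p => (G p)%:E).
  by apply: measurable_funTS; exact/measurable_EFinP.
have G0E p : QQ p -> (0 <= (G p)%:E)%E by rewrite lee_fin.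
apply: (@le_trans _ _ ((1 / 2)%:E * \int[mQQ]_(p in QQ) (G p)%:E)%E); last first.
  move: (moment_bound _ _ _ _ _) D => mb D.
  by rewrite (EFinM (1 / 2)); apply: lee_wpmul2l.
rewrite -(@ge0_integralZl _ _ _ mQQ QQ mQQs _ mGE (1 / 2)%:E G0E half0).
apply: ge0_le_integral => //.
- apply/measurable_EFinP; apply: measurableT_comp => //; apply/measurable_EFinP.
  by case/integrableP : iF.
- exact: measurable_funeM.
move=> p _; rewrite -EFinM lee_fin /F normrM normrN (ger0_norm h2).
rewrite ler_wpM2l//.
rewrite !normrM /G ler_pM ?Sle// ?mulr_ge0//.
by rewrite ger0_norm ?addr_ge0 ?sqr_ge0// ler_wpM2l ?addr_ge0 ?sqr_ge0// h1.
Qed.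

Let mx := mode_x e.
Let my := mode_y e.
Let mz := mode_z e.
Let cX : forall p, continuous (mx p). Proof. exact: (continuous_mode_x K). Qed.
Let cY : forall p, continuous (my p). Proof. exact: (continuous_mode_y K). Qed.
Let cZ : forall p, continuous (mz p). Proof. exact: (continuous_mode_z K). Qed.
Let rate := M `^ (1 - gamma).
Let rate0 : 0 <= rate. Proof. exact: powR_ge0. Qed.
Let M0 : 0 < M. Proof. exact: lt_le_trans M1. Qed.

Let scaleE : (M^-1) `^ gamma = rate / M /\ (M^-1) `^ (gamma - 2) = rate * M.
Proof.
have Mn : M != 0 by rewrite gt_eqF.
have H (t : R) : (M^-1) `^ t = M `^ (- t).
  by rewrite -(powR_inv1 (ltW M0)) -powRrM mulN1r.
rewrite !H /rate; split.
  rewrite -[X in _ / X](powRr1 (ltW M0)) -powRN -powRD ?Mn ?implybT//.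
  by congr (_ `^ _); ring.
rewrite -[X in _ * X](powRr1 (ltW M0)) -powRD ?Mn ?implybT//.
by congr (_ `^ _); ring.
Qed.

Let sin_ge0' (f : R -> R) : (forall s, 0 <= f s) -> 0 <= m0 f /\ 0 <= m2 f.
Proof.
move=> f0; split; first exact: Rintegral_ge0.
by apply: Rintegral_ge0 => s _; rewrite mulr_ge0// sqr_ge0.
Qed.

Let d0 s : 0 <= d s. Proof. exact: le_trans (normr_ge0 _) (kernel_derive K s). Qed.

(* One derivative of the kernel costs a factor [M], so the scale [1/M] leaves
   [M * M^(- gamma)]. *)
Let flux_moment : [/\ moment_bound d k k gamma M^-1 <= 20 * pi * rate,
  moment_bound k d k gamma M^-1 <= 20 * pi * rate &
  moment_bound k k d gamma M^-1 <= 20 * pi * rate].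
Proof.
have [x y] := scaleE; have [a0 a2] := sin_ge0' d0; have [b0 b2] := sin_ge0' (kernel_ge0 K).
have k1 : m0 k = 1 := kernel_int K; have k2 := kernel_int2 K; have e0 := kernel_intd K; have e2 := kernel_intd2 K.
have main : rate / M * m0 d + 3 * (rate * M) * (m2 d + 2 * (m0 d * m2 k)) <= 20 * pi * rate.
  have Mn : M != 0 by rewrite gt_eqF.
  rewrite [leRHS](_ : _ = rate / M * (2 * pi * M) + 3 * (rate * M) * (2 * pi / M + 2 * (2 * pi * M * M ^- 2))); last first.
    by field; exact: Mn.
  have rM : 0 <= rate / M by rewrite divr_ge0// ltW.
  have rM' : 0 <= 3 * (rate * M) by rewrite mulr_ge0// mulr_ge0// ltW.
  apply: lerD; first by rewrite ler_wpM2l.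
  rewrite ler_wpM2l// lerD// ler_wpM2l//; exact: ler_pM.
by split; rewrite /moment_bound x y k1; apply: le_trans main; rewrite le_eqVlt; apply/orP; left; apply/eqP; ring.
Qed.

Let energy_moment : moment_bound k k k gamma M^-1 <= 10 * rate.
Proof.
have [x y] := scaleE; have [b0 b2] := sin_ge0' (kernel_ge0 K).
have k1 : m0 k = 1 := kernel_int K; have k2 := kernel_int2 K.
have Mn : M != 0 by rewrite gt_eqF.
rewrite /moment_bound x y k1 (_ : _ + _ = rate / M + 9 * (rate * M) * m2 k); last by ring.
apply: (@le_trans _ _ (rate / M + 9 * (rate * M) * M ^- 2)).
  rewrite lerD2l ler_wpM2l// mulr_ge0// mulr_ge0// ltW//; exact: M0.
rewrite (_ : _ + _ = 10 * (rate / M)); last by field; exact: Mn.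
by rewrite ler_wpM2l// ler_piMr// invf_le1.
Qed.

Let int_mode_derive p : [/\ \int[leb3]_(X in Q) (1 * mx p X) = 0,
  \int[leb3]_(X in Q) (1 * my p X) = 0 & \int[leb3]_(X in Q) (1 * mz p X) = 0].
Proof.
have se i := kernel_se K i; have pe i := kernel_pe K i.
have z i : \int[leb1 R]_(s in `[0, 1]) derive1 (e i) s = 0.
  have D := smooth1_derive (se i).
  rewrite (ftc2 ler01 D (smooth1_continuous (smooth1_derive1 (se i)))).
  by rewrite -[X in e i X]add0r (pe i) subrr.
have sd i := smooth1_derive1 (se i).
split; under eq_Rintegral do rewrite mul1r.
- by rewrite (Rintegral_tensor (sd p.1.1) (se p.1.2) (se p.2)) z !mul0r.
- by rewrite (Rintegral_tensor (se p.1.1) (sd p.1.2) (se p.2)) z mulr0 mul0r.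
- by rewrite (Rintegral_tensor (se p.1.1) (se p.1.2) (sd p.2)) z mulr0.
Qed.

(* The terms with a constant in [X] vanish, as the kernel differentiated in [Y] is
   minus the one differentiated in [X], whose integral over a period is zero. *)
Let anti H : (forall X Y, \sum_p c p * (E p X * H p Y) = - \sum_p c p * (H p X * E p Y)) ->
  (forall p, continuous (H p)) -> (forall p, \int[leb3]_(X in Q) (1 * H p X) = 0) ->
  forall g, cube_L1 g -> bil c (fun=> 1) g E H = 0.
Proof.
move=> hE cH h0 g Lg; rewrite (bil_transfer (L1h controlled_1) Lg cE cH hE) /bil.
by rewrite big1 ?oppr0// => p _; rewrite h0 mul0r mulr0.
Qed.

Let antiX X Y : \sum_p c p * (E p X * mx p Y) = - \sum_p c p * (mx p X * E p Y).
Proof. by have [-> ->] := sum_mode_x K X Y. Qed.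
Let antiY X Y : \sum_p c p * (E p X * my p Y) = - \sum_p c p * (my p X * E p Y).
Proof. by have [-> ->] := sum_mode_y K X Y. Qed.
Let antiZ X Y : \sum_p c p * (E p X * mz p Y) = - \sum_p c p * (mz p X * E p Y).
Proof. by have [-> ->] := sum_mode_z K X Y. Qed.

Let int_mul f g : cube_L1 f -> continuous g -> leb3.-integrable Q (fun X => (f X * g X)%:E).
Proof. by move=> Lf cg; have [] := cube_L1_mul Lf cg. Qed.

Let div0 p : (\int[leb3]_(X in Q) (u X * mx p X)) + (\int[leb3]_(X in Q) (v X * my p X)) +
   (\int[leb3]_(X in Q) (w X * mz p X)) = 0.
Proof.
have i1 := int_mul (L1h controlled_u) (@cX p); have i2 := int_mul (L1h controlled_v) (@cY p).
have i3 := int_mul (L1h controlled_w) (@cZ p); have i12 := integrableD mQ i1 i2.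
have := slice_div reg (kernel_se K p.1.1) (kernel_se K p.1.2) (kernel_se K p.2)
  (kernel_pe K p.1.1) (kernel_pe K p.1.2) (kernel_pe K p.2).
rewrite (@RintegralD _ _ _ leb3 Q (fun X => u X * mx p X + v X * my p X) (fun X => w X * mz p X) mQ i12 i3).
by rewrite (@RintegralD _ _ _ leb3 Q (fun X => u X * mx p X) (fun X => v X * my p X) mQ i1 i2).
Qed.

Let advection f : (f = u \/ f = v) -> forall p,
  leb3.-integrable Q (fun X => (f X * (u X * mx p X + v X * my p X + w X * mz p X))%:E) /\
  \int[leb3]_(X in Q) (f X * (u X * mx p X + v X * my p X + w X * mz p X)) =
  (\int[leb3]_(X in Q) (f X * u X * mx p X)) + (\int[leb3]_(X in Q) (f X * v X * my p X)) +
  (\int[leb3]_(X in Q) (f X * w X * mz p X)).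
Proof.
move=> hf p.
have i1 := int_mul (L1fh hf controlled_u) (@cX p); have i2 := int_mul (L1fh hf controlled_v) (@cY p).
have i3 := int_mul (L1fh hf controlled_w) (@cZ p); have i12 := integrableD mQ i1 i2.
have i := integrableD mQ i12 i3.
have FE X : f X * u X * mx p X + f X * v X * my p X + f X * w X * mz p X =
  f X * (u X * mx p X + v X * my p X + w X * mz p X) by ring.
split; first by apply: (eq_integrable mQ _ _ _ i) => X _ /=; rewrite -FE.
under eq_Rintegral do rewrite -FE.
rewrite (@RintegralD _ _ _ leb3 Q (fun X => f X * u X * mx p X + f X * v X * my p X) (fun X => f X * w X * mz p X) mQ i12 i3).
by rewrite (@RintegralD _ _ _ leb3 Q (fun X => f X * u X * mx p X) (fun X => f X * v X * my p X) mQ i1 i2).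
Qed.

Definition coef (f : vec3 -> R) p : R := \int[leb3]_(X in Q) (f X * E p X).

Definition tendency (Om : R) (f g P : vec3 -> R) (m : modes n -> vec3 -> R) p : R :=
  \int[leb3]_(X in Q) (f X * (u X * mx p X + v X * my p X + w X * mz p X) +
    Om * g X * E p X + P X * m p X).

Let tendencyE Om f g P m p : (f = u \/ f = v) -> (g = u \/ g = v) -> cube_L1 P ->
  (forall p, continuous (m p)) ->
  tendency Om f g P m p = (\int[leb3]_(X in Q) (f X * u X * mx p X)) +
   (\int[leb3]_(X in Q) (f X * v X * my p X)) + (\int[leb3]_(X in Q) (f X * w X * mz p X)) +
   Om * coef g p + \int[leb3]_(X in Q) (P X * m p X).
Proof.
move=> hf hg' LP cm; have [i1 e1] := advection hf p.
have Lg : cube_L1 g by case: hg' => ->; apply: L1h; [exact: controlled_u|exact: controlled_v].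
have i2 := int_mul (L1Z Om Lg) (@cE p); have i3 := int_mul LP (cm p).
have i12 := integrableD mQ i1 i2.
rewrite /tendency (@RintegralD _ _ _ leb3 Q (fun X => f X * (u X * mx p X + v X * my p X + w X * mz p X) +
    Om * g X * E p X) (fun X => P X * m p X) mQ i12 i3).
rewrite (@RintegralD _ _ _ leb3 Q (fun X => f X * (u X * mx p X + v X * my p X + w X * mz p X))
  (fun X => Om * g X * E p X) mQ i1 i2) e1; congr (_ + _ + _).
rewrite /coef -(@RintegralZl _ _ _ leb3 Q (fun X => g X * E p X) Om mQ (int_mul Lg (@cE p))).
by apply: eq_Rintegral => X _; rewrite mulrA.
Qed.

(** The Coriolis force does no work, the pressure acts through [w d_z P = 0],
    and what remains of the advection is a double integral of squared
    increments against the gradient of the kernel. *)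
Lemma flux_le (Om : R) (P : vec3 -> R) : cube_L1 P ->
  (forall p, \int[leb3]_(X in Q) (P X * mz p X) = 0) ->
  `|\sum_p c p * (coef u p * tendency Om u v P mx p +
     coef v p * tendency (- Om) v u P my p)| <= A * (30 * pi * rate).
Proof.
move=> LP Pz; have hu : u = u \/ u = v by left.
have hv : v = u \/ v = v by right.
(* Moving the derivatives from [P] onto the velocity produces the divergence, up
   to the vertical term, and the latter is zero because [P] does not depend on
   the height. *)
have pressure : bil c u P E mx + bil c v P E my = 0.
  rewrite (bil_transfer (L1h controlled_u) LP cE cX antiX) (bil_transfer (L1h controlled_v) LP cE cY antiY).
  have : bil c w P E mz = 0.
    by rewrite /bil big1// => p _; rewrite Pz !mulr0.
  rewrite (bil_transfer (L1h controlled_w) LP cE cZ antiZ) => /eqP; rewrite oppr_eq0 => /eqP hz.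
  rewrite -opprD -[X in - X]addr0 -[X in - (_ + X)]hz /bil -!big_split/= big1 ?oppr0// => p _.
  by rewrite -!mulrDr -!mulrDl div0 mul0r mulr0.
have [bx by' bz] := flux_moment.
have dk s := kernel_derive K s; have k0 s := kernel_ge0 K s.
have sk := kernel_sk K; have sd := kernel_sd K; have pk := kernel_pk K; have pd := kernel_pd K.
have Mi : 0 < M^-1 by rewrite invr_gt0.
have A0 := slice_A_ge0.
have Tx : `|polarised u mx| <= 1 / 2 * (A * (20 * pi * rate)).
  have SE X Y : \sum_p c p * (E p X * mx p Y) = - tensor (derive1 k) k k (X - Y) by have [] := sum_mode_x K X Y.
  apply: (le_trans (polarised_le controlled_u cX SE sd sk sk pd pk pk d0 k0 k0 Mi _)).
    by move=> X Y; rewrite normrN /tensor !normrM !(ger0_norm (k0 _)) !ler_pM// mulr_ge0.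
  by rewrite ler_wpM2l// ler_wpM2l.
have Ty : `|polarised v my| <= 1 / 2 * (A * (20 * pi * rate)).
  have SE X Y : \sum_p c p * (E p X * my p Y) = - tensor k (derive1 k) k (X - Y) by have [] := sum_mode_y K X Y.
  apply: (le_trans (polarised_le controlled_v cY SE sk sd sk pk pd pk k0 d0 k0 Mi _)).
    by move=> X Y; rewrite normrN /tensor !normrM !(ger0_norm (k0 _)) !ler_pM// mulr_ge0.
  by rewrite ler_wpM2l// ler_wpM2l.
have Tz : `|polarised w mz| <= 1 / 2 * (A * (20 * pi * rate)).
  have SE X Y : \sum_p c p * (E p X * mz p Y) = - tensor k k (derive1 k) (X - Y) by have [] := sum_mode_z K X Y.
  apply: (le_trans (polarised_le controlled_w cZ SE sk sk sd pk pk pd k0 k0 d0 Mi _)).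
    by move=> X Y; rewrite normrN /tensor !normrM !(ger0_norm (k0 _)) !ler_pM// mulr_ge0.
  by rewrite ler_wpM2l// ler_wpM2l.
(* The squares at the point [X] meet the divergence of the velocity at [Y]. *)
have Z1 : bil c (fun X => - (1 / 2) * q X) u E mx + bil c (fun X => - (1 / 2) * q X) v E my +
    bil c (fun X => - (1 / 2) * q X) w E mz = 0.
  rewrite /bil -!big_split/= big1// => p _.
  by rewrite -!mulrDr div0 !mulr0.
have Z2x := anti antiX cX (fun p => let: And3 h _ _ := int_mode_derive p in h) (L1Z (- (1 / 2)) (L1qh controlled_u)).
have Z2y := anti antiY cY (fun p => let: And3 _ h _ := int_mode_derive p in h) (L1Z (- (1 / 2)) (L1qh controlled_v)).
have Z2z := anti antiZ cZ (fun p => let: And3 _ _ h := int_mode_derive p in h) (L1Z (- (1 / 2)) (L1qh controlled_w)).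
have -> : \sum_p c p * (coef u p * tendency Om u v P mx p + coef v p * tendency (- Om) v u P my p) =
    polarised u mx + polarised v my + polarised w mz.
  rewrite /polarised Z2x Z2y Z2z !addr0.
  transitivity ((bil c u (fun X => u X * u X) E mx + bil c v (fun X => v X * u X) E mx) +
     (bil c u (fun X => u X * v X) E my + bil c v (fun X => v X * v X) E my) +
     (bil c u (fun X => u X * w X) E mz + bil c v (fun X => v X * w X) E mz) +
     (bil c u P E mx + bil c v P E my)).
    rewrite /bil -!big_split; apply: eq_bigr => p _ /=.
    rewrite (tendencyE Om p hu hv LP cX) (tendencyE (- Om) p hv hu LP cY) /coef; ring.
  rewrite pressure addr0 -[LHS]addr0 -[X in _ + X = _]Z1; ring.
apply: le_trans (ler_normD _ _) _; apply: le_trans (lerD (ler_normD _ _) (lexx _)) _.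
apply: (le_trans (lerD (lerD Tx Ty) Tz)).
by rewrite le_eqVlt; apply/orP; left; apply/eqP; field.
Qed.

(** The same polarisation with the undifferentiated kernel: since the kernel has
    mass one, the squares at [X] and at [Y] add up to the energy. *)
Lemma energy_le : `|\sum_p c p * (coef u p ^+ 2 + coef v p ^+ 2) -
  \int[leb3]_(X in Q) (u X ^+ 2 + v X ^+ 2)| <= A * (5 * rate).
Proof.
have k0 s := kernel_ge0 K s; have sk := kernel_sk K; have pk := kernel_pk K.
have Mi : 0 < M^-1 by rewrite invr_gt0.
have A0 := slice_A_ge0.
have T := polarised_le controlled_1 cE (sum_mode K) sk sk sk pk pk pk k0 k0 k0 Mi.
have {}T : `|polarised (fun=> 1) E| <= 1 / 2 * (A * (10 * rate)).
  apply: (le_trans (T _)); last by rewrite ler_wpM2l// ler_wpM2l// energy_moment.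
  by move=> X Y; rewrite ger0_norm// /tensor !mulr_ge0.
apply: le_trans (le_trans T _); last by rewrite le_eqVlt; apply/orP; left; apply/eqP; field.
suff -> : polarised (fun=> 1) E = \sum_p c p * (coef u p ^+ 2 + coef v p ^+ 2) -
  \int[leb3]_(X in Q) (u X ^+ 2 + v X ^+ 2) by [].
have pkk : torus_periodic (tensor k k k : vec3 -> R) by exact: torus_periodic_tensor.
have ckk : continuous (tensor k k k : vec3 -> R) by exact: continuous_tensor.
have mass (X : vec3) : \int[leb3]_(Y in Q) tensor k k k (X - Y) = 1.
  have Lk : torus_L1 (tensor k k k : vec3 -> R).
    split => //; have [_] := cube_L1_mul (L1h controlled_1) ckk.
    by apply: eq_integrable => // Y _ /=; rewrite mul1r.
  rewrite (_ : Rintegral _ _ _ = \int[leb3]_(Y in Q) tensor k k k (Y + - X)).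
    by rewrite (Rintegral_shift (- X) Lk) Rintegral_tensor// (kernel_int K) !mulr1.
  apply: eq_Rintegral => Y _; rewrite -(sum_mode K X Y) -(sum_mode K Y X).
  by apply: eq_bigr => p _; rewrite [mode e p X * _]mulrC.
have half f : cube_L1 f -> bil c f (fun=> 1) E E = \int[leb3]_(X in Q) f X.
  move=> Lf; have [i ->] := bilE Lf (L1h controlled_1) cE cE (sum_mode K).
  rewrite (@Rfubini1 _ _ _ _ _ (sleb3 R) (sleb3 R) _ _ mQ mQ
    (fun p => f p.1 * 1 * tensor k k k ((p.1 : vec3) - (p.2 : vec3))) i).
  apply: eq_Rintegral => X _ /=; rewrite mulr1.
  have iX : (sleb3 R).-integrable Q (fun Y => (tensor k k k ((X : vec3) - (Y : vec3)))%:E).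
    have cX' : continuous (fun Y : vec3 => tensor k k k (X - Y)).
      move=> Y; apply: (continuous_comp (f := fun Y : vec3 => X - Y)); last exact: ckk.
      by apply: cvgB; [exact: cvg_cst|exact: cvg_id].
    have [_] := cube_L1_mul (L1h controlled_1) cX'.
    by apply: eq_integrable => // Y _ /=; rewrite mul1r.
  by rewrite [LHS](@RintegralZl _ _ _ (sleb3 R) Q _ (f X) mQ iX) [X in _ * X](mass X) mulr1.
have Lq2 := L1Z (- (1 / 2)) L1q.
have swap f : bil c (fun=> 1) f E E = bil c f (fun=> 1) E E.
  by rewrite /bil; apply: eq_bigr => p _; rewrite [X in _ * X]mulrC.
have Zq : \int[leb3]_(X in Q) (- (1 / 2) * q X) = - (1 / 2) * (\int[leb3]_(X in Q) q X).
  by rewrite RintegralZl//; exact: L1q.2.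
rewrite /polarised (half _ Lq2) swap.
rewrite (_ : (fun X => - (1 / 2) * (q X * 1)) = fun X => - (1 / 2) * q X); last first.
  by apply/funext => X; rewrite mulr1.
rewrite (half _ Lq2) Zq -/q.
have -> : bil c u (fun X => u X * 1) E E + bil c v (fun X => v X * 1) E E =
    \sum_p c p * (coef u p ^+ 2 + coef v p ^+ 2).
  rewrite /bil -big_split; apply: eq_bigr => p _ /=.
  rewrite /coef (_ : Rintegral leb3 Q (fun X => u X * 1 * E p X) = \int[leb3]_(X in Q) (u X * E p X)).
    rewrite (_ : Rintegral leb3 Q (fun X => v X * 1 * E p X) = \int[leb3]_(X in Q) (v X * E p X)).
      by rewrite -mulrDr !expr2.
    by apply: eq_Rintegral => X _; rewrite mulr1.
  by apply: eq_Rintegral => X _; rewrite mulr1.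
by rewrite -addrA -mulrDl -opprD (_ : 1 / 2 + 1 / 2 = 1) ?mulN1r//; field.
Qed.

End Flux.

(** * The evolution of the modes *)

Lemma test1_0 (R : realType) (T : R) : 0 < T -> test1 T (fun=> 0).
Proof.
move=> hT; split; first exact: smooth1_cst.
by exists (T / 3), (T / 2); split => //; lra.
Qed.

Section Evolution.
Variable R : realType.
Local Notation B := (measurableTypeR R).
Local Notation V := (B * B * B)%type.
Local Notation W := (B * B * B * B)%type.
Local Notation leb1 := (leb1 R).
Local Notation leb3 := (leb3 R).
Local Notation leb4 := (leb4 R).
Local Notation Q := (@cube R).
Local Notation vec3 := (vec3 R).
Local Notation spacetime := (spacetime R).

Let mQ : measurable (Q : set V) := @measurable_cube R.

Variables (T Omega gamma : R) (u v w P : spacetime -> R) (A : B -> R).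
Hypothesis hT : 0 < T.
Hypotheses (mu : measurable_fun setT (u : W -> R)) (mv : measurable_fun setT (v : W -> R))
  (mw : measurable_fun setT (w : W -> R)) (mP : measurable_fun setT (P : W -> R)).
Hypothesis hg : 1 < gamma <= 2.
Hypothesis A0 : forall t, 0 <= A t.
Hypothesis iA : leb1.-integrable `]0, T[ (EFin \o A).
Hypothesis reg : {ae leb1, forall t, 0 < t < T ->
      slice_reg gamma (A t) (slice u t) (slice v t) (slice w t)}.
Hypothesis iP : leb4.-integrable (torus_time T) (EFin \o P).
Hypothesis weak : weak_solution T Omega u v w P.

Local Notation TT := (torus_time T : set W).
Local Notation I := (`]0, T[%classic : set B).
Let mI : measurable I. Proof. exact: measurable_itvB. Qed.
Let mTT : measurable TT. Proof. exact: measurable_torus_time. Qed.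

(* Dominates all products of the velocities that occur, up to constants; its
   integral over the torus is bounded by [A]. *)
Let major (p : W) : R := (1 + u p ^+ 2 + v p ^+ 2) * (1 + `|u p| + `|v p| + `|w p|).

Let major0 p : 0 <= major p.
Proof. by rewrite /major mulr_ge0 ?addr_ge0 ?sqr_ge0. Qed.

Let mmajor : measurable_fun setT major.
Proof.
apply: measurable_funM.
  by apply: measurable_funD; [apply: measurable_funD|] => //; exact: measurable_funX.
apply: measurable_funD; [apply: measurable_funD; [apply: measurable_funD|]|] => //;
  exact: measurableT_comp.
Qed.

Let imajor : leb4.-integrable TT (EFin \o major).
Proof.
apply: (@integrable_prod2 _ _ _ _ _ (sleb3 R) leb1 _ _ mQ mI major mmajor).
have mn : measurable_fun setT (fun p : W => (`|major p|)%:E).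
  by apply/measurable_EFinP; exact: measurableT_comp.
have n0 (p : W) : (0 <= (`|major p|)%:E)%E by rewrite lee_fin.
apply: (@le_lt_trans _ _ (\int[leb1]_(t in I) (A t)%:E)%E); last first.
  have := integrable_fin_num mI iA; rewrite ge0_fin_numE//.
  by apply: integral_ge0 => t _; rewrite lee_fin.
apply: ae_ge0_le_integral => //.
- by move=> t _; exact: integral_ge0.
- apply: measurable_funTS.
  exact: (@measurable_tonelli2 _ _ _ _ _ (sleb3 R) _ mQ _ mn n0).
- by move=> t _; rewrite lee_fin.
- by case/integrableP : iA.
- apply: ae_imp reg => t H; rewrite /= in_itv/= => t0.
  apply: le_trans (slice_int (H t0)); rewrite le_eqVlt; apply/orP; left; apply/eqP.
  by apply: eq_integral => X _; rewrite ger0_norm.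
Qed.

Let dominated (f : W -> R) (C : R) : measurable_fun setT f ->
  (forall p, TT p -> `|f p| <= C * major p) -> leb4.-integrable TT (EFin \o f).
Proof.
move=> mf h; apply: (le_integrable mTT _ _ (integrableZl mTT C imajor)).
  by apply: measurable_funTS; exact/measurable_EFinP.
move=> p hp; suff : `|f p| <= `|C * major p| by rewrite -lee_fin.
by apply: (le_trans (h p hp)); exact: ler_norm.
Qed.

Let time_fubini (f : W -> R) (psi : R -> R) : measurable_fun setT f ->
  leb4.-integrable TT (EFin \o f) -> test1 T psi ->
  [/\ leb1.-integrable I (fun t => (\int[leb3]_(X in Q) f (X, t))%:E),
    leb4.-integrable TT (fun p => (f p * psi p.2)%:E) &
    \int[leb4]_(p in TT) (f p * psi p.2) =
    \int[leb1]_(t in I) ((\int[leb3]_(X in Q) f (X, t)) * psi t)].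
Proof.
move=> mf fi tp; have [M psiM] := test1_bounded hT tp.
have mp := smooth1_measurable tp.1.
have mp2 : measurable_fun setT (fun p : W => psi p.2) by exact: measurableT_comp mp measurable_snd.
have i1 := @integrable_Rfubini2 _ _ _ _ _ (sleb3 R) leb1 _ _ mQ mI f mf fi.
have i2 : leb4.-integrable TT (fun p => (f p * psi p.2)%:E).
  by apply: (integrable_mul_bounded (M := M)) => //; exact: measurable_funTS.
split => //.
have mF : measurable_fun setT (fun p : W => f p * psi p.2) by exact: measurable_funM.
rewrite [LHS](@Rfubini2 _ _ _ _ _ (sleb3 R) leb1 _ _ mQ mI (fun p => f p * psi p.2) mF i2).
have iL := @integrable_Rfubini2 _ _ _ _ _ (sleb3 R) leb1 _ _ mQ mI (fun p => f p * psi p.2) mF i2.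
have iR := integrable_test hT i1 tp.
rewrite /Rintegral; congr fine; apply: ae_eq_integral => //.
- by case/integrableP : iL.
- by case/integrableP : iR.
apply: ae_imp (@ae_integrable_fubini2 _ _ _ _ _ (sleb3 R) leb1 _ _ mQ mI f mf fi) => t H It.
by congr EFin; exact: (@RintegralZr _ _ _ (sleb3 R) Q (fun X => f (X, t)) (psi t) mQ (H It)).
Qed.

Section one_mode.
Variables (a b c : R -> R).
Hypotheses (sa : smooth1 a) (sb : smooth1 b) (sc : smooth1 c)
  (pa : per1 a) (pb : per1 b) (pc : per1 c).

Let E : vec3 -> R := tensor a b c.
Let EX : vec3 -> R := tensor (derive1 a) b c.
Let EY : vec3 -> R := tensor a (derive1 b) c.
Let EZ : vec3 -> R := tensor a b (derive1 c).

Lemma test_times_psi psi : test1 T psi -> test_function T (times_psi E psi).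
Proof.
move=> [sp [s [t [s0 tT out]]]]; split.
- exact: smooth_times_psi.
- move=> r X; have [h1 h2 h3] := torus_periodic_tensor pa pb pc X.
  by split; rewrite /slice /times_psi; congr (_ * _).
- by exists s, t; split => // X r nr; rewrite /times_psi /= out// mulr0.
Qed.

Let der psi : smooth1 psi -> forall p : spacetime,
  [/\ d_t (times_psi E psi) p = E p.1 * derive1 psi p.2,
    d_x (times_psi E psi) p = EX p.1 * psi p.2,
    d_y (times_psi E psi) p = EY p.1 * psi p.2 &
    d_z (times_psi E psi) p = EZ p.1 * psi p.2].
Proof.
move=> sp p; rewrite /d_t /d_x /d_y /d_z; split;
  by rewrite (derive_times_psi sa sb sc sp) /= ?mul0r ?mul1r ?addr0 ?add0r ?mul0r ?add0r ?addr0.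
Qed.

Let bounded_mode (h : vec3 -> R) : continuous h -> exists2 M, 0 <= M & forall X, Q X -> `|h X| <= M.
Proof.
move=> ch; have [M hM] := bounded_on_compact ch (@compact_cube R).
exists (Num.max 0 M); first by rewrite le_max lexx.
by move=> X QX; rewrite le_max hM// orbT.
Qed.

Let sda := smooth1_derive1 sa.
Let sdb := smooth1_derive1 sb.
Let sdc := smooth1_derive1 sc.
Let cE : continuous E. Proof. exact: continuous_tensor. Qed.
Let cEX : continuous EX. Proof. exact: continuous_tensor. Qed.
Let cEY : continuous EY. Proof. exact: continuous_tensor. Qed.
Let cEZ : continuous EZ. Proof. exact: continuous_tensor. Qed.
Let mfst (h : vec3 -> R) : continuous h -> measurable_fun setT (fun p : W => h p.1).
Proof. by move=> ch; exact: measurableT_comp (continuous_measurable3 ch) measurable_fst. Qed.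

(** Testing with a mode times a function of time, Fubini turns the weak formulation
    into a weak differential equation for the coefficient. Both momentum equations
    have this form. *)
Lemma evolution (f g : spacetime -> R) (Om : R) (m : vec3 -> R) :
  (f = u \/ f = v) -> (g = u \/ g = v) -> continuous m ->
  (forall psi, test1 T psi -> \int[leb4]_(p in TT) (f p * (E p.1 * derive1 psi p.2)
    + f p * (u p * (EX p.1 * psi p.2) + v p * (EY p.1 * psi p.2) + w p * (EZ p.1 * psi p.2))
    + Om * g p * (E p.1 * psi p.2) + P p * (m p.1 * psi p.2)) = 0) ->
  let U t := \int[leb3]_(X in Q) (f (X, t) * E X) in
  let G t := \int[leb3]_(X in Q) (f (X, t) * (u (X, t) * EX X + v (X, t) * EY X + w (X, t) * EZ X)
    + Om * g (X, t) * E X + P (X, t) * m X) in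
  [/\ leb1.-integrable I (EFin \o U), leb1.-integrable I (EFin \o G) &
    forall psi, test1 T psi -> \int[leb1]_(t in I) (U t * derive1 psi t + G t * psi t) = 0].
Proof.
move=> hf hg' cm weakf U G.
have mf : measurable_fun setT (f : W -> R) by case: hf => ->.
have mg : measurable_fun setT (g : W -> R) by case: hg' => ->.
pose F1 (p : W) := f p * E p.1.
pose F2 (p : W) := f p * (u p * EX p.1 + v p * EY p.1 + w p * EZ p.1) + Om * g p * E p.1.
pose F3 (p : W) := P p * m p.1.
pose F4 (p : W) := F2 p + F3 p.
have [ME ME0 hE] := bounded_mode cE; have [MX MX0 hX] := bounded_mode cEX.
have [MY MY0 hY] := bounded_mode cEY; have [MZ MZ0 hZ] := bounded_mode cEZ.
have [MP MP0 hP] := bounded_mode cm.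
have mF1 : measurable_fun setT F1 by apply: measurable_funM => //; exact: mfst.
have mF2 : measurable_fun setT F2.
  apply: measurable_funD; apply: measurable_funM => //; [|exact: measurable_funM|exact: mfst].
  by apply: measurable_funD; [apply: measurable_funD|]; apply: measurable_funM => //; exact: mfst.
have mF3 : measurable_fun setT F3 by apply: measurable_funM => //; exact: mfst.
have fle (h : spacetime -> R) p : (h = u \/ h = v) -> `|h p| <= 1 + u p ^+ 2 + v p ^+ 2.
  have H (x : R) : `|x| <= 1 + x ^+ 2.
    rewrite -(real_normK (num_real x)); have := sqr_ge0 (`|x| - 1); have := normr_ge0 x.
    by move: (`|x|) => y; nra.
  have h1 := H (u p); have h2 := H (v p); have u2 := sqr_ge0 (u p); have v2 := sqr_ge0 (v p).
  by case=> ->; [apply: (le_trans h1); rewrite lerDl|apply: (le_trans h2); rewrite addrAC lerDl].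
have wt1 p : 1 <= 1 + `|u p| + `|v p| + `|w p| by rewrite -!addrA lerDl !addr_ge0.
have hle (h : spacetime -> R) p : (h = u \/ h = v) -> `|h p| <= major p.
  move=> hh; apply: (le_trans (fle h p hh)); rewrite /major ler_peMr//.
  by rewrite !addr_ge0 ?sqr_ge0.
have i1 : leb4.-integrable TT (EFin \o F1).
  apply: (dominated (C := ME)) => // -[X t] [/= QX _].
  by rewrite /F1 /= (normrM (f (X, t))) mulrC ler_pM ?hE// hle.
have i2 : leb4.-integrable TT (EFin \o F2).
  apply: (dominated (C := MX + MY + MZ + `|Om| * ME)) => // -[X t] [/= QX _].
  rewrite /F2 /=; apply: le_trans (ler_normD _ _) _; rewrite mulrDl; apply: lerD; last first.
    rewrite (normrM (Om * g (X, t))) (normrM Om) [leLHS]mulrAC; apply: ler_pM => //; last exact: hle.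
    by apply: ler_wpM2l => //; exact: hE.
  rewrite (normrM (f (X, t))) mulrC; apply: (@le_trans _ _ (((MX + MY + MZ) *
     (1 + `|u (X, t)| + `|v (X, t)| + `|w (X, t)|)) * (1 + u (X, t) ^+ 2 + v (X, t) ^+ 2))); last first.
    by rewrite /major -mulrA [X in _ * X]mulrC.
  rewrite ler_pM ?fle//; apply: le_trans (ler_normD _ _) _.
  apply: le_trans (lerD (ler_normD _ _) (lexx _)) _.
  rewrite (normrM (u (X, t))) (normrM (v (X, t))) (normrM (w (X, t))).
  have p1 : `|u (X, t)| * `|EX X| <= (1 + `|u (X, t)| + `|v (X, t)| + `|w (X, t)|) * MX.
    apply: ler_pM; rewrite ?hX//; rewrite [X in _ <= X + _ + _]addrC -!addrA lerDl !addr_ge0//.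
  have p2 : `|v (X, t)| * `|EY X| <= (1 + `|u (X, t)| + `|v (X, t)| + `|w (X, t)|) * MY.
    apply: ler_pM; rewrite ?hY//; rewrite [X in _ <= X + _]addrC -!addrA lerDl !addr_ge0//.
  have p3 : `|w (X, t)| * `|EZ X| <= (1 + `|u (X, t)| + `|v (X, t)| + `|w (X, t)|) * MZ.
    by apply: ler_pM; rewrite ?hZ//; rewrite lerDr !addr_ge0.
  apply: (le_trans (lerD (lerD p1 p2) p3)).
  by rewrite le_eqVlt; apply/orP; left; apply/eqP; ring.
have i3 : leb4.-integrable TT (EFin \o F3).
  apply: (integrable_mul_bounded (M := MP)) => //; first by apply: measurable_funTS; exact: mfst.
  by move=> [X t] [/= QX _]; exact: hP.
have mF4 : measurable_fun setT F4 by exact: measurable_funD.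
have i4 : leb4.-integrable TT (EFin \o F4) by exact: (integrableD mTT i2 i3).
have UE t : U t = \int[leb3]_(X in Q) F1 (X, t) by [].
have GE t : G t = \int[leb3]_(X in Q) F4 (X, t) by [].
have tp0 := test1_0 hT.
have [j1 _ _] := time_fubini mF1 i1 tp0; have [j4 _ _] := time_fubini mF4 i4 tp0.
split => // psi tp; have td := test1_derive tp.
have [_ k1 e1] := time_fubini mF1 i1 td; have [_ k4 e4] := time_fubini mF4 i4 tp.
have tU := integrable_test hT j1 td; have tG := integrable_test hT j4 tp.
rewrite (@RintegralD _ _ _ leb1 I (fun t => U t * derive1 psi t) (fun t => G t * psi t) mI tU tG).
rewrite -[X in X + _]e1 -[X in _ + X]e4.
rewrite -(@RintegralD _ _ _ leb4 TT (fun p => F1 p * derive1 psi p.2) (fun p => F4 p * psi p.2) mTT k1 k4).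
rewrite -[RHS](weakf psi tp); apply: eq_Rintegral => p _.
by rewrite /F1 /F4 /F2 /F3; ring.
Qed.

Lemma evolution_u : let U t := \int[leb3]_(X in Q) (u (X, t) * E X) in
  let G t := \int[leb3]_(X in Q) (u (X, t) * (u (X, t) * EX X + v (X, t) * EY X + w (X, t) * EZ X)
    + Omega * v (X, t) * E X + P (X, t) * EX X) in
  [/\ leb1.-integrable I (EFin \o U), leb1.-integrable I (EFin \o G) &
    forall psi, test1 T psi -> \int[leb1]_(t in I) (U t * derive1 psi t + G t * psi t) = 0].
Proof.
apply: (@evolution u v Omega EX) => //; [by left|by right|].
move=> psi tp; have tf := test_times_psi tp; have [<- _ _] := weak tf tf tf.
by apply: eq_Rintegral => p _; have [-> -> -> ->] := der tp.1 p.
Qed.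

Lemma evolution_v : let U t := \int[leb3]_(X in Q) (v (X, t) * E X) in
  let G t := \int[leb3]_(X in Q) (v (X, t) * (u (X, t) * EX X + v (X, t) * EY X + w (X, t) * EZ X)
    + - Omega * u (X, t) * E X + P (X, t) * EY X) in
  [/\ leb1.-integrable I (EFin \o U), leb1.-integrable I (EFin \o G) &
    forall psi, test1 T psi -> \int[leb1]_(t in I) (U t * derive1 psi t + G t * psi t) = 0].
Proof.
apply: (@evolution v u (- Omega) EY) => //; [by right|by left|].
move=> psi tp; have tf := test_times_psi tp; have [_ <- _] := weak tf tf tf.
by apply: eq_Rintegral => p _; have [-> -> -> ->] := der tp.1 p; rewrite !mulNr.
Qed.

(** Testing with all functions of time gives the vertical balance at almost every
    time; for finitely many modes the exceptional times form a negligible set. *)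
Lemma pressure_z : {ae leb1, forall t, 0 < t < T ->
  \int[leb3]_(X in Q) (P (X, t) * EZ X) = 0}.
Proof.
pose F (p : W) := P p * EZ p.1.
have mF : measurable_fun setT F by apply: measurable_funM => //; exact: mfst.
have [M M0 hM] := bounded_mode cEZ.
have iF : leb4.-integrable TT (EFin \o F).
  apply: (integrable_mul_bounded (M := M)) => //; first by apply: measurable_funTS; exact: mfst.
  by move=> [X t] [/= QX _]; exact: hM.
have tp0 := test1_0 hT.
have [j _ _] := time_fubini mF iF tp0.
apply: (time_unique hT j) => psi tp; have [_ _ <-] := time_fubini mF iF tp.
have tf := test_times_psi tp; have [_ _ <-] := weak tf tf tf.
apply: eq_Rintegral => p _; have [_ _ _ ->] := der tp.1 p.
by rewrite /F mulrA.
Qed.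

End one_mode.
End Evolution.

(** * Conservation of energy *)

Section Conservation.
Variable R : realType.
Local Notation B := (measurableTypeR R).
Local Notation V := (B * B * B)%type.
Local Notation W := (B * B * B * B)%type.
Local Notation leb1 := (leb1 R).
Local Notation leb3 := (leb3 R).
Local Notation leb4 := (leb4 R).
Local Notation Q := (@cube R).
Local Notation vec3 := (vec3 R).
Local Notation spacetime := (spacetime R).

Let mQ : measurable (Q : set V) := @measurable_cube R.

Lemma ae_fin d (T : measurableType d) (mu : {measure set T -> \bar R}) (J : finType)
    (P : J -> T -> Prop) : (forall j, {ae mu, forall x, P j x}) ->
  {ae mu, forall x, forall j, P j x}.
Proof.
move=> H; have : {ae mu, forall x, forall j, j \in enum J -> P j x}.
  elim: (enum J) => [|i s IH]; first by apply: aeW => x j; rewrite in_nil.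
  apply: ae_imp2 (H i) IH => x h1 h2 j; rewrite inE => /orP[/eqP ->//|]; exact: h2.
by apply: ae_imp => x h j; apply: h; rewrite mem_enum.
Qed.

Variables (T Omega gamma : R) (u v w P : spacetime -> R) (A : B -> R).
Hypothesis hT : 0 < T.
Hypotheses (mu : measurable_fun setT (u : W -> R)) (mv : measurable_fun setT (v : W -> R))
  (mw : measurable_fun setT (w : W -> R)) (mP : measurable_fun setT (P : W -> R)).
Hypothesis hg : 1 < gamma <= 2.
Hypothesis A0 : forall t, 0 <= A t.
Hypothesis iA : leb1.-integrable `]0, T[ (EFin \o A).
Hypothesis reg : {ae leb1, forall t, 0 < t < T ->
      slice_reg gamma (A t) (slice u t) (slice v t) (slice w t)}.
Hypothesis iP : leb4.-integrable (torus_time T) (EFin \o P).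
Hypothesis weak : weak_solution T Omega u v w P.

Local Notation I := (`]0, T[%classic : set B).
Let mI : measurable I. Proof. exact: measurable_itvB. Qed.

Let IA := \int[leb1]_(t in `]0, T[) A t.
Let IAE : (\int[leb1]_(t in `]0%R, T[) (A t)%:E = IA%:E)%E.
Proof. by rewrite /IA /Rintegral fineK//; exact: integrable_fin_num. Qed.

Definition kinetic (t : R) : R := \int[leb3]_(X in Q) (u (X, t) ^+ 2 + v (X, t) ^+ 2).

Section at_scale.
Variables (M : R) (n : nat) (ka : 'I_n -> R) (e : 'I_n -> R -> R) (k d : R -> R).
Hypothesis M1 : 1 <= M.
Hypothesis K : sum_kernel M ka e k d.

Let c := mode_coef ka.
Let rate := M `^ (1 - gamma).
Let U p t := coef e (slice u t) p.
Let V' p t := coef e (slice v t) p.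
Let G p t := tendency (slice u t) (slice v t) (slice w t) e Omega
  (slice u t) (slice v t) (slice P t) (mode_x e) p.
Let H p t := tendency (slice u t) (slice v t) (slice w t) e (- Omega)
  (slice v t) (slice u t) (slice P t) (mode_y e) p.

Let evU p := evolution_u hT mu mv mw mP A0 iA reg iP weak
  (kernel_se K p.1.1) (kernel_se K p.1.2) (kernel_se K p.2)
  (kernel_pe K p.1.1) (kernel_pe K p.1.2) (kernel_pe K p.2).
Let evV p := evolution_v hT mu mv mw mP A0 iA reg iP weak
  (kernel_se K p.1.1) (kernel_se K p.1.2) (kernel_se K p.2)
  (kernel_pe K p.1.1) (kernel_pe K p.1.2) (kernel_pe K p.2).

Let sliceP : {ae leb1, forall t, 0 < t < T -> cube_L1 (slice P t)}.
Proof.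
apply: ae_imp (@ae_integrable_fubini2 _ _ _ _ _ (sleb3 R) leb1 _ _ mQ mI P mP iP) => t h t0.
split; last by apply: h; rewrite /= in_itv.
exact: (measurableT_comp mP (pair2_measurable t)).
Qed.

(** The energy at the scale [1/M] is the sum over the modes of the squares of the
    continuous representatives of the coefficients: being a primitive of the flux
    it varies little, and it is close to the kinetic energy. *)
Lemma energy_at_scale : exists EK : R -> R,
  {ae leb1, forall t, 0 < t < T -> `|EK t - kinetic t| <= A t * (5 * rate)} /\
  forall s t, 0 < s -> s <= t -> t < T -> `|EK t - EK s| <= 60 * pi * rate * IA.
Proof.
have /choice[F hF] : forall p : modes n, exists F : B -> R,
  [/\ {ae leb1, forall t, 0 < t < T -> U p t = F t},
      leb1.-integrable I (fun t => (F t * G p t)%:E) &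
      forall s t, 0 < s -> s <= t -> t < T ->
        F t ^+ 2 - F s ^+ 2 = \int[leb1]_(r in `]s, t[) (2 * (F r * G p r))].
  by move=> p; have [i1 i2 W1] := evU p; exact: (weak_primitive_square hT i1 i2 W1).
have /choice[F' hF'] : forall p : modes n, exists F : B -> R,
  [/\ {ae leb1, forall t, 0 < t < T -> V' p t = F t},
      leb1.-integrable I (fun t => (F t * H p t)%:E) &
      forall s t, 0 < s -> s <= t -> t < T ->
        F t ^+ 2 - F s ^+ 2 = \int[leb1]_(r in `]s, t[) (2 * (F r * H p r))].
  by move=> p; have [i1 i2 W1] := evV p; exact: (weak_primitive_square hT i1 i2 W1).
have aeF : {ae leb1, forall t, forall p, 0 < t < T -> U p t = F p t}.
  by apply: ae_fin => p; have [] := hF p.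
have aeF' : {ae leb1, forall t, forall p, 0 < t < T -> V' p t = F' p t}.
  by apply: ae_fin => p; have [] := hF' p.
have aeP : {ae leb1, forall t, forall p, 0 < t < T ->
    \int[leb3]_(X in Q) (P (X, t) * mode_z e p X) = 0}.
  apply: ae_fin => p.
  exact: (pressure_z hT mP iP weak (kernel_se K p.1.1) (kernel_se K p.1.2) (kernel_se K p.2)
    (kernel_pe K p.1.1) (kernel_pe K p.1.2) (kernel_pe K p.2)).
have aeFF := ae_imp2 (fun t h1 h2 => conj h1 h2) aeF aeF'.
exists (fun t => \sum_p c p * (F p t ^+ 2 + F' p t ^+ 2)); split.
  apply: ae_imp2 aeFF reg => t [h1 h2] rt t0.
  have := energy_le hg (rt t0) M1 K; rewrite -/c.
  suff -> : \sum_p c p * (F p t ^+ 2 + F' p t ^+ 2) =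
    \sum_p c p * (coef e (slice u t) p ^+ 2 + coef e (slice v t) p ^+ 2) by [].
  by apply: eq_bigr => p _; rewrite -(h1 p t0) -(h2 p t0).
move=> s t s0 st tT.
pose f p (r : B) := c p * (2 * (F p r * G p r) + 2 * (F' p r * H p r)).
have iF p : leb1.-integrable I (EFin \o (fun r => 2 * (F p r * G p r))).
  by have [_ i _] := hF p; exact: (integrableZl mI 2 i).
have iF' p : leb1.-integrable I (EFin \o (fun r => 2 * (F' p r * H p r))).
  by have [_ i _] := hF' p; exact: (integrableZl mI 2 i).
have if_ p : leb1.-integrable I (EFin \o f p).
  exact: (integrableZl mI (c p) (integrableD mI (iF p) (iF' p))).
have mJ : measurable (`]s, t[%classic : set B) by exact: measurable_itvB.
have JI : `]s, t[%classic `<=` I.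
  move=> r; rewrite /= !in_itv/= => /andP[sr rt].
  by rewrite (lt_trans s0 sr) (lt_trans rt tT).
have sub g : leb1.-integrable I g -> leb1.-integrable `]s, t[ g by exact: integrableS.
have [iS ES] := Rintegral_sum (index_enum (modes n)) mJ (fun p => sub _ (if_ p)).
have [iSI _] := Rintegral_sum (index_enum (modes n)) mI if_.
have -> : \sum_p c p * (F p t ^+ 2 + F' p t ^+ 2) - \sum_p c p * (F p s ^+ 2 + F' p s ^+ 2) =
    \int[leb1]_(r in `]s, t[) (\sum_p f p r).
  rewrite ES -sumrB; apply: eq_bigr => p _; rewrite -mulrBr.
  rewrite (@RintegralZl _ _ _ leb1 _ (fun r => 2 * (F p r * G p r) + 2 * (F' p r * H p r)) (c p) mJ
    (sub _ (integrableD mI (iF p) (iF' p)))).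
  rewrite (@RintegralD _ _ _ leb1 _ (fun r => 2 * (F p r * G p r)) (fun r => 2 * (F' p r * H p r)) mJ
    (sub _ (iF p)) (sub _ (iF' p))).
  have [_ _ <-//] := hF p; have [_ _ <-//] := hF' p.
  by congr (_ * _); ring.
rewrite -lee_fin.
apply: (@le_trans _ _ (\int[leb1]_(r in `]s, t[) (`|\sum_p f p r|)%:E)%E).
  apply: (@le_trans _ _ (`|\int[leb1]_(r in `]s, t[) (\sum_p f p r)%:E|)%E).
    by rewrite /Rintegral; case: (integral _ _ _) => [z| |] /=; [exact: lexx|exact: leey|exact: leey].
  by apply: le_abse_integral => //; case/integrableP : iS.
have mS : measurable_fun I (fun r => (`|\sum_p f p r|)%:E).
  apply/measurable_EFinP; apply: measurableT_comp => //; apply/measurable_EFinP.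
  by case/integrableP : iSI.
apply: (@le_trans _ _ (\int[leb1]_(r in I) (`|\sum_p f p r|)%:E)%E).
  by apply: ge0_subset_integral => // r _; rewrite lee_fin.
have r0 : 0 <= 60 * pi * rate.
  by apply: mulr_ge0; [apply: mulr_ge0 => //; exact: pi_ge0|exact: powR_ge0].
apply: (@le_trans _ _ (\int[leb1]_(r in I) ((60 * pi * rate)%:E * (A r)%:E))%E); last first.
  rewrite ge0_integralZl//; [by rewrite IAE EFinM| |].
  - by case/integrableP : iA.
  - by move=> r _; rewrite lee_fin.
have aePr := ae_imp2 (fun t h1 h2 => conj h1 h2) aeP sliceP.
have aeR := ae_imp2 (fun t h1 h2 => conj h1 h2) aePr reg.
apply: ae_ge0_le_integral => //.
- by move=> r _; rewrite -EFinM lee_fin mulr_ge0.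
- by apply: measurable_funeM; case/integrableP : iA.
apply: ae_imp2 aeFF aeR => r [h1 h2] [[h3 h4] h5]; rewrite /= in_itv/= => r0T.
rewrite -EFinM lee_fin.
have := flux_le hg (h5 r0T) M1 K Omega (h4 r0T) (fun p => h3 p r0T).
rewrite -/c -/rate => fl.
have -> : \sum_p f p r = 2 * \sum_p c p * (coef e (slice u r) p *
    tendency (slice u r) (slice v r) (slice w r) e Omega (slice u r) (slice v r) (slice P r) (mode_x e) p +
    coef e (slice v r) p * tendency (slice u r) (slice v r) (slice w r) e (- Omega) (slice v r) (slice u r)
      (slice P r) (mode_y e) p).
  rewrite mulr_sumr; apply: eq_bigr => p _; rewrite /f -(h1 p r0T) -(h2 p r0T) /U /V' /G /H; ring.
rewrite normrM ger0_norm//.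
apply: (@le_trans _ _ (2 * (A r * (30 * pi * rate)))); first by rewrite ler_wpM2l.
by rewrite le_eqVlt; apply/orP; left; apply/eqP; ring.
Qed.

End at_scale.

(** Let [M] run through the positive integers; outside a countable union of
    negligible sets, both errors tend to zero. *)
Lemma kinetic_conserved : exists2 N : set R, leb1.-negligible N &
  forall s t, 0 < s < T -> 0 < t < T -> ~ N s -> ~ N t -> kinetic s = kinetic t.
Proof.
pose rate (m : nat) : R := m.+1%:R `^ (1 - gamma).
have IA0 : 0 <= IA by apply: Rintegral_ge0.
have step m : exists N : set R, leb1.-negligible N /\
  forall s t, 0 < s < T -> 0 < t < T -> ~ N s -> ~ N t ->
    `|kinetic t - kinetic s| <= rate m * (5 * A t + 5 * A s + 60 * pi * IA).
  have [n [ka [e [k [d K]]]]] := sum_kernel_exists R m.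
  have M1 : 1 <= m.+1%:R :> R by rewrite ler1n.
  have [EK [hE vE]] := energy_at_scale M1 K.
  exists (~` [set t | 0 < t < T -> `|EK t - kinetic t| <= A t * (5 * rate m)]); split.
    exact: hE.
  move=> s t s0 t0 /contrapT/(_ s0) hs /contrapT/(_ t0) ht.
  have var : `|EK t - EK s| <= 60 * pi * rate m * IA.
    have [st|ts] := leP s t; first by apply: vE => //; [case/andP : s0|case/andP : t0].
    by rewrite distrC; apply: vE; [case/andP : t0|exact: ltW|case/andP : s0].
  rewrite (_ : kinetic t - kinetic s = - (EK t - kinetic t) + (EK s - kinetic s) + (EK t - EK s)); last by ring.
  apply: le_trans (ler_normD _ _) _; apply: le_trans (lerD (ler_normD _ _) (lexx _)) _.
  rewrite normrN; apply: (le_trans (lerD (lerD ht hs) var)).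
  by rewrite le_eqVlt; apply/orP; left; apply/eqP; ring.
have /choice[N hN] := step.
exists (\bigcup_m N m); first by apply: negligible_bigcup => m; have [] := hN m.
move=> s t s0 t0 ns nt.
have bound m : `|kinetic t - kinetic s| <= rate m * (5 * A t + 5 * A s + 60 * pi * IA).
  by have [_ h] := hN m; apply: h => // h'; [apply: ns|apply: nt]; exists m.
apply/eqP; rewrite eq_sym -subr_eq0 -normr_le0 leNgt; apply/negP => x0.
set x := `|_| in x0 bound; set C := 5 * A t + _ + _ in bound.
have C0 : 0 <= C.
  apply: addr_ge0; first by apply: addr_ge0; apply: mulr_ge0.
  by apply: mulr_ge0 => //; apply: mulr_ge0 => //; exact: pi_ge0.
have a0 : 0 < gamma - 1 by rewrite subr_gt0; case/andP : hg.
have y0 : 0 <= C / x by rewrite divr_ge0// ltW.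
pose b := (C / x + 1) `^ (gamma - 1)^-1.
have b0 : 0 <= b by exact: powR_ge0.
pose m := Num.trunc b.
have bm : b <= m.+1%:R by apply: ltW; have /andP[] := trunc_itv b0.
have big : C / x + 1 <= m.+1%:R `^ (gamma - 1).
  have -> : C / x + 1 = b `^ (gamma - 1).
    by rewrite /b -powRrM mulVf ?gt_eqF// powRr1// addr_ge0.
  by apply: ge0_ler_powR; rewrite ?nnegrE//; exact: ltW.
have := bound m; rewrite /rate -[1 - gamma]opprB powRN => h.
have q0 : 0 < m.+1%:R `^ (gamma - 1) by rewrite powR_gt0.
rewrite ler_pdivlMl// in h.
have : (C / x + 1) * x <= C by apply: le_trans h; rewrite ler_wpM2r// ltW.
by rewrite mulrDl divfK ?gt_eqF// mul1r -subr_ge0 opprD addrA subrr sub0r oppr_ge0 leNgt x0.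
Qed.

End Conservation.

(** * From the kinetic energy to the L^2 norms *)

Section Energy.
Variable R : realType.
Local Notation B := (measurableTypeR R).
Local Notation V := (B * B * B)%type.
Local Notation W := (B * B * B * B)%type.
Local Notation leb1 := (leb1 R).
Local Notation leb3 := (leb3 R).
Local Notation leb4 := (leb4 R).
Local Notation Q := (@cube R).
Local Notation vec3 := (vec3 R).
Local Notation spacetime := (spacetime R).

Let mQ : measurable (Q : set V) := @measurable_cube R.

Lemma torus_Lnorm2 (f : vec3 -> R) :
  leb3.-integrable Q (fun X => (f X ^+ 2)%:E) ->
  (torus_Lnorm 2%:E f ^+ 2 = (\int[leb3]_(X in Q) f X ^+ 2)%:E)%E.
Proof.
move=> i; rewrite /torus_Lnorm unlock.
have -> : (\int[leb3]_x `|(EFin \o f \_ Q) x| `^ 2 = (\int[leb3]_(X in Q) (f X ^+ 2))%:E)%E.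
  transitivity (\int[leb3]_(X in Q) (f X ^+ 2)%:E)%E.
    rewrite [RHS]integral_mkcond; apply: eq_integral => X _.
    rewrite [RHS]patchE /= patchE; case: ifP => _ /=.
      by rewrite (powR_mulrn 2)// real_normK ?num_real.
    by rewrite normr0 powR0// pnatr_eq0.
  by rewrite /Rintegral fineK//; exact: integrable_fin_num.
have I0 : 0 <= \int[leb3]_(X in Q) (f X ^+ 2) by apply: Rintegral_ge0 => X _; exact: sqr_ge0.
move: (\int[leb3]_(X in Q) (f X ^+ 2)) I0 => y y0.
rewrite poweR_EFin -EFin_expe; congr EFin.
by rewrite -(powR_mulrn 2) ?powR_ge0// -powRrM mulVf ?pnatr_eq0// powRr1.
Qed.

Lemma energyE (u v w : spacetime -> R) (gamma a t : R) :
  slice_reg gamma a (slice u t) (slice v t) (slice w t) ->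
  energy u v t = (kinetic u v t)%:E.
Proof.
move=> reg.
have L1 (f : vec3 -> R) : (f = slice u t \/ f = slice v t) -> leb3.-integrable Q (fun X => (f X ^+ 2)%:E).
  move=> hf; have [] : cube_L1 (fun X => f X ^+ 2); last by [].
  apply: (cube_L1_weight reg).
    by apply: measurable_funX; case: hf => ->; [exact: slice_mu reg|exact: slice_mv reg].
  move=> X; rewrite ger0_norm ?sqr_ge0//.
  apply: (@le_trans _ _ (1 + (slice u t X ^+ 2 + slice v t X ^+ 2))).
    have u2 := sqr_ge0 (slice u t X); have v2 := sqr_ge0 (slice v t X).
    by case: hf => ->; lra.
  rewrite ler_peMr ?addr_ge0 ?sqr_ge0//.
  by rewrite /weight -!addrA lerDl !addr_ge0.
have iu := L1 _ (or_introl erefl); have iv := L1 _ (or_intror erefl).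
rewrite /energy !torus_Lnorm2// -EFinD; congr EFin.
by rewrite /kinetic (@RintegralD _ _ _ leb3 Q (fun X => slice u t X ^+ 2) (fun X => slice v t X ^+ 2) mQ iu iv).
Qed.

End Energy.

Theorem proposition5p1 (R : realType) (T Omega : R)
  (u v w P : spacetime R -> R)
  (hT : 0 < T)
  (hreg :
    (exists (beta : R) (p : \bar R),
      [/\ 1 / 2 < beta, (1%:E < p)%E,
          bochner 3 T (holder_W1_norm beta p) u &
          bochner 3 T (holder_W1_norm beta p) v])
    \/
    (exists p : \bar R,
      [/\ (6%:E < p)%E,
          bochner 3 T (W1_norm p) u &
          bochner 3 T (W1_norm p) v]))
  (hmean : {ae leb1 R, forall t, 0 < t < T ->
    zero_mean_div_H (slice u t) (slice v t)})
  (hw_meas : measurable_fun ([set: vec3 R] `*` `]0, T[) w)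
  (hw : {ae leb1 R, forall t, 0 < t < T ->
    vertical_velocity (slice u t) (slice v t) (slice w t)})
  (hP_per : forall t, torus_periodic (slice P t))
  (hP : (leb4 R).-integrable (torus_time T) (EFin \o P))
  (hu_even : even_z T u) (hv_even : even_z T v)
  (hP_even : even_z T P) (hw_odd : odd_z T w)
  (hweak : weak_solution T Omega u v w P) :
  (forall phi : vec3 R -> R, mollifier phi ->
    defect_is T phi u v w (fun _ => 0)) /\
  exists2 N : set R, (leb1 R).-negligible N &
    forall t1 t2 : R, 0 < t1 < T -> 0 < t2 < T -> ~ N t1 -> ~ N t2 ->
      energy u v t1 = energy u v t2.
Proof.
have [gamma [A [hg A0 mA iA reg]]] := slice_regularity hreg hw.
have [mu mv] : measurable_fun ([set: vec3 R] `*` `]0, T[) u /\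
    measurable_fun ([set: vec3 R] `*` `]0, T[) v.
  by case: hreg => [[? [? [_ _ [mu _ _ _] [mv _ _ _]]]]|[? [_ [mu _ _ _] [mv _ _ _]]]].
split; first by apply: defect_zero mu mv hw_meas _ A0 iA reg; case/andP : hg.
(* Extension by zero outside (0, T) makes the fields measurable everywhere and
   does not affect the weak formulation. *)
pose u' := u \_ (timeset T); pose v' := v \_ (timeset T); pose w' := w \_ (timeset T).
pose P' := P \_ (torus_time T).
have mTT := @measurable_torus_time R T.
have reg' : {ae leb1 R, forall t, 0 < t < T ->
    slice_reg gamma (A t) (slice u' t) (slice v' t) (slice w' t)}.
  by apply: ae_imp reg => t h t0; rewrite !slice_patch//; exact: h.
have patchP p : torus_time T p -> P' p = P p by move=> hp; rewrite /P' patchE mem_set.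
have patchU (f : spacetime R -> R) p : torus_time T p -> (f \_ (timeset T)) p = f p.
  by case: p => X t [/= _]; rewrite in_itv/= => t0; exact: patch_timeE.
have iP' : (leb4 R).-integrable (torus_time T) (EFin \o P').
  by apply: (eq_integrable mTT _ _ _ hP) => p /set_mem hp /=; rewrite patchP.
have mP' : measurable_fun setT P'.
  by apply/(measurable_restrictT _ mTT)/measurable_EFinP; case/integrableP : hP.
have weak' : weak_solution T Omega u' v' w' P'.
  move=> phi1 phi2 phi3 h1 h2 h3; have [e1 e2 e3] := hweak phi1 phi2 phi3 h1 h2 h3.
  split; [rewrite -[RHS]e1|rewrite -[RHS]e2|rewrite -[RHS]e3];
    by apply: eq_Rintegral => p /set_mem hp; rewrite ?patchP// /u' /v' /w' ?patchU.
have [N0 negN0 conserved] := kinetic_conserved hT (measurable_patch_time mu)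
  (measurable_patch_time mv) (measurable_patch_time hw_meas) mP' hg A0 iA reg' iP' weak'.
exists (N0 `|` ~` [set t | 0 < t < T ->
    slice_reg gamma (A t) (slice u t) (slice v t) (slice w t)]).
  exact: negligibleU.
move=> t1 t2 h1 h2 /not_orP[n1 /contrapT r1] /not_orP[n2 /contrapT r2].
rewrite (energyE (r1 h1)) (energyE (r2 h2)); congr EFin.
have kE t : 0 < t < T -> kinetic u v t = kinetic u' v' t.
  by move=> t0; apply: eq_Rintegral => X _; rewrite /u' /v' !patch_timeE.
by rewrite !kE//; exact: conserved.
Qed.
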